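(* There exists a family $\{\varphi_{1,\alpha,\beta}:\ 0<\alpha\le 1,\ \beta>-2\sqrt{\alpha}\}$ such that each $\varphi_{1,\alpha,\beta}$ is an even ground state solution of $$\varphi-\alpha\varphi''-\beta\mathcal{H}\varphi'=\tfrac12\varphi^2,$$ and such that $$\lim_{\beta\to0}\|\varphi_{1,1,\beta}-Q_{KdV}\|_{H^1}=0\qquad\text{and}\qquad \lim_{\alpha\to0^+}\|\varphi_{1,\alpha,1}-Q_{BO}\|_{H^1}=0,$$ where $Q_{KdV}(x)=3\,\mathrm{sech}^2(x/2)$ and $Q_{BO}(x)=\frac{4}{1+x^2}$ are respectively the unique even soliton profiles of speed $1$ of the KdV and the Benjamin–Ono equation.
   Context: All functions are real-valued. $\mathcal{H}$ is the Hilbert transform with $\widehat{\mathcal{H}v}(\xi)=i\,\mathrm{sgn}(\xi)\hat v(\xi)$, so $-\mathcal{H}\partial_x$ has Fourier symbol $|\xi|$. $D_x^{1/2}$ is the Fourier multiplier with symbol $|\xi|^{1/2}$. $H^1_e(\mathbb{R})$ is the subspace of even functions in $H^1(\mathbb{R})$. $Q_{KdV}$ solves $\varphi-\varphi''=\frac12\varphi^2$ and $Q_{BO}$ solves $\varphi-\mathcal{H}\varphi'=\frac12\varphi^2$. Set $I_{1,\alpha,\beta}(\varphi)=\frac12\int_{\mathbb{R}}\big(\alpha(\varphi_x)^2+\beta(D_x^{1/2}\varphi)^2+\varphi^2\big)dx$, $K(\varphi)=\frac16\int_{\mathbb{R}}\varphi^3dx$, and for $\lambda>0$, $M^\lambda_{1,\alpha,\beta}=\inf\{I_{1,\alpha,\beta}(\varphi):\varphi\in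 H^1_e(\mathbb{R}),\ K(\varphi)=\lambda\}$. An even ground state solution of the equation $\varphi-\alpha\varphi''-\beta\mathcal{H}\varphi'=\frac12\varphi^2$ is an $H^1(\mathbb{R})$-solution of it that solves the constrained minimization problem $M^\lambda_{1,\alpha,\beta}$ for some $\lambda>0$, i.e. it lies in $H^1_e(\mathbb{R})$, satisfies $K=\lambda$, and attains the infimum. *)

(* Defs.v *)
From HB Require Import structures.
From mathcomp Require Import all_boot all_order all_algebra.
From mathcomp Require Import all_classical all_reals all_analysis.
From mathcomp Require Import complex.

Set Implicit Arguments.
Unset Strict Implicit.
Unset Printing Implicit Defensive.

Import Order.TTheory GRing.Theory Num.Theory.
Import numFieldNormedType.Exports.

Local Open Scope classical_set_scope.
Local Open Scope ring_scope.

(* Elements of L^2(R) and H^1(R) are represented by functions [R -> R]; the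
   notions below do not distinguish measurable functions equal Lebesgue-a.e.
   Operators defined up to a.e. equality (weak derivative, Fourier multipliers)
   are turned into functions by choosing a representative with [xget]; the
   default value [cst 0] is irrelevant on the domain of the operator. *)

Section Spaces.
Context {R : realType}.
Implicit Types (f g psi : R -> R).

Local Notation mu := (@lebesgue_measure R).

Definition L2 : set (R -> R) := [set f | f \in Lfun mu 2%:E].

Definition L2norm f : R := fine ('N[mu]_2%:E [EFin \o f])%E.

Definition test_function psi : Prop :=
  (forall (n : nat) (x : R), derivable (derive1n n psi) x 1) /\
  (exists M : R, forall x : R, M < `|x| -> psi x = 0).

Definition is_weak_derivative f g : Prop :=
  forall psi, test_function psi ->
    \int[mu]_x (f x * derive1 psi x) = - \int[mu]_x (g x * psi x).

Definition H1 : set (R -> R) :=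
  [set f | L2 f /\ exists2 g, L2 g & is_weak_derivative f g].

Definition weak_derivative f : R -> R :=
  xget (cst 0) [set g | L2 g /\ is_weak_derivative f g].

Definition H1norm f : R :=
  Num.sqrt (L2norm f ^+ 2 + L2norm (weak_derivative f) ^+ 2).

Definition H1even : set (R -> R) :=
  [set f | H1 f /\ {ae mu, forall x : R, f (- x) = f x}].

End Spaces.

Section Fourier.
Context {R : realType}.
Implicit Types (f g : R -> R).

Local Notation mu := (@lebesgue_measure R).

(* The integral of [f x * e^(- i x xi)] over [-n, n]. *)
Definition truncated_fourier (n : nat) f (xi : R) : R[i] :=
  Complex (\int[mu]_(x in `[- n%:R, n%:R]) (f x * cos (x * xi)))
          (- \int[mu]_(x in `[- n%:R, n%:R]) (f x * sin (x * xi))).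

(* The Fourier-Plancherel transform: the limit in L^2 of the truncated
   integrals. *)
Definition is_fourier_transform f (F : R -> R[i]) : Prop :=
  [/\ L2 (fun xi => complex.Re (F xi)),
      L2 (fun xi => complex.Im (F xi)) &
      Lnorm mu 2%:E (fun xi =>
         (complex.Re `|F xi - truncated_fourier n f xi|)%:E)
        @[n --> \oo] --> 0%E].

Definition is_fourier_multiplier (m : R -> R[i]) f g : Prop :=
  L2 g /\
  exists Ff Fg : R -> R[i],
    [/\ is_fourier_transform f Ff, is_fourier_transform g Fg &
        {ae mu, forall xi : R, Fg xi = m xi * Ff xi}].

Definition fourier_multiplier (m : R -> R[i]) f : R -> R :=
  xget (cst 0) [set g | is_fourier_multiplier m f g].

Definition hilbert f : R -> R :=
  fourier_multiplier (fun xi => Complex 0 (Num.sg xi)) f.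

Definition half_derivative f : R -> R :=
  fourier_multiplier (fun xi => Complex (Num.sqrt `|xi|) 0) f.

End Fourier.

Section GroundStates.
Context {R : realType}.
Implicit Types (alpha beta lambda : R) (phi : R -> R).

Local Notation mu := (@lebesgue_measure R).

Definition functional_I alpha beta phi : R :=
  2^-1 * \int[mu]_x (alpha * weak_derivative phi x ^+ 2
                     + beta * half_derivative phi x ^+ 2
                     + phi x ^+ 2).

Definition functional_K phi : R := 6^-1 * \int[mu]_x (phi x ^+ 3).

Definition min_I alpha beta lambda : \bar R :=
  ereal_inf [set (functional_I alpha beta phi)%:E |
              phi in [set phi | H1even phi /\ functional_K phi = lambda]].

(* [phi] is an H^1 solution of
   [phi - alpha phi'' - beta H phi' = 1/2 phi^2], where [phi''] is taken in
   the sense of distributions ([H phi'] is a function in L^2). *)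
Definition H1_solution alpha beta phi : Prop :=
  H1 phi /\
  forall psi : R -> R, test_function psi ->
    \int[mu]_x ((phi x - beta * hilbert (weak_derivative phi) x) * psi x)
      - alpha * \int[mu]_x (phi x * derive1n 2 psi x)
    = \int[mu]_x (2^-1 * phi x ^+ 2 * psi x).

Definition even_ground_state alpha beta phi : Prop :=
  H1_solution alpha beta phi /\
  exists lambda, [/\ 0 < lambda, H1even phi, functional_K phi = lambda &
    (functional_I alpha beta phi)%:E = min_I alpha beta lambda].

Definition even_soliton_profile alpha beta phi : Prop :=
  [/\ H1even phi, H1_solution alpha beta phi &
      ~ {ae mu, forall x : R, phi x = 0}].

Definition unique_even_soliton_profile alpha beta phi : Prop :=
  even_soliton_profile alpha beta phi /\
  forall phi', even_soliton_profile alpha beta phi' ->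
    {ae mu, forall x : R, phi' x = phi x}.

Definition sech (x : R) : R := 2 / (expR x + expR (- x)).

Definition Q_KdV (x : R) : R := 3 * sech (x / 2) ^+ 2.

Definition Q_BO (x : R) : R := 4 / (1 + x ^+ 2).

End GroundStates.

(* Main.v *)
Require Import Defs.
From HB Require Import structures.
From mathcomp Require Import all_boot all_order all_algebra.
From mathcomp Require Import all_classical all_reals all_analysis.
From mathcomp Require Import measurable_realfun complex ring lra.
Set Implicit Arguments.
Unset Strict Implicit.
Unset Printing Implicit Defensive.
Import Order.TTheory GRing.Theory Num.Theory.
Import numFieldNormedType.Exports.
Local Open Scope classical_set_scope.
Local Open Scope ring_scope.

(** On the Hartley side (a real, unitary, involutive version [U] of the Fourier
    transform of L^2) the equation is [(1 + beta|x| + alpha x^2) Uf = U(f^2)/2],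
    and for even [f] products become convolutions, f^2 -> c0 (Uf * Uf).

    Existence: with E(p) the quadratic form of the symbol and k(p) the integral
    of the cube, let S be the supremum of k over E <= 1.  Replacing Uf by |Uf|
    increases k, so a maximising sequence may be taken with Uf >= 0; then
    f(0) = max f, the weak limit is nonzero (no translation to correct), and the
    Brezis-Lieb splitting with e^(3/2) + (1-e)^(3/2) < 1 for 0 < e < 1 shows that
    it is a maximiser.  Its multiple by 2/S is the ground state, with energy 4/S^2.

    Uniqueness for KdV: the energy integral of the profile is constant and
    integrable, hence zero, which gives f(0) = 3, and Gronwall concludes.
    Uniqueness for Benjamin-Ono: with u = f/2 and v = -H u, the functions
    a = u' + uv and b = (u^2 + v^2)/2 - u satisfy b = H a up to sign and
    b' = (u - 1) a, so that a = (1+|D|)^-1 (u a).  Since u = (1+|D|)^-1 (u^2) and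
    the resolvent is positivity improving, a has constant sign; being odd it
    vanishes, and so does b.  Then v - xu solves a linear equation, so v = xu
    and u = 2/(1+x^2).

    Limits: comparing with the limit profile Q bounds the energies by a quantity
    converging to that of Q.  Weak limits solve the limit equation and are
    nonzero because the values at 0 are at least 1; they are Q by uniqueness,
    and the convergence of the energies makes the convergence strong.  As
    alpha -> 0 the energy controls only H^(1/2); the H^1 bound and the H^1
    convergence are recovered from (1+|x|) Uf <= U(f^2)/2. *)

(** The Hartley transform stays within real functions and is its own inverse, so that symmetry and
    unitarity become a single property. Evenness turns the transform of a product into a plain
    convolution, with no reflected term, and this is why the cubic functional grows when Uf is
    replaced by |Uf|. The replacement leaves the energy unchanged whatever the sign of beta;
    decreasing rearrangement could raise it, since for beta < 0 the symbol is not monotone in |x|.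
    The condition beta > -2 sqrt(alpha) says exactly that the symbol is positive.

    Ground states are not known to be unique, so no continuity in the parameters can be expected.
    Both limits are therefore proved along arbitrary sequences of parameters, by extracting
    subsequences, and uniqueness is required of the limit equation only.

    As alpha -> 0 the coercivity in H^1 degenerates. The equation replaces it: it bounds the H^1
    seminorm by the L^1 norm of Uf, which is in turn interpolated between the L^2 norm and the same
    seminorm with a free scale, chosen so that the seminorm can be absorbed. *)

Ltac mble := repeat first
  [ assumption | exact: measurable_cst | exact: measurable_id
  | exact: measurable_fst | exact: measurable_snd
  | exact: measurable_indic
  | apply: measurable_funD | apply: measurable_funB | apply: measurable_funM
  | apply: measurable_funX | apply: measurable_funN
  | apply: (measurableT_comp (@normr_measurable _ setT))
  | apply: (measurableT_comp (@measurable_expR _)) ].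

(** * Real-valued integrals and the Hilbert space L^2 *)

Section RealIntegral.
Context d (T : measurableType d) (R : realType) (mu : {measure set T -> \bar R}).
Implicit Types f g h : T -> R.

Lemma aeS (P Q : T -> Prop) : {ae mu, forall x, P x} ->
  (forall x, P x -> Q x) -> {ae mu, forall x, Q x}.
Proof. by move=> aP PQ; apply: filterS aP. Qed.

Lemma aeS2 (P Q S : T -> Prop) : {ae mu, forall x, P x} ->
  {ae mu, forall x, Q x} ->
  (forall x, P x -> Q x -> S x) -> {ae mu, forall x, S x}.
Proof. by move=> aP aQ PQ; move: aP aQ; exact: filterS2. Qed.

Definition intg f : Prop := mu.-integrable setT (EFin \o f).

Lemma intg_mble f : intg f -> measurable_fun setT f.
Proof. by move=> /integrableP[/measurable_EFinP]. Qed.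

Lemma intgD f g : intg f -> intg g -> intg (fun x => f x + g x).
Proof. by move=> fi gi; have := integrableD measurableT fi gi. Qed.

Lemma intgN f : intg f -> intg (fun x => - f x).
Proof. by move=> fi; have := integrableN fi. Qed.

Lemma intgB f g : intg f -> intg g -> intg (fun x => f x - g x).
Proof. by move=> fi gi; apply: (intgD fi); exact: intgN. Qed.

Lemma intgZ c f : intg f -> intg (fun x => c * f x).
Proof. by move=> fi; have := integrableZl measurableT c fi. Qed.

Lemma intg0 : intg (fun=> 0).
Proof. exact: integrable0. Qed.

Lemma intg_abs f : intg f -> intg (fun x => `|f x|).
Proof. exact: integrable_norm. Qed.

Lemma intg_dom f g : measurable_fun setT f -> intg g ->
  (forall x, `|f x| <= g x) -> intg f.
Proof.
move=> mf gi fg; apply: (le_integrable measurableT _ _ gi).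
  exact/measurable_EFinP.
by move=> x _ /=; rewrite lee_fin (le_trans (fg x))// ler_norm.
Qed.

Lemma intg_domC f g C : measurable_fun setT f -> intg g ->
  (forall x, `|f x| <= C * `|g x|) -> intg f.
Proof. by move=> mf gi; apply: intg_dom => //; apply/intgZ/intg_abs. Qed.

Lemma intg_boundedM f g C : intg f -> measurable_fun setT g ->
  (forall x, `|g x| <= C) -> intg (fun x => f x * g x).
Proof.
move=> fi mg gC; apply: (@intg_domC _ f C) => //.
  by apply: measurable_funM => //; exact: intg_mble.
by move=> x; rewrite normrM mulrC ler_wpM2r.
Qed.

(** The measure is not assumed complete, so an a.e. modification of an integrable function has to
    come with its own measurability. *)
Lemma intg_ae f g : measurable_fun setT f -> intg g ->
  {ae mu, forall x, f x = g x} -> intg f.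
Proof.
move=> mf gi fg; apply/integrableP; split; first exact/measurable_EFinP.
have /integrableP[mg] := gi; apply: le_lt_trans.
rewrite le_eqVlt; apply/orP; left; apply/eqP.
apply: ae_eq_integral => //.
- by do 2 apply: measurableT_comp => //.
- by apply: measurableT_comp.
- by apply: filterS fg => x /= -> .
Qed.

Lemma RintD f g : intg f -> intg g ->
  \int[mu]_x (f x + g x) = \int[mu]_x f x + \int[mu]_x g x.
Proof. by move=> fi gi; exact: RintegralD. Qed.

Lemma RintB f g : intg f -> intg g ->
  \int[mu]_x (f x - g x) = \int[mu]_x f x - \int[mu]_x g x.
Proof. by move=> fi gi; exact: RintegralB. Qed.

Lemma RintZ c f : intg f -> \int[mu]_x (c * f x) = c * \int[mu]_x f x.
Proof. by move=> fi; exact: RintegralZl. Qed.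

Lemma RintN f : intg f -> \int[mu]_x (- f x) = - \int[mu]_x f x.
Proof.
move=> fi; under eq_Rintegral do rewrite -mulN1r.
by rewrite RintZ// mulN1r.
Qed.

Lemma eq_Rint f g : f =1 g -> \int[mu]_x f x = \int[mu]_x g x.
Proof. by move=> fg; apply: eq_Rintegral => x _; exact: fg. Qed.

Lemma Rint_ae f g : measurable_fun setT f -> measurable_fun setT g ->
  {ae mu, forall x, f x = g x} -> \int[mu]_x f x = \int[mu]_x g x.
Proof.
move=> mf mg fg; congr fine; apply: ae_eq_integral => //; try exact/measurable_EFinP.
by apply: filterS fg => x /= ->.
Qed.

Lemma Rintegral0 : \int[mu]_x (0 : R) = 0.
Proof. by rewrite /Rintegral integral0. Qed.

Lemma le_Rint f g : intg f -> intg g -> (forall x, f x <= g x) ->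
  \int[mu]_x f x <= \int[mu]_x g x.
Proof. by move=> fi gi fg; exact: le_Rintegral. Qed.

Lemma Rint_ge0 f : (forall x, 0 <= f x) -> 0 <= \int[mu]_x f x.
Proof. by move=> f0; exact: Rintegral_ge0. Qed.

Lemma le_normr_Rint f : intg f -> `|\int[mu]_x f x| <= \int[mu]_x `|f x|.
Proof. by move=> fi; exact: le_normr_Rintegral. Qed.

Lemma EFin_Rint f : intg f -> (\int[mu]_x f x)%:E = (\int[mu]_x (f x)%:E)%E.
Proof. by move=> fi; rewrite fineK//; exact: integrable_fin_num. Qed.

Lemma Rint_eq0_ae f : intg f -> (forall x, 0 <= f x) -> \int[mu]_x f x = 0 ->
  {ae mu, forall x, f x = 0}.
Proof.
move=> fi f0 int0; have mf := intg_mble fi.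
have /(ae_eq_integral_abs mu measurableT) : measurable_fun setT (EFin \o f).
  exact/measurable_EFinP.
move=> [+ _].
have -> : (\int[mu]_x `|(EFin \o f) x| = 0)%E.
  under eq_integral do rewrite /= ger0_norm//.
  by rewrite -EFin_Rint// int0.
by move=> /(_ erefl); apply: filterS => x /(_ I) /= [].
Qed.

Lemma dominated_Rint_ae (F : nat -> T -> R) f g :
  (forall n, measurable_fun setT (F n)) -> measurable_fun setT f -> intg g ->
  (forall n x, `|F n x| <= g x) ->
  {ae mu, forall x, F n x @[n --> \oo] --> f x} ->
  intg f /\ \int[mu]_x F n x @[n --> \oo] --> \int[mu]_x f x.
Proof.
move=> mF mf gi Fg Ff.
have [] := @dominated_convergence _ _ _ mu setT measurableT
  (fun n => EFin \o F n) (EFin \o f) (EFin \o g).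
- by move=> n; exact/measurable_EFinP.
- exact/measurable_EFinP.
- by apply: aeS Ff _ => x Fx _ /=; apply: cvg_EFin; [exact: nearW|exact: Fx].
- exact: gi.
- by apply: aeW => x n _ /=; rewrite lee_fin.
move=> fi _ /= cv; split => //.
apply: fine_cvg; rewrite -[X in _ --> X%:E]/(\int[mu]_x f x).
by rewrite EFin_Rint.
Qed.

Lemma dominated_Rint (F : nat -> T -> R) f g :
  (forall n, measurable_fun setT (F n)) -> intg g ->
  (forall n x, `|F n x| <= g x) ->
  (forall x, F n x @[n --> \oo] --> f x) ->
  intg f /\ \int[mu]_x F n x @[n --> \oo] --> \int[mu]_x f x.
Proof.
move=> mF gi Fg Ff; apply: (dominated_Rint_ae mF _ gi Fg); last exact: aeW.
by apply: (measurable_fun_cvg (h := F)) => // x _; exact: Ff.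
Qed.

(** A real-valued integral is 0 when the extended one is infinite, so an upper bound on it carries
    no information alone: integrability of the limit is part of the conclusion. *)
Lemma fatou_Rint (F : nat -> T -> R) f C :
  (forall n, intg (F n)) -> (forall n x, 0 <= F n x) ->
  (forall n, \int[mu]_x F n x <= C) -> measurable_fun setT f ->
  {ae mu, forall x, F n x @[n --> \oo] --> f x} ->
  intg f /\ \int[mu]_x f x <= C.
Proof.
move=> Fi F0 FC mf Ff.
have f0 : {ae mu, forall x, 0 <= f x}.
  apply: filterS Ff => x Fx; rewrite -(cvg_lim _ Fx)//.
  by apply: limr_ge; [apply/cvg_ex; exists (f x)|exact: nearW].
have le : (\int[mu]_x `|(f x)%:E| <= C%:E)%E.
  have mE n : measurable_fun setT (EFin \o F n).
    by apply/measurable_EFinP/intg_mble.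
  have := @fatou _ _ _ mu setT measurableT (fun n => EFin \o F n) mE.
  move=> /(_ (fun n x _ => F0 n x)) le.
  apply: (@le_trans _ _ (limn_einf (fun n => \int[mu]_x (EFin \o F n) x))%E).
    apply: le_trans le; rewrite le_eqVlt; apply/orP; left; apply/eqP.
    apply: ae_eq_integral => //.
    - by do 2 apply: measurableT_comp => //.
    - have -> : (fun x => limn_einf ((fun n => EFin \o F n) ^~ x)) =
          (fun x => - limn_esup (fun n => - (F n x)%:E))%E.
        apply/funext => x; rewrite -limn_einfN; congr limn_einf.
        by apply/funext => n /=; rewrite opprK.
      apply: (measurableT_comp (@oppe_measurable R setT)).
      apply: (@measurable_fun_limn_esup _ _ _ _ (fun n x => - (F n x)%:E)%E) => n.
      by apply: measurableT_comp => //; exact: mE.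
    - move: Ff f0; apply: filterS2 => x Fx fx0 _ /=.
      have cF : (F n x)%:E @[n --> \oo] --> (f x)%:E.
        by apply: cvg_EFin; [exact: nearW|exact: Fx].
      rewrite ger0_norm// is_cvg_limn_einfE; last by apply/cvg_ex; exists (f x)%:E.
      exact/esym/cvg_lim.
  rewrite limn_einf_lim; apply: lime_le; first exact: is_cvg_einfs.
  apply: nearW => n; apply: (@le_trans _ _ (\int[mu]_x (EFin \o F n) x)%E).
    by apply: ereal_inf_lbound => /=; exists n => /=.
  by rewrite -EFin_Rint// lee_fin.
have fi : intg f.
  apply/integrableP; split; first exact/measurable_EFinP.
  by apply: le_lt_trans le _; rewrite ltry.
split=> //; rewrite -lee_fin EFin_Rint//; apply: le_trans le.
by apply: le_integral => //; [exact: (intg_abs fi)|move=> x _; rewrite lee_fin ler_norm].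
Qed.

End RealIntegral.

Section MonotoneBound.
Context d (T : measurableType d) (R : realType) (mu : {measure set T -> \bar R}).

(** By monotone convergence the extended-valued supremum has integral at most [C], hence is finite
    almost everywhere. *)
Lemma nondecreasing_ae_bounded (F : nat -> T -> R) C :
  (forall n, intg mu (F n)) -> (forall n x, 0 <= F n x) ->
  (forall n x, F n x <= F n.+1 x) -> (forall n, \int[mu]_x F n x <= C) ->
  {ae mu, forall x, exists M, forall n, F n x <= M}.
Proof.
move=> Fi F0 Fnd FC.
have mE n : measurable_fun setT (EFin \o F n).
  by apply/measurable_EFinP/intg_mble.
have nd x : setT x -> {homo (fun n => EFin \o F n)^~ x : n m / (n <= m)%N >-> (n <= m)%E}.
  move=> _ n m nm /=; rewrite lee_fin.
  by apply: (homo_leq (f := fun n => F n x) (r := fun a b => a <= b)) => // ? ? ? /le_trans; exact.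
have := @monotone_convergence _ _ _ mu _ measurableT _ mE (fun n x _ => F0 n x) nd.
set G := fun x => limn _ => eG.
have G0 x : (0 <= G x)%E.
  apply: lime_ge; first by apply: ereal_nondecreasing_is_cvgn; exact: nd.
  by apply: nearW => n; rewrite lee_fin.
have Gi : mu.-integrable setT G.
  apply/integrableP; split.
    apply: (emeasurable_fun_cvg (fun n => EFin \o F n)) => // x _.
    by apply: ereal_nondecreasing_is_cvgn; exact: nd.
  under eq_integral do rewrite gee0_abs//.
  rewrite eG; apply: (@le_lt_trans _ _ C%:E); last exact: ltry.
  apply: lime_le.
    apply: ereal_nondecreasing_is_cvgn => n m nm.
    by apply: ge0_le_integral => // x _; rewrite ?lee_fin//; exact: nd.
  by apply: nearW => n /=; rewrite -EFin_Rint// lee_fin.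
have := integrable_ae measurableT Gi; apply: filterS => x /(_ I) Gx.
exists (fine (G x)) => n; rewrite -lee_fin fineK//.
apply: lime_ge; first by apply: ereal_nondecreasing_is_cvgn; exact: nd.
by near=> m; apply: nd => //; near: m; exists n.
Unshelve. all: by end_near. Qed.

End MonotoneBound.

Section L2theory.
Context {R : realType}.
Local Notation mu := (@lebesgue_measure R).
Implicit Types f g h : R -> R.

Lemma L2P f : L2 f <-> measurable_fun setT f /\ intg mu (fun x => f x ^+ 2).
Proof.
split=> [fL|[mf fi]].
  split; last exact: Lfun2_integrable_sqr.
  by move: fL; rewrite /L2 /= inE => /andP[/[!inE]/=].
rewrite /L2 /= inE; apply/andP; split; rewrite inE//=.
rewrite /finite_norm unlock poweR_lty//.
have /integrableP[_] := fi; congr (_ < _)%E; apply: eq_integral => x _ /=.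
by rewrite powR_mulrn// normrX.
Qed.

Lemma L2_mble f : L2 f -> measurable_fun setT f. Proof. by case/L2P. Qed.
Lemma L2_sqr f : L2 f -> intg mu (fun x => f x ^+ 2). Proof. by case/L2P. Qed.

Definition ip f g := \int[mu]_x (f x * g x).

Lemma L2M f g : L2 f -> L2 g -> intg mu (fun x => f x * g x).
Proof.
move=> fL gL; apply: (intg_dom _ (intgD (L2_sqr fL) (L2_sqr gL))) => [|x].
  by apply: measurable_funM; exact: L2_mble.
rewrite normrM -[f x ^+ 2]real_normK ?num_real// -[g x ^+ 2]real_normK ?num_real//.
have : 0 <= (`|f x| - `|g x|) ^+ 2 by exact: sqr_ge0.
have := normr_ge0 (f x); have := normr_ge0 (g x); nra.
Qed.

Lemma L2D f g : L2 f -> L2 g -> L2 (fun x => f x + g x).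
Proof.
move=> fL gL; apply/L2P; split.
  by apply: measurable_funD; exact: L2_mble.
have := intgD (intgD (L2_sqr fL) (L2_sqr gL)) (intgZ 2 (L2M fL gL)).
by congr intg; apply/funext => x; ring.
Qed.

Lemma L2Z c f : L2 f -> L2 (fun x => c * f x).
Proof.
move=> fL; apply/L2P; split.
  by apply: measurable_funM => //; exact: L2_mble.
have := intgZ (c ^+ 2) (L2_sqr fL).
by congr intg; apply/funext => x; ring.
Qed.

Lemma L2N f : L2 f -> L2 (fun x => - f x).
Proof.
move=> /(L2Z (-1)); congr (L2 _).
by apply/funext => x; rewrite mulN1r.
Qed.

Lemma L2B f g : L2 f -> L2 g -> L2 (fun x => f x - g x).
Proof. by move=> fL /L2N; exact: L2D. Qed.

Lemma L2_0 : L2 (fun=> 0 : R).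
Proof.
apply/L2P; split=> //.
by rewrite expr0n /=; exact: intg0.
Qed.

Lemma L2_dom f g C : measurable_fun setT f -> L2 g ->
  (forall x, `|f x| <= C * `|g x|) -> L2 f.
Proof.
move=> mf gL fg; apply/L2P; split=> //.
apply: (intg_dom _ (intgZ (C ^+ 2) (L2_sqr gL))) => [|x].
  exact: measurable_funX.
rewrite normrX -[g x ^+ 2]real_normK ?num_real// -exprMn.
by apply: lerXn2r; rewrite ?nnegrE ?(le_trans _ (fg x)).
Qed.

Lemma L2_dom1 f g : measurable_fun setT f -> L2 g ->
  (forall x, `|f x| <= `|g x|) -> L2 f.
Proof. by move=> mf gL fg; apply: (L2_dom (C := 1) mf gL) => x; rewrite mul1r. Qed.

Lemma L2_boundedM f g C : L2 f -> measurable_fun setT g ->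
  (forall x, `|g x| <= C) -> L2 (fun x => f x * g x).
Proof.
move=> fL mg gC; apply: (L2_dom (C := C) _ fL).
  by apply: measurable_funM => //; exact: L2_mble.
by move=> x; rewrite normrM mulrC ler_wpM2r.
Qed.

Lemma L2_ae f g : measurable_fun setT f -> L2 g ->
  {ae mu, forall x, f x = g x} -> L2 f.
Proof.
move=> mf gL fg; apply/L2P; split=> //.
apply: (intg_ae _ (L2_sqr gL)); first exact: measurable_funX.
by apply: (aeS fg) => x ->.
Qed.

Lemma L2_abs f : L2 f -> L2 (fun x => `|f x|).
Proof.
move=> fL; apply: (L2_dom1 _ fL) => [|x]; last by rewrite normr_id.
by apply: measurableT_comp => //; exact: L2_mble.
Qed.

Lemma ipC f g : ip f g = ip g f.
Proof. by apply: eq_Rint => x; rewrite mulrC. Qed.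

Lemma ip_ge0 f : 0 <= ip f f.
Proof. by apply: Rint_ge0 => x; rewrite -expr2 sqr_ge0. Qed.

Lemma ipDl f g h : L2 f -> L2 g -> L2 h ->
  ip (fun x => f x + g x) h = ip f h + ip g h.
Proof.
move=> fL gL hL; rewrite /ip -RintD; [|exact: L2M|exact: L2M].
by apply: eq_Rint => x; ring.
Qed.

Lemma ipBl f g h : L2 f -> L2 g -> L2 h ->
  ip (fun x => f x - g x) h = ip f h - ip g h.
Proof.
move=> fL gL hL; rewrite /ip -RintB; [|exact: L2M|exact: L2M].
by apply: eq_Rint => x; ring.
Qed.

Lemma ipZl c f h : L2 f -> L2 h -> ip (fun x => c * f x) h = c * ip f h.
Proof.
move=> fL hL; rewrite /ip -RintZ; last exact: L2M.
by apply: eq_Rint => x; ring.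
Qed.

Lemma ipDr f g h : L2 f -> L2 g -> L2 h ->
  ip h (fun x => f x + g x) = ip h f + ip h g.
Proof. by move=> *; rewrite ipC ipDl// ![ip _ h]ipC. Qed.

Lemma ipBr f g h : L2 f -> L2 g -> L2 h ->
  ip h (fun x => f x - g x) = ip h f - ip h g.
Proof. by move=> *; rewrite ipC ipBl// ![ip _ h]ipC. Qed.

Lemma ipZr c f h : L2 f -> L2 h -> ip h (fun x => c * f x) = c * ip h f.
Proof. by move=> *; rewrite ipC ipZl// ![ip _ h]ipC. Qed.

Lemma ip_ae f f' g g' : L2 f -> L2 f' -> L2 g -> L2 g' ->
  {ae mu, forall x, f x = f' x} -> {ae mu, forall x, g x = g' x} ->
  ip f g = ip f' g'.
Proof.
move=> /L2_mble ? /L2_mble ? /L2_mble ? /L2_mble ? ff gg; apply: Rint_ae.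
- exact: measurable_funM.
- exact: measurable_funM.
by apply: (aeS2 ff gg) => x -> ->.
Qed.

Lemma sqD f g : L2 f -> L2 g ->
  ip (fun x => f x + g x) (fun x => f x + g x) = ip f f + 2 * ip f g + ip g g.
Proof.
move=> fL gL; rewrite ipDl ?ipDr//; try exact: L2D.
by rewrite [ip g f]ipC; ring.
Qed.

Lemma sqB f g : L2 f -> L2 g ->
  ip (fun x => f x - g x) (fun x => f x - g x) = ip f f - 2 * ip f g + ip g g.
Proof.
move=> fL gL; rewrite ipBl ?ipBr//; try exact: L2B.
by rewrite [ip g f]ipC; ring.
Qed.

Lemma ip_sym_dist f g : ip (fun x => f x - g x) (fun x => f x - g x) =
  ip (fun x => g x - f x) (fun x => g x - f x).
Proof. by apply: eq_Rint => x; ring. Qed.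

Lemma CS f g : L2 f -> L2 g -> ip f g ^+ 2 <= ip f f * ip g g.
Proof.
move=> fL gL; have pos t : 0 <= ip f f + 2 * (t * ip f g) + t ^+ 2 * ip g g.
  have := ip_ge0 (fun x => f x + t * g x).
  rewrite sqD//; last exact: L2Z.
  rewrite !ipZr ?ipZl//; last exact: L2Z.
  by rewrite expr2 mulrA.
have := ip_ge0 g; rewrite le_eqVlt => /predU1P[g0|g0].
  have [->|b0] := eqVneq (ip f g) 0; first by rewrite -g0; lra.
  (* With [ip g g = 0] the trinomial is affine in [t], and at this [t] it equals [- ip f f - 2],
     which is negative. *)
  have := pos (- (ip f f + 1) / ip f g); rewrite -g0 mulrAC -mulrA divff//.
  by have := ip_ge0 f; lra.
have := pos (- ip f g / ip g g).
have -> : ip f f + 2 * (- ip f g / ip g g * ip f g) +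
  (- ip f g / ip g g) ^+ 2 * ip g g = ip f f - ip f g ^+ 2 / ip g g.
  by field; rewrite gt_eqF.
by rewrite subr_ge0 ler_pdivrMr.
Qed.

Definition nrm f := Num.sqrt (ip f f).

Lemma nrm_ge0 f : 0 <= nrm f. Proof. exact: sqrtr_ge0. Qed.

Lemma sqr_nrm f : nrm f ^+ 2 = ip f f.
Proof. by rewrite sqr_sqrtr// ip_ge0. Qed.

Lemma CS_nrm f g : L2 f -> L2 g -> `|ip f g| <= nrm f * nrm g.
Proof.
move=> fL gL; rewrite -ler_sqr ?nnegrE// ?mulr_ge0 ?nrm_ge0//.
by rewrite real_normK ?num_real// exprMn !sqr_nrm; exact: CS.
Qed.

Lemma L2norm_nrm f : L2 f -> L2norm f = nrm f.
Proof.
move=> fL; rewrite /L2norm unlock /Lnorm.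
have -> : (\int[mu]_x `|(EFin \o f) x| `^ 2 = (ip f f)%:E)%E.
  rewrite EFin_Rint; last exact: L2M.
  by apply: eq_integral => x _ /=; rewrite powR_mulrn// real_normK ?num_real// expr2.
by rewrite poweR_EFin /= powR12_sqrt// ip_ge0.
Qed.

Lemma ip_eq0_ae f : L2 f -> ip f f = 0 -> {ae mu, forall x, f x = 0}.
Proof.
move=> fL f0; have h x : 0 <= f x * f x by rewrite -expr2 sqr_ge0.
apply: (aeS (Rint_eq0_ae (L2M fL fL) h f0)) => x /eqP.
by rewrite mulf_eq0 => /orP[]/eqP.
Qed.

Lemma ip_dist_eq0_ae f g : L2 f -> L2 g ->
  ip (fun x => f x - g x) (fun x => f x - g x) = 0 -> {ae mu, forall x, f x = g x}.
Proof.
move=> fL gL /(ip_eq0_ae (L2B fL gL)) fg; apply: (aeS fg) => x /eqP.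
by rewrite subr_eq0 => /eqP.
Qed.

Lemma sqrt_cvg0 (u : nat -> R) : u n @[n --> \oo] --> 0 -> Num.sqrt (u n) @[n --> \oo] --> 0.
Proof.
move=> u0; rewrite -(@sqrtr0 R).
by apply: continuous_cvg u0; exact: sqrt_continuous.
Qed.

Lemma ip_cvg (f_ g_ : nat -> R -> R) f g : (forall n, L2 (f_ n)) -> (forall n, L2 (g_ n)) ->
  L2 f -> L2 g ->
  ip (fun x => f_ n x - f x) (fun x => f_ n x - f x) @[n --> \oo] --> 0 ->
  ip (fun x => g_ n x - g x) (fun x => g_ n x - g x) @[n --> \oo] --> 0 ->
  ip (f_ n) (g_ n) @[n --> \oo] --> ip f g.
Proof.
move=> fnL gnL fL gL /sqrt_cvg0 cf /sqrt_cvg0 cg.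
apply/subr_cvg0; apply/norm_cvg0P.
pose e n := nrm (fun x => f_ n x - f x); pose e' n := nrm (fun x => g_ n x - g x).
apply: (@squeeze_cvgr _ _ _ _ (fun=> 0) (fun n => e n * e' n + (e n * nrm g + nrm f * e' n))).
- apply: nearW => n; rewrite normr_ge0 /=.
  have -> : ip (f_ n) (g_ n) - ip f g =
    ip (fun x => f_ n x - f x) (fun x => g_ n x - g x) +
    (ip (fun x => f_ n x - f x) g + ip f (fun x => g_ n x - g x)).
    rewrite !(ipBl, ipBr)//; try exact: L2B.
    ring.
  apply: (le_trans (ler_normD _ _)); apply: lerD.
    by apply: CS_nrm; exact: L2B.
  apply: (le_trans (ler_normD _ _)); apply: lerD; by apply: CS_nrm => //; exact: L2B.
- exact: cvg_cst.
have -> : 0 = 0 * 0 + (0 * nrm g + nrm f * 0) :> R by ring.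
apply: cvgD; first exact: cvgM.
apply: cvgD; apply: cvgM => //; exact: cvg_cst.
Qed.

Lemma cst_ip_cvg f : ip (fun x => f x - f x) (fun x => f x - f x) @[n --> \oo] --> (0 : R).
Proof.
have -> : ip (fun x => f x - f x) (fun x => f x - f x) = 0.
  by rewrite -[RHS](Rintegral0 mu); apply: eq_Rint => x; rewrite subrr mul0r.
exact: cvg_cst.
Qed.

End L2theory.

(** * Completeness of L^2, Riesz representation and weak sequential compactness *)

Section Complete.
Context {R : realType}.
Local Notation mu := (@lebesgue_measure R).
Implicit Types f g h : R -> R.

Definition sqd f g := ip (fun x => f x - g x) (fun x => f x - g x).
Definition L2cvg (f_ : nat -> R -> R) f := sqd (f_ n) f @[n --> \oo] --> (0 : R).

Lemma geometric_cauchy_cvg (g : nat -> R) (M : R) :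
  (forall k, `|g k.+1 - g k| <= M * 2^-1 ^+ k) -> cvg (g n @[n --> \oo]).
Proof.
move=> gM; have M0 : 0 <= M by have := le_trans (normr_ge0 _) (gM 0%N); rewrite expr0 mulr1.
have cs : cvgn (series (telescope g)).
  apply: normed_cvg; apply: (@series_le_cvg _ _ (geometric M 2^-1)) => //=.
  - by move=> n; rewrite mulr_ge0 ?exprn_ge0 ?invr_ge0.
  - apply: is_cvg_geometric_series; rewrite ger0_norm ?invr_ge0//.
    by rewrite invf_lt1// ltr1n.
have -> : g = (fun n => g 0%N + series (telescope g) n).
  by apply/funext => n; exact: eq_sum_telescope.
by apply: is_cvgD => //; exact: is_cvg_cst.
Qed.

Lemma L2_complete (f_ : nat -> R -> R) : (forall n, L2 (f_ n)) ->
  (forall e, 0 < e -> exists N, forall n m, (N <= n)%N -> (N <= m)%N ->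
    sqd (f_ n) (f_ m) <= e) ->
  exists2 f, L2 f & L2cvg f_ f.
Proof.
move=> fL fC.
(* 16 = 4 * 4: weighted by [4^k], the squared gaps still have summable integrals, and a pointwise
   bound [B] on the weighted sum gives gaps of size at most [sqrt B * 2^-k]. *)
have e16 k : 0 < 16^-1 ^+ k.+1 :> R by rewrite exprn_gt0 ?invr_gt0.
have /choice[N NP] := fun k => fC _ (e16 k).
(* Partial sums of [N] give nondecreasing indices that still satisfy [N k <= M k]. *)
pose M k := (\sum_(j < k.+1) N j)%N.
have NM k : (N k <= M k)%N by rewrite /M big_ord_recr /= leq_addl.
have MS k : (M k <= M k.+1)%N by rewrite /M [leqRHS]big_ord_recr /= leq_addr.
pose g k := f_ (M k).
pose S n x := \sum_(k < n) 4 ^+ k * (g k.+1 x - g k x) ^+ 2.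
have gL k : L2 (g k) by exact: fL.
have iD k : intg mu (fun x => 4 ^+ k * (g k.+1 x - g k x) ^+ 2).
  by apply/intgZ/L2_sqr/L2B.
have S_S n : S n.+1 = fun x => S n x + 4 ^+ n * (g n.+1 x - g n x) ^+ 2.
  by apply/funext => x; rewrite /S big_ord_recr.
have Si n : intg mu (S n).
  elim: n => [|n ih]; last by rewrite S_S; exact: intgD.
  have -> : S 0%N = fun=> 0 by apply/funext => x; rewrite /S big_ord0.
  exact: intg0.
have S0 n x : 0 <= S n x.
  by apply: sumr_ge0 => k _; rewrite mulr_ge0 ?sqr_ge0// exprn_ge0.
have SS n x : S n x <= S n.+1 x.
  by rewrite S_S lerDl mulr_ge0 ?sqr_ge0// exprn_ge0.
have ge4 n : 0 < 4^-1 ^+ n :> R by rewrite exprn_gt0// invr_gt0.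
have SC n : \int[mu]_x S n x <= 2 - 4^-1 ^+ n.
  elim: n => [|n ih].
    rewrite expr0; have -> : S 0%N = fun=> 0 by apply/funext => x; rewrite /S big_ord0.
    by rewrite Rintegral0; lra.
  rewrite S_S RintD// RintZ; last exact/L2_sqr/L2B.
  have le16 : \int[mu]_x (g n.+1 x - g n x) ^+ 2 <= 16^-1 ^+ n.+1.
    by apply: (NP n); [exact: leq_trans (NM n) (MS n)|exact: NM].
  have : 4 ^+ n * \int[mu]_x (g n.+1 x - g n x) ^+ 2 <= 16^-1 * 4^-1 ^+ n.
    apply: (@le_trans _ _ (4 ^+ n * 16^-1 ^+ n.+1)).
      by rewrite ler_wpM2l// exprn_ge0.
    rewrite exprS mulrCA ler_wpM2l ?invr_ge0//.
    by rewrite -exprMn; have -> : 4 * 16^-1 = 4^-1 :> R by field.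
  rewrite exprS; have := ge4 n; lra.
have /(nondecreasing_ae_bounded Si S0 SS)[Z [mZ Z0 subZ]] : forall n, \int[mu]_x S n x <= 2.
  by move=> n; apply: (le_trans (SC n)); rewrite lerBlDr lerDl ltW.
(* Cutting out the null set [Z] makes the sequence converge everywhere, so that the limit is
   measurable as a pointwise limit. *)
pose g' k x := g k x * \1_(~` Z) x.
have mnZ : measurable (~` Z) by exact: measurableC.
have mg' k : measurable_fun setT (g' k) by apply: measurable_funM; [exact: L2_mble|exact: measurable_indic].
have aeZ : {ae mu, forall x, ~ Z x}.
  by exists Z; split=> // x /= /contrapT.
have ae_g' k : {ae mu, forall x, g' k x = g k x}.
  by apply: (aeS aeZ) => x nZ; rewrite /g' indicE mem_set ?mulr1.
have cvg_g' x : cvg (g' k x @[k --> \oo]).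
  rewrite /g' indicE; case: (boolP (x \in ~` Z)) => [|_] /=; last first.
    by under eq_fun do rewrite mulr0; exact: is_cvg_cst.
  under [X in _ -> cvg (X @ _)]eq_fun do rewrite mulr1.
  rewrite inE /= => nZ.
  have [B SB] : exists B, forall n, S n x <= B by apply: contrapT => h; apply/nZ/subZ.
  apply: (@geometric_cauchy_cvg _ (Num.sqrt B)) => k.
  have B0 : 0 <= B by exact: le_trans (S0 0%N x) (SB 0%N).
  rewrite -ler_sqr ?nnegrE ?mulr_ge0 ?sqrtr_ge0 ?exprn_ge0 ?invr_ge0//.
  rewrite exprMn sqr_sqrtr// real_normK ?num_real// -exprM mulnC exprM.
  have -> : 2^-1 ^+ 2 = 4^-1 :> R by field.
  rewrite exprVn ler_pdivlMr ?exprn_gt0// mulrC.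
  by apply: le_trans (SB k.+1); rewrite S_S lerDr.
pose f x := lim (g' k x @[k --> \oo]).
have mf : measurable_fun setT f.
  by apply: (measurable_fun_cvg (h := g')) => // x _; exact: cvg_g'.
(* Fatou along the subsequence transfers the Cauchy estimate from [f_ m] to the limit [f]. *)
have key n k : (N k <= n)%N ->
    intg mu (fun x => (f_ n x - f x) ^+ 2) /\ \int[mu]_x (f_ n x - f x) ^+ 2 <= 16^-1 ^+ k.+1.
  move=> Nn; apply: (@fatou_Rint _ _ _ mu (fun j x => (f_ n x - g (k + j)%N x) ^+ 2)).
  - by move=> j; exact/L2_sqr/L2B.
  - by move=> j x; exact: sqr_ge0.
  - move=> j; apply: NP => //; apply: (leq_trans (NM k)).
    by apply: (homo_leq (r := fun a b => (a <= b)%N)) => //; [exact: leq_trans|exact: leq_addr].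
  - by apply/measurable_funX/measurable_funB => //; exact: L2_mble.
  - apply: (aeS aeZ) => x nZ.
    have c : g (k + j)%N x @[j --> \oo] --> f x.
      have -> : (fun j => g (k + j)%N x) = (fun j => g' (j + k)%N x).
        by apply/funext => j; rewrite /g' indicE mem_set// mulr1 addnC.
      rewrite (cvg_shiftn k (fun j => g' j x)); exact: cvg_g'.
    rewrite !expr2; apply: cvgM; apply: cvgB => //; exact: cvg_cst.
have fL2 : L2 f.
  have : L2 (fun x => f_ (N 0%N) x - f x).
    apply/L2P; split; first by apply: measurable_funB => //; exact: L2_mble.
    exact: (key _ 0%N (leqnn _)).1.
  move=> /(L2B (fL (N 0%N))); congr L2.
  by apply/funext => x; ring.
exists f => //; apply/cvgrPdist_le => e e0.
have [k ke] : exists k, 16^-1 ^+ k.+1 <= e.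
  have /cvgrPdist_le/(_ e e0)[k _ /(_ k (leqnn _))] : 16^-1 ^+ n @[n --> \oo] --> (0 : R).
    by apply: cvg_expr; rewrite ger0_norm ?invr_ge0//; lra.
  rewrite sub0r normrN ger0_norm ?exprn_ge0 ?invr_ge0// => le.
  by exists k; apply: le_trans le; rewrite exprS ger_pMl ?exprn_gt0 ?invr_gt0//; lra.
near=> n; rewrite sub0r normrN ger0_norm; last exact: ip_ge0.
apply: le_trans ke; apply: (key n k _).2.
by near: n; exists (N k).
Unshelve. all: by end_near. Qed.

(** The representative minimises [J g = |g|^2 - 2 l g]. The parallelogram identity makes minimising
    sequences Cauchy, and the first variation of [J] at the minimum is the claim. *)
Lemma riesz_representation (l : (R -> R) -> R) (C : R) :
  (forall g h, L2 g -> L2 h -> l (fun x => g x + h x) = l g + l h) ->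
  (forall a g, L2 g -> l (fun x => a * g x) = a * l g) ->
  (forall g, L2 g -> `|l g| <= C * nrm g) ->
  exists2 h, L2 h & forall g, L2 g -> l g = ip h g.
Proof.
move=> lD lZ lC.
have lB g h : L2 g -> L2 h -> l (fun x => g x - h x) = l g - l h.
  move=> gL hL; have -> : (fun x => g x - h x) = (fun x => g x + -1 * h x).
    by apply/funext => x; rewrite mulN1r.
  by rewrite lD ?lZ ?mulN1r//; exact: L2Z.
pose J g := ip g g - 2 * l g.
have J_lb g : L2 g -> - C ^+ 2 <= J g.
  move=> gL; rewrite /J -sqr_nrm.
  have := lC g gL; have := ler_norm (l g); have := sqr_ge0 (nrm g - C).
  rewrite sqrrB -mulr_natl; move: (nrm g) (l g); clear => n a; lra.
pose A := [set J g | g in @L2 R].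
have hA : has_inf A.
  split; first by exists (J (fun=> 0)), (fun=> 0) => //; exact: L2_0.
  by exists (- C ^+ 2) => _ [g gL <-]; exact: J_lb.
have e0 (n : nat) : 0 < n.+1%:R^-1 :> R by rewrite invr_gt0.
have /choice[g_ gP] : forall n : nat, exists g, L2 g /\ J g < inf A + n.+1%:R^-1.
  by move=> n; have [_ [g gL <-] ?] := inf_adherent (e0 n) hA; exists g.
have gL n : L2 (g_ n) := (gP n).1.
have J_inf g : L2 g -> inf A <= J g.
  by move=> gL'; apply: (ge_inf hA.2); exists g.
have par n m : sqd (g_ n) (g_ m) <= 2 * n.+1%:R^-1 + 2 * m.+1%:R^-1.
  have sL : L2 (fun x => g_ n x + g_ m x) by exact: L2D.
  have := J_inf _ (L2Z 2^-1 sL).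
  rewrite /J ipZl ?ipZr// ?sqD// ?lZ// ?lD//; last exact: L2Z.
  have := (gP n).2; have := (gP m).2; rewrite /J /sqd sqB//.
  by move: n.+1%:R^-1 m.+1%:R^-1 (inf A) => a b i; lra.
have [h hL gh] : exists2 h, L2 h & L2cvg g_ h.
  apply: L2_complete => // e e_gt0.
  have /cvgrPdist_le/(_ (e / 4))[|N _ NP] := @cvg_harmonic R.
    by rewrite divr_gt0.
  exists N => n m /NP + /NP; rewrite /harmonic /= !sub0r !normrN.
  rewrite !ger0_norm ?invr_ge0// => en em.
  by move: en em (par n m); move: n.+1%:R^-1 m.+1%:R^-1 => a b; lra.
have Jh : J h <= inf A.
  have Jcv : J (g_ n) @[n --> \oo] --> J h.
    apply: cvgB; first exact: ip_cvg.
    apply: cvgM; first exact: cvg_cst.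
    apply/subr_cvg0/norm_cvg0P.
    apply: (@squeeze_cvgr _ _ _ _ (fun=> 0) (fun n => C * nrm (fun x => g_ n x - h x))).
    - apply: nearW => n; rewrite normr_ge0 /= -lB//; apply: lC; exact: L2B.
    - exact: cvg_cst.
    - rewrite -(mulr0 C); apply: cvgM; first exact: cvg_cst.
      exact: sqrt_cvg0.
  have icv : inf A + harmonic n @[n --> \oo] --> inf A.
    rewrite -[X in _ --> X]addr0; apply: cvgD; first exact: cvg_cst.
    exact: cvg_harmonic.
  apply: (ler_cvg_to Jcv icv); apply: nearW => n; exact/ltW/(gP n).2.
exists h => // g gL'; apply/eqP; rewrite -subr_eq0; apply/eqP.
set b := _ - _.
have c0 := ip_ge0 g.
have pos t : 0 <= - (2 * t * b) + t ^+ 2 * ip g g.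
  have tL : L2 (fun x => t * g x) by exact: L2Z.
  have := le_trans Jh (J_inf _ (L2D hL tL)).
  rewrite /J sqD// !ipZr ?ipZl ?lD ?lZ// /b; nra.
(* The optimal [t] would be [b / ip g g]; adding 1 avoids the case [ip g g = 0] and still gives a
   value [<= 0], strictly so unless [b = 0]. *)
have := pos (b / (ip g g + 1)).
have -> : - (2 * (b / (ip g g + 1)) * b) + (b / (ip g g + 1)) ^+ 2 * ip g g =
   - (b ^+ 2 * ((ip g g + 2) / (ip g g + 1) ^+ 2)).
  by field; rewrite gt_eqF//; lra.
rewrite oppr_ge0 pmulr_lle0; last by rewrite divr_gt0 ?exprn_gt0//; lra.
by move=> b0; apply/eqP; rewrite -sqrf_eq0 eq_le b0 sqr_ge0.
Qed.

Lemma ultra_fmap (T S : Type) (f : T -> S) (U : set_system T) :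
  UltraFilter U -> UltraFilter (f @ U).
Proof.
move=> UU; split; first exact: fmap_proper_filter.
move=> G GP UG; apply/seteqP; split => // A GA.
have [//|nA] := in_ultra_setVsetC (f @^-1` A) UU.
have GnA : G (~` A) by exact: UG.
have : G (A `&` ~` A) by exact: filterI.
by rewrite setICr => G0; case: (@filter_not_empty _ G GP G0).
Qed.

(** Along an ultrafilter every bounded real sequence converges, so all the pairings have limits at
    once. The limit is a bounded linear functional of [g], which Riesz represents. *)
Lemma ultra_weak_limit (U : set_system nat) (h_ : nat -> R -> R) (C : R) :
  UltraFilter U -> (forall n, L2 (h_ n)) -> (forall n, ip (h_ n) (h_ n) <= C) ->
  exists2 h, L2 h & forall g, L2 g -> ip (h_ n) g @[n --> U] --> ip h g.
Proof.
move=> UU hL hC.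
have bd g n : L2 g -> `|ip (h_ n) g| <= Num.sqrt C * nrm g.
  move=> gL; apply: (le_trans (CS_nrm (hL n) gL)).
  by rewrite ler_wpM2r ?nrm_ge0// ler_wsqrtr.
have cv g : L2 g -> cvg (ip (h_ n) g @[n --> U]).
  move=> gL; pose K : set R := `[- (Num.sqrt C * nrm g), Num.sqrt C * nrm g]%classic.
  have cK : compact K by exact: segment_compact.
  move: cK; rewrite compact_ultra => /(_ _ (ultra_fmap (fun n => ip (h_ n) g) UU)).
  have KU : ((fun n => ip (h_ n) g) @ U) K.
    apply: (@filterE _ U) => n; rewrite /K /= in_itv /=.
    by have := bd g n gL; rewrite ler_norml.
  by move=> /(_ KU)[p [_ /= pc]]; apply/cvg_ex; exists p.
pose l g := lim (ip (h_ n) g @[n --> U]).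
have [h hL' hP] : exists2 h, L2 h & forall g, L2 g -> l g = ip h g.
  apply: (@riesz_representation l (Num.sqrt C)).
  - move=> g k gL kL; apply/cvg_lim => //.
    under eq_fun do rewrite ipDr//.
    by apply: cvgD; exact: cv.
  - move=> a g gL; apply/cvg_lim => //.
    under eq_fun do rewrite ipZr//.
    by apply: cvgM; [exact: cvg_cst|exact: cv].
  - move=> g gL; rewrite ler_norml; apply/andP; split.
      apply: limr_ge; [exact: cv|apply: nearW => n].
      by have := bd g n gL; rewrite ler_norml => /andP[].
    apply: limr_le; [exact: cv|apply: nearW => n].
    by have := bd g n gL; rewrite ler_norml => /andP[].
by exists h => // g gL; rewrite -hP//; exact: cv.
Qed.

Definition wcvg (h_ : nat -> R -> R) h :=
  forall g, L2 g -> ip (h_ n) g @[n --> \oo] --> ip h g.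

(* An ultrafilter limit [h] is tested only against the countable family [h_]
   and a subsequence is extracted; a second ultrafilter limit along any further
   subsequence has the same products with [h_], hence is equal to [h]. *)
Lemma weak_compactness (h_ : nat -> R -> R) (C : R) :
  (forall n, L2 (h_ n)) -> (forall n, ip (h_ n) (h_ n) <= C) ->
  exists s h, [/\ {homo s : m n / (m < n)%N}, L2 h & wcvg (fun n => h_ (s n)) h].
Proof.
move=> hL hC.
have [U [UU ooU]] := @ultraFilterLemma nat \oo _.
have [h hL' hP] := ultra_weak_limit UU hL hC.
have /choice[F FP] : forall kp : nat * nat, exists n, (kp.2 < n)%N /\
    forall m, (m <= kp.1)%N -> `|ip h (h_ m) - ip (h_ n) (h_ m)| < kp.1.+1%:R^-1.
  move=> [k p] /=.
  have Uj (e : R) j : 0 < e ->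
      U [set n | forall m, (m < j)%N -> `|ip h (h_ m) - ip (h_ n) (h_ m)| < e].
    move=> e0; elim: j => [|j ih]; first exact: filterE.
    have Uje : U [set n | `|ip h (h_ j) - ip (h_ n) (h_ j)| < e].
      by move/cvgrPdist_lt : (hP _ (hL j)); exact.
    apply: filterS2 ih Uje => n /= H1 H2 m.
    by rewrite ltnS leq_eqVlt => /predU1P[->|/H1].
  have Up : U [set n | (p < n)%N] by apply: ooU; exists p.+1.
  have k0 : 0 < k.+1%:R^-1 :> R by rewrite invr_gt0.
  have : U ([set n | (p < n)%N] `&`
      [set n | forall m, (m < k.+1)%N -> `|ip h (h_ m) - ip (h_ n) (h_ m)| < k.+1%:R^-1]).
    by apply: filterI => //; exact: Uj.
  by move=> /filter_ex[n nP]; exists n.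
pose s := fix s k := if k is k'.+1 then F (k, s k') else F (0%N, 0%N).
have sP k m : (m <= k)%N -> `|ip h (h_ m) - ip (h_ (s k)) (h_ m)| < k.+1%:R^-1.
  by case: k => [|k]; [exact: (FP (0%N, 0%N)).2|exact: (FP (k.+1, s k)).2].
have sS k : (s k < s k.+1)%N by exact: (FP (k.+1, s k)).1.
have s_h m : ip (h_ (s k)) (h_ m) @[k --> \oo] --> ip h (h_ m).
  apply/cvgrPdist_lt => e e0.
  have /cvgrPdist_lt/(_ e e0)[N _ NP] := @cvg_harmonic R.
  near=> k; apply: (@lt_trans _ _ k.+1%:R^-1).
    by apply: sP; near: k; exists m.
  have /NP : (N <= k)%N by near: k; exists N.
  by rewrite /harmonic /= sub0r normrN ger0_norm ?invr_ge0.
exists s, h; split=> //; first by apply: homo_ltn => //; exact: ltn_trans.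
move=> g gL; apply: contrapT => ncv.
have [e e0 /choice[t tP]] : exists2 e : R, 0 < e & forall K, exists k, (K <= k)%N /\
    e <= `|ip h g - ip (h_ (s k)) g|.
  apply: contrapT => /forall2NP H; apply: ncv; apply/cvgrPdist_lt => e e0.
  have [//|/existsNP[K KP]] := H e; exists K => // k /= Kk.
  by rewrite ltNge; apply/negP => le; apply: KP; exists k.
have [h' hL'' hP'] := @ultra_weak_limit U (fun K => h_ (s (t K))) C UU
  (fun K => hL _) (fun K => hC _).
have t_oo : t K @[K --> \oo] --> \oo.
  move=> A [N _ NA]; exists N => // K /= NK; apply: NA => /=.
  exact: leq_trans NK (tP K).1.
have UP : ProperFilter U by exact: ultra_proper.
have h'h m : ip h' (h_ m) = ip h (h_ m).
  have c1 := hP' _ (hL m).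
  have c2 : ip (h_ (s (t K))) (h_ m) @[K --> \oo] --> ip h (h_ m).
    exact: (cvg_comp _ _ t_oo (s_h m)).
  apply: (cvg_unique _ c1) => //= A nA; exact: (ooU _ (c2 _ nA)).
(* The difference [h' - h] is orthogonal to every [h_ m], hence to the weak limits [h] and [h'],
   hence to itself. *)
have dL : L2 (fun x => h' x - h x) by exact: L2B.
have orth m : ip (h_ m) (fun x => h' x - h x) = 0.
  by rewrite ipBr// ![ip (h_ m) _]ipC h'h subrr.
have o1 : ip h (fun x => h' x - h x) = 0.
  apply: (cvg_unique _ (hP _ dL)) => //=; under eq_fun do rewrite orth; exact: cvg_cst.
have o2 : ip h' (fun x => h' x - h x) = 0.
  apply: (cvg_unique _ (hP' _ dL)) => //=; under eq_fun do rewrite orth; exact: cvg_cst.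
have hh' : {ae mu, forall x, h' x = h x}.
  by apply: ip_dist_eq0_ae => //; rewrite ipBl// o1 o2 subrr.
have /cvgrPdist_lt/(_ e e0)/filter_ex[K] := hP' _ gL.
have -> : ip h' g = ip h g by apply: ip_ae => //; exact: aeW.
by rewrite ltNge (tP K).2.
Unshelve. all: by end_near. Qed.

End Complete.

(** * Invariance of Lebesgue measure and antiderivatives on the line *)

Section LineIntegrals.
Context {R : realType}.
Local Notation mu := (@lebesgue_measure R).
Implicit Types (f g F : R -> R) (x : R).

Section MeasurePreserving.
Context (phi : measurableTypeR R -> measurableTypeR R) (mphi : measurable_fun setT phi)
  (phi_mu : forall X, ocitv X -> mu (phi @^-1` X) = mu X).

Let mphi_mixin := isMeasurableFun.Build _ _ _ _ phi mphi.
Let mphi_pack : {mfun _ >-> _} := HB.pack phi mphi_mixin.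

(** Lebesgue measure is characterised by its values on half-open intervals, the only sets on which
    [phi_mu] gives information. *)
Lemma pushforward_lebesgue A : measurable A -> pushforward mu phi A = mu A.
Proof.
move=> mA; apply/esym.
apply: (@lebesgue_measure_unique R (pushforward mu mphi_pack)) => // X oX.
by rewrite /= /pushforward phi_mu.
Qed.

Lemma intg_comp f : intg mu f -> intg mu (fun x => f (phi x)).
Proof.
move=> fi; have mf := intg_mble fi.
apply/integrableP; split.
  by apply/measurable_EFinP; exact: (measurableT_comp mf).
have /integrableP[_] := fi; congr (_ < _)%E.
transitivity (\int[pushforward mu mphi_pack]_x `|(EFin \o f) x|)%E.
  by apply: eq_measure_integral => A mA _; rewrite /= pushforward_lebesgue.
rewrite ge0_integral_pushforward//.
by do 2 apply: measurableT_comp => //.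
Qed.

Lemma Rint_comp f : intg mu f -> \int[mu]_x f (phi x) = \int[mu]_x f x.
Proof.
move=> fi; have mf := intg_mble fi; congr fine.
transitivity (\int[pushforward mu mphi_pack]_x (EFin \o f) x)%E; last first.
  by apply: eq_measure_integral => A mA _; rewrite /= pushforward_lebesgue.
by rewrite integral_pushforward//; [exact/measurable_EFinP|exact: intg_comp].
Qed.
End MeasurePreserving.

Lemma translation_ocitv (a : R) X : ocitv X -> mu ((fun x => x + a) @^-1` X) = mu X.
Proof.
move=> [[b c] _ <-] /=.
have -> : (fun x => x + a) @^-1` `]b, c]%classic = `]b - a, c - a]%classic.
  by apply/seteqP; split => x /=; rewrite !in_itv /= ltrBlDr lerBrDr.
rewrite !lebesgue_measure_itv /= !lte_fin ltrD2r; case: ifP => // _.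
by rewrite -!EFinD; congr (_%:E); ring.
Qed.

Lemma reflection_ocitv X : ocitv X -> mu ((fun x => - x) @^-1` X) = mu X.
Proof.
move=> [[b c] _ <-] /=.
have -> : (fun x => - x) @^-1` `]b, c]%classic = `[- c, - b[%classic.
  by apply/seteqP; split => x /=; rewrite !in_itv /= andbC ltrNr lerNl.
rewrite !lebesgue_measure_itv /= !lte_fin ltrN2; case: ifP => // _.
by rewrite -!EFinD; congr (_%:E); ring.
Qed.

Let mtrans (a : R) : measurable_fun setT (fun x : R => x + a).
Proof. mble. Qed.
Let mrefl : measurable_fun setT (fun x : R => - x).
Proof. mble. Qed.

Lemma intg_shift f a : intg mu f -> intg mu (fun x => f (x + a)).
Proof. exact: (intg_comp (mtrans a) (@translation_ocitv a)). Qed.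

Lemma Rint_shift f a : intg mu f -> \int[mu]_x f (x + a) = \int[mu]_x f x.
Proof. exact: (Rint_comp (mtrans a) (@translation_ocitv a)). Qed.

Lemma intg_opp f : intg mu f -> intg mu (fun x => f (- x)).
Proof. exact: (intg_comp mrefl reflection_ocitv). Qed.

Lemma Rint_opp f : intg mu f -> \int[mu]_x f (- x) = \int[mu]_x f x.
Proof. exact: (Rint_comp mrefl reflection_ocitv). Qed.

Lemma ae_opp (P : R -> Prop) : {ae mu, forall x, P x} -> {ae mu, forall x, P (- x)}.
Proof.
move=> [N [mN N0 subN]]; exists ((fun x => - x) @^-1` N); split.
- by rewrite -[X in measurable X]setTI; exact: mrefl.
- by rewrite -N0; exact: (pushforward_lebesgue mrefl reflection_ocitv mN).
- by move=> x /= nP; exact: subN.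
Qed.

Lemma ae_shift (P : R -> Prop) a : {ae mu, forall x, P x} -> {ae mu, forall x, P (x + a)}.
Proof.
move=> [N [mN N0 subN]]; exists ((fun x => x + a) @^-1` N); split.
- by rewrite -[X in measurable X]setTI; exact: mtrans.
- by rewrite -N0; exact: (pushforward_lebesgue (mtrans a) (@translation_ocitv a) mN).
- by move=> x /= nP; exact: subN.
Qed.

Lemma ae_neq (a : R) : {ae mu, forall x, x != a}.
Proof.
exists [set a]; split => //; first exact: lebesgue_measure_set1.
by move=> x /= /negP; rewrite negbK => /eqP.
Qed.

Lemma Rint_odd f : intg mu f -> (forall x, f (- x) = - f x) -> \int[mu]_x f x = 0.
Proof.
move=> fi fo; have := Rint_opp fi.
under eq_Rintegral do rewrite fo.
by rewrite RintN// => /eqP; rewrite eq_sym -addr_eq0 -mulr2n mulrn_eq0 => /eqP.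
Qed.

Lemma RintI (D : set R) f : \int[mu]_(x in D) f x = \int[mu]_x (\1_D x * f x).
Proof.
rewrite Rintegral_mkcond; apply: eq_Rint => x.
by rewrite patchE indicE; case: (x \in D); rewrite ?mul1r ?mul0r.
Qed.

Lemma intg_indicM (D : set R) f : measurable D -> intg mu f -> intg mu (fun x => \1_D x * f x).
Proof.
move=> mD fi; apply: (intg_domC (C := 1) _ fi) => [|x].
  by apply: measurable_funM; [exact: measurable_indic|exact: (intg_mble fi)].
by rewrite normrM ler_wpM2r// indicE; case: (x \in D); rewrite ?normr1 ?normr0.
Qed.

Lemma intg_itv f (a b : R) : continuous f -> intg mu (fun x => \1_`[a, b] x * f x).
Proof.
move=> cf; have := @continuous_compact_integrable R f `[a, b] (@segment_compact R a b) _.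
move=> /(_ (continuous_subspaceT cf)); rewrite integrable_mkcond//.
congr integrable; apply/funext => x.
by rewrite /= patchE indicE; case: (x \in _); rewrite /= ?mul1r ?mul0r.
Qed.

Lemma ftc_segment f F (a b : R) : a <= b -> continuous f ->
  (forall x, is_derive x 1 F (f x)) -> \int[mu]_x (\1_`[a, b] x * f x) = F b - F a.
Proof.
move=> ab cf dF; rewrite -RintI; move: ab; rewrite le_eqVlt => /predU1P[<-|ab].
  by rewrite set_itv1 Rintegral_set1 subrr.
have dvF x : derivable F x 1 by exact: ex_derive.
have cF : continuous F by move=> x; apply/differentiable_continuous/derivable1_diffP.
rewrite /Rintegral (@continuous_FTC2 _ f F)//.
- exact: continuous_subspaceT.
- split => //; first exact/cvg_at_right_filter/cF.
  exact/cvg_at_left_filter/cF.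
- by move=> x _; rewrite derive1E derive_val.
Qed.

Lemma indic_ge0E (x : R) : \1_`[0, +oo[ x = (0 <= x)%R%:R :> R.
Proof. by rewrite indicE; congr (_%:R); congr nat_of_bool; apply/idP/idP; rewrite inE /= in_itv /= andbT. Qed.

Lemma indic_itvE (a b x : R) : \1_`[a, b] x = (a <= x <= b)%R%:R :> R.
Proof. by rewrite indicE; congr (_%:R); congr nat_of_bool; apply/idP/idP; rewrite inE /= in_itv. Qed.

Lemma cvg_indic_half (x : R) : (\1_`[0, n%:R] x : R) @[n --> \oo] --> ((0 <= x)%R%:R : R).
Proof.
apply: cvg_near_cst; near=> n; rewrite indic_itvE.
have -> : x <= n%:R by near: n; exact: nbhs_infty_ger.
by rewrite andbT.
Unshelve. all: by end_near. Qed.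

Lemma cvg_indic_line (x : R) : (\1_`[- n%:R, n%:R] x : R) @[n --> \oo] --> (1 : R).
Proof.
apply: cvg_near_cst; near=> n; rewrite indic_itvE.
have : `|x| <= n%:R by near: n; exact: nbhs_infty_ger.
by rewrite ler_norml => ->.
Unshelve. all: by end_near. Qed.

(** The integrals over [[0, n]] are [F n - F 0 <= C - F 0]; Fatou turns this bound into
    integrability. *)
Lemma ftc_half_intg f F (C : R) : continuous f -> (forall x, 0 <= x -> 0 <= f x) ->
  (forall x, is_derive x 1 F (f x)) -> (forall x, 0 <= x -> F x <= C) ->
  intg mu (fun x => (0 <= x)%R%:R * f x).
Proof.
move=> cf f0 dF FC.
apply: (@fatou_Rint _ _ _ mu (fun n x => \1_`[0, n%:R] x * f x) _ (C - F 0) _ _ _ _ _).1.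
- by move=> n; exact: intg_itv.
- move=> n x; rewrite indic_itvE; case: (boolP (0 <= x)) => [/f0 ?|_]; last by rewrite mul0r.
  by rewrite mulr_ge0.
- by move=> n; rewrite (ftc_segment _ cf dF)// lerD2r FC.
- apply: measurable_funM; last exact: continuous_measurable_fun.
  by under eq_fun do rewrite -indic_ge0E; exact: measurable_indic.
- apply: aeW => x; apply: cvgM; [exact: cvg_indic_half|exact: cvg_cst].
Qed.

Lemma ftc_half f F (l : R) : continuous f ->
  (forall x, is_derive x 1 F (f x)) -> intg mu (fun x => (0 <= x)%R%:R * f x) ->
  F n%:R @[n --> \oo] --> l -> \int[mu]_x ((0 <= x)%R%:R * f x) = l - F 0.
Proof.
move=> cf dF fi Fl.
have [] := @dominated_Rint _ _ _ mu (fun n x => \1_`[0, n%:R] x * f x)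
  (fun x => (0 <= x)%R%:R * f x) _ _ (intg_abs fi).
- by move=> n; apply: intg_mble; exact: intg_itv.
- move=> n x; rewrite !normrM ler_wpM2r// indic_itvE.
  by case: (0 <= x); case: (x <= n%:R); rewrite /= ?normr1 ?normr0.
- by move=> x; apply: cvgM; [exact: cvg_indic_half|exact: cvg_cst].
move=> _ c1; apply: (cvg_unique _ c1) => //=.
under eq_fun do rewrite (ftc_segment _ cf dF)//.
by apply: cvgB => //; exact: cvg_cst.
Qed.

Lemma ftc_line_intg f F (C : R) : continuous f -> (forall x, 0 <= f x) ->
  (forall x, is_derive x 1 F (f x)) -> (forall x, `|F x| <= C) ->
  intg mu f /\ \int[mu]_x f x <= C + C.
Proof.
move=> cf f0 dF FC.
apply: (@fatou_Rint _ _ _ mu (fun n x => \1_`[- n%:R, n%:R] x * f x) _ (C + C)).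
- by move=> n; exact: intg_itv.
- by move=> n x; rewrite mulr_ge0.
- move=> n; rewrite (ftc_segment _ cf dF) ?lerD//; last by rewrite ge0_cp.
    exact: le_trans (ler_norm _) (FC _).
  by rewrite (le_trans (ler_norm _))// normrN.
- exact: continuous_measurable_fun.
- apply: aeW => x; rewrite -[X in _ --> X]mul1r.
  by apply: cvgM; [exact: cvg_indic_line|exact: cvg_cst].
Qed.

Lemma ftc_line f F (l m : R) : continuous f ->
  (forall x, is_derive x 1 F (f x)) -> intg mu f ->
  F n%:R @[n --> \oo] --> l -> F (- n%:R) @[n --> \oo] --> m ->
  \int[mu]_x f x = l - m.
Proof.
move=> cf dF fi Fl Fm.
have [] := @dominated_Rint _ _ _ mu (fun n x => \1_`[- n%:R, n%:R] x * f x) f _ _ (intg_abs fi).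
- by move=> n; apply: intg_mble; exact: intg_itv.
- move=> n x; rewrite normrM ler_piMl// indicE; by case: (_ \in _); rewrite ?normr1 ?normr0.
- move=> x; rewrite -[X in _ --> X]mul1r.
  by apply: cvgM; [exact: cvg_indic_line|exact: cvg_cst].
move=> _ c1; apply: (cvg_unique _ c1) => //=.
under eq_fun do rewrite (ftc_segment _ cf dF) ?ge0_cp//.
by apply: cvgB.
Qed.

Lemma Rint_even f : intg mu f -> (forall x, f (- x) = f x) ->
  \int[mu]_x f x = 2 * \int[mu]_x ((0 <= x)%R%:R * f x).
Proof.
move=> fi fe.
have hi : intg mu (fun x => (0 <= x)%R%:R * f x).
  by under eq_fun do rewrite -indic_ge0E; exact: intg_indicM.
transitivity (\int[mu]_x ((0 <= x)%R%:R * f x + (0 <= - x)%R%:R * f (- x))).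
  apply: Rint_ae; [exact: (intg_mble fi)|apply: (@intg_mble _ _ _ mu)|].
    by apply: intgD => //; exact: (intg_opp hi).
  apply: (aeS (ae_neq 0)) => x x0; rewrite fe -mulrDl oppr_ge0.
  by case: ltgtP x0 => //; rewrite ?addr0 ?add0r mul1r.
rewrite RintD//; last exact: (intg_opp hi).
by rewrite (Rint_opp hi) mulr_natl mulr2n.
Qed.

Lemma intg_even_dom f g : measurable_fun setT f -> intg mu (fun x => (0 <= x)%R%:R * g x) ->
  (forall x, 0 <= x -> `|f x| <= g x) -> (forall x, 0 <= x -> `|f (- x)| <= g x) -> intg mu f.
Proof.
move=> mf gi fg fg'; apply: (intg_dom _ (intgD (intg_abs gi) (intg_abs (intg_opp gi)))) => // x.
case: (leP 0 x) => [x0|x0].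
  by rewrite mul1r ler_wpDr// (le_trans (fg _ x0)) ?ler_norm.
rewrite mul0r normr0 add0r oppr_ge0 (ltW x0) mul1r.
by have := fg' (- x); rewrite opprK oppr_ge0 (ltW x0) => /(_ isT) h; rewrite (le_trans h) ?ler_norm.
Qed.

End LineIntegrals.

(** * Fubini's theorem for real-valued integrals *)

Section FubiniLine.
Context {R : realType}.
Local Notation mu := (@lebesgue_measure R).

(** All sections, and not merely almost all, are integrable: the real-valued inner integrals then
    agree everywhere with the extended-valued ones of the product-measure theorem. *)
Lemma fubini_line (F : R * R -> R) : measurable_fun setT F ->
  (forall x, intg mu (fun y => F (x, y))) -> (forall y, intg mu (fun x => F (x, y))) ->
  intg mu (fun x => \int[mu]_y `|F (x, y)|) ->
  [/\ intg mu (fun x => \int[mu]_y F (x, y)), intg mu (fun y => \int[mu]_x F (x, y)) &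
    \int[mu]_x \int[mu]_y F (x, y) = \int[mu]_y \int[mu]_x F (x, y)].
Proof.
move=> mF F1 F2 FF.
have Fi : (mu \x mu)%E.-integrable setT (EFin \o F).
  apply/integrable12ltyP; first exact/measurable_EFinP.
  have /integrableP[_] := FF; apply: le_lt_trans.
  apply: ge0_le_integral => //.
  - by move=> x _; exact: integral_ge0.
  - apply: (@measurable_fun_fubini_tonelli_F _ _ _ _ _ mu (fun z => `|F z|%:E)) => //.
    by apply: measurableT_comp => //; exact: measurableT_comp.
  - have mFF := intg_mble FF; by do 2 apply: measurableT_comp => //.
  move=> x _ /=; rewrite ger0_norm; last exact: Rint_ge0.
  by rewrite EFin_Rint//; exact: intg_abs.
have eF : (fun x => \int[mu]_y F (x, y))%R = fine \o fubini_F mu (EFin \o F) by [].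
have eF' : EFin \o (fun x => \int[mu]_y F (x, y))%R = fubini_F mu (EFin \o F).
  by apply/funext => x /=; rewrite EFin_Rint.
have eG' : EFin \o (fun y => \int[mu]_x F (x, y))%R = fubini_G mu (EFin \o F).
  by apply/funext => x /=; rewrite EFin_Rint.
split.
- by rewrite /intg eF'; exact: integrable_fubini_F.
- rewrite /intg eG'; apply/integrableP; split; first exact: (measurable_fubini_G Fi).
  have := (integrable21ltyP mu mu (measurable_int _ Fi)).1 Fi; apply: le_lt_trans.
  apply: ge0_le_integral => //.
  - by apply: measurableT_comp => //; exact: (measurable_fubini_G Fi).
  - apply: (@measurable_fun_fubini_tonelli_G _ _ _ _ _ mu (fun z => `|F z|%:E)) => //.
    by apply: measurableT_comp => //; exact: measurableT_comp.
  move=> y _; apply: le_abse_integral => //.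
  exact: measurable_int (F2 y).
congr fine; transitivity (\int[mu]_x (fubini_F mu (EFin \o F) x))%E.
  by rewrite -eF'.
rewrite /fubini_F (Fubini Fi); apply: eq_integral => y _.
by rewrite -/(fubini_G mu (EFin \o F) y) -eG'.
Qed.

Lemma fubini_dom (F : R * R -> R) (f g : R -> R) : measurable_fun setT F ->
  intg mu f -> intg mu g -> (forall x y, `|F (x, y)| <= `|f x| * `|g y|) ->
  [/\ intg mu (fun x => \int[mu]_y F (x, y)), intg mu (fun y => \int[mu]_x F (x, y)) &
    \int[mu]_x \int[mu]_y F (x, y) = \int[mu]_y \int[mu]_x F (x, y)].
Proof.
move=> mF fi gi Ffg.
have m1 x : measurable_fun setT (fun y => F (x, y)).
  by apply: (measurableT_comp mF); exact: measurable_pair1.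
have m2 y : measurable_fun setT (fun x => F (x, y)).
  by apply: (measurableT_comp mF); exact: measurable_pair2.
have F1 x : intg mu (fun y => F (x, y)).
  by apply: (intg_domC (C := `|f x|) _ gi); [exact: m1|exact: Ffg].
apply: fubini_line => //.
  move=> y; apply: (intg_domC (C := `|g y|) _ fi) => [|x]; first exact: m2.
  by rewrite mulrC.
apply: (intg_domC (C := \int[mu]_y `|g y|) _ fi) => [|x]; last first.
  rewrite ger0_norm; last exact: Rint_ge0.
  rewrite mulrC -RintZ; last exact: intg_abs.
  by apply: le_Rint => //; [exact: intg_abs|exact/intgZ/intg_abs].
have -> : (fun x => \int[mu]_y `|F (x, y)|)%R = fine \o fubini_F mu (fun z => `|F z|%:E) by [].
apply: measurableT_comp => //.
apply: measurable_fun_fubini_tonelli_F => //.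
by apply: measurableT_comp => //; exact: measurableT_comp.
Qed.

End FubiniLine.

(** * Differentiation rules *)

Section RealDerivatives.
Context {R : realType}.
Implicit Types (f g : R -> R) (x a b c : R).

Lemma drv_cst c x : is_derive x 1 (fun=> c) (0 : R).
Proof. exact: is_derive_cst. Qed.

Lemma drv_id x : is_derive x 1 (fun y : R => y) (1 : R).
Proof. exact: is_derive_id. Qed.

Lemma drvD f g x a b : is_derive x 1 f a -> is_derive x 1 g b ->
  is_derive x 1 (fun y => f y + g y) (a + b).
Proof. by move=> fa gb; exact: is_deriveD. Qed.

Lemma drvN f x a : is_derive x 1 f a -> is_derive x 1 (fun y => - f y) (- a).
Proof. by move=> fa; exact: is_deriveN. Qed.

Lemma drvM f g x a b : is_derive x 1 f a -> is_derive x 1 g b ->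
  is_derive x 1 (fun y => f y * g y) (a * g x + f x * b).
Proof.
move=> fa gb; apply: (is_derive_eq (is_deriveM fa gb)).
by rewrite /GRing.scale /= addrC mulrC.
Qed.

Lemma drvZ c f x a : is_derive x 1 f a -> is_derive x 1 (fun y => c * f y) (c * a).
Proof.
move=> fa; apply: (is_derive_eq (drvM (drv_cst c x) fa)).
by rewrite mul0r add0r.
Qed.

Lemma drv_comp f g x a b : is_derive (g x) 1 f a -> is_derive x 1 g b ->
  is_derive x 1 (fun y => f (g y)) (a * b).
Proof. by move=> fa gb; have := is_derive1_comp fa gb. Qed.

Lemma drvX f x a n : is_derive x 1 f a ->
  is_derive x 1 (fun y => f y ^+ n) (n%:R * f x ^+ n.-1 * a).
Proof.
move=> fa; elim: n => [|n ih].
  by rewrite !mul0r; under eq_fun do rewrite expr0; exact: drv_cst.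
under eq_fun do rewrite exprS; apply: (is_derive_eq (drvM fa ih)).
case: n {ih} => [|n]; first by rewrite !expr0; ring.
by rewrite !exprS /= -natr1; ring.
Qed.

Lemma drvV f x a : f x != 0 -> is_derive x 1 f a ->
  is_derive x 1 (fun y => (f y)^-1) (- a / f x ^+ 2).
Proof.
move=> f0 fa; apply: (is_derive_eq (is_deriveV f0 fa)).
by rewrite /GRing.scale /= !mulNr mulrC.
Qed.

Lemma drv_expR f x a : is_derive x 1 f a ->
  is_derive x 1 (fun y => expR (f y)) (expR (f x) * a).
Proof. by move=> fa; exact: (@drv_comp expR f _ _ _ (is_derive_expR _) fa). Qed.

Lemma drv_sin f x a : is_derive x 1 f a ->
  is_derive x 1 (fun y => sin (f y)) (cos (f x) * a).
Proof. by move=> fa; exact: (@drv_comp sin f _ _ _ (is_derive_sin _) fa). Qed.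

Lemma drv_cos f x a : is_derive x 1 f a ->
  is_derive x 1 (fun y => cos (f y)) (- sin (f x) * a).
Proof. by move=> fa; exact: (@drv_comp cos f _ _ _ (is_derive_cos _) fa). Qed.

Lemma drv_atan f x a : is_derive x 1 f a ->
  is_derive x 1 (fun y => atan (f y)) ((1 + f x ^+ 2)^-1 * a).
Proof. by move=> fa; exact: (@drv_comp atan f _ _ _ (is_derive1_atan _) fa). Qed.

Lemma drv_cont f x a : is_derive x 1 f a -> {for x, continuous f}.
Proof.
by case=> df _; apply: differentiable_continuous; exact/derivable1_diffP.
Qed.

(** Stated with a conjunction so that the differentiation rules instantiate [a] in the first
    component before the second compares it with [b]. *)
Lemma drv_eq f x a b : is_derive x 1 f a /\ a = b -> is_derive x 1 f b.
Proof. by case=> fa <-. Qed.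

End RealDerivatives.

Ltac drv := repeat first
  [ assumption | exact: drv_cst | exact: drv_id | apply: drvN | apply: drvD
  | apply: drvZ | apply: drvM | apply: drv_expR | apply: drv_sin
  | apply: drv_cos | apply: drv_atan | apply: drvX ].

Ltac drve := apply: drv_eq; split; [by drv | rewrite /GRing.scale /=].

(** * The Hartley transform *)

Section Hartley.
Context {R : realType}.
Local Notation mu := (@lebesgue_measure R).
Implicit Types (f g h : R -> R) (x y xi e : R).

Definition c0 : R := (Num.sqrt (2 * pi))^-1.

(* The kernel of the Hartley transform, normalised so that the transform is a
   unitary involution of the real space L^2. For real [f] with Fourier
   transform [F] one has [Re F - Im F = c0^-1 * hart f]. *)
Definition K x xi : R := c0 * (cos (x * xi) + sin (x * xi)).

Definition hart f xi : R := \int[mu]_x (f x * K x xi).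

Lemma c0_gt0 : 0 < c0.
Proof. by rewrite invr_gt0 sqrtr_gt0 mulr_gt0 ?pi_gt0. Qed.

Lemma sqr_c0 : c0 ^+ 2 = (2 * pi)^-1.
Proof. by rewrite exprVn sqr_sqrtr// mulr_ge0// pi_ge0. Qed.

Lemma c0_le : c0 * 2 <= 1.
Proof.
rewrite mulrC ler_pdivrMr ?sqrtr_gt0 ?mulr_gt0 ?pi_gt0// mul1r.
rewrite -[leLHS]ger0_norm// -sqrtr_sqr ler_wsqrtr// expr2.
by rewrite ler_pM2l// pi_ge2.
Qed.

Lemma K_bound x xi : `|K x xi| <= 1.
Proof.
rewrite normrM gtr0_norm ?c0_gt0//; apply: le_trans c0_le.
rewrite ler_pM2l ?c0_gt0//; apply: (le_trans (ler_normD _ _)).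
by rewrite (_ : 2 = 1 + 1)// lerD ?cos_max ?sin_max.
Qed.

Lemma K_sym x y : K x y = K y x.
Proof. by rewrite /K [x * y]mulrC. Qed.

Lemma KN x xi : K (- x) xi = K x (- xi).
Proof. by rewrite /K mulNr mulrN. Qed.

(** The cosine depends on [x - y] only, and the sine is odd in [xi]. Against an even weight in [xi]
    only the cosine survives, which produces a convolution kernel. *)
Lemma KK x y xi : K x xi * K y xi =
  (2 * pi)^-1 * (cos ((x - y) * xi) + sin ((x + y) * xi)).
Proof.
rewrite /K -sqr_c0 mulrBl mulrDl cosB sinD; ring.
Qed.

Lemma K_cont x : continuous (K x).
Proof.
move=> y; apply: cvgM; first exact: cvg_cst.
have c : {for y, continuous (fun z => x * z)} by apply: cvgM; [exact: cvg_cst|exact: cvg_id].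
apply: cvgD.
  exact: (continuous_comp c (@continuous_cos R _)).
exact: (continuous_comp c (@continuous_sin R _)).
Qed.

Lemma mK x : measurable_fun setT (K x).
Proof. by apply: continuous_measurable_fun; exact: K_cont. Qed.

Lemma mK' y : measurable_fun setT (K^~ y).
Proof. by under eq_fun do rewrite K_sym; exact: mK. Qed.

Lemma mK2 : measurable_fun setT (fun z : R * R => K z.1 z.2).
Proof.
have mm : measurable_fun setT (fun z : R * R => z.1 * z.2) by mble.
apply: measurable_funM => //; apply: measurable_funD.
  apply: (measurableT_comp _ mm).
  by apply: continuous_measurable_fun; exact: continuous_cos.
apply: (measurableT_comp _ mm).
by apply: continuous_measurable_fun; exact: continuous_sin.
Qed.

Lemma intgK f xi : intg mu f -> intg mu (fun x => f x * K x xi).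
Proof.
by move=> fi; apply: (intg_boundedM (C := 1) fi); [exact: mK'|move=> x; exact: K_bound].
Qed.

Lemma hart_le f xi : intg mu f -> `|hart f xi| <= \int[mu]_x `|f x|.
Proof.
move=> fi; apply: (le_trans (le_normr_Rint (intgK xi fi))).
apply: le_Rint; [exact/intg_abs/intgK|exact: intg_abs|move=> x].
by rewrite normrM ler_piMr// K_bound.
Qed.

Lemma hart_cont f : intg mu f -> continuous (hart f).
Proof.
move=> fi y; apply/(@cvg_nbhsP _ R^o) => u uy.
apply: (@dominated_Rint _ _ _ mu (fun n x => f x * K x (u n)) _ _ _ (intg_abs fi) _ _).2.
- by move=> n; apply: (@intg_mble _ _ _ mu); exact: intgK.
- by move=> n x; rewrite normrM ler_piMr// K_bound.
move=> x; apply: cvgM; first exact: cvg_cst.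
exact: (continuous_cvg _ (@K_cont x y) uy).
Qed.

Lemma mhart f : intg mu f -> measurable_fun setT (hart f).
Proof. by move=> fi; apply: continuous_measurable_fun; exact: hart_cont. Qed.

Lemma hartM_intg f g : intg mu f -> intg mu g -> intg mu (fun x => hart f x * g x).
Proof.
move=> fi gi; under eq_fun do rewrite mulrC.
apply: (intg_boundedM gi); first exact: mhart.
by move=> x; exact: hart_le.
Qed.

Lemma hart_sym f g : intg mu f -> intg mu g ->
  \int[mu]_x (hart f x * g x) = \int[mu]_x (f x * hart g x).
Proof.
move=> fi gi; pose F (z : R * R) := f z.1 * g z.2 * K z.1 z.2.
have mF : measurable_fun setT F.
  apply: measurable_funM; last exact: mK2.
  apply: measurable_funM.
    by apply: (measurableT_comp (intg_mble fi)); exact: measurable_fst.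
  by apply: (measurableT_comp (intg_mble gi)); exact: measurable_snd.
have Ffg x y : `|F (x, y)| <= `|f x| * `|g y|.
  by rewrite /F /= -normrM [leLHS]normrM ler_piMr ?K_bound.
have [_ _ FF] := fubini_dom mF fi gi Ffg.
transitivity (\int[mu]_y \int[mu]_x F (x, y)).
  apply: eq_Rint => y; rewrite mulrC -RintZ; last exact: intgK.
  by apply: eq_Rint => x; rewrite /F /=; ring.
rewrite -FF; apply: eq_Rint => x; rewrite -RintZ; last exact: intgK.
by apply: eq_Rint => y; rewrite /F /= K_sym; ring.
Qed.

Lemma hartD f g xi : intg mu f -> intg mu g ->
  hart (fun x => f x + g x) xi = hart f xi + hart g xi.
Proof.
move=> fi gi; rewrite -RintD; [|exact: intgK..].
by apply: eq_Rint => x; ring.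
Qed.

Lemma hartZ a f xi : intg mu f -> hart (fun x => a * f x) xi = a * hart f xi.
Proof.
move=> fi; rewrite -RintZ; last exact: intgK.
by apply: eq_Rint => x; ring.
Qed.

Lemma hartB f g xi : intg mu f -> intg mu g ->
  hart (fun x => f x - g x) xi = hart f xi - hart g xi.
Proof.
move=> fi gi; rewrite -RintB; [|exact: intgK..].
by apply: eq_Rint => x; ring.
Qed.

Lemma hart_opp f xi : intg mu f -> hart (fun x => f (- x)) xi = hart f (- xi).
Proof.
move=> fi; rewrite /hart -(Rint_opp (intgK (- xi) fi)).
by apply: eq_Rint => x; rewrite KN opprK.
Qed.

(** The damping factor of Abel summation. Its cosine integral is, up to [2 pi], the Poisson kernel
    [pois e] of the half-plane. *)
Definition pexp e x : R := expR (- (e * `|x|)).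
Definition pois e x : R := e / (pi * (e ^+ 2 + x ^+ 2)).

Lemma cvg_expRN e : 0 < e -> expR (- (e * n%:R)) @[n --> \oo] --> (0 : R).
Proof.
move=> e0; have -> : (fun n : nat => expR (- (e * n%:R))) = fun n => expR (- e) ^+ n.
  by apply/funext => n; rewrite -expRM_natr mulNr.
by apply: cvg_expr; rewrite gtr0_norm ?expR_gt0// expR_lt1 oppr_lt0.
Qed.

Lemma intg_half_exp e : 0 < e -> intg mu (fun x => (0 <= x)%R%:R * expR (- (e * x))).
Proof.
move=> e0; under eq_fun do rewrite -mulNr.
apply: (@ftc_half_intg R (fun x => expR (- e * x)) (fun x => - e^-1 * expR (- e * x)) 0).
- move=> x; apply: continuous_comp; last exact: continuous_expR.
  by apply: cvgM; [exact: cvg_cst|exact: cvg_id].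
- by move=> x _; exact: expR_ge0.
- by move=> x; drve; field; rewrite gt_eqF.
- by move=> x _; rewrite mulNr oppr_le0 mulr_ge0 ?expR_ge0// invr_ge0 ltW.
Qed.

Lemma mpexp e : measurable_fun setT (pexp e).
Proof.
apply: continuous_measurable_fun => x; apply: continuous_comp; last exact: continuous_expR.
by apply: cvgN; apply: cvgM; [exact: cvg_cst|exact: norm_continuous].
Qed.

Lemma pexp_ge0 e x : 0 <= pexp e x. Proof. exact: expR_ge0. Qed.

Lemma pexpN e x : pexp e (- x) = pexp e x. Proof. by rewrite /pexp normrN. Qed.

Lemma intg_pexp e : 0 < e -> intg mu (pexp e).
Proof.
move=> e0; apply: (intg_even_dom _ (intg_half_exp e0)); first exact: mpexp.
  by move=> x x0; rewrite ger0_norm ?pexp_ge0// /pexp ger0_norm.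
by move=> x x0; rewrite pexpN ger0_norm ?pexp_ge0// /pexp ger0_norm.
Qed.

Lemma poisE e x : 0 < e -> 2 * pi * pois e x = 2 * (e / (e ^+ 2 + x ^+ 2)).
Proof.
move=> e0; have p0 : (pi : R) != 0 by rewrite gt_eqF ?pi_gt0.
have d0 : e ^+ 2 + x ^+ 2 != 0 by rewrite gt_eqF// ltr_pwDl ?exprn_gt0 ?sqr_ge0.
by rewrite /pois; move: (@pi R) p0 => p p0; field; rewrite d0 p0.
Qed.

Lemma pois_gt0 e x : 0 < e -> 0 < pois e x.
Proof.
move=> e0; rewrite /pois divr_gt0// mulr_gt0 ?pi_gt0//.
by rewrite ltr_pwDl ?exprn_gt0 ?sqr_ge0.
Qed.

Lemma poisN e x : pois e (- x) = pois e x. Proof. by rewrite /pois sqrrN. Qed.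

Lemma mcosM t : measurable_fun setT (fun x => cos (t * x) : R).
Proof.
apply: (measurableT_comp (f := @cos R)).
  by apply: continuous_measurable_fun; exact: continuous_cos.
mble.
Qed.

Lemma msinM t : measurable_fun setT (fun x => sin (t * x) : R).
Proof.
apply: (measurableT_comp (f := @sin R)).
  by apply: continuous_measurable_fun; exact: continuous_sin.
mble.
Qed.

Lemma Rint_pexp_cos e t : 0 < e ->
  \int[mu]_x (pexp e x * cos (t * x)) = 2 * pi * pois e t.
Proof.
move=> e0; have ci : intg mu (fun x => pexp e x * cos (t * x)).
  apply: (intg_boundedM (C := 1) (intg_pexp e0)); first exact: mcosM.
  by move=> x; exact: cos_max.
have d0 : e ^+ 2 + t ^+ 2 != 0 by rewrite gt_eqF// ltr_pwDl ?exprn_gt0 ?sqr_ge0.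
rewrite poisE// Rint_even//; last by move=> x; rewrite pexpN mulrN cosN.
congr (2 * _).
pose f x := expR (- e * x) * cos (t * x).
(* The real part of [exp ((- e + i t) x) / (- e + i t)]. *)
pose F x := (e ^+ 2 + t ^+ 2)^-1 * (expR (- e * x) * (t * sin (t * x) - e * cos (t * x))).
transitivity (\int[mu]_x ((0 <= x)%R%:R * f x)).
  apply: eq_Rint => x; case: (leP 0 x) => [x0|_]; last by rewrite !mul0r.
  by rewrite /f /pexp ger0_norm// mulNr.
have dF x : is_derive x 1 F (f x).
  by rewrite /F; drve; rewrite /f; field; exact: d0.
have cf : continuous f.
  move=> x; apply: cvgM.
    apply: continuous_comp; last exact: continuous_expR.
    by apply: cvgM; [exact: cvg_cst|exact: cvg_id].
  apply: (continuous_comp (g := @cos R)); last exact: continuous_cos.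
  by apply: cvgM; [exact: cvg_cst|exact: cvg_id].
have fi : intg mu (fun x => (0 <= x)%R%:R * f x).
  have := intg_indicM (measurable_itv `[0, +oo[) ci.
  congr intg; apply/funext => x; rewrite indic_ge0E.
  case: (leP 0 x) => [x0|_]; last by rewrite !mul0r.
  by rewrite /f /pexp ger0_norm// mulNr.
rewrite (@ftc_half R f F 0)//.
  rewrite /F !mulr0 expR0 sin0 cos0; field; exact: d0.
rewrite /F -[X in _ --> X](mulr0 (e ^+ 2 + t ^+ 2)^-1).
apply: cvgM; first exact: cvg_cst.
apply/norm_cvg0P.
apply: (@squeeze_cvgr _ _ _ _ (fun=> 0) (fun n => expR (- (e * n%:R)) * (`|t| + e))).
- apply: nearW => n; rewrite normr_ge0 /= mulNr normrM gtr0_norm ?expR_gt0//.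
  rewrite ler_wpM2l ?expR_ge0//; apply: (le_trans (ler_normB _ _)).
  by rewrite !normrM (gtr0_norm e0) lerD// ?ler_piMr ?sin_max ?cos_max// ltW.
- exact: cvg_cst.
- rewrite -(mul0r (`|t| + e)); apply: cvgM; last exact: cvg_cst.
  exact: cvg_expRN.
Qed.

End Hartley.

(** * The Poisson kernel and the contraction property of the transform *)

Section Plancherel.
Context {R : realType}.
Local Notation mu := (@lebesgue_measure R).
Implicit Types (f g h : R -> R) (x y xi e a b : R).

Lemma atan_bound x : `|pi^-1 * atan x| <= 2^-1.
Proof.
rewrite normrM gtr0_norm ?invr_gt0 ?pi_gt0// mulrC ler_pdivrMr ?pi_gt0// mulrC.
by rewrite ler_norml -mulNr (ltW (atan_ltpi2 _)) mulNr (ltW (atan_gtNpi2 _)).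
Qed.

Lemma is_derive_pois e y x : 0 < e ->
  is_derive x 1 (fun t => pi^-1 * atan (e^-1 * (t - y))) (pois e (x - y)).
Proof.
move=> e0; have p0 : (pi : R) != 0 by rewrite gt_eqF ?pi_gt0.
have d0 : e ^+ 2 + (x - y) ^+ 2 != 0 by rewrite gt_eqF// ltr_pwDl ?exprn_gt0 ?sqr_ge0.
have d1 : 1 + (e^-1 * (x - y)) ^+ 2 != 0 by rewrite gt_eqF// ltr_pwDl ?sqr_ge0.
drve; rewrite /pois; move: (@pi R) p0 => p p0.
have -> : 1 + (e^-1 * (x - y)) ^+ 2 = (e ^+ 2 + (x - y) ^+ 2) / e ^+ 2.
  by field; rewrite gt_eqF.
by field; rewrite d0 p0 gt_eqF.
Qed.

Lemma pois_cont e y : 0 < e -> continuous (fun x => pois e (x - y)).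
Proof.
move=> e0 x.
have d0 : pi * (e ^+ 2 + (x - y) ^+ 2) != 0.
  by rewrite mulf_neq0// gt_eqF ?pi_gt0// ltr_pwDl ?exprn_gt0 ?sqr_ge0.
have h : is_derive x 1 (fun x => pi * (e ^+ 2 + (x - y) ^+ 2)) (pi * (2 * (x - y))).
  by drve; ring.
have c := drv_cont (drvZ e (@drvV _ (fun x => pi * (e ^+ 2 + (x - y) ^+ 2)) _ _ d0 h)).
by rewrite /pois; exact: c.
Qed.

Lemma mpois e y : 0 < e -> measurable_fun setT (fun x => pois e (x - y)).
Proof. by move=> e0; apply: continuous_measurable_fun; exact: pois_cont. Qed.

Lemma Rint_pois e y : 0 < e ->
  intg mu (fun x => pois e (x - y)) /\ \int[mu]_x pois e (x - y) <= 1.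
Proof.
move=> e0; have -> : 1 = 2^-1 + 2^-1 :> R by field.
apply: (@ftc_line_intg R _ (fun t => pi^-1 * atan (e^-1 * (t - y)))).
- exact: pois_cont.
- by move=> x; rewrite ltW// pois_gt0.
- by move=> x; exact: is_derive_pois.
- by move=> x; exact: atan_bound.
Qed.

Lemma pois_le e x : 0 < e -> pois e x <= (pi * e)^-1.
Proof.
move=> e0; rewrite /pois ler_pdivrMr; last first.
  by rewrite mulr_gt0 ?pi_gt0// ltr_pwDl ?exprn_gt0 ?sqr_ge0.
have p0 : (pi : R) != 0 by rewrite gt_eqF ?pi_gt0.
have -> : (pi * e)^-1 * (pi * (e ^+ 2 + x ^+ 2)) = (e ^+ 2 + x ^+ 2) / e.
  by move: (@pi R) p0 => p p0; field; rewrite p0 gt_eqF.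
by rewrite ler_pdivlMr// -expr2 lerDl sqr_ge0.
Qed.

Definition pconv e f x : R := \int[mu]_y (f y * pois e (y - x)).

Lemma intg_pexpK e x : 0 < e -> intg mu (fun xi => pexp e xi * K xi x).
Proof. by move=> e0; exact/intgK/intg_pexp. Qed.

Lemma hart_pexpK e x y : 0 < e -> hart (fun xi => pexp e xi * K xi x) y = pois e (y - x).
Proof.
move=> e0; rewrite /hart.
have ci t : intg mu (fun xi => pexp e xi * cos (t * xi)).
  apply: (intg_boundedM (C := 1) (intg_pexp e0)); first exact: mcosM.
  by move=> z; exact: cos_max.
have si t : intg mu (fun xi => pexp e xi * sin (t * xi)).
  apply: (intg_boundedM (C := 1) (intg_pexp e0)); first exact: msinM.
  by move=> z; exact: sin_max.
transitivity (\int[mu]_xi ((2 * pi)^-1 * (pexp e xi * cos ((y - x) * xi) +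
    pexp e xi * sin ((y + x) * xi)))).
  by apply: eq_Rint => xi; rewrite ![K xi _]K_sym -mulrA mulrC [K x xi * _]mulrC KK; ring.
rewrite RintZ ?RintD//; last exact: intgD.
rewrite Rint_pexp_cos// [X in _ + X]Rint_odd//; last first.
  by move=> z; rewrite pexpN mulrN sinN mulrN.
- by rewrite addr0 mulrA mulVf ?mul1r// mulf_neq0 ?gt_eqF ?pi_gt0.
Qed.

Lemma hart_damped e f x : 0 < e -> intg mu f ->
  hart (fun xi => pexp e xi * hart f xi) x = pconv e f x.
Proof.
move=> e0 fi; rewrite /hart /pconv.
transitivity (\int[mu]_xi (hart f xi * (pexp e xi * K xi x))).
  by apply: eq_Rint => xi; rewrite /hart; ring.
rewrite hart_sym//; last exact: intg_pexpK.
by apply: eq_Rint => y; rewrite hart_pexpK.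
Qed.

Lemma intg_pexp_hart e f : 0 < e -> intg mu f -> intg mu (fun xi => pexp e xi * hart f xi).
Proof.
move=> e0 fi; under eq_fun do rewrite mulrC.
exact: (hartM_intg fi (intg_pexp e0)).
Qed.

Lemma damped e f g : 0 < e -> intg mu f -> intg mu g ->
  \int[mu]_xi (pexp e xi * (hart f xi * hart g xi)) = \int[mu]_x (g x * pconv e f x).
Proof.
move=> e0 fi gi.
transitivity (\int[mu]_xi (hart g xi * (pexp e xi * hart f xi))).
  by apply: eq_Rint => xi; ring.
rewrite (hart_sym gi (intg_pexp_hart e0 fi)).
by apply: eq_Rint => x; rewrite (hart_damped _ e0 fi).
Qed.

Lemma cvg_pexp1 x : pexp (n.+1%:R^-1) x @[n --> \oo] --> (1 : R).
Proof.
rewrite -[X in _ --> X]expR0 /pexp.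
rewrite -[X in _ --> expR X](_ : - (0 * `|x|) = 0); last by rewrite mul0r oppr0.
apply: continuous_cvg; first exact: continuous_expR.
apply: cvgN; apply: cvgM; last exact: cvg_cst.
exact: cvg_harmonic.
Qed.

Lemma pexp_le1 e x : 0 <= e -> pexp e x <= 1.
Proof. by move=> e0; rewrite /pexp expR_le1 oppr_le0 mulr_ge0. Qed.

(** With damping, the squared norm of the transform is the integral of [f] against its Poisson
    average. By [2 a b <= a^2 + b^2] and a kernel of mass at most 1, this is at most [ip f f]; Fatou
    removes the damping. The inequality is enough to extend the transform to L^2, where equality
    will come from the involution. *)
Lemma bessel f : intg mu f -> L2 f -> L2 (hart f) /\ ip (hart f) (hart f) <= ip f f.
Proof.
move=> fi fL.
have ePos n : 0 < n.+1%:R^-1 :> R by rewrite invr_gt0.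
have bound e : 0 < e -> \int[mu]_xi (pexp e xi * (hart f xi * hart f xi)) <= ip f f.
  move=> e0; rewrite damped//.
  have f2 := L2_sqr fL.
  have poi x : intg mu (fun y => pois e (y - x)) := (Rint_pois x e0).1.
  have fpi h x : intg mu h -> intg mu (fun y => h y * pois e (y - x)).
    move=> hi; apply: (intg_boundedM (C := (pi * e)^-1) hi); first exact: mpois.
    by move=> y; rewrite ger0_norm ?pois_le// ltW// pois_gt0.
  pose F (z : R * R) := f z.2 ^+ 2 * pois e (z.2 - z.1).
  have mF : measurable_fun setT F.
    apply: measurable_funM.
      by apply: (measurableT_comp (intg_mble f2)); exact: measurable_snd.
    apply: (measurableT_comp (f := pois e)); last by mble.
    have := mpois 0 e0; under eq_fun do rewrite subr0; exact.
  pose G (z : R * R) := F (z.2, z.1).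
  have F0 z : 0 <= F z by rewrite mulr_ge0 ?sqr_ge0// ltW// pois_gt0.
  have Gint x : \int[mu]_y G (x, y) <= f x ^+ 2.
    have [pi1 pi2] := Rint_pois x e0.
    rewrite /G /F /=; under eq_Rintegral do rewrite -poisN opprB.
    by rewrite RintZ// -[leRHS]mulr1 ler_wpM2l ?sqr_ge0.
  have mG : measurable_fun setT G.
    by apply: (measurableT_comp mF); apply/measurable_fun_pair => /=; mble.
  have G1 x : intg mu (fun y => G (x, y)).
    rewrite /G /F /=; under eq_fun do rewrite -poisN opprB.
    exact/intgZ/poi.
  have G2 y : intg mu (fun x => G (x, y)) by exact: fpi.
  have [G'i Gi GG] : [/\ intg mu (fun x => \int[mu]_y G (x, y)),
      intg mu (fun y => \int[mu]_x G (x, y)) &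
      \int[mu]_x \int[mu]_y G (x, y) = \int[mu]_y \int[mu]_x G (x, y)].
    apply: fubini_line => //.
    apply: (intg_domC (C := 1) _ f2) => [|x]; last first.
      rewrite mul1r ger0_norm ?Rint_ge0// ger0_norm ?sqr_ge0//.
      apply: le_trans (Gint x); rewrite le_eqVlt; apply/orP; left; apply/eqP.
      by apply: eq_Rint => y; rewrite ger0_norm ?F0.
    have -> : (fun x => \int[mu]_y `|G (x, y)|)%R = fine \o fubini_F mu (fun z => `|G z|%:E) by [].
    apply: measurableT_comp => //.
    apply: measurable_fun_fubini_tonelli_F => //.
    by apply: measurableT_comp => //; exact: measurableT_comp.
  have pc2 : \int[mu]_x pconv e (fun y => f y ^+ 2) x <= ip f f.
    rewrite -[leLHS]/(\int[mu]_y \int[mu]_x G (x, y)) -GG.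
    rewrite /ip; under [leRHS]eq_Rintegral do rewrite -expr2.
    exact: (le_Rint G'i f2 Gint).
  have pointwise x : f x * pconv e f x <= 2^-1 * (f x ^+ 2 + pconv e (fun y => f y ^+ 2) x).
    rewrite /pconv -RintZ; last exact: fpi.
    apply: (@le_trans _ _ (\int[mu]_y (2^-1 * (f x ^+ 2 * pois e (y - x) + f y ^+ 2 * pois e (y - x))))).
      apply: le_Rint; [exact/intgZ/fpi|apply/intgZ/intgD; [exact/intgZ/poi|exact: fpi]|move=> y].
      have := pois_gt0 (y - x) e0; have := sqr_ge0 (f x - f y); nra.
    rewrite RintZ; last by apply: intgD; [exact/intgZ/poi|exact: fpi].
    rewrite ler_pM2l ?invr_gt0// RintD; [|exact/intgZ/poi|exact: fpi].
    rewrite RintZ; last exact: poi.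
    rewrite lerD2r -[leRHS]mulr1 ler_wpM2l ?sqr_ge0//.
    exact: (Rint_pois x e0).2.
  have ifp : intg mu (fun x => f x * pconv e f x).
    under eq_fun do rewrite -hart_damped// mulrC.
    exact/hartM_intg/fi/intg_pexp_hart.
  apply: (le_trans (le_Rint ifp _ pointwise)); first exact/intgZ/intgD.
  rewrite (RintZ _ (intgD f2 Gi)) (RintD f2 Gi).
  have -> : \int[mu]_x f x ^+ 2 = ip f f by apply: eq_Rint => x; rewrite expr2.
  by move: (\int[mu]_x pconv e _ x) (ip f f) pc2 => X s Xs; clear -Xs; lra.
have mf := mhart fi.
have [i2 le2] : intg mu (fun x => hart f x * hart f x) /\ \int[mu]_x (hart f x * hart f x) <= ip f f.
  apply: (@fatou_Rint _ _ _ mu (fun n x => pexp n.+1%:R^-1 x * (hart f x * hart f x))).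
  - move=> n; under eq_fun do rewrite mulrA mulrC.
    have hi := intg_pexp_hart (ePos n) fi.
    exact: (hartM_intg fi hi).
  - by move=> n x; rewrite mulr_ge0 ?pexp_ge0// -expr2 sqr_ge0.
  - by move=> n; exact: bound.
  - exact: measurable_funM.
  apply: aeW => x; rewrite -[X in _ --> X]mul1r; apply: cvgM; last exact: cvg_cst.
  exact: cvg_pexp1.
by split=> //; apply/L2P; split=> //; under eq_fun do rewrite expr2.
Qed.

End Plancherel.

(** * Extension of the transform to a unitary involution of L^2 *)

Section Unitary.
Context {R : realType}.
Local Notation mu := (@lebesgue_measure R).
Implicit Types (f g h : R -> R) (x y xi e a b : R).

Definition ind a b : R -> R := \1_`[a, b].

Lemma mind a b : measurable_fun setT (ind a b).
Proof. exact: measurable_indic. Qed.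

Lemma ind_sq a b x : ind a b x ^+ 2 = ind a b x.
Proof. by rewrite /ind indicE; case: (_ \in _); rewrite ?expr1n ?expr0n. Qed.

Lemma ind_norm a b x : `|ind a b x| <= 1.
Proof. by rewrite /ind indicE; case: (_ \in _); rewrite ?normr1 ?normr0. Qed.

Lemma intg_ind a b : intg mu (ind a b).
Proof.
have -> : ind a b = fun x => \1_`[a, b] x * cst 1 x.
  by apply/funext => x; rewrite /= mulr1.
by apply: intg_itv => x; exact: cvg_cst.
Qed.

Lemma L2_ind a b : L2 (ind a b).
Proof.
apply/L2P; split; first exact: mind.
by under eq_fun do rewrite ind_sq; exact: intg_ind.
Qed.

Lemma atan_cvg_pos t : 0 < t -> pi^-1 * atan (n.+1%:R^-1^-1 * t) @[n --> \oo] --> (2^-1 : R).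
Proof.
move=> t0; have -> : 2^-1 = pi^-1 * (pi / 2) :> R.
  by rewrite mulrA mulVf ?mul1r// gt_eqF// pi_gt0.
apply: cvgM; first exact: cvg_cst.
have toy : n.+1%:R^-1^-1 * t @[n --> \oo] --> +oo%R.
  apply/cvgryPge => A; have [N _ NP] := nbhs_infty_ger (A / t).
  exists N => // n /= Nn; rewrite invrK -ler_pdivrMr//.
  apply: (le_trans (NP n Nn)); by rewrite ler_nat.
exact: (cvg_comp _ _ toy (@cvgy_atan R)).
Qed.

Lemma atan_cvg_neg t : t < 0 -> pi^-1 * atan (n.+1%:R^-1^-1 * t) @[n --> \oo] --> (- 2^-1 : R).
Proof.
move=> t0.
have -> : (fun n => pi^-1 * atan (n.+1%:R^-1^-1 * t)) =
    (fun n => - (pi^-1 * atan (n.+1%:R^-1^-1 * - t))).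
  by apply/funext => n; rewrite mulrN atanN mulrN opprK.
by apply: cvgN; apply: atan_cvg_pos; rewrite oppr_gt0.
Qed.

Lemma pconv_ind e a b x : 0 < e -> a <= b ->
  pconv e (ind a b) x = pi^-1 * atan (e^-1 * (b - x)) - pi^-1 * atan (e^-1 * (a - x)).
Proof.
move=> e0 ab; rewrite /pconv /ind.
apply: (@ftc_segment R _ (fun t => pi^-1 * atan (e^-1 * (t - x)))) => //.
  exact: pois_cont.
by move=> y; exact: is_derive_pois.
Qed.

(* Damping by [e^(-e|xi|)] turns the left-hand side into a Poisson integral of
   the indicator, whose limit as e -> 0 is the indicator up to its endpoints. *)
Lemma hart_ind_ip a b g : a < b -> intg mu g -> L2 g ->
  ip (hart (ind a b)) (hart g) = ip (ind a b) g.
Proof.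
move=> ab gi gL; have ei := intg_ind a b.
have [h1L _] := bessel ei (L2_ind a b); have [h2L _] := bessel gi gL.
have ePos n : 0 < n.+1%:R^-1 :> R by rewrite invr_gt0.
have [_ c1] : intg mu (fun x => hart (ind a b) x * hart g x) /\
   \int[mu]_x (pexp n.+1%:R^-1 x * (hart (ind a b) x * hart g x)) @[n --> \oo] -->
   \int[mu]_x (hart (ind a b) x * hart g x).
  apply: (dominated_Rint _ (intg_abs (L2M h1L h2L))).
  - move=> n; apply: measurable_funM; first exact: mpexp.
    by apply: measurable_funM; exact: L2_mble.
  - move=> n x; rewrite [leLHS]normrM ler_piMl// ger0_norm ?pexp_ge0//.
    by rewrite pexp_le1// ltW.
  - move=> x; rewrite -[X in _ --> X]mul1r; apply: cvgM; last exact: cvg_cst.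
    exact: cvg_pexp1.
have [_ c2] : intg mu (fun x => g x * ind a b x) /\
   \int[mu]_x (g x * pconv n.+1%:R^-1 (ind a b) x) @[n --> \oo] -->
   \int[mu]_x (g x * ind a b x).
  apply: (dominated_Rint_ae _ _ (intg_abs gi)).
  - move=> n; apply: (@intg_mble _ _ _ mu); under eq_fun do rewrite -hart_damped// mulrC.
    exact/hartM_intg/gi/intg_pexp_hart.
  - by apply: measurable_funM; [exact: (intg_mble gi)|exact: mind].
  - move=> n x; rewrite normrM ler_piMr// pconv_ind ?(ltW ab)//.
    apply: (le_trans (ler_normB _ _)).
    by rewrite (_ : 1 = 2^-1 + 2^-1) ?lerD ?atan_bound//; field.
  - apply: (aeS2 (ae_neq a) (ae_neq b)) => x xa xb.
    apply: cvgM; first exact: cvg_cst.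
    under eq_fun do rewrite pconv_ind// ?ltW//.
    rewrite /ind indic_itvE; case: (ltgtP a x) xa => //= ax _.
      case: (ltgtP x b) xb => //= bx _.
        have -> : 1%:R = 2^-1 - - 2^-1 :> R by rewrite opprK; field.
        by apply: cvgB; [apply: atan_cvg_pos|apply: atan_cvg_neg]; rewrite ?subr_gt0 ?subr_lt0.
      have -> : 0%:R = - 2^-1 - - 2^-1 :> R by rewrite subrr.
      by apply: cvgB; apply: atan_cvg_neg; rewrite subr_lt0.
    have -> : 0%:R = 2^-1 - 2^-1 :> R by rewrite subrr.
    by apply: cvgB; apply: atan_cvg_pos; rewrite subr_gt0// (lt_trans ax).
rewrite [RHS]ipC; apply: (cvg_unique _ c1) => //=.
by under eq_fun do rewrite damped//.
Qed.

(** The primitive of [h] based at [-n] vanishes identically, while its derivative is [h] almost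
    everywhere by Lebesgue differentiation. The null sets are then collected over all [n]. *)
Lemma ind_total h : L2 h -> (forall a b, a < b -> ip (ind a b) h = 0) ->
  {ae mu, forall x, h x = 0}.
Proof.
move=> hL h0; have mh := L2_mble hL.
have ii a b : mu.-integrable `[a, b] (EFin \o h).
  rewrite integrable_mkcond//; have := L2M (L2_ind a b) hL.
  congr integrable; apply/funext => x.
  by rewrite /= patchE /ind indicE; case: (x \in _); rewrite /= ?mul1r ?mul0r.
have loc : locally_integrable setT h.
  split => //; first exact: openT.
  move=> C _ cC; have [M [Mr MP]] := compact_bounded cC.
  have CM : C `<=` `[- (M + 1), M + 1].
    move=> x Cx; rewrite /= in_itv /= -ler_norml.
    by apply: (MP (M + 1)) => //; rewrite ltrDl.
  have /integrableP[_] := ii (- (M + 1)) (M + 1); apply: le_lt_trans.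
  apply: ge0_subset_integral => //; first exact: compact_measurable.
  by do 2 apply: measurableT_comp => //; exact: measurable_funTS.
have key (n : nat) : {ae mu, forall x, - n%:R < x -> h x = 0}.
  have := @FTC1 R h (BLeft (- n%:R)) (fun y => ii _ y) loc.
  set F := fun x => _ => H.
  have F0 x : F x = 0.
    rewrite /F RintI; case: (ltP (- n%:R) x) => [nx|xn]; first exact: h0.
    move: xn; rewrite le_eqVlt => /predU1P[->|xn].
      by rewrite -RintI set_itv1 Rintegral_set1.
    by rewrite -RintI set_itv_ge ?Rintegral_set0// bnd_simp -ltNge.
apply: (aeS H) => x Hx nx; have [|_ <-] := Hx; first by rewrite lte_fin.
  have -> : F = cst 0 by apply/funext.
  by rewrite derive1_cst.
have : {ae mu, forall x, forall n : nat, - n%:R < x -> h x = 0}.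
  by apply/ae_foralln => n; exact: key.
move=> H; apply: (aeS H) => x Hx.
have [N _ NP] := nbhs_infty_gtr (`|x|); apply: (Hx N).
rewrite ltrNl; apply: le_lt_trans (NP N _); last exact: leqnn.
by rewrite -normrN ler_norm.
Qed.

Definition trunc (n : nat) f x : R := ind (- n%:R) n%:R x * f x.

Lemma trunc_L2 n f : L2 f -> L2 (trunc n f).
Proof.
move=> fL; apply: (L2_dom1 _ fL) => [|x].
  by apply: measurable_funM; [exact: mind|exact: L2_mble].
by rewrite normrM ler_piMl// ind_norm.
Qed.

Lemma trunc_intg n f : L2 f -> intg mu (trunc n f).
Proof. by move=> fL; exact: L2M (L2_ind _ _) fL. Qed.

Lemma trunc_cvg f : L2 f -> L2cvg (fun n => trunc n f) f.
Proof.
move=> fL; rewrite /L2cvg /sqd /ip.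
have mt n : measurable_fun setT (fun x => (trunc n f x - f x) * (trunc n f x - f x)).
  by apply: measurable_funM; apply: L2_mble; apply: L2B => //; exact: trunc_L2.
rewrite -[X in _ --> X](Rintegral0 mu).
apply: (@dominated_Rint _ _ _ mu _ (fun=> 0) _ mt (L2_sqr fL) _ _).2.
- move=> n x; rewrite -expr2 ger0_norm ?sqr_ge0// /trunc /ind indicE.
  by case: (_ \in _); rewrite ?mul1r ?subrr ?mul0r ?sub0r ?sqrrN// expr0n sqr_ge0.
- move=> x; rewrite -[X in _ --> X](mulr0 0); apply: cvgM.
    rewrite -(subrr (1 * f x)) [X in _ - X]mul1r; apply: cvgB; last exact: cvg_cst.
    apply: cvgM; [exact: cvg_indic_line|exact: cvg_cst].
  rewrite -(subrr (1 * f x)) [X in _ - X]mul1r; apply: cvgB; last exact: cvg_cst.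
  apply: cvgM; [exact: cvg_indic_line|exact: cvg_cst].
Qed.

Lemma sqd_tri f g h : L2 f -> L2 g -> L2 h -> sqd f g <= 2 * sqd f h + 2 * sqd h g.
Proof.
move=> fL gL hL; rewrite /sqd /ip.
have i1 : intg mu (fun x => (f x - h x) * (f x - h x)) by apply: L2M; exact: L2B.
have i2 : intg mu (fun x => (h x - g x) * (h x - g x)) by apply: L2M; exact: L2B.
rewrite -!RintZ// -RintD//; [|exact: intgZ..].
apply: le_Rint; [by apply: L2M; exact: L2B|by apply: intgD; exact: intgZ|move=> x].
have := sqr_ge0 (f x - h x - (h x - g x)); nra.
Qed.

Lemma L2cvg_uniq (u : nat -> R -> R) f g : (forall n, L2 (u n)) -> L2 f -> L2 g ->
  L2cvg u f -> L2cvg u g -> {ae mu, forall x, f x = g x}.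
Proof.
move=> uL fL gL uf ug; apply: ip_dist_eq0_ae => //.
apply/eqP; rewrite eq_le ip_ge0 andbT.
have c : 2 * sqd (u n) f + 2 * sqd (u n) g @[n --> \oo] --> (2 * 0 + 2 * 0 : R).
  by apply: cvgD; apply: cvgM => //; exact: cvg_cst.
rewrite mulr0 addr0 in c.
apply: (ler_cvg_to (cvg_cst _) c); apply: nearW => n.
apply: (le_trans (sqd_tri fL gL (uL n))).
by rewrite {1}/sqd ip_sym_dist.
Qed.

Lemma cvg_sqd_cauchy (u : nat -> R -> R) f : (forall n, L2 (u n)) -> L2 f -> L2cvg u f ->
  forall e, 0 < e -> exists N, forall n m, (N <= n)%N -> (N <= m)%N -> sqd (u n) (u m) <= e.
Proof.
move=> uL fL uf e e0; have e4 : 0 < e / 4 by rewrite divr_gt0.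
have /cvgrPdist_le/(_ _ e4)[N _ NP] := uf.
exists N => n m /NP /= + /NP /=.
rewrite !sub0r !normrN !ger0_norm ?ip_ge0// => en em.
apply: (le_trans (sqd_tri (uL n) (uL m) fL)).
rewrite [X in _ + 2 * X]ip_sym_dist; move: en em; rewrite /sqd; lra.
Qed.

Lemma hart_sqd f g : intg mu f -> L2 f -> intg mu g -> L2 g ->
  sqd (hart f) (hart g) <= sqd f g.
Proof.
move=> fi fL gi gL; have [_] := bessel (intgB fi gi) (L2B fL gL).
apply: le_trans; rewrite le_eqVlt; apply/orP; left; apply/eqP.
by apply: eq_Rint => x; rewrite hartB.
Qed.

Lemma ex_U f : L2 f -> exists h, L2 h /\ L2cvg (fun n => hart (trunc n f)) h.
Proof.
move=> fL.
have ti n := trunc_intg n fL; have tL n := trunc_L2 n fL.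
have [] := @L2_complete R (fun n => hart (trunc n f)).
- by move=> n; exact: (bessel (ti n) (tL n)).1.
- move=> e e0; have [N NP] := cvg_sqd_cauchy tL fL (trunc_cvg fL) e0.
  by exists N => n m Nn Nm; apply: le_trans (NP n m Nn Nm); exact: hart_sqd.
by move=> h hL hc; exists h.
Qed.

End Unitary.

(* Locked: conversion would otherwise unfold the choice of a representative. *)
HB.lock Definition U {R : realType} (f : R -> R) : R -> R :=
  xget (cst 0) [set h | L2 h /\ L2cvg (fun n => hart (trunc n f)) h].

Section Unitary.
Context {R : realType}.
Local Notation mu := (@lebesgue_measure R).
Implicit Types (f g h : R -> R) (x y xi e a b : R).

Lemma U_spec f : L2 f -> L2 (U f) /\ L2cvg (fun n => hart (trunc n f)) (U f).
Proof.
by move=> /ex_U[h hP]; rewrite U.unlock; case: xgetP => [y -> //|/(_ h)].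
Qed.

Lemma U_L2 f : L2 f -> L2 (U f). Proof. by move=> /U_spec[]. Qed.

Lemma hart_trunc_L2 n f : L2 f -> L2 (hart (trunc n f)).
Proof. by move=> fL; exact: (bessel (trunc_intg n fL) (trunc_L2 n fL)).1. Qed.

Lemma U_hart f : intg mu f -> L2 f -> {ae mu, forall x, U f x = hart f x}.
Proof.
move=> fi fL; have [UL Uc] := U_spec fL.
apply: (@L2cvg_uniq R (fun n => hart (trunc n f))) => //.
- by move=> n; exact: hart_trunc_L2.
- exact: (bessel fi fL).1.
apply: (@squeeze_cvgr _ _ _ _ (fun=> 0) (fun n => sqd (trunc n f) f)).
- apply: nearW => n; rewrite ip_ge0 hart_sqd//; [exact: trunc_intg|exact: trunc_L2].
- exact: cvg_cst.
- exact: trunc_cvg.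
Qed.

Lemma U_sym f g : L2 f -> L2 g -> ip (U f) g = ip f (U g).
Proof.
move=> fL gL; have [UfL Ufc] := U_spec fL; have [UgL Ugc] := U_spec gL.
have c1 : ip (hart (trunc n f)) (trunc n g) @[n --> \oo] --> ip (U f) g.
  exact: (ip_cvg (fun n => hart_trunc_L2 n fL) (fun n => trunc_L2 n gL) UfL gL Ufc (trunc_cvg gL)).
have c2 : ip (trunc n f) (hart (trunc n g)) @[n --> \oo] --> ip f (U g).
  exact: (ip_cvg (fun n => trunc_L2 n fL) (fun n => hart_trunc_L2 n gL) fL UgL (trunc_cvg fL) Ugc).
have e n : ip (hart (trunc n f)) (trunc n g) = ip (trunc n f) (hart (trunc n g)).
  by apply: hart_sym; exact: trunc_intg.
by apply: (cvg_unique _ c1) => //=; under eq_fun do rewrite e; exact: c2.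
Qed.

Lemma U_ind a b g : a < b -> L2 g -> ip (U (ind a b)) (U g) = ip (ind a b) g.
Proof.
move=> ab gL; have [UgL Ugc] := U_spec gL.
have iL := L2_ind a b; have ii := intg_ind a b; have hL := (bessel ii iL).1.
rewrite (ip_ae (U_L2 iL) hL UgL UgL (U_hart ii iL) (aeW _ (fun=> erefl))).
have c1 : ip (hart (ind a b)) (hart (trunc n g)) @[n --> \oo] --> ip (hart (ind a b)) (U g).
  exact: (ip_cvg (fun=> hL) (fun n => hart_trunc_L2 n gL) hL UgL (cst_ip_cvg _) Ugc).
have c2 : ip (ind a b) (trunc n g) @[n --> \oo] --> ip (ind a b) g.
  exact: (ip_cvg (fun=> iL) (fun n => trunc_L2 n gL) iL gL (cst_ip_cvg _) (trunc_cvg gL)).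
have e n : ip (hart (ind a b)) (hart (trunc n g)) = ip (ind a b) (trunc n g).
  by apply: hart_ind_ip => //; [exact: trunc_intg|exact: trunc_L2].
by apply: (cvg_unique _ c1) => //=; under eq_fun do rewrite e; exact: c2.
Qed.

(** By symmetry and [U_ind], [U (U g)] and [g] have the same integral over every interval. The
    isometry property is a consequence of this involution together with [U_sym]. *)
Theorem U_invol g : L2 g -> {ae mu, forall x, U (U g) x = g x}.
Proof.
move=> gL; have UgL := U_L2 gL; have UUgL := U_L2 UgL.
have : {ae mu, forall x, U (U g) x - g x = 0}.
  apply: ind_total; first exact: L2B.
  move=> a b ab; rewrite ipBr//; last exact: L2_ind.
  by rewrite -U_sym ?U_ind ?subrr//; exact: L2_ind.
by move=> H; apply: (aeS H) => x /eqP; rewrite subr_eq0 => /eqP.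
Qed.

Theorem U_iso f g : L2 f -> L2 g -> ip (U f) (U g) = ip f g.
Proof.
move=> fL gL; rewrite U_sym//; last exact: U_L2.
by apply: ip_ae => //; [exact/U_L2/U_L2|exact: aeW|exact: U_invol].
Qed.

(** [U] selects a representative, so linearity can hold only almost everywhere. It is read off by
    expanding the squared norm of the defect, all of whose inner products are preserved by [U]. *)
Lemma U_D f g : L2 f -> L2 g -> {ae mu, forall x, U (fun x => f x + g x) x = U f x + U g x}.
Proof.
move=> fL gL; have sL := L2D fL gL; set s := fun x => _ in sL *.
have UfL := U_L2 fL; have UgL := U_L2 gL; have UsL := U_L2 sL.
apply: (ip_dist_eq0_ae UsL (L2D UfL UgL)).
rewrite (sqB UsL (L2D UfL UgL)) (ipDr UfL UgL UsL) (sqD UfL UgL).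
rewrite (U_iso sL sL) (U_iso sL fL) (U_iso sL gL) (U_iso fL fL) (U_iso fL gL) (U_iso gL gL).
rewrite /s (sqD fL gL) (ipDl fL gL fL) (ipDl fL gL gL) [ip g f]ipC; ring.
Qed.

Lemma U_Z c f : L2 f -> {ae mu, forall x, U (fun x => c * f x) x = c * U f x}.
Proof.
move=> fL; have sL := L2Z c fL; set s := fun x => _ in sL *.
have UfL := U_L2 fL; have UsL := U_L2 sL; have cUL := L2Z c UfL.
apply: (ip_dist_eq0_ae UsL cUL).
rewrite (sqB UsL cUL) (ipZr c UfL UsL) (ipZr c UfL cUL) (ipZl c UfL UfL).
rewrite (U_iso sL sL) (U_iso sL fL) (U_iso fL fL).
rewrite /s (ipZr c fL sL) (ipZl c fL fL); ring.
Qed.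

Lemma U_ae f g : L2 f -> L2 g -> {ae mu, forall x, f x = g x} ->
  {ae mu, forall x, U f x = U g x}.
Proof.
move=> fL gL fg; have UfL := U_L2 fL; have UgL := U_L2 gL.
have ff : {ae mu, forall x, f x = f x} by exact: aeW.
apply: (ip_dist_eq0_ae UfL UgL).
rewrite (sqB UfL UgL) (U_iso fL fL) (U_iso fL gL) (U_iso gL gL).
rewrite -(ip_ae fL fL fL gL ff fg) -(ip_ae fL gL fL gL fg fg); ring.
Qed.

Lemma U_B f g : L2 f -> L2 g -> {ae mu, forall x, U (fun x => f x - g x) x = U f x - U g x}.
Proof.
move=> fL gL; have ngL := L2Z (-1) gL.
have sL := L2B fL gL; have tL := L2D fL ngL.
have st : {ae mu, forall x, f x - g x = f x + -1 * g x} by apply: aeW => x; rewrite mulN1r.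
have H : {ae mu, forall x, U (fun x => f x - g x) x = U f x + U (fun x => -1 * g x) x}.
  by apply: (aeS2 (U_ae sL tL st) (U_D fL ngL)) => x -> ->.
by apply: (aeS2 H (U_Z (-1) gL)) => x -> ->; rewrite mulN1r.
Qed.

Lemma U_eq f g : L2 f -> L2 g -> {ae mu, forall x, U f x = U g x} ->
  {ae mu, forall x, f x = g x}.
Proof.
move=> fL gL H; have UH := U_ae (U_L2 fL) (U_L2 gL) H.
have H1 : {ae mu, forall x, f x = U (U g) x}.
  by apply: (aeS2 (U_invol fL) UH) => x <- ->.
by apply: (aeS2 H1 (U_invol gL)) => x -> ->.
Qed.

End Unitary.

(** * Test functions and weak derivatives *)

Section SmoothBump.
Context {R : realType}.
Local Notation mu := (@lebesgue_measure R).
Implicit Types (f g h : R -> R) (x y t a b c : R) (p q : {poly R}).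

(** Peeling off the first derivative, rather than the last, lets the Leibniz and chain rules go
    through by induction on [n]. *)
Fixpoint Cn (n : nat) f : Prop :=
  if n is m.+1 then (forall x, derivable f x 1) /\ Cn m (derive1 f) else True.

Lemma Cn_smooth f : (forall n, Cn n f) -> forall (n : nat) x, derivable (derive1n n f) x 1.
Proof.
move=> fC n; elim: n f fC => [|n ih] f fC x; first by have [] := fC 1%N.
by rewrite derive1Sn; apply: ih => m; have [] := fC m.+1.
Qed.

Lemma smooth_Cn f : (forall (n : nat) x, derivable (derive1n n f) x 1) -> forall n, Cn n f.
Proof.
move=> fC n; elim: n f fC => [//|n ih] f fC; split; first exact: (fC 0%N).
by apply: ih => m x; rewrite -derive1Sn.
Qed.

Lemma Cn_le n f : Cn n.+1 f -> Cn n f.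
Proof. by elim: n f => [//|n ih] f [df /ih]. Qed.

Lemma is_derive1P f x : derivable f x 1 -> is_derive x 1 f (derive1 f x).
Proof. by move=> df; rewrite derive1E; apply: DeriveDef. Qed.

Lemma is_derive1E f x a : is_derive x 1 f a -> derive1 f x = a.
Proof. by case=> _; rewrite derive1E. Qed.

Lemma derive1_fun f f' : (forall x, is_derive x 1 f (f' x)) -> derive1 f = f'.
Proof. by move=> H; apply/funext => x; exact: is_derive1E. Qed.

Lemma CnD n f g : Cn n f -> Cn n g -> Cn n (fun x => f x + g x).
Proof.
elim: n f g => [//|n ih] f g [df fC] [dg gC]; split.
  by move=> x; have [] := drvD (is_derive1P (df x)) (is_derive1P (dg x)).
rewrite (derive1_fun (fun x => drvD (is_derive1P (df x)) (is_derive1P (dg x)))).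
exact: ih.
Qed.

Lemma CnM n f g : Cn n f -> Cn n g -> Cn n (fun x => f x * g x).
Proof.
elim: n f g => [//|n ih] f g; move=> /[dup] /Cn_le fC' [df fC] /[dup] /Cn_le gC' [dg gC]; split.
  by move=> x; have [] := drvM (is_derive1P (df x)) (is_derive1P (dg x)).
rewrite (derive1_fun (fun x => drvM (is_derive1P (df x)) (is_derive1P (dg x)))).
by apply: CnD; exact: ih.
Qed.

Lemma CnZ n c f : Cn n f -> Cn n (fun x => c * f x).
Proof.
elim: n f => [//|n ih] f [df fC]; split.
  by move=> x; have [] := drvZ c (is_derive1P (df x)).
by rewrite (derive1_fun (fun x => drvZ c (is_derive1P (df x)))); exact: ih.
Qed.

Lemma Cn_affine n a b f : Cn n f -> Cn n (fun x => f (a * x + b)).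
Proof.
elim: n f => [//|n ih] f [df fC].
have H x : is_derive x 1 (fun x => f (a * x + b)) (a * derive1 f (a * x + b)).
  rewrite mulrC; apply: (drv_comp (is_derive1P (df _))).
  by drve; ring.
split; first by move=> x; have [] := H x.
by rewrite (derive1_fun H); apply: CnZ; exact: ih.
Qed.

(** The derivatives of [exp (- 1 / t)] are polynomials in [1 / t] times the same exponential. The
    family is stable under differentiation, [p] becoming [X^2 (p - p')], so smoothness reduces to
    one derivative. *)
Definition eta p t : R := if 0 < t then p.[t^-1] * expR (- t^-1) else 0.

Lemma horner_exp_bound q : exists2 C, 0 <= C & forall s, 0 <= s -> `|q.[s]| * expR (- s) <= C.
Proof.
exists (\sum_(i < size q) `|q`_i| * (i`!)%:R); first by apply: sumr_ge0 => i _; rewrite mulr_ge0.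
move=> s s0; rewrite expRN ler_pdivrMr ?expR_gt0// horner_coef.
apply: (le_trans (ler_norm_sum _ _ _)); rewrite mulr_suml; apply: ler_sum => i _.
rewrite normrM -mulrA ler_wpM2l// normrX ger0_norm//.
case: (nat_of_ord i) => [|k].
  by rewrite expr0 fact0 mul1r -[leLHS]expR0 ler_expR.
rewrite -ler_pdivrMl ?ltr0n ?fact_gt0// mulrC.
by apply: le_trans (expR_ge1Dxn k s0); rewrite lerDr.
Qed.

Lemma is_derive_eta p t : is_derive t 1 (eta p) (eta ('X^2 * (p - p^`())) t).
Proof.
case: (ltgtP t 0) => [t0|t0|->].
- rewrite {2}/eta ltNge (ltW t0) /=.
  apply: near_eq_is_derive (drv_cst 0 t).
  near=> s; rewrite /eta ltNge ltW//=; near: s; exact: lt_nbhsl.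
- have H : is_derive t 1 (fun t => p.[t^-1] * expR (- t^-1)) (eta ('X^2 * (p - p^`())) t).
    have tn : t != 0 by rewrite gt_eqF.
    have hV : is_derive t 1 (fun t : R => t^-1) (- 1 / t ^+ 2) by exact: (drvV tn (drv_id t)).
    have hP : is_derive t 1 (fun t : R => p.[t^-1]) (p^`().[t^-1] * (- 1 / t ^+ 2)).
      exact: (@drv_comp _ (horner p) (fun t : R => t^-1) _ _ _ (is_derive_poly p _) hV).
    apply: drv_eq; split; first exact: (drvM hP (drv_expR (drvN hV))).
    by rewrite /eta t0 !hornerE exprVn /=; field.
  apply: near_eq_is_derive H.
  near=> s; rewrite /eta ifT//; near: s; exact: lt_nbhsr.
have e0 q : eta q 0 = 0 by rewrite /eta ltxx.
rewrite e0.
(* The two extra powers of [1 / s] yield [|eta p s| <= C s^2], so the difference quotient at 0 tends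
   to 0. *)
have [C C0 CP] := horner_exp_bound (p * 'X^2).
have bd s : `|eta p s| <= C * s ^+ 2.
  rewrite /eta; case: ltP => [s0|_]; last by rewrite normr0 mulr_ge0// sqr_ge0.
  have /(CP s^-1) : 0 <= s^-1 by rewrite invr_ge0 ltW.
  rewrite hornerM hornerXn exprVn !normrM [`|expR _|]ger0_norm ?expR_ge0// [`|_ ^- 2|]ger0_norm ?invr_ge0 ?sqr_ge0//.
  by rewrite mulrAC ler_pdivrMr ?exprn_gt0.
have cv : h^-1 *: ((eta p \o shift 0) (h *: 1) - eta p 0) @[h --> (0:R)^'] --> (0 : R).
  apply/norm_cvg0P.
  apply: (@squeeze_cvgr _ _ _ _ (fun _ : R => 0) (fun h : R => C * `|h|)).
  - near=> h; rewrite normr_ge0 /= e0 subr0 addr0 /GRing.scale /= mulr1.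
    have h0 : h != 0 by near: h; exact: nbhs_dnbhs_neq.
    rewrite normrM normfV ler_pdivrMl ?normr_gt0//; apply: (le_trans (bd h)).
    by rewrite -[h ^+ 2]real_normK ?num_real// expr2 mulrCA.
  - exact: cvg_cst.
  - rewrite -[X in _ --> X](mulr0 C); apply: cvgM; first exact: cvg_cst.
    have c : `|h| @[h --> (0 : R)] --> `|(0 : R)| by exact: norm_continuous.
    by rewrite normr0 in c; exact: cvg_within_filter c.
apply: DeriveDef; first by apply/cvg_ex; exists 0.
exact: cvg_lim cv.
Unshelve. all: by end_near. Qed.

Lemma Cn_eta n p : Cn n (eta p).
Proof.
elim: n p => [//|n ih] p; split; first by move=> t; have [] := is_derive_eta p t.
by rewrite (derive1_fun (is_derive_eta p)).
Qed.

Lemma eta_ge0 t : 0 <= eta 1 t.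
Proof. by rewrite /eta; case: ifP => // _; rewrite hornerE mul1r expR_ge0. Qed.

Lemma eta_gt0 t : 0 < t -> 0 < eta 1 t.
Proof. by move=> t0; rewrite /eta t0 hornerE mul1r expR_gt0. Qed.

Lemma eta_eq0 t : t <= 0 -> eta 1 t = 0.
Proof. by move=> t0; rewrite /eta ltNge t0. Qed.

Definition steep (n : nat) a b x : R := eta 1 (n%:R * (b - x)) * eta 1 (n%:R * (x - a)).

Lemma Cn_steep m n a b : Cn m (steep n a b).
Proof.
apply: CnM.
  have -> : (fun x => eta 1 (n%:R * (b - x))) = (fun x => eta 1 (- n%:R * x + n%:R * b)).
    by apply/funext => x; congr eta; ring.
  by apply: Cn_affine; exact: Cn_eta.
have -> : (fun x => eta 1 (n%:R * (x - a))) = (fun x => eta 1 (n%:R * x + - (n%:R * a))).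
  by apply/funext => x; congr eta; ring.
by apply: Cn_affine; exact: Cn_eta.
Qed.

Lemma steep_out n a b x : ~~ (a <= x <= b) -> steep n a b x = 0.
Proof.
rewrite negb_and -!ltNge => /orP[xa|bx]; rewrite /steep.
  by rewrite [X in _ * X]eta_eq0 ?mulr0// mulr_ge0_le0// subr_le0 ltW.
by rewrite eta_eq0 ?mul0r// mulr_ge0_le0// subr_le0 ltW.
Qed.

Lemma steep_test n a b : test_function (steep n a b).
Proof.
split; first by apply: Cn_smooth => m; exact: Cn_steep.
exists (`|a| + `|b|) => x xM; apply: steep_out; apply/negP => /andP[ax xb].
move: xM; rewrite ltNge => /negP; apply.
rewrite ler_norml; apply/andP; split.
  apply: le_trans ax; rewrite lerNl; apply: (@le_trans _ _ `|a|); last by rewrite lerDl.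
  by rewrite -normrN ler_norm.
by apply: (le_trans xb); apply: (le_trans (ler_norm b)); rewrite lerDr.
Qed.

End SmoothBump.

Section Reflection.
Context {R : realType}.
Local Notation mu := (@lebesgue_measure R).
Implicit Types (f g h : R -> R) (x y t a b c : R).

Lemma mopp f : measurable_fun setT f -> measurable_fun setT (fun x => f (- x)).
Proof. by move=> mf; apply: (measurableT_comp mf); mble. Qed.

Lemma L2_opp f : L2 f -> L2 (fun x => f (- x)).
Proof.
move=> /L2P[mf fi]; apply/L2P; split; first exact: mopp.
exact: (intg_opp fi).
Qed.

Lemma ip_opp f g : L2 f -> L2 g -> ip (fun x => f (- x)) (fun x => g (- x)) = ip f g.
Proof. by move=> fL gL; exact: (Rint_opp (L2M fL gL)). Qed.

Lemma ip_oppl f g : L2 f -> L2 g -> ip (fun x => f (- x)) g = ip f (fun x => g (- x)).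
Proof.
move=> fL gL; rewrite -(ip_opp fL (L2_opp gL)).
by apply: eq_Rint => x; rewrite opprK.
Qed.

Lemma U_opp f : L2 f -> {ae mu, forall x, U (fun x => f (- x)) x = U f (- x)}.
Proof.
move=> fL; have foL := L2_opp fL.
have [UL Uc] := U_spec fL; have [UoL Uoc] := U_spec foL.
apply: (L2cvg_uniq (fun n => hart_trunc_L2 n foL) UoL (L2_opp UL) Uoc).
have e n : hart (trunc n (fun x => f (- x))) = fun x => hart (trunc n f) (- x).
  apply/funext => x; rewrite -hart_opp; last exact: trunc_intg.
  congr hart; apply/funext => y; rewrite /trunc /ind !indic_itvE.
  by rewrite lerN2 [- y <= _]lerNl andbC.
have e2 n : sqd (hart (trunc n (fun x => f (- x)))) (fun x => U f (- x)) = sqd (hart (trunc n f)) (U f).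
  rewrite e; exact: (ip_opp (L2B (hart_trunc_L2 n fL) UL) (L2B (hart_trunc_L2 n fL) UL)).
by rewrite /L2cvg; under eq_fun do rewrite e2.
Qed.

End Reflection.

Section TestFunctions.
Context {R : realType}.
Local Notation mu := (@lebesgue_measure R).
Implicit Types (f g h psi : R -> R) (x y t a b c M : R).

Lemma compact_support_eq f M : (forall x, M < `|x| -> f x = 0) ->
  f = fun x => \1_`[- M, M] x * f x.
Proof.
move=> fM; apply/funext => x; rewrite indic_itvE -ler_norml.
by case: leP => [_|/fM ->]; rewrite ?mul1r ?mul0r.
Qed.

Lemma compact_support_intg f M : continuous f -> (forall x, M < `|x| -> f x = 0) -> intg mu f.
Proof. by move=> cf /compact_support_eq ->; exact: intg_itv. Qed.

Lemma compact_support_L2 f M : continuous f -> (forall x, M < `|x| -> f x = 0) -> L2 f.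
Proof.
move=> cf fM; apply/L2P; split; first exact: continuous_measurable_fun.
under eq_fun do rewrite expr2.
apply: (@compact_support_intg _ M) => [x|x /fM ->]; last by rewrite mulr0.
by apply: cvgM; exact: cf.
Qed.

Lemma test_is_derive psi x : test_function psi -> is_derive x 1 psi (derive1 psi x).
Proof. by case=> dpsi _; apply: is_derive1P; exact: (dpsi 0%N). Qed.

Lemma test_cont psi : test_function psi -> continuous psi.
Proof. by move=> tpsi x; exact: drv_cont (test_is_derive x tpsi). Qed.

Lemma test_deriv psi : test_function psi -> test_function (derive1 psi).
Proof.
move=> [dpsi [M psiM]]; split; first by move=> n x; rewrite -derive1Sn.
exists M => x xM; apply: is_derive1E; apply: near_eq_is_derive (drv_cst 0 x).
near=> y; rewrite psiM//; near: y.
by apply: (cvgr_gt _ (@norm_continuous _ _ x)).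
Unshelve. all: by end_near. Qed.

Lemma test_intg psi : test_function psi -> intg mu psi.
Proof. by move=> tpsi; have [_ [M psiM]] := tpsi; exact: compact_support_intg (test_cont tpsi) psiM. Qed.

Lemma test_L2 psi : test_function psi -> L2 psi.
Proof. by move=> tpsi; have [_ [M psiM]] := tpsi; exact: compact_support_L2 (test_cont tpsi) psiM. Qed.

Lemma test_shift psi a : test_function psi -> test_function (fun x => psi (x - a)).
Proof.
move=> [dpsi [M psiM]]; split.
  apply: Cn_smooth => n; have -> : (fun x => psi (x - a)) = (fun x => psi (1 * x + - a)).
    by apply/funext => x; rewrite mul1r.
  by apply: Cn_affine; exact: smooth_Cn.
exists (M + `|a|) => x xM; apply: psiM.
by have := ler_normD (x - a) a; rewrite subrK; lra.
Qed.

Lemma test_ibp psi g g' : test_function psi -> (forall x, is_derive x 1 g (g' x)) ->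
  continuous g' -> \int[mu]_x (derive1 psi x * g x) = - \int[mu]_x (psi x * g' x).
Proof.
move=> tpsi dg cg'; have [_ [M psiM]] := tpsi.
have cg : continuous g by move=> x; exact: drv_cont (dg x).
have td := test_deriv tpsi; have cpsi := test_cont tpsi; have cpsi' := test_cont td.
have psiM' : forall x, M < `|x| -> derive1 psi x = 0.
  move=> x xM; apply: is_derive1E; apply: near_eq_is_derive (drv_cst 0 x).
  near=> y; rewrite psiM//; near: y.
  by apply: (cvgr_gt _ (@norm_continuous _ _ x)).
have i1 : intg mu (fun x => derive1 psi x * g x).
  apply: (@compact_support_intg _ M) => [x|x /psiM' ->]; last by rewrite mul0r.
  by apply: cvgM; [exact: cpsi'|exact: cg].
have i2 : intg mu (fun x => psi x * g' x).
  apply: (@compact_support_intg _ M) => [x|x /psiM ->]; last by rewrite mul0r.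
  by apply: cvgM; [exact: cpsi|exact: cg'].
apply/eqP; rewrite -addr_eq0 -RintD//; apply/eqP; rewrite -[RHS](subrr 0).
apply: (@ftc_line R _ (fun x => psi x * g x)).
- by move=> x; apply: cvgD; apply: cvgM; [exact: cpsi'|exact: cg|exact: cpsi|exact: cg'].
- by move=> x; exact: drvM (test_is_derive x tpsi) (dg x).
- exact: intgD.
- apply: cvg_near_cst; near=> n; rewrite psiM ?mul0r// ger0_norm//.
  near: n; exact: nbhs_infty_gtr.
- apply: cvg_near_cst; near=> n; rewrite psiM ?mul0r// normrN ger0_norm//.
  near: n; exact: nbhs_infty_gtr.
Unshelve. all: by end_near. Qed.

Lemma is_derive_K xi x : is_derive x 1 (fun x => K x xi) (xi * K x (- xi)).
Proof. by rewrite /K; drve; rewrite mulrN cosN sinN; ring. Qed.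

Lemma hart_deriv psi xi : test_function psi -> hart (derive1 psi) xi = - xi * hart psi (- xi).
Proof.
move=> tpsi; rewrite /hart (test_ibp tpsi (is_derive_K xi)).
  rewrite mulNr -RintZ; last exact: intgK (test_intg tpsi).
  by congr (- _); apply: eq_Rint => x; ring.
move=> x; apply: cvgM; first exact: cvg_cst.
by under eq_fun do rewrite K_sym; rewrite K_sym; exact: K_cont.
Qed.

Lemma hart_deriv2 psi xi : test_function psi ->
  hart (derive1n 2 psi) xi = - xi ^+ 2 * hart psi xi.
Proof.
move=> tpsi; rewrite -[derive1n 2 psi]/(derive1 (derive1 psi)).
rewrite hart_deriv ?hart_deriv//; [rewrite opprK; ring|exact: test_deriv].
Qed.

(** In general a translation mixes the values of the transform at [xi] and [- xi], with coefficients
    the cosine and sine of [a xi]. For even [psi] these two values agree and the kernel factors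
    out. *)
Lemma hart_shift psi a xi : intg mu psi -> (forall x, psi (- x) = psi x) ->
  hart (fun x => psi (x - a)) xi = c0^-1 * (hart psi xi * K a xi).
Proof.
move=> ipsi even_psi.
have hs : intg mu (fun x => psi (x - a)) by exact: (intg_shift (- a) ipsi).
rewrite /hart -(Rint_shift a (intgK xi hs)) /=.
under eq_Rint do rewrite addrK.
have ci : intg mu (fun x => psi x * cos (xi * x)).
  by apply: (intg_boundedM (C := 1) ipsi); [exact: mcosM|move=> x; exact: cos_max].
have si : intg mu (fun x => psi x * sin (xi * x)).
  by apply: (intg_boundedM (C := 1) ipsi); [exact: msinM|move=> x; exact: sin_max].
have s0 : \int[mu]_x (psi x * sin (xi * x)) = 0.
  by apply: Rint_odd => // x; rewrite even_psi mulrN sinN mulrN.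
have cE : c0 != 0 :> R by rewrite gt_eqF// c0_gt0.
have -> : \int[mu]_x (psi x * K x xi) = c0 * \int[mu]_x (psi x * cos (xi * x)).
  transitivity (\int[mu]_x (c0 * (psi x * cos (xi * x) + psi x * sin (xi * x)))).
    by apply: eq_Rint => x; rewrite /K [x * xi]mulrC; ring.
  by rewrite RintZ ?RintD ?s0 ?addr0//; exact: intgD.
transitivity (\int[mu]_x (K a xi * (psi x * cos (xi * x)) + K a (- xi) * (psi x * sin (xi * x)))).
  apply: eq_Rint => x; rewrite /K mulrDl cosD sinD mulrN cosN sinN [xi * x]mulrC; ring.
rewrite RintD ?RintZ//; [|exact: intgZ..].
by rewrite s0 mulr0 addr0; field.
Qed.

Definition ebump (n : nat) : R -> R := steep 1 (- n.+1%:R^-1) n.+1%:R^-1.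

Lemma ebump_test n : test_function (ebump n). Proof. exact: steep_test. Qed.

Lemma ebump_even n x : ebump n (- x) = ebump n x.
Proof. by rewrite /ebump /steep [LHS]mulrC; congr (_ * _); congr eta; rewrite !mul1r ?opprK addrC // addrC. Qed.

Lemma cont_ae_eq0 f : continuous f -> {ae mu, forall x, f x = 0} -> forall x, f x = 0.
Proof.
move=> cf [N [mN N0 subN]] x; apply/eqP; apply/negP => /negP fx.
have /nbhs_ballP[e /= e0 eP] : \forall y \near x, f y != 0.
  exact: (cvgr_neq0 _ (cf x) fx).
have : mu (ball x e) = 0%E.
  apply/eqP; rewrite -measure_le0 -N0; apply: le_measure; rewrite ?inE//.
    exact: measurable_ball.
  by move=> y /eP /eqP ?; exact: subN.
rewrite lebesgue_measure_ball ?ltW// => -[/eqP].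
by rewrite mulrn_eq0 /= gt_eqF.
Qed.

(** The support has half-width [1 / (n+1)], so on it [|xi x| <= 1 < pi / 2] and the cosine is
    positive. *)
Lemma ebump_hart_gt0 n xi : `|xi| <= n.+1%:R -> 0 < hart (ebump n) xi.
Proof.
move=> xin; have tb := ebump_test n; have ib := test_intg tb.
have ci : intg mu (fun x => ebump n x * cos (xi * x)).
  by apply: (intg_boundedM (C := 1) ib); [exact: mcosM|move=> x; exact: cos_max].
have si : intg mu (fun x => ebump n x * sin (xi * x)).
  by apply: (intg_boundedM (C := 1) ib); [exact: msinM|move=> x; exact: sin_max].
have s0 : \int[mu]_x (ebump n x * sin (xi * x)) = 0.
  by apply: Rint_odd => // x; rewrite ebump_even mulrN sinN mulrN.
have -> : hart (ebump n) xi = c0 * \int[mu]_x (ebump n x * cos (xi * x)).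
  transitivity (\int[mu]_x (c0 * (ebump n x * cos (xi * x) + ebump n x * sin (xi * x)))).
    by apply: eq_Rint => x; rewrite /K [x * xi]mulrC; ring.
  by rewrite RintZ ?RintD ?s0 ?addr0//; exact: intgD.
rewrite mulr_gt0 ?c0_gt0//.
have pos x : 0 <= ebump n x * cos (xi * x).
  have [xn|xn] := boolP (- n.+1%:R^-1 <= x <= n.+1%:R^-1); last first.
    by rewrite /ebump steep_out ?mul0r.
  rewrite mulr_ge0//; first by rewrite mulr_ge0 ?eta_ge0.
  apply/ltW/cos_gt0_pihalf; rewrite -ltr_norml.
  apply: (@le_lt_trans _ _ 1); last first.
    rewrite lt_neqAle pihalf_ge1 andbT; apply/eqP => /(congr1 (@cos R)) p1.
    by have := @cos1_gt0 R; rewrite p1 cos_pihalf ltxx.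
  rewrite normrM -(mulfV (_ : n.+1%:R != 0 :> R))// ler_pM//.
  by rewrite ler_norml.
rewrite lt_neqAle Rint_ge0// andbT; apply/eqP => e0.
have ae0 := Rint_eq0_ae ci pos (esym e0).
have cf : continuous (fun x => ebump n x * cos (xi * x)).
  move=> x; apply: cvgM; first exact: test_cont.
  apply: (continuous_comp (g := @cos R)); last exact: continuous_cos.
  by apply: cvgM; [exact: cvg_cst|exact: cvg_id].
have /eqP := cont_ae_eq0 cf ae0 0.
rewrite mulr0 cos0 mulr1 /ebump /steep !mul1r sub0r opprK subr0 mulf_eq0 orbb.
by rewrite gt_eqF// eta_gt0// invr_gt0.
Qed.

End TestFunctions.

(** * Weak derivatives and H^1 on the transform side *)

Section WeakDerivative.
Context {R : realType}.
Local Notation mu := (@lebesgue_measure R).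
Implicit Types (f g h psi p : R -> R) (x y t a b c xi : R).

Lemma ae_refl f : {ae mu, forall x, f x = f x}. Proof. exact: aeW. Qed.

Lemma ae_sym f g : {ae mu, forall x, f x = g x} -> {ae mu, forall x, g x = f x}.
Proof. by move=> fg; apply: (aeS fg) => x ->. Qed.

Lemma ae_trans f g h : {ae mu, forall x, f x = g x} -> {ae mu, forall x, g x = h x} ->
  {ae mu, forall x, f x = h x}.
Proof. by move=> fg gh; apply: (aeS2 fg gh) => x -> ->. Qed.

Lemma den_gt0 x : 0 < 1 + x ^+ 2. Proof. by rewrite ltr_pwDl ?sqr_ge0. Qed.

Lemma den_neq0 x : 1 + x ^+ 2 != 0. Proof. by rewrite gt_eqF ?den_gt0. Qed.

Lemma mden : measurable_fun setT (fun x : R => (1 + x ^+ 2)^-1).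
Proof.
apply: continuous_measurable_fun => x.
have h : is_derive x 1 (fun x : R => 1 + x ^+ 2) (2 * x) by drve; ring.
exact: drv_cont (@drvV _ (fun x : R => 1 + x ^+ 2) _ _ (den_neq0 x) h).
Qed.

Lemma den_bound x : `|(1 + x ^+ 2)^-1| <= 1.
Proof.
rewrite normfV gtr0_norm ?den_gt0// invf_le1 ?den_gt0//.
by rewrite lerDl sqr_ge0.
Qed.

Lemma xden_bound x : `|x / (1 + x ^+ 2)| <= 1.
Proof.
rewrite normrM normfV [`|1 + _|]gtr0_norm ?den_gt0// ler_pdivrMr ?den_gt0// mul1r.
rewrite -[x ^+ 2]real_normK ?num_real//.
have := sqr_ge0 (`|x| - 1); have := normr_ge0 x; nra.
Qed.

Lemma x2den_bound x : `|x ^+ 2 / (1 + x ^+ 2)| <= 1.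
Proof.
rewrite ger0_norm; last by apply: divr_ge0; [exact: sqr_ge0|exact/ltW/den_gt0].
by rewrite ler_pdivrMr ?den_gt0// mul1r lerDr.
Qed.

Lemma hart_test_L2 psi : test_function psi -> L2 (hart psi).
Proof. by move=> tp; exact: (bessel (test_intg tp) (test_L2 tp)).1. Qed.

(** Here [q] is the transform of [psi - psi'']. This decay allows transforms of test functions to be
    paired with functions that are in L^2 only after division by [1 + x^2]. *)
Lemma hart_test_dec psi : test_function psi ->
  exists2 q, L2 q & (forall x, hart psi x = (1 + x ^+ 2)^-1 * q x) /\
    exists C, forall x, `|q x| <= C.
Proof.
move=> tp; have tpp : test_function (derive1n 2 psi).
  by have := test_deriv (test_deriv tp).
pose q x := hart psi x - hart (derive1n 2 psi) x.
exists q; first by apply: L2B; exact: hart_test_L2.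
split=> [x|].
  rewrite /q (hart_deriv2 x tp); field; exact: den_neq0.
exists (\int[mu]_x `|psi x| + \int[mu]_x `|derive1n 2 psi x|) => x.
by apply: (le_trans (ler_normB _ _)); apply: lerD; apply: hart_le; exact: test_intg.
Qed.

Lemma L2_den p : L2 (fun x => p x / (1 + x ^+ 2)) -> measurable_fun setT p.
Proof.
move=> /L2_mble mp; have -> : p = fun x => p x / (1 + x ^+ 2) * (1 + x ^+ 2).
  by apply/funext => x; rewrite mulfVK ?den_neq0.
by apply: measurable_funM => //; mble.
Qed.

(* Translating an even bump multiplies its transform by the kernel, so the
   hypothesis says that the transform of [p * hart (ebump n)] vanishes. *)
Lemma dual_test p : L2 (fun x => p x / (1 + x ^+ 2)) ->
  (forall psi, test_function psi -> \int[mu]_x (p x * hart psi x) = 0) ->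
  {ae mu, forall x, p x = 0}.
Proof.
move=> pL p0; have mp := L2_den pL.
have key n : {ae mu, forall x, p x * hart (ebump n) x = 0}.
  have tb : test_function (ebump n : R -> R) := ebump_test n; have [q qL [qE [C qC]]] := hart_test_dec tb.
  pose M x := p x * hart (ebump n) x.
  have ME : M = fun x => p x / (1 + x ^+ 2) * q x.
    by apply/funext => x; rewrite /M qE; ring.
  have ML : L2 M by rewrite ME; exact: (L2_boundedM pL (L2_mble qL) qC).
  have Mi : intg mu M by rewrite ME; exact: L2M.
  have hM a : hart M a = 0.
    have := p0 _ (test_shift a tb); rewrite /hart.
    have -> : \int[mu]_x (p x * hart (fun x => ebump n (x - a)) x) =
        \int[mu]_x (c0^-1 * (M x * K x a)).
      apply: eq_Rint => x; rewrite (hart_shift a x (test_intg tb)); last exact: ebump_even.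
      by rewrite /M K_sym; ring.
    rewrite RintZ; last exact: intgK.
    by move=> /eqP; rewrite mulf_eq0 invr_eq0 gt_eqF ?c0_gt0//= => /eqP.
  have UM : {ae mu, forall x, U M x = 0}.
    by apply: (aeS (U_hart Mi ML)) => x ->.
  apply: (ip_eq0_ae ML); rewrite -(U_iso ML ML).
  rewrite (ip_ae (U_L2 ML) L2_0 (U_L2 ML) L2_0 UM UM).
  by rewrite /ip; under eq_Rint do rewrite mulr0; rewrite Rintegral0.
have H : {ae mu, forall x, forall n : nat, p x * hart (ebump n) x = 0}.
  by apply/ae_foralln => n; exact: key.
apply: (aeS H) => x Hx; have [N _ NP] := nbhs_infty_ger (`|x|).
have h0 : 0 < hart (ebump N) x.
  apply: ebump_hart_gt0; apply: (le_trans (NP N (leqnn N))).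
  by rewrite ler_nat.
by have /eqP := Hx N; rewrite mulf_eq0 (gt_eqF h0) orbF => /eqP.
Qed.

Lemma ip_test f psi : L2 f -> test_function psi ->
  \int[mu]_x (f x * psi x) = \int[mu]_x (U f x * hart psi x).
Proof.
move=> fL tp; have pL := test_L2 tp.
rewrite -[LHS]/(ip f psi) -(U_iso fL pL).
exact: (ip_ae (U_L2 fL) (U_L2 fL) (U_L2 pL) (hart_test_L2 tp) (ae_refl _) (U_hart (test_intg tp) pL)).
Qed.

Lemma ip_test_deriv f psi : L2 f -> test_function psi ->
  intg mu (fun x => x * U f (- x) * hart psi x) /\
  \int[mu]_x (f x * derive1 psi x) = \int[mu]_x (x * U f (- x) * hart psi x).
Proof.
move=> fL tp; have tp' := test_deriv tp.
have e x : U f (- x) * hart (derive1 psi) (- x) = x * U f (- x) * hart psi x.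
  by rewrite (hart_deriv _ tp) !opprK; ring.
split.
  have := L2M (L2_opp (U_L2 fL)) (L2_opp (hart_test_L2 tp')).
  by under eq_fun do rewrite e.
rewrite (ip_test fL tp') -[LHS]/(ip _ _) -(ip_opp (U_L2 fL) (hart_test_L2 tp')).
exact: eq_Rint.
Qed.

(** Differentiating the kernel in [x] gives [xi K x (- xi)], so a derivative becomes a
    multiplication composed with a reflection. One direction is Parseval against test functions, the
    other is [dual_test]. *)
Lemma weak_derivP f g : L2 f -> L2 g ->
  is_weak_derivative f g <-> {ae mu, forall x, U g x = - x * U f (- x)}.
Proof.
move=> fL gL; have UfL := U_L2 fL; have UgL := U_L2 gL; split => [wd|fg psi tp]; last first.
  have [i1 ->] := ip_test_deriv fL tp; rewrite (ip_test gL tp).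
  rewrite -RintN; last exact: L2M UgL (hart_test_L2 tp).
  apply: Rint_ae; first exact: (intg_mble i1).
    by apply: (@intg_mble _ _ _ mu); apply: intgN; exact: L2M UgL (hart_test_L2 tp).
  by apply: (aeS fg) => x ->; ring.
have : {ae mu, forall x, U g x + x * U f (- x) = 0}.
  apply: dual_test.
    have -> : (fun x => (U g x + x * U f (- x)) / (1 + x ^+ 2)) =
      (fun x => U g x * (1 + x ^+ 2)^-1 + U f (- x) * (x / (1 + x ^+ 2))).
      by apply/funext => x; ring.
    apply: L2D; first exact: (L2_boundedM UgL mden den_bound).
    apply: (L2_boundedM (L2_opp UfL) _ xden_bound).
    by apply: measurable_funM => //; exact: mden.
  move=> psi tp; have [i1 e1] := ip_test_deriv fL tp.
  have i2 : intg mu (fun x => U g x * hart psi x) := L2M UgL (hart_test_L2 tp).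
  transitivity (\int[mu]_x (U g x * hart psi x + x * U f (- x) * hart psi x)).
    by apply: eq_Rint => x; ring.
  by rewrite (RintD i2 i1) -e1 (wd psi tp) -(ip_test gL tp) subrr.
by move=> H; apply: (aeS H) => x /eqP; rewrite addr_eq0 mulNr => /eqP.
Qed.

Lemma H1_weak_derivative f : H1 f ->
  [/\ L2 f, L2 (weak_derivative f) & {ae mu, forall x, U (weak_derivative f) x = - x * U f (- x)}].
Proof.
move=> [fL [g gL fg]].
have [wL wd] : L2 (weak_derivative f) /\ is_weak_derivative f (weak_derivative f).
  by rewrite /weak_derivative; case: xgetP => [y -> //|/(_ g)] H; case: H.
by split => //; apply/(weak_derivP fL wL).
Qed.

Lemma H1P f : H1 f <-> L2 f /\ L2 (fun x => x * U f x).
Proof.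
split=> [/H1_weak_derivative[fL wL wd]|[fL xL]].
  split=> //; have woL := L2_opp (U_L2 wL).
  apply: (L2_ae _ woL); first by apply: measurable_funM => //; exact: (L2_mble (U_L2 fL)).
  by apply: (aeS (ae_opp wd)) => x ->; rewrite !opprK.
split=> //; pose h x := - x * U f (- x).
have hL : L2 h by exact: (L2_opp xL).
exists (U h); first exact: U_L2.
by apply/(weak_derivP fL (U_L2 hL)); exact: U_invol.
Qed.

Lemma nrm_weak_derivative f : H1 f ->
  ip (weak_derivative f) (weak_derivative f) = ip (fun x => x * U f x) (fun x => x * U f x).
Proof.
move=> /[dup] /H1P[_ xL] /H1_weak_derivative[fL wL wd].
rewrite -(U_iso wL wL) -(ip_opp xL xL).
exact: (ip_ae (U_L2 wL) (L2_opp xL) (U_L2 wL) (L2_opp xL) wd wd).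
Qed.

End WeakDerivative.

(** * Fourier multipliers and the functionals *)

Section FourierLink.
Context {R : realType}.
Local Notation mu := (@lebesgue_measure R).
Implicit Types (f g h p : R -> R) (F : R -> R[i]) (x y xi : R).

(** The even part of [U f], rescaled to the cosine integral of [f]; [st] is likewise the odd part
    and the sine integral. The Fourier transform of [f] is [ct f - i st f]. *)
Definition ct f xi : R := (2 * c0)^-1 * (U f xi + U f (- xi)).
Definition st f xi : R := (2 * c0)^-1 * (U f xi - U f (- xi)).

Lemma c0_neq0 : c0 != 0 :> R. Proof. by rewrite gt_eqF// c0_gt0. Qed.

Lemma ct_L2 f : L2 f -> L2 (ct f).
Proof. by move=> /U_L2 fL; apply/L2Z/L2D => //; exact: L2_opp. Qed.

Lemma st_L2 f : L2 f -> L2 (st f).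
Proof. by move=> /U_L2 fL; apply/L2Z/L2B => //; exact: L2_opp. Qed.

Definition ctn (n : nat) f xi : R := \int[mu]_(x in `[- n%:R, n%:R]) (f x * cos (x * xi)).
Definition stn (n : nat) f xi : R := \int[mu]_(x in `[- n%:R, n%:R]) (f x * sin (x * xi)).

Lemma trunc_cos_sin n f xi : L2 f ->
  intg mu (fun x => trunc n f x * cos (x * xi)) /\ intg mu (fun x => trunc n f x * sin (x * xi)).
Proof.
move=> fL; have ti := trunc_intg n fL; split; apply: (intg_boundedM (C := 1) ti).
- by under eq_fun do rewrite mulrC; exact: mcosM.
- by move=> x; exact: cos_max.
- by under eq_fun do rewrite mulrC; exact: msinM.
- by move=> x; exact: sin_max.
Qed.

Lemma ctnE n f xi : L2 f ->
  ctn n f xi = (2 * c0)^-1 * (hart (trunc n f) xi + hart (trunc n f) (- xi)).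
Proof.
move=> fL; have [ci si] := trunc_cos_sin n xi fL.
rewrite -RintD; [|exact/intgK/trunc_intg|exact/intgK/trunc_intg].
have -> : ctn n f xi = \int[mu]_x (trunc n f x * cos (x * xi)).
  by rewrite /ctn RintI; apply: eq_Rint => x; rewrite /trunc mulrA.
transitivity ((2 * c0)^-1 * \int[mu]_x (2 * c0 * (trunc n f x * cos (x * xi)))).
  by rewrite RintZ// mulrA mulVf ?mul1r// mulf_neq0// c0_neq0.
congr (_ * _); apply: eq_Rint => x; rewrite /K mulrN cosN sinN; ring.
Qed.

Lemma stnE n f xi : L2 f ->
  stn n f xi = (2 * c0)^-1 * (hart (trunc n f) xi - hart (trunc n f) (- xi)).
Proof.
move=> fL; have [ci si] := trunc_cos_sin n xi fL.
rewrite -RintB; [|exact/intgK/trunc_intg|exact/intgK/trunc_intg].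
have -> : stn n f xi = \int[mu]_x (trunc n f x * sin (x * xi)).
  by rewrite /stn RintI; apply: eq_Rint => x; rewrite /trunc mulrA.
transitivity ((2 * c0)^-1 * \int[mu]_x (2 * c0 * (trunc n f x * sin (x * xi)))).
  by rewrite RintZ// mulrA mulVf ?mul1r// mulf_neq0// c0_neq0.
congr (_ * _); apply: eq_Rint => x; rewrite /K mulrN cosN sinN; ring.
Qed.

Lemma ctn_L2 n f : L2 f -> L2 (ctn n f).
Proof.
move=> fL; rewrite (_ : ctn n f = fun x => (2 * c0)^-1 * (hart (trunc n f) x + hart (trunc n f) (- x))).
  by apply/L2Z/L2D; [|apply: L2_opp]; exact: hart_trunc_L2.
by apply/funext => x; exact: ctnE.
Qed.

Lemma stn_L2 n f : L2 f -> L2 (stn n f).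
Proof.
move=> fL; rewrite (_ : stn n f = fun x => (2 * c0)^-1 * (hart (trunc n f) x - hart (trunc n f) (- x))).
  by apply/L2Z/L2B; [|apply: L2_opp]; exact: hart_trunc_L2.
by apply/funext => x; exact: stnE.
Qed.

Lemma sqd_opp f g : L2 f -> L2 g -> sqd (fun x => f (- x)) (fun x => g (- x)) = sqd f g.
Proof. by move=> fL gL; exact: (ip_opp (L2B fL gL) (L2B fL gL)). Qed.

(** The sign [s] is 1 for the cosine transform and -1 for the sine transform, so one estimate covers
    both. *)
Lemma sqd_bound (c a a' b b' s : R -> R) (d : R) : L2 a -> L2 a' -> L2 b -> L2 b' ->
  (forall x, c x = d * ((a x - a' x) + s x * (b x - b' x))) ->
  (forall x, s x ^+ 2 <= 1) -> measurable_fun setT c ->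
  L2 c /\ ip c c <= 2 * d ^+ 2 * (sqd a a' + sqd b b').
Proof.
move=> aL a'L bL b'L cE s1 mc.
have i1 := L2_sqr (L2B aL a'L); have i2 := L2_sqr (L2B bL b'L).
have le x : c x ^+ 2 <= 2 * d ^+ 2 * ((a x - a' x) ^+ 2 + (b x - b' x) ^+ 2).
  rewrite cE exprMn; set u := a x - a' x; set v := b x - b' x.
  have h : (u + s x * v) ^+ 2 <= 2 * (u ^+ 2 + v ^+ 2).
    have := s1 x; have := sqr_ge0 (u - s x * v); have := sqr_ge0 v; move: (s x) => z; nra.
  rewrite (_ : 2 * d ^+ 2 * _ = d ^+ 2 * (2 * (u ^+ 2 + v ^+ 2))); last by ring.
  by apply: ler_wpM2l; [exact: sqr_ge0|exact: h].
have ic := intgZ (2 * d ^+ 2) (intgD i1 i2).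
have c2 : intg mu (fun x => c x ^+ 2).
  apply: (intg_dom _ ic) => [|x]; first exact: measurable_funX.
  by rewrite ger0_norm ?sqr_ge0.
split; first by apply/L2P.
have -> : ip c c = \int[mu]_x (c x ^+ 2) by apply: eq_Rint => x; rewrite expr2.
apply: (le_trans (le_Rint c2 ic le)).
rewrite (RintZ _ (intgD i1 i2)) (RintD i1 i2).
by rewrite le_eqVlt; apply/orP; left; apply/eqP; congr (_ * (_ + _)); apply: eq_Rint => x; rewrite expr2.
Qed.

Lemma ctn_cvg f : L2 f -> L2cvg (fun n => ctn n f) (ct f).
Proof.
move=> fL; have [UL Uc] := U_spec fL.
pose d : R := (2 * c0)^-1.
apply: (@squeeze_cvgr _ _ _ _ (fun=> 0) (fun n => 2 * d ^+ 2 *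
  (sqd (hart (trunc n f)) (U f) + sqd (hart (trunc n f)) (U f)))).
- apply: nearW => n; rewrite ip_ge0 /=.
  have hL := hart_trunc_L2 n fL.
  rewrite -{2}(sqd_opp hL UL).
  apply: (@sqd_bound _ _ _ _ _ (fun=> 1) d hL UL (L2_opp hL) (L2_opp UL) _ _ _).2.
  + by move=> x; rewrite ctnE// /ct -/d; ring.
  + by move=> x; rewrite expr1n.
  + by apply: measurable_funB; apply: L2_mble; [exact: ctn_L2|exact: ct_L2].
- exact: cvg_cst.
- rewrite -[X in _ --> X](mulr0 (2 * d ^+ 2)); apply: cvgM; first exact: cvg_cst.
  by rewrite -[X in _ --> X](addr0 0); apply: cvgD.
Qed.

Lemma stn_cvg f : L2 f -> L2cvg (fun n => stn n f) (st f).
Proof.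
move=> fL; have [UL Uc] := U_spec fL.
pose d : R := (2 * c0)^-1.
apply: (@squeeze_cvgr _ _ _ _ (fun=> 0) (fun n => 2 * d ^+ 2 *
  (sqd (hart (trunc n f)) (U f) + sqd (hart (trunc n f)) (U f)))).
- apply: nearW => n; rewrite ip_ge0 /=.
  have hL := hart_trunc_L2 n fL.
  rewrite -{2}(sqd_opp hL UL).
  apply: (@sqd_bound _ _ _ _ _ (fun=> -1) d hL UL (L2_opp hL) (L2_opp UL) _ _ _).2.
  + by move=> x; rewrite stnE// /st -/d; ring.
  + by move=> x; rewrite sqrrN expr1n.
  + by apply: measurable_funB; apply: L2_mble; [exact: stn_L2|exact: st_L2].
- exact: cvg_cst.
- rewrite -[X in _ --> X](mulr0 (2 * d ^+ 2)); apply: cvgM; first exact: cvg_cst.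
  by rewrite -[X in _ --> X](addr0 0); apply: cvgD.
Qed.

Lemma truncated_fourierE n f xi : truncated_fourier n f xi = Complex (ctn n f xi) (- stn n f xi).
Proof. by []. Qed.

Lemma Lnorm_pair (a b : R -> R) : L2 a -> L2 b ->
  Lnorm mu 2%:E (fun x => (Num.sqrt (a x ^+ 2 + b x ^+ 2))%:E) =
  (Num.sqrt (ip a a + ip b b))%:E.
Proof.
move=> aL bL; rewrite unlock.
have i1 := L2_sqr aL; have i2 := L2_sqr bL.
have -> : (\int[mu]_x `|(Num.sqrt (a x ^+ 2 + b x ^+ 2))%:E| `^ 2 = (ip a a + ip b b)%:E)%E.
  rewrite (_ : ip a a + ip b b = \int[mu]_x (a x ^+ 2 + b x ^+ 2)).
    rewrite EFin_Rint; last exact: intgD.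
    apply: eq_integral => x _ /=; rewrite powR_mulrn// real_normK ?num_real//.
    by rewrite sqr_sqrtr// addr_ge0 ?sqr_ge0.
  by rewrite (RintD i1 i2); congr (_ + _); apply: eq_Rint => x; rewrite expr2.
by rewrite poweR_EFin /= powR12_sqrt// addr_ge0 ?ip_ge0.
Qed.

Lemma is_fourier_transformE f F : L2 f ->
  is_fourier_transform f F <->
  [/\ L2 (fun x => complex.Re (F x)), L2 (fun x => complex.Im (F x)) &
    ip (fun x => complex.Re (F x) - ctn n f x) (fun x => complex.Re (F x) - ctn n f x) +
    ip (fun x => complex.Im (F x) + stn n f x) (fun x => complex.Im (F x) + stn n f x)
    @[n --> \oo] --> (0 : R)].
Proof.
move=> fL.
suff H : L2 (fun x => complex.Re (F x)) -> L2 (fun x => complex.Im (F x)) ->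
  (fun n => Lnorm mu 2%:E (fun xi => (complex.Re `|F xi - truncated_fourier n f xi|)%:E)) =
  (fun n => (Num.sqrt (ip (fun x => complex.Re (F x) - ctn n f x) (fun x => complex.Re (F x) - ctn n f x) +
    ip (fun x => complex.Im (F x) + stn n f x) (fun x => complex.Im (F x) + stn n f x)))%:E).
  split=> -[rL iL]; rewrite ?(H rL iL) => c; split=> //; last first.
    rewrite (H rL iL); apply: cvg_EFin; first exact: nearW.
    exact: sqrt_cvg0.
  pose u (n : nat) := Num.sqrt
    (ip (fun x => complex.Re (F x) - ctn n f x) (fun x => complex.Re (F x) - ctn n f x) +
     ip (fun x => complex.Im (F x) + stn n f x) (fun x => complex.Im (F x) + stn n f x)).
  have c' : u n @[n --> \oo] --> (0 : R) by exact: (fine_cvg c).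
  have -> : (fun n => ip (fun x => complex.Re (F x) - ctn n f x) (fun x => complex.Re (F x) - ctn n f x) +
    ip (fun x => complex.Im (F x) + stn n f x) (fun x => complex.Im (F x) + stn n f x)) =
    (fun n => u n * u n).
    by apply/funext => n; rewrite -expr2 sqr_sqrtr// addr_ge0 ?ip_ge0.
  by rewrite -[X in _ --> X](mulr0 0); apply: cvgM.
move=> rL iL; apply/funext => n.
have cL := ctn_L2 n fL; have sL := stn_L2 n fL.
rewrite -(Lnorm_pair (L2B rL cL) (L2D iL sL)); congr Lnorm; apply/funext => xi.
rewrite truncated_fourierE; case: (F xi) => a b /=.
by rewrite opprK.
Qed.

Lemma fourier_exists f : L2 f -> is_fourier_transform f (fun x => Complex (ct f x) (- st f x)).
Proof.
move=> fL; apply/(is_fourier_transformE _ fL); split => /=; [exact: ct_L2|exact/L2N/st_L2|].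
rewrite -[X in _ --> X](addr0 0); apply: cvgD.
  by have := ctn_cvg fL; rewrite /L2cvg /sqd; under eq_fun do rewrite ip_sym_dist.
have e n : ip (fun x => - st f x + stn n f x) (fun x => - st f x + stn n f x) = sqd (stn n f) (st f).
  by apply: eq_Rint => x; ring.
by under eq_fun do rewrite e; exact: stn_cvg.
Qed.

Lemma fourier_unique f F : L2 f -> is_fourier_transform f F ->
  {ae mu, forall x, complex.Re (F x) = ct f x} /\ {ae mu, forall x, complex.Im (F x) = - st f x}.
Proof.
move=> fL /(is_fourier_transformE _ fL)[rL iL c]; split.
  apply: (L2cvg_uniq (fun n => ctn_L2 n fL) rL (ct_L2 fL) _ (ctn_cvg fL)).
  apply: squeeze_cvgr c; last exact: cvg_cst; apply: nearW => n.
  by rewrite ip_ge0 /= /sqd ip_sym_dist lerDl ip_ge0.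
apply: (L2cvg_uniq (u := fun n x => - stn n f x)) => //.
- by move=> n; exact/L2N/stn_L2.
- exact/L2N/st_L2.
- apply: squeeze_cvgr c; last exact: cvg_cst; apply: nearW => n.
  rewrite ip_ge0 /= /sqd ip_sym_dist.
  have -> : ip (fun x => complex.Im (F x) - - stn n f x) (fun x => complex.Im (F x) - - stn n f x) =
    ip (fun x => complex.Im (F x) + stn n f x) (fun x => complex.Im (F x) + stn n f x).
    by apply: eq_Rint => x; rewrite opprK.
  by rewrite lerDr ip_ge0.
have e n : sqd (fun x => - stn n f x) (fun x => - st f x) = sqd (stn n f) (st f).
  by apply: eq_Rint => x; ring.
by rewrite /L2cvg; under eq_fun do rewrite e; exact: stn_cvg.
Qed.

Lemma U_ct_st f xi : U f xi = c0 * (ct f xi + st f xi).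
Proof. by rewrite /ct /st; field; exact: c0_neq0. Qed.

Lemma U_ct_stN f xi : U f (- xi) = c0 * (ct f xi - st f xi).
Proof. by rewrite /ct /st; field; exact: c0_neq0. Qed.

Lemma L2_sg p : L2 p -> L2 (fun x => - Num.sg x * p x).
Proof.
move=> pL; apply: (L2_dom1 _ pL) => [|x].
  apply: measurable_funM; last exact: L2_mble.
  apply: measurable_funN.
  apply: (eq_measurable_fun (fun x : R => \1_`]0, +oo[ x - \1_`]-oo, 0[ x : R)).
    move=> x _; rewrite !indicE; case: (ltgtP x 0) => [x0|x0|->].
    - by rewrite [RHS]ltr0_sg// memNset ?mem_set ?sub0r//= in_itv /= ?andbT// ltNge ltW.
    - by rewrite [RHS]gtr0_sg// mem_set ?memNset ?subr0//= in_itv /= ?andbT// ltNge ltW.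
    - by rewrite [RHS]sgr0 !memNset ?subrr//= in_itv /= ?andbT ltxx.
  by apply: measurable_funB; exact: measurable_indic.
by rewrite normrM normrN ler_piMl// normr_sg; case: (x != 0).
Qed.

(** The symbol [i sgn] exchanges cosine and sine transforms, which on the Hartley side is a
    reflection with a sign. A multiplier is exhibited first, to ensure that the choice made in
    [hilbert] is a genuine one; uniqueness of the Fourier transform then determines it. *)
Lemma hilbertP f : L2 f -> L2 (hilbert f) /\
  {ae mu, forall xi, U (hilbert f) xi = - Num.sg xi * U f (- xi)}.
Proof.
move=> fL; pose m (xi : R) := Complex 0 (Num.sg xi).
have pL : L2 (fun x => - Num.sg x * U f (- x)) := L2_sg (L2_opp (U_L2 fL)).
have ex : is_fourier_multiplier m f (U (fun x => - Num.sg x * U f (- x))).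
  split; first exact: U_L2.
  exists (fun x => Complex (ct f x) (- st f x)).
  set g := U _; have gL : L2 g by exact: U_L2.
  exists (fun x => Complex (ct g x) (- st g x)); split; [exact: fourier_exists..|].
  have H := U_invol pL; apply: (aeS2 H (ae_opp H)) => x Hx HNx.
  rewrite /ct /st -/g Hx HNx /m sgrN !opprK.
  by apply/eqP; rewrite eq_complex /= /ct /st; apply/andP; split; apply/eqP; field; exact: c0_neq0.
have [hL [Ff [Fg [FF FG FE]]]] : is_fourier_multiplier m f (hilbert f).
  by rewrite /hilbert /fourier_multiplier; case: xgetP => [y ->//|/(_ _ ex)].
split => //; have [rf imf] := fourier_unique fL FF; have [rg img] := fourier_unique hL FG.
have H1 := aeS2 rf imf (fun x a b => conj a b).
have H2 := aeS2 rg img (fun x a b => conj a b).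
have H3 := aeS2 H1 H2 (fun x a b => conj a b).
apply: (aeS2 H3 FE) => x [[ra ia] [rb ib]] E.
rewrite U_ct_st U_ct_stN; move: ra ia rb ib E; rewrite /m.
case: (Ff x) => a b; case: (Fg x) => a' b' /= <- eb <- eb'.
move=> /eqP; rewrite eq_complex /= => /andP[/eqP ea' /eqP]; rewrite eb' => eb''.
have -> : st f x = - b by rewrite eb opprK.
have -> : st (hilbert f) x = - (0 * b + Num.sg x * a) by rewrite -eb'' opprK.
rewrite ea'; ring.
Qed.

(** A real even symbol acts alike on cosine and sine transforms, so it multiplies [U f] without any
    reflection. *)
Lemma half_derivativeP f : L2 f -> L2 (fun x => Num.sqrt `|x| * U f x) ->
  L2 (half_derivative f) /\
  {ae mu, forall xi, U (half_derivative f) xi = Num.sqrt `|xi| * U f xi}.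
Proof.
move=> fL pL; pose m (xi : R) := Complex (Num.sqrt `|xi|) 0.
have ex : is_fourier_multiplier m f (U (fun x => Num.sqrt `|x| * U f x)).
  split; first exact: U_L2.
  exists (fun x => Complex (ct f x) (- st f x)).
  set g := U _; have gL : L2 g by exact: U_L2.
  exists (fun x => Complex (ct g x) (- st g x)); split; [exact: fourier_exists..|].
  have H := U_invol pL; apply: (aeS2 H (ae_opp H)) => x Hx HNx.
  rewrite /ct /st -/g Hx HNx /m normrN.
  by apply/eqP; rewrite eq_complex /= /ct /st; apply/andP; split; apply/eqP; field; exact: c0_neq0.
have [hL [Ff [Fg [FF FG FE]]]] : is_fourier_multiplier m f (half_derivative f).
  by rewrite /half_derivative /fourier_multiplier; case: xgetP => [y ->//|/(_ _ ex)].
split => //; have [rf imf] := fourier_unique fL FF; have [rg img] := fourier_unique hL FG.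
have H1 := aeS2 rf imf (fun x a b => conj a b).
have H2 := aeS2 rg img (fun x a b => conj a b).
have H3 := aeS2 H1 H2 (fun x a b => conj a b).
apply: (aeS2 H3 FE) => x [[ra ia] [rb ib]] E.
rewrite !U_ct_st; move: ra ia rb ib E; rewrite /m.
case: (Ff x) => a b; case: (Fg x) => a' b' /= <- eb <- eb'.
move=> /eqP; rewrite eq_complex /= => /andP[/eqP ea' /eqP]; rewrite eb' => eb''.
have -> : st f x = - b by rewrite eb opprK.
have -> : st (half_derivative f) x = - (Num.sqrt `|x| * b + 0 * a) by rewrite -eb'' opprK.
rewrite ea'; ring.
Qed.

End FourierLink.

(** * The energy and the equation in terms of the symbol *)

Section Sobolev.
Context {R : realType}.
Local Notation mu := (@lebesgue_measure R).
Implicit Types (f g h p phi psi : R -> R) (x y xi al be : R).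

Lemma intg_den : intg mu (fun x : R => (1 + x ^+ 2)^-1).
Proof.
have [i _] := Rint_pois (0 : R) (ltr01 : 0 < 1).
have -> : (fun x : R => (1 + x ^+ 2)^-1) = (fun x => pi * pois 1 (x - 0)).
  apply/funext => x; rewrite subr0 /pois expr1n.
  by rewrite mul1r invfM mulrA mulfV ?mul1r// gt_eqF// pi_gt0.
exact: intgZ.
Qed.

Lemma AMGM_den (x u : R) : `|u| <= 2^-1 * (1 + x ^+ 2)^-1 + 2^-1 * ((1 + x ^+ 2) * u ^+ 2).
Proof.
have d0 := den_gt0 x; set d := 1 + x ^+ 2 in d0 *.
have -> : 2^-1 * d^-1 + 2^-1 * (d * u ^+ 2) = 2^-1 * d * (`|u| - d^-1) ^+ 2 + `|u|.
  by rewrite -[u ^+ 2]real_normK ?num_real//; field; rewrite gt_eqF.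
by rewrite lerDr mulr_ge0 ?sqr_ge0// mulr_ge0 ?ltW.
Qed.

(** When [p] is the transform of a function of H^1, this is its squared H^1 norm. *)
Definition Ed (p : R -> R) : R := \int[mu]_x ((1 + x ^+ 2) * p x ^+ 2).

Lemma Ed_intg p : L2 p -> L2 (fun x => x * p x) -> intg mu (fun x => (1 + x ^+ 2) * p x ^+ 2).
Proof.
move=> pL xL; have := intgD (L2_sqr pL) (L2_sqr xL).
by under eq_fun do rewrite exprMn -[X in X + _]mul1r -mulrDl.
Qed.

Lemma intg_of_weight p : L2 p -> L2 (fun x => x * p x) ->
  intg mu p /\ \int[mu]_x `|p x| <= 2^-1 * (\int[mu]_x (1 + x ^+ 2)^-1) + 2^-1 * Ed p.
Proof.
move=> pL xL; have iE := Ed_intg pL xL.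
have id := intgD (intgZ 2^-1 intg_den) (intgZ 2^-1 iE).
have pi : intg mu p.
  by apply: (intg_dom _ id) => [|x]; [exact: L2_mble|exact: AMGM_den].
split=> //; rewrite /Ed -(RintZ _ intg_den) -(RintZ _ iE) -RintD; [|exact: intgZ intg_den|exact: intgZ].
by apply: le_Rint => [||x]; [exact: intg_abs|exact: id|exact: AMGM_den].
Qed.

Lemma H1_UL1 f : H1 f -> intg mu (U f).
Proof. by move=> /H1P[fL xL]; have [] := intg_of_weight (U_L2 fL) xL. Qed.

(** The continuous representative of [f], available as soon as [U f] is integrable; functions of H^1
    are evaluated pointwise through it. *)
Definition rep f := hart (U f).

Lemma rep_ae f : L2 f -> intg mu (U f) -> {ae mu, forall x, rep f x = f x}.
Proof.
move=> fL fi; apply: (ae_trans _ (U_invol fL)).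
exact: ae_sym (U_hart fi (U_L2 fL)).
Qed.

Lemma bounded_mul_L2 f g : L2 f -> intg mu (U f) -> L2 g -> L2 (fun x => f x * g x).
Proof.
move=> fL fi gL.
have rL : L2 (fun x => g x * rep f x).
  apply: (L2_boundedM gL (mhart fi)) => x; exact: hart_le.
apply: (L2_ae _ rL).
  by apply: measurable_funM; exact: L2_mble.
by apply: (aeS (rep_ae fL fi)) => x ->; rewrite mulrC.
Qed.

Lemma sqr_L2 f : L2 f -> intg mu (U f) -> L2 (fun x => f x ^+ 2).
Proof. by move=> fL fi; under eq_fun do rewrite expr2; exact: bounded_mul_L2. Qed.

Definition sym al be x : R := 1 + be * `|x| + al * x ^+ 2.

Lemma sym_cont al be : continuous (sym al be).
Proof.
move=> x; apply: cvgD.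
  apply: cvgD; first exact: cvg_cst.
  by apply: cvgM; [exact: cvg_cst|exact: norm_continuous].
by apply: cvgM; [exact: cvg_cst|exact: exprn_continuous].
Qed.

Lemma msym al be : measurable_fun setT (sym al be).
Proof. by apply: continuous_measurable_fun; exact: sym_cont. Qed.

Lemma symN al be x : sym al be (- x) = sym al be x.
Proof. by rewrite /sym normrN sqrrN. Qed.

Lemma sym_bound al be x : `|sym al be x| <= (1 + `|be| + `|al|) * (1 + x ^+ 2).
Proof.
rewrite /sym; apply: (le_trans (ler_normD _ _)); apply: (le_trans (lerD (ler_normD _ _) (lexx _))).
rewrite normr1 [`|be * _|]normrM [`|al * _|]normrM normr_id [`|x ^+ 2|]ger0_norm ?sqr_ge0//.
have h : `|x| <= 1 + x ^+ 2.
  by rewrite -[x ^+ 2]real_normK ?num_real//; have := sqr_ge0 (`|x| - 1); have := normr_ge0 x; nra.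
have := normr_ge0 be; have := normr_ge0 al; have := sqr_ge0 x; nra.
Qed.

Definition En al be p : R := \int[mu]_x (sym al be x * p x ^+ 2).

Lemma En_intg al be p : L2 p -> L2 (fun x => x * p x) -> intg mu (fun x => sym al be x * p x ^+ 2).
Proof.
move=> pL xL; apply: (intg_domC (C := 1 + `|be| + `|al|) _ (Ed_intg pL xL)) => [|x].
  by apply: measurable_funM; [exact: msym|exact: measurable_funX (L2_mble pL)].
have -> : `|(1 + x ^+ 2) * p x ^+ 2| = (1 + x ^+ 2) * `|p x ^+ 2|.
  by rewrite normrM gtr0_norm ?den_gt0.
by rewrite normrM mulrA ler_wpM2r// sym_bound.
Qed.

Lemma L2_sqrt_norm p : L2 p -> L2 (fun x => x * p x) -> L2 (fun x => Num.sqrt `|x| * p x).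
Proof.
move=> pL xL; apply/L2P; split.
  apply: measurable_funM; last exact: L2_mble.
  apply: continuous_measurable_fun => x.
  by apply: continuous_comp; [exact: norm_continuous|exact: sqrt_continuous].
apply: (intg_dom _ (Ed_intg pL xL)) => [|x].
  apply: measurable_funX; apply: measurable_funM; last exact: L2_mble.
  apply: continuous_measurable_fun => x.
  by apply: continuous_comp; [exact: norm_continuous|exact: sqrt_continuous].
rewrite exprMn sqr_sqrtr// normrM normr_id [`|p x ^+ 2|]ger0_norm ?sqr_ge0//.
apply: ler_wpM2r; first exact: sqr_ge0.
rewrite -[x ^+ 2]real_normK ?num_real//.
have := sqr_ge0 (`|x| - 1); have := normr_ge0 x; nra.
Qed.

Lemma functional_IE al be phi : H1 phi -> functional_I al be phi = 2^-1 * En al be (U phi).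
Proof.
move=> Hphi; have [fL wL wd] := H1_weak_derivative Hphi.
have [_ xL] := (H1P phi).1 Hphi; have UL := U_L2 fL.
have sL := L2_sqrt_norm UL xL.
have [hL hE] := half_derivativeP fL sL.
rewrite /functional_I; congr (_ * _).
have i1 := intgZ al (L2_sqr wL); have i2 := intgZ be (L2_sqr hL); have i3 := L2_sqr fL.
rewrite (RintD (intgD i1 i2) i3) (RintD i1 i2) (RintZ _ (L2_sqr wL)) (RintZ _ (L2_sqr hL)).
have e1 : \int[mu]_x weak_derivative phi x ^+ 2 = \int[mu]_x (x * U phi x) ^+ 2.
  have := nrm_weak_derivative Hphi; rewrite /ip.
  by under eq_Rint do rewrite -expr2; under [RHS]eq_Rint do rewrite -expr2.
have e2 : \int[mu]_x half_derivative phi x ^+ 2 = \int[mu]_x (Num.sqrt `|x| * U phi x) ^+ 2.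
  under eq_Rint do rewrite expr2; under [RHS]eq_Rint do rewrite expr2.
  rewrite -[LHS]/(ip _ _) -(U_iso hL hL).
  exact: (ip_ae (U_L2 hL) sL (U_L2 hL) sL hE hE).
have e3 : \int[mu]_x phi x ^+ 2 = \int[mu]_x U phi x ^+ 2.
  under eq_Rint do rewrite expr2; under [RHS]eq_Rint do rewrite expr2.
  by rewrite -[LHS]/(ip _ _) -(U_iso fL fL).
rewrite e1 e2 e3 -(RintZ _ (L2_sqr xL)) -(RintZ _ (L2_sqr sL)).
have j1 := intgZ al (L2_sqr xL); have j2 := intgZ be (L2_sqr sL).
rewrite -(RintD j1 j2) -(RintD (intgD j1 j2) (L2_sqr UL)).
by apply: eq_Rint => x; rewrite /sym !exprMn sqr_sqrtr//; ring.
Qed.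

Lemma sym_den_L2 al be p : L2 p -> L2 (fun x => sym al be x * p x / (1 + x ^+ 2)).
Proof.
move=> pL; apply: (L2_dom (C := 1 + `|be| + `|al|) _ pL) => [|x].
  apply: measurable_funM; last exact: mden.
  by apply: measurable_funM; [exact: msym|exact: L2_mble].
rewrite !normrM normfV [`|1 + x ^+ 2|]gtr0_norm ?den_gt0//.
rewrite mulrAC ler_wpM2r// ler_pdivrMr ?den_gt0//; exact: sym_bound.
Qed.

Lemma hilbert_deriv phi : H1 phi -> L2 (hilbert (weak_derivative phi)) /\
  {ae mu, forall x, U (hilbert (weak_derivative phi)) x = - `|x| * U phi x}.
Proof.
move=> Hphi; have [fL wL wd] := H1_weak_derivative Hphi.
have [hL hE] := hilbertP wL; split=> //.
apply: (aeS2 hE (ae_opp wd)) => x -> ->; rewrite !opprK mulrA.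
by rewrite [`|x|]normrEsg mulNr.
Qed.

Lemma intg_sym_hart al be p psi : L2 p -> test_function psi ->
  intg mu (fun x => sym al be x * p x * hart psi x).
Proof.
move=> pL tp; have [q qL [qE _]] := hart_test_dec tp.
have := L2M (sym_den_L2 al be pL) qL.
by congr intg; apply/funext => x; rewrite qE; ring.
Qed.

Lemma weak_form al be phi psi : H1 phi -> test_function psi ->
  \int[mu]_x ((phi x - be * hilbert (weak_derivative phi) x) * psi x)
    - al * \int[mu]_x (phi x * derive1n 2 psi x) =
  \int[mu]_x (sym al be x * U phi x * hart psi x).
Proof.
move=> Hphi tp; have [fL wL wd] := H1_weak_derivative Hphi.
have [hL hE] := hilbert_deriv Hphi; have UL := U_L2 fL; have pL := test_L2 tp.
have bhL := L2Z be hL.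
have tpp : test_function (derive1n 2 psi) := test_deriv (test_deriv tp).
rewrite -[X in X - _]/(ip (fun x => phi x - be * hilbert (weak_derivative phi) x) psi).
rewrite (ipBl fL bhL pL) (ipZl be hL pL) [ip phi psi](ip_test fL tp).
rewrite [ip (hilbert _) psi](ip_test hL tp) (ip_test fL tpp).
(* [sym 0 1] is [1 + |x|] and [sym 1 0] is [1 + x^2]; subtracting [k1] isolates the weights [|x|]
   and [x^2]. *)
have i1 := intg_sym_hart 0 0 UL tp; have i2 := intg_sym_hart 0 1 UL tp.
have i3 := intg_sym_hart 1 0 UL tp.
have k1 : intg mu (fun x => U phi x * hart psi x) := L2M UL (hart_test_L2 tp).
have k2 : intg mu (fun x => `|x| * (U phi x * hart psi x)).
  have := intgB i2 k1; congr intg; apply/funext => x; rewrite /sym; ring.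
have k3 : intg mu (fun x => x ^+ 2 * (U phi x * hart psi x)).
  have := intgB i3 k1; congr intg; apply/funext => x; rewrite /sym; ring.
have -> : \int[mu]_x (U (hilbert (weak_derivative phi)) x * hart psi x) =
    - \int[mu]_x (`|x| * (U phi x * hart psi x)).
  rewrite -RintN//; apply: Rint_ae.
  - apply: measurable_funM; apply: L2_mble; [exact: U_L2|exact: hart_test_L2].
  - exact: (intg_mble (intgN k2)).
  - by apply: (aeS hE) => x ->; ring.
have -> : \int[mu]_x (U phi x * hart (derive1n 2 psi) x) =
    - \int[mu]_x (x ^+ 2 * (U phi x * hart psi x)).
  rewrite -RintN//; apply: eq_Rint => x; rewrite (hart_deriv2 _ tp); ring.
rewrite !mulrN !opprK -(RintZ be k2) -(RintZ al k3).
rewrite -(RintD k1 (intgZ be k2)) -(RintD (intgD k1 (intgZ be k2)) (intgZ al k3)).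
by apply: eq_Rint => x; rewrite /sym; ring.
Qed.

(** Each side of the weak form pairs a function with the transforms of test functions. The symbol
    times [U phi] is known to be in L^2 only after division by [1 + x^2], which is the weight that
    [dual_test] accepts. *)
Lemma solutionP al be phi : H1 phi ->
  H1_solution al be phi <->
  {ae mu, forall x, sym al be x * U phi x = 2^-1 * U (fun y => phi y ^+ 2) x}.
Proof.
move=> Hphi; have [fL xL] := (H1P phi).1 Hphi; have UL := U_L2 fL.
have sL := sqr_L2 fL (H1_UL1 Hphi).
have rhs psi : test_function psi -> \int[mu]_x (2^-1 * phi x ^+ 2 * psi x) =
    \int[mu]_x (2^-1 * U (fun y => phi y ^+ 2) x * hart psi x).
  move=> tp; transitivity (2^-1 * \int[mu]_x (phi x ^+ 2 * psi x)).
    by rewrite -RintZ; [apply: eq_Rint => x; ring|exact: L2M sL (test_L2 tp)].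
  rewrite (ip_test sL tp) -RintZ; [by apply: eq_Rint => x; ring|].
  exact: L2M (U_L2 sL) (hart_test_L2 tp).
split=> [[_ sol]|H].
  have : {ae mu, forall x, sym al be x * U phi x - 2^-1 * U (fun y => phi y ^+ 2) x = 0}.
    apply: dual_test.
      have -> : (fun x => (sym al be x * U phi x - 2^-1 * U (fun y => phi y ^+ 2) x) / (1 + x ^+ 2)) =
        (fun x => sym al be x * U phi x / (1 + x ^+ 2) - 2^-1 * (U (fun y => phi y ^+ 2) x * (1 + x ^+ 2)^-1)).
        by apply/funext => x; ring.
      apply: L2B; first exact: sym_den_L2.
      exact/L2Z/(L2_boundedM (U_L2 sL) mden den_bound).
    move=> psi tp; have := sol psi tp; rewrite (weak_form al be Hphi tp) (rhs psi tp) => e.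
    have i1 := intg_sym_hart al be UL tp.
    have i2 : intg mu (fun x => 2^-1 * U (fun y => phi y ^+ 2) x * hart psi x).
      have := intgZ 2^-1 (L2M (U_L2 sL) (hart_test_L2 tp)).
      by under eq_fun do rewrite mulrA.
    rewrite -[RHS](subrr (\int[mu]_x (2^-1 * U (fun y => phi y ^+ 2) x * hart psi x))) -{1}e.
    by rewrite -RintB//; apply: eq_Rint => x; ring.
  by move=> H; apply: (aeS H) => x /eqP; rewrite subr_eq0 => /eqP.
split=> // psi tp; rewrite (weak_form al be Hphi tp) (rhs psi tp); apply: Rint_ae.
- exact: (intg_mble (intg_sym_hart al be UL tp)).
- apply: measurable_funM; last exact: (L2_mble (hart_test_L2 tp)).
  exact: (L2_mble (L2Z 2^-1 (U_L2 sL))).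
- by apply: (aeS H) => x ->.
Qed.

End Sobolev.

(** * Convolution and regularity *)

Section Convolution.
Context {R : realType}.
Local Notation mu := (@lebesgue_measure R).
Implicit Types (f g h p phi psi : R -> R) (x y xi : R).

Definition convol f g xi : R := \int[mu]_y (f y * g (xi - y)).

Lemma L2_flip g xi : L2 g -> L2 (fun y => g (xi - y)).
Proof.
move=> /L2P[mg gi]; apply/L2P; split.
  by apply: (measurableT_comp mg); mble.
have := intg_opp (intg_shift xi gi).
by congr intg; apply/funext => y /=; rewrite addrC.
Qed.

Lemma ip_flip g xi : L2 g -> ip (fun y => g (xi - y)) (fun y => g (xi - y)) = ip g g.
Proof.
move=> gL; have gi := L2M gL gL; rewrite /ip.
rewrite -(Rint_shift xi gi) -(Rint_opp (intg_shift xi gi)).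
by apply: eq_Rint => y /=; rewrite addrC.
Qed.

Lemma conv_intg_pt f g xi : L2 f -> L2 g -> intg mu (fun y => f y * g (xi - y)).
Proof. by move=> fL gL; exact: L2M fL (L2_flip xi gL). Qed.

Lemma conv_bound f g xi : L2 f -> L2 g -> `|convol f g xi| <= nrm f * nrm g.
Proof.
move=> fL gL; have := CS_nrm fL (L2_flip xi gL).
by rewrite [X in _ <= _ * X](_ : _ = nrm g)// /nrm ip_flip.
Qed.

Lemma Rint_odd_ae g : intg mu g -> {ae mu, forall x, g (- x) = - g x} -> \int[mu]_x g x = 0.
Proof.
move=> gi go; have := Rint_opp gi.
have -> : \int[mu]_x g (- x) = - \int[mu]_x g x.
  rewrite -(RintN gi); apply: Rint_ae => //.
  - exact: (intg_mble (intg_opp gi)).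
  - exact: (intg_mble (intgN gi)).
by move/eqP; rewrite eq_sym -addr_eq0 -mulr2n mulrn_eq0 => /eqP.
Qed.

Section FubiniConv.
Context (f g : R -> R) (fL : L2 f) (gL : L2 g) (fi : intg mu f) (gi : intg mu g).

(** Applied with [k = 1] for the integrability of the convolution and with the Hartley kernel for
    its transform. *)
Lemma conv_fubini (k : R -> R) : measurable_fun setT k -> (forall x, `|k x| <= 1) ->
  intg mu (fun xi => convol f g xi * k xi) /\
  \int[mu]_xi (convol f g xi * k xi) = \int[mu]_y (f y * \int[mu]_xi (g xi * k (xi + y))).
Proof.
move=> mk k1; pose F (z : R * R) := f z.1 * g (z.2 - z.1) * k z.2.
have mF : measurable_fun setT F.
  apply: measurable_funM; last by apply: (measurableT_comp mk); mble.
  apply: measurable_funM; first by apply: (measurableT_comp (L2_mble fL)); mble.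
  by apply: (measurableT_comp (L2_mble gL)); mble.
have i1 y : intg mu (fun xi => F (y, xi)).
  rewrite /F /=; apply: (intg_boundedM (C := 1)) => //.
  exact: intgZ (intg_shift (- y) gi).
have i2 xi : intg mu (fun y => F (y, xi)).
  rewrite /F /=; under eq_fun do rewrite mulrC.
  exact: intgZ (conv_intg_pt xi fL gL).
have i3 : intg mu (fun y => \int[mu]_xi `|F (y, xi)|).
  apply: (intg_domC (C := \int[mu]_x `|g x|) _ fi) => [|y].
    have -> : (fun x => \int[mu]_y `|F (x, y)|)%R = fine \o fubini_F mu (fun z => `|F z|%:E) by [].
    apply: measurableT_comp => //.
    apply: measurable_fun_fubini_tonelli_F => //.
    by apply: measurableT_comp => //; exact: measurableT_comp.
  rewrite ger0_norm ?Rint_ge0// -(Rint_shift (- y) (intg_abs gi)) mulrC.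
  have gi' : intg mu (fun xi => `|g (xi - y)|) := intg_shift (- y) (intg_abs gi).
  rewrite -(RintZ _ gi'); apply: le_Rint => [||xi]; [exact: intg_abs|exact: intgZ|].
  by rewrite /F /= -normrM [leLHS]normrM ler_piMr.
have [_ j2 j3] := fubini_line mF i1 i2 i3.
have e xi : \int[mu]_y F (y, xi) = convol f g xi * k xi.
  rewrite /convol mulrC -(RintZ _ (conv_intg_pt xi fL gL)).
  by apply: eq_Rint => y; rewrite /F /=; ring.
split; first by move: j2; under eq_fun do rewrite e.
transitivity (\int[mu]_xi \int[mu]_y F (y, xi)); first by apply: eq_Rint => xi; rewrite e.
rewrite -j3; apply: eq_Rint => y.
have gk : intg mu (fun xi => g xi * k (xi + y)).
  apply: (intg_boundedM (C := 1)) => //.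
  by apply: (measurableT_comp mk); mble.
rewrite -(RintZ _ gk) -(Rint_shift (- y) (intgZ (f y) gk)).
by apply: eq_Rint => xi; rewrite /F /= subrK; ring.
Qed.

Lemma conv_intg : intg mu (convol f g).
Proof.
have [] := conv_fubini (k := fun=> 1).
- exact: measurable_cst.
- by move=> x; rewrite normr1.
by move=> + _; under eq_fun do rewrite mulr1.
Qed.

Lemma conv_L2 : L2 (convol f g).
Proof.
apply/L2P; split; first exact: (intg_mble conv_intg).
under eq_fun do rewrite expr2.
apply: (intg_boundedM conv_intg); first exact: (intg_mble conv_intg).
by move=> x; exact: conv_bound.
Qed.

(** The addition formulas give [K (xi + y) x = cos (x y) K xi x + sin (x y) K xi (- x)]. The parity
    of [f] then decides which of the two terms remains. *)
Lemma hart_conv_split x : hart (convol f g) x =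
  \int[mu]_y (f y * cos (x * y)) * hart g x + \int[mu]_y (f y * sin (x * y)) * hart g (- x).
Proof.
have ci : intg mu (fun y => f y * cos (x * y)).
  by apply: (intg_boundedM (C := 1) fi); [exact: mcosM|move=> z; exact: cos_max].
have si : intg mu (fun y => f y * sin (x * y)).
  by apply: (intg_boundedM (C := 1) fi); [exact: msinM|move=> z; exact: sin_max].
have [_] := conv_fubini (mK' x) (fun y => K_bound y x).
rewrite -[LHS]/(hart _ x) => ->.
transitivity (\int[mu]_y (hart g x * (f y * cos (x * y)) + hart g (- x) * (f y * sin (x * y)))).
  apply: eq_Rint => y.
  have -> : \int[mu]_xi (g xi * K (xi + y) x) = cos (x * y) * hart g x + sin (x * y) * hart g (- x).
    rewrite -(RintZ _ (intgK x gi)) -(RintZ _ (intgK (- x) gi)).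
    rewrite -(RintD (intgZ _ (intgK x gi)) (intgZ _ (intgK (- x) gi))).
    by apply: eq_Rint => xi; rewrite /K mulrDl cosD sinD mulrN cosN sinN [x * y]mulrC; ring.
  ring.
by rewrite (RintD (intgZ _ ci) (intgZ _ si)) (RintZ _ ci) (RintZ _ si) ![hart g _ * _]mulrC.
Qed.

Lemma hart_cos_sin x : hart f x =
  c0 * (\int[mu]_y (f y * cos (x * y)) + \int[mu]_y (f y * sin (x * y))).
Proof.
have ci : intg mu (fun y => f y * cos (x * y)).
  by apply: (intg_boundedM (C := 1) fi); [exact: mcosM|move=> z; exact: cos_max].
have si : intg mu (fun y => f y * sin (x * y)).
  by apply: (intg_boundedM (C := 1) fi); [exact: msinM|move=> z; exact: sin_max].
rewrite -(RintD ci si) -(RintZ _ (intgD ci si)).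
by apply: eq_Rint => y; rewrite /K [y * x]mulrC; ring.
Qed.

Lemma hart_conv x : {ae mu, forall y, f (- y) = f y} ->
  hart (convol f g) x = c0^-1 * (hart f x * hart g x).
Proof.
move=> fe.
have si : intg mu (fun y => f y * sin (x * y)).
  by apply: (intg_boundedM (C := 1) fi); [exact: msinM|move=> z; exact: sin_max].
have s0 : \int[mu]_y (f y * sin (x * y)) = 0.
  apply: (Rint_odd_ae si); apply: (aeS fe) => y ->; by rewrite mulrN sinN mulrN.
by rewrite hart_conv_split hart_cos_sin s0; field; exact: c0_neq0.
Qed.

Lemma hart_conv_odd x : {ae mu, forall y, f (- y) = - f y} ->
  hart (convol f g) x = c0^-1 * (hart f x * hart g (- x)).
Proof.
move=> fe.
have ci : intg mu (fun y => f y * cos (x * y)).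
  by apply: (intg_boundedM (C := 1) fi); [exact: mcosM|move=> z; exact: cos_max].
have s0 : \int[mu]_y (f y * cos (x * y)) = 0.
  apply: (Rint_odd_ae ci); apply: (aeS fe) => y ->; by rewrite mulrN cosN mulNr.
by rewrite hart_conv_split hart_cos_sin s0; field; exact: c0_neq0.
Qed.

End FubiniConv.

Lemma even_U f : L2 f -> {ae mu, forall x, f (- x) = f x} -> {ae mu, forall x, U f (- x) = U f x}.
Proof.
move=> fL fe; apply: (ae_trans _ (U_ae (L2_opp fL) fL fe)).
exact: ae_sym (U_opp fL).
Qed.

Lemma even_rep f : intg mu (U f) -> {ae mu, forall x, U f (- x) = U f x} ->
  forall x, rep f (- x) = rep f x.
Proof.
move=> fi fe x; rewrite /rep -(hart_opp x fi); apply: Rint_ae.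
- exact: (intg_mble (intgK x (intg_opp fi))).
- exact: (intg_mble (intgK x fi)).
- by apply: (aeS fe) => y ->.
Qed.

End Convolution.

(** * Classical derivatives from the transform, and Gronwall's lemma *)

Section FundamentalTheorem.
Context {R : realType}.
Local Notation mu := (@lebesgue_measure R).
Implicit Types (f g h p r u v : R -> R) (x y xi a b : R).

(* If [p = U f] then [dual_deriv p = U f']. *)
Definition dual_deriv p xi : R := - xi * p (- xi).

Lemma hart_indE a b xi : a < b -> xi != 0 ->
  hart (ind a b) xi = - xi^-1 * (K b (- xi) - K a (- xi)).
Proof.
move=> ab xi0; rewrite /hart /ind.
have dF x : is_derive x 1 (fun x => - xi^-1 * K x (- xi)) (K x xi).
  have := drvZ (- xi^-1) (is_derive_K (- xi) x).
  by rewrite opprK mulrA mulrNN mulVf// mul1r.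
have cK : continuous (fun x => K x xi) by move=> x; exact: drv_cont (is_derive_K xi x).
by rewrite (ftc_segment (ltW ab) cK dF) -mulrBr.
Qed.

(** Symmetry moves [U] onto the indicator, whose transform is a difference of kernels divided by
    [xi]; the division cancels the factor in [dual_deriv]. *)
Lemma hart_ftc p a b : intg mu p -> L2 p -> L2 (dual_deriv p) -> a < b ->
  \int[mu]_x (\1_`[a, b] x * U (dual_deriv p) x) = hart p b - hart p a.
Proof.
move=> pi pL rL ab; have iL := L2_ind a b; have ii := intg_ind a b.
rewrite -[LHS]/(ip (ind a b) (U (dual_deriv p))) -(U_sym iL rL).
rewrite (ip_ae (U_L2 iL) (bessel ii iL).1 rL rL (U_hart ii iL) (ae_refl _)).
have di : intg mu (fun x => p x * K x b - p x * K x a) by apply: intgB; exact: intgK.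
transitivity (\int[mu]_x (p (- x) * K (- x) b - p (- x) * K (- x) a)).
  apply: Rint_ae.
  - apply: measurable_funM; first exact: mhart.
    exact: (L2_mble rL).
  - exact: (intg_mble (intg_opp di)).
  - apply: (aeS (ae_neq 0)) => x x0; rewrite hart_indE// /dual_deriv ![K (- x) _]K_sym.
    by field.
by rewrite (Rint_opp di) RintB; [|exact: intgK..].
Qed.

Lemma ftc_derive f g : continuous g ->
  (forall a b, a < b -> \int[mu]_x (\1_`[a, b] x * g x) = f b - f a) ->
  forall x, is_derive x 1 f (g x).
Proof.
move=> cg fg x; pose a := x - 1.
have ax : a < x by rewrite /a ltrBlDr ltrDl.
have ig : mu.-integrable `[a, x + 1] (EFin \o g).
  apply: continuous_compact_integrable; first exact: segment_compact.
  exact: continuous_subspaceT.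
have xx : x < x + 1 by rewrite ltrDl.
have H : is_derive x 1 (fun y => f a + \int[mu]_(t in `[a, y]) g t) (g x).
  have [d1 d2] := @continuous_FTC1_closed R g a x (x + 1) xx ig ax (cg x).
  have := drvD (drv_cst (f a) x) (is_derive1P d1).
  by rewrite add0r d2.
apply: near_eq_is_derive H; near=> y.
have ay : a < y by near: y; exact: lt_nbhsr.
by rewrite RintI fg// addrC subrK.
Unshelve. all: by end_near. Qed.

(** [dual_deriv p] is only required to be in L^2. This serves when the continuity of the derivative
    is known from an equation instead of from integrability. *)
Lemma hart_C1 p g : intg mu p -> L2 p -> L2 (dual_deriv p) -> continuous g ->
  {ae mu, forall x, U (dual_deriv p) x = g x} -> forall x, is_derive x 1 (hart p) (g x).
Proof.
move=> pi pL rL cg rg; apply: ftc_derive => // a b ab; rewrite -(hart_ftc pi pL rL ab).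
apply: Rint_ae.
- by apply: measurable_funM; [exact: measurable_indic|exact: continuous_measurable_fun].
- by apply: measurable_funM; [exact: measurable_indic|exact: (L2_mble (U_L2 rL))].
- by apply: (aeS rg) => x ->.
Qed.

Lemma hart_C1_hart p : intg mu p -> L2 p -> intg mu (dual_deriv p) -> L2 (dual_deriv p) ->
  forall x, is_derive x 1 (hart p) (hart (dual_deriv p) x).
Proof. by move=> pi pL ri rL; apply: hart_C1 => //; [exact: hart_cont|exact: U_hart]. Qed.

Lemma C1_weak_derivative f g : L2 f -> L2 g -> continuous g ->
  (forall x, is_derive x 1 f (g x)) -> {ae mu, forall x, U g x = - x * U f (- x)}.
Proof.
move=> fL gL cg dfg; apply/(weak_derivP fL gL) => psi tp.
under eq_Rint do rewrite mulrC; rewrite (test_ibp tp dfg cg).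
by congr (- _); apply: eq_Rint => x; rewrite mulrC.
Qed.

Lemma cont_ae_eq f g : continuous f -> continuous g -> {ae mu, forall x, f x = g x} ->
  forall x, f x = g x.
Proof.
move=> cf cg fg x; apply/eqP; rewrite -subr_eq0; apply/eqP; move: x.
apply: cont_ae_eq0; first by move=> x; apply: cvgB; [exact: cf|exact: cg].
by apply: (aeS fg) => x ->; rewrite subrr.
Qed.

(** [y t * exp (- M t)] is nonincreasing for [t >= 0] and starts at 0; negative arguments are
    handled by reflection. *)
Lemma gronwall (y y' : R -> R) (M : R) : (forall x, is_derive x 1 y (y' x)) -> (forall x, 0 <= y x) ->
  (forall x, `|y' x| <= M * y x) -> y 0 = 0 -> forall x, y x = 0.
Proof.
move=> dy y0 yM y00.
have key (z z' : R -> R) : (forall x, is_derive x 1 z (z' x)) -> (forall x, 0 <= z x) ->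
    (forall x, `|z' x| <= M * z x) -> z 0 = 0 -> forall x, 0 <= x -> z x = 0.
  move=> dz z0 zM z00 x; rewrite le_eqVlt => /predU1P[<-//|x0].
  pose w t := z t * expR (- M * t).
  have dw (t : R) : is_derive t 1 w ((z' t - M * z t) * expR (- M * t)).
    by apply: drv_eq; split; [exact: (drvM (dz t) (drv_expR (drvZ (- M) (drv_id t))))|rewrite /w /GRing.scale /=; ring].
  have le : w x <= w 0.
    have dr : forall t : R, t \in `]0, x[ -> derivable w t 1 by move=> t _; case: (dw t).
    have d0 : forall t : R, t \in `]0, x[ -> derive1 w t <= 0.
      move=> t _; rewrite (is_derive1E (dw t)) pmulr_lle0 ?expR_gt0// subr_le0.
      exact: le_trans (ler_norm _) (zM t).
    have cw : {within `[0, x], continuous w}.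
      by apply: continuous_subspaceT => t; exact: drv_cont (dw t).
    by apply: (ler0_derive1_le_cc dr d0 cw); rewrite ?in_itv/= ?lexx ?ltW.
  apply/le_anti; rewrite z0 andbT.
  by move: le; rewrite /w z00 mul0r pmulr_lle0 ?expR_gt0.
move=> x; have [x0|x0] := leP 0 x; first exact: (key y y').
have := @key (fun t => y (- t)) (fun t => - y' (- t)) _ _ _ _ (- x).
rewrite opprK; apply => //; last by rewrite oppr_ge0 ltW.
- by move=> t; apply: drv_eq; split; [exact: (drv_comp (dy (- t)) (drvN (drv_id t)))|rewrite /GRing.scale /=; ring].
- by move=> t; rewrite normrN.
- by rewrite oppr0.
Qed.

End FundamentalTheorem.

(** * The KdV soliton *)

Section KdVSoliton.
Context {R : realType}.
Local Notation mu := (@lebesgue_measure R).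
Implicit Types (f g h p r u v : R -> R) (x y xi a b c t : R).

Lemma aeI (P Q : R -> Prop) : {ae mu, forall x, P x} -> {ae mu, forall x, Q x} ->
  {ae mu, forall x, P x /\ Q x}.
Proof. by move=> p q; apply: (aeS2 p q) => x. Qed.

Lemma cst_intg c : intg mu (fun=> c) -> c = 0.
Proof.
move=> ci; pose M : R := \int[mu]_x (fun=> `|c|) x.
have M0 : 0 <= M by apply: Rint_ge0.
have key n : `|c| * n%:R <= M.
  have dF : forall x, is_derive x 1 (fun x => `|c| * x) (`|c|).
    by move=> x; apply: drv_eq; split; [exact: (drvZ `|c| (drv_id x))|rewrite mulr1].
  have cc : continuous (fun _ : R => `|c|) by move=> x; exact: cvg_cst.
  have := ftc_segment (ler0n R n) cc dF; rewrite mulr0 subr0 => <-.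
  have ii : intg mu (fun x => \1_`[0, n%:R] x * `|c|).
    by apply: (intg_boundedM (C := `|c|) (intg_ind 0 n%:R)) => [|x]; [exact: measurable_cst|rewrite normr_id].
  apply: le_Rint => //; first exact: (intg_abs ci).
  by move=> x; rewrite ler_piMl// /indic; case: (_ \in _).
apply/eqP; rewrite -normr_le0 leNgt; apply/negP => c0.
have := key (Num.trunc (M / `|c|)).+1; rewrite leNgt mulrC -ltr_pdivrMr// => /negP; apply.
exact: truncnS_gt.
Qed.

Lemma kdv_ode_unique (u g v h : R -> R) (B : R) :
  (forall x, is_derive x 1 u (g x)) -> (forall x, is_derive x 1 g (u x - 2^-1 * u x ^+ 2)) ->
  (forall x, is_derive x 1 v (h x)) -> (forall x, is_derive x 1 h (v x - 2^-1 * v x ^+ 2)) ->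
  (forall x, `|u x| <= B) -> (forall x, `|v x| <= B) -> u 0 = v 0 -> g 0 = h 0 -> forall x, u x = v x.
Proof.
move=> du dg dv dh uB vB uv gh x.
pose y x := (u x - v x) ^+ 2 + (g x - h x) ^+ 2.
pose y' x := 2 * (u x - v x) * (g x - h x) * (2 - 2^-1 * (u x + v x)).
have dy t : is_derive t 1 y (y' t).
  have d1 := drvX 2 (drvD (du t) (drvN (dv t))); have d2 := drvX 2 (drvD (dg t) (drvN (dh t))).
  by apply: drv_eq; split; [exact: (drvD d1 d2)|rewrite /y' /=; field].
have : y x = 0.
  (* [y] is the squared distance in the phase plane. In [y'] the factor [2 (u - v) (g - h)] is at
     most [y] in absolute value, and [2 - (u + v) / 2] is at most [2 + B]. *)
  apply: (gronwall (M := 2 + B) dy) => [t|t|].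
  - by rewrite addr_ge0 ?sqr_ge0.
  - rewrite /y' normrM mulrC; apply: ler_pM => //.
      have := uB t; have := vB t; rewrite !ler_norml => /andP[? ?] /andP[? ?].
      by apply/andP; split; lra.
    have := sqr_ge0 (u t - v t - (g t - h t)); have := sqr_ge0 (u t - v t + (g t - h t)).
    by rewrite ler_norml /y => ? ?; apply/andP; split; nra.
  - by rewrite /y uv gh !subrr expr0n addr0.
move=> /eqP; rewrite paddr_eq0 ?sqr_ge0// => /andP[+ _].
by rewrite sqrf_eq0 subr_eq0 => /eqP.
Qed.

(* Q_KdV = 12 qden^2. *)
Definition qden x : R := (expR (x / 2) + expR (- (x / 2)))^-1.
Definition qnum x : R := expR (x / 2) - expR (- (x / 2)).
Definition dQ x : R := - 12 * qnum x * qden x ^+ 3.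

Lemma qden_pos x : 0 < expR (x / 2) + expR (- (x / 2)).
Proof. by rewrite addr_gt0 ?expR_gt0. Qed.

Lemma Q_KdVE x : Q_KdV x = 12 * qden x ^+ 2.
Proof. by rewrite /Q_KdV /sech /qden; field; rewrite gt_eqF ?qden_pos. Qed.

Lemma drv_half x : is_derive x 1 (fun x : R => x / 2) (2^-1).
Proof. by apply: drv_eq; split; [exact: (drvM (drv_id x) (drv_cst 2^-1 x))|rewrite mulr0 addr0 mul1r]. Qed.

Lemma drv_qden x : is_derive x 1 qden (- 2^-1 * qnum x * qden x ^+ 2).
Proof.
have h := drvD (drv_expR (drv_half x)) (drv_expR (drvN (drv_half x))).
have h0 : expR (x / 2) + expR (- (x / 2)) != 0 by rewrite gt_eqF ?qden_pos.
apply: drv_eq; split; first exact: (@drvV _ (fun x => expR (x / 2) + expR (- (x / 2))) _ _ h0 h).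
by rewrite /qden /qnum; field.
Qed.

Lemma drv_qnum x : is_derive x 1 qnum (2^-1 * (qden x)^-1).
Proof.
apply: drv_eq; split; first exact: (drvD (drv_expR (drv_half x)) (drvN (drv_expR (drvN (drv_half x))))).
by rewrite /qden invrK; field.
Qed.

(** The relation [tanh^2 = 1 - sech^2] at [x / 2]; it eliminates [qnum] from the second derivative
    of the profile. *)
Lemma qnum_qden x : qnum x ^+ 2 * qden x ^+ 2 = 1 - 4 * qden x ^+ 2.
Proof.
rewrite /qnum /qden expRN; have := expR_gt0 (x / 2); move: (expR _) => e e0.
have ? : e != 0 by rewrite gt_eqF.
have ? : e * e + 1 != 0 by rewrite gt_eqF// addr_gt0// mulr_gt0.
by field; apply/andP; split.
Qed.

Lemma drv_Q x : is_derive x 1 Q_KdV (dQ x).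
Proof.
have -> : Q_KdV = (fun x => 12 * qden x ^+ 2) by apply/funext => y; exact: Q_KdVE.
apply: drv_eq; split; first exact: (drvZ 12 (drvX 2 (drv_qden x))).
by rewrite /dQ /=; field.
Qed.

Lemma qden_neq0 x : qden x != 0.
Proof. by rewrite invr_eq0 gt_eqF ?qden_pos. Qed.

Lemma drv_dQ x : is_derive x 1 dQ (Q_KdV x - 2^-1 * Q_KdV x ^+ 2).
Proof.
apply: drv_eq; split; first exact: (drvM (drvZ (- 12) (drv_qnum x)) (drvX 3 (drv_qden x))).
rewrite Q_KdVE; have := qnum_qden x; have := qden_neq0 x; move: (qnum x) (qden x) => n d d0 nd.
have -> : - 12 * (2^-1 * d^-1) * d ^+ 3 + - 12 * n * (3 * d ^+ 3.-1 * (- 2^-1 * n * d ^+ 2)) =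
  - 6 * d ^+ 2 + 18 * d ^+ 2 * (n ^+ 2 * d ^+ 2) by rewrite /=; field.
by rewrite nd; field.
Qed.

Lemma qden_le x : qden x ^+ 2 <= 4 * (1 + x ^+ 2)^-1.
Proof.
rewrite /qden exprVn ler_pdivlMr ?den_gt0// mulrC ler_pdivrMr ?exprn_gt0 ?qden_pos//.
have e1 := expR_ge1Dx (x / 2); have e2 := expR_ge1Dx (- (x / 2)).
have p1 := expR_gt0 (x / 2); have p2 := expR_gt0 (- (x / 2)).
have : expR (x / 2) * expR (- (x / 2)) = 1 by rewrite -expRD subrr expR0.
move: (expR _) (expR (- _)) e1 e2 p1 p2 => a b e1 e2 p1 p2 ab.
have -> : 4 * (a + b) ^+ 2 = 4 * a ^+ 2 + 8 * (a * b) + 4 * b ^+ 2 by ring.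
have sq (s t : R) : 1 + s <= t -> 0 <= s -> 1 + s ^+ 2 <= t ^+ 2 by nra.
have := sqr_ge0 a; have := sqr_ge0 b; rewrite ab.
have [x0|x0] := leP 0 x; [have := sq _ _ e1|have := sq _ _ e2]; rewrite ?sqrrN expr_div_n; lra.
Qed.

Lemma qden_le1 x : qden x <= 2^-1.
Proof.
rewrite /qden lef_pV2 ?posrE ?qden_pos//.
have p1 := expR_gt0 (x / 2); have p2 := expR_gt0 (- (x / 2)).
have : expR (x / 2) * expR (- (x / 2)) = 1 by rewrite -expRD subrr expR0.
move: (expR _) (expR (- _)) p1 p2 => a b p1 p2 ab.
have := sqr_ge0 (a - b); nra.
Qed.

Lemma qden_gt0 x : 0 < qden x.
Proof. by rewrite invr_gt0 qden_pos. Qed.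

Lemma Q_KdV_ge0 x : 0 <= Q_KdV x.
Proof. by rewrite Q_KdVE mulr_ge0// sqr_ge0. Qed.

Lemma Q_KdV_le x : Q_KdV x <= 3.
Proof. by rewrite Q_KdVE; have := qden_le1 x; have := qden_gt0 x; nra. Qed.

Lemma Q_KdV_cont : continuous (@Q_KdV R).
Proof. by move=> x; exact: drv_cont (drv_Q x). Qed.

Lemma dQ_cont : continuous dQ.
Proof. by move=> x; exact: drv_cont (drv_dQ x). Qed.

Lemma Q_KdV_L2 : L2 (@Q_KdV R).
Proof.
apply/L2P; split; first exact: continuous_measurable_fun Q_KdV_cont.
apply: (intg_domC (C := 144) _ intg_den) => [|x].
  by apply: measurable_funX; exact: continuous_measurable_fun Q_KdV_cont.
rewrite !ger0_norm ?sqr_ge0 ?invr_ge0 ?(ltW (den_gt0 x))//.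
have := Q_KdV_le x; have := Q_KdV_ge0 x; have := qden_le x; rewrite !Q_KdVE.
move: (_^-1) (_ ^+ 2) => d w le1 le2 le3.
have -> : 144 * d = 3 * (12 * (4 * d)) by ring.
rewrite expr2; apply: ler_pM => //; by rewrite ler_pM2l.
Qed.

Lemma dQ_L2 : L2 dQ.
Proof.
apply: (L2_dom (C := 1) _ Q_KdV_L2) => [|x]; first exact: continuous_measurable_fun dQ_cont.
rewrite mul1r -ler_sqr ?nnegrE// !real_normK ?num_real// /dQ Q_KdVE.
have := qnum_qden x; have := qden_gt0 x; move: (qnum x) (qden x) => n d d0 nd.
have -> : (- 12 * n * d ^+ 3) ^+ 2 = 144 * d ^+ 4 * (n ^+ 2 * d ^+ 2) by ring.
rewrite nd -subr_ge0; have d6 : 0 <= d ^+ 6 by apply: exprn_ge0; exact: ltW.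
have -> : (12 * d ^+ 2) ^+ 2 - 144 * d ^+ 4 * (1 - 4 * d ^+ 2) = 576 * d ^+ 6 by ring.
by rewrite pmulr_rge0 ?ltr0n.
Qed.

Lemma Q_KdV_sqr_L2 : L2 (fun x : R => Q_KdV x ^+ 2).
Proof.
apply: (L2_dom (C := 3) _ Q_KdV_L2) => [|x].
  by apply: measurable_funX; exact: continuous_measurable_fun Q_KdV_cont.
by rewrite !ger0_norm ?sqr_ge0 ?Q_KdV_ge0// expr2 ler_wpM2r ?Q_KdV_ge0 ?Q_KdV_le.
Qed.

Lemma Q_KdV_even x : Q_KdV (- x) = Q_KdV x.
Proof. by rewrite /Q_KdV /sech mulNr opprK addrC. Qed.

Lemma Q_KdV0 : Q_KdV (0 : R) = 3.
Proof. by rewrite /Q_KdV /sech mul0r oppr0 expR0; field. Qed.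

Lemma Q_KdV_soliton : even_soliton_profile 1 0 (@Q_KdV R).
Proof.
have qL := Q_KdV_L2; have dL := dQ_L2; have sL := Q_KdV_sqr_L2; have UqL := U_L2 qL.
have hL : L2 (fun x : R => 2^-1 * Q_KdV x ^+ 2) by exact: L2Z.
have w1 := C1_weak_derivative qL dL dQ_cont drv_Q.
have c2 : continuous (fun x : R => Q_KdV x - 2^-1 * Q_KdV x ^+ 2).
  move=> x; apply: cvgB; first exact: Q_KdV_cont.
  by apply: cvgM; [exact: cvg_cst|apply: cvgM; exact: Q_KdV_cont].
have w2 := C1_weak_derivative dL (L2B qL hL) c2 drv_dQ.
have xL : L2 (fun x : R => x * U Q_KdV x).
  apply: (L2_ae _ (L2_opp (U_L2 dL))); first by apply: measurable_funM => //; exact: (L2_mble UqL).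
  by apply: (aeS (ae_opp w1)) => x ->; rewrite !opprK.
have HQ : H1 (@Q_KdV R) by apply/H1P.
split; [by split=> //; apply: aeW => x; exact: Q_KdV_even| |].
  apply/(solutionP _ _ HQ); have uB := U_B qL hL; have uZ := U_Z 2^-1 sL.
  apply: (aeS2 (aeI (ae_opp w1) w2) (aeI uB uZ)).
  move=> x; rewrite !opprK => -[-> e2] [e3 e4]; rewrite /sym mul0r addr0 mul1r.
  by rewrite -e4; move: e2; rewrite e3; lra.
move=> q0; have := cont_ae_eq0 Q_KdV_cont q0 0.
by rewrite Q_KdV0 => /eqP; rewrite pnatr_eq0.
Qed.

(** A bootstrap: the equation puts [(1 + x^2) U phi] in L^2. This makes [x U phi] integrable and
    gives a continuous first derivative; the second derivative inherits continuity from the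
    right-hand side. *)
Lemma kdv_profile_C2 (phi : R -> R) : even_soliton_profile 1 0 phi -> exists g : R -> R,
  [/\ L2 g, forall x, is_derive x 1 (rep phi) (g x) &
      forall x, is_derive x 1 g (rep phi x - 2^-1 * rep phi x ^+ 2)].
Proof.
move=> [[Hphi _] Sphi _]; have [fL xL] := (H1P phi).1 Hphi; have pL := U_L2 fL.
have pi := H1_UL1 Hphi; have E := (solutionP _ _ Hphi).1 Sphi; have sL := sqr_L2 fL pi.
have qL := U_L2 sL; have mp := L2_mble pL.
have rL : L2 (dual_deriv (U phi)).
  by have := L2_opp xL.
have xdL : L2 (fun x : R => x / (1 + x ^+ 2)).
  apply/L2P; split; first by apply: measurable_funM => //; exact: mden.
  apply: (intg_domC (C := 1) _ intg_den) => [|x].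
    by apply: measurable_funX; apply: measurable_funM => //; exact: mden.
  rewrite mul1r [`|_^-1|]ger0_norm ?invr_ge0 ?(ltW (den_gt0 x))// ger0_norm ?sqr_ge0//.
  rewrite exprMn [_^-1 ^+ 2]expr2 mulrA ler_piMl ?invr_ge0 ?(ltW (den_gt0 x))//.
  by have := x2den_bound x; rewrite ler_norml => /andP[].
(* [x U phi] is the product of [x / (1 + x^2)] and half of [U (phi^2)], both in L^2. *)
have xi : intg mu (fun x => x * U phi x).
  apply: (intg_ae _ (intgZ 2^-1 (L2M xdL qL))); first exact: (L2_mble xL).
  apply: (aeS E) => x; rewrite /sym mul0r addr0 mul1r => e.
  have -> : 2^-1 * (x / (1 + x ^+ 2) * U (fun y => phi y ^+ 2) x) =
    x / (1 + x ^+ 2) * (2^-1 * U (fun y => phi y ^+ 2) x) by ring.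
  by rewrite -e; field; exact: den_neq0.
have ri : intg mu (dual_deriv (U phi)) by have := intg_opp xi.
pose s x := U phi x - 2^-1 * U (fun y => phi y ^+ 2) x.
have sE : {ae mu, forall x, dual_deriv (dual_deriv (U phi)) x = s x}.
  apply: (aeS E) => x; rewrite /dual_deriv /sym /s opprK => <-; ring.
have hL := L2Z 2^-1 qL; have sL2 : L2 s by exact: L2B.
have ms : measurable_fun setT (dual_deriv (dual_deriv (U phi))).
  by apply: measurable_funM; [exact: measurable_funN|exact: (L2_mble (L2_opp rL))].
have ddL := L2_ae ms sL2 sE.
exists (hart (dual_deriv (U phi))); split; first exact: (bessel ri rL).1.
  exact: hart_C1_hart.
have cu : continuous (rep phi) by exact: hart_cont.
apply: hart_C1 => // [x|].
  apply: cvgB; [exact: cu|apply: cvgM; [exact: cvg_cst|apply: cvgM; exact: cu]].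
apply: (ae_trans (U_ae ddL sL2 sE)); apply: (ae_trans (U_B pL hL)).
have i1 := U_invol fL; have i2 := U_invol sL; have z := U_Z 2^-1 qL.
apply: (aeS2 (aeI i1 i2) (aeI z (rep_ae fL pi))).
by move=> x [-> e2] [-> ->]; rewrite e2.
Qed.

Lemma kdv_unique (phi : R -> R) : even_soliton_profile 1 0 phi -> {ae mu, forall x, phi x = Q_KdV x}.
Proof.
move=> P; have [g [gL du dg]] := kdv_profile_C2 P.
have [[Hphi ev] _ nz] := P; have [fL xL] := (H1P phi).1 Hphi; have pi := H1_UL1 Hphi.
have re := rep_ae fL pi; have pL := U_L2 fL; have ri : intg mu (U phi) := pi.
have uE := even_rep pi (even_U fL ev); have cu : continuous (rep phi) by exact: hart_cont.
have uL : L2 (rep phi) by exact: (bessel pi pL).1.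
have [B uB] : exists B, forall x, `|rep phi x| <= B by eexists => x; exact: hart_le pi.
set u := rep phi in du dg uE cu uL uB re *.
have g0 : g 0 = 0.
  have d1 : is_derive (- 0 : R) 1 u (g 0) by rewrite oppr0.
  have := drv_comp d1 (drvN (drv_id (0 : R))).
  have -> : (fun y => u (- y)) = u by apply/funext.
  by move=> d2; have := is_derive1E d2; rewrite (is_derive1E (du 0)); lra.
pose H x := g x ^+ 2 - u x ^+ 2 + 3^-1 * u x ^+ 3.
have dH x : is_derive x 1 H 0.
  apply: drv_eq; split.
    exact: (drvD (drvD (drvX 2 (dg x)) (drvN (drvX 2 (du x)))) (drvZ 3^-1 (drvX 3 (du x)))).
  by rewrite /=; field.
have Hc x : H x = H 0 by exact: is_derive_0_is_cst.
have H0 : H 0 = 0.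
  apply: cst_intg; have -> : (fun=> H 0) = H by apply/funext => x; rewrite Hc.
  apply: intgD; first by apply: intgB; exact: L2_sqr.
  apply: intgZ; under eq_fun do rewrite exprSr.
  by apply: (intg_boundedM (C := B) (L2_sqr uL)) => //; exact: L2_mble.
have dQ0 : dQ 0 = 0 by rewrite /dQ /qnum mul0r oppr0 subrr mulr0 mul0r.
have Qb x : `|Q_KdV x| <= Num.max B 3.
  by rewrite ger0_norm ?Q_KdV_ge0// le_max Q_KdV_le orbT.
have uB' x : `|u x| <= Num.max B 3 by rewrite le_max uB.
have [u0|u0] : u 0 = 0 \/ u 0 = 3.
  have : u 0 ^+ 2 * (u 0 - 3) = 0 by move: H0; rewrite /H g0; lra.
  by move/eqP; rewrite mulf_eq0 sqrf_eq0 subr_eq0 => /orP[/eqP|/eqP]; [left|right].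
(* The initial data [(0, 0)] belong to the zero solution, excluded by nontriviality; in the other
   case they are those of [Q_KdV]. *)
- have z := kdv_ode_unique du dg (fun x => drv_cst 0 x) _ uB _ u0 g0.
  exfalso; apply: nz; apply: (aeS re) => x <-; apply: z => y; last first.
    by rewrite normr0 (le_trans _ (uB 0)).
  by apply: drv_eq; split; [exact: drv_cst|rewrite expr0n mulr0 subrr].
- have z : forall x, u x = Q_KdV x.
    by apply: (kdv_ode_unique du dg drv_Q drv_dQ uB' Qb); rewrite ?Q_KdV0 ?dQ0.
  by apply: (aeS re) => x; rewrite z => <-.
Qed.

Lemma Q_KdV_unique : unique_even_soliton_profile 1 0 (@Q_KdV R).
Proof. by split; [exact: Q_KdV_soliton|exact: kdv_unique]. Qed.

End KdVSoliton.

(** * The Benjamin-Ono soliton *)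

Section Resolvent.
Context {R : realType}.
Local Notation mu := (@lebesgue_measure R).
Implicit Types (f g h p r u v : R -> R) (x y xi a b c t : R).

Lemma den1_gt0 x : 0 < 1 + `|x|.
Proof. by rewrite ltr_pwDl. Qed.

Lemma den1_neq0 x : 1 + `|x| != 0.
Proof. by rewrite gt_eqF ?den1_gt0. Qed.

Lemma mden1 : measurable_fun setT (fun x : R => (1 + `|x|)^-1).
Proof.
apply: continuous_measurable_fun => x; apply: cvgV; first exact: den1_neq0.
by apply: cvgD; [exact: cvg_cst|exact: norm_continuous].
Qed.

Lemma den1_bound x : `|(1 + `|x|)^-1| <= 1.
Proof.
by rewrite gtr0_norm ?invr_gt0 ?den1_gt0// invf_le1 ?den1_gt0// lerDl.
Qed.

(* [inv_op f g] says [g = (1 + |D|)^-1 f]. *)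
Definition inv_op f g := {ae mu, forall x, (1 + `|x|) * U g x = U f x}.

Lemma inv_op_D f g f' g' : L2 f -> L2 g -> L2 f' -> L2 g' -> inv_op f g -> inv_op f' g' ->
  inv_op (fun x => f x + f' x) (fun x => g x + g' x).
Proof.
move=> fL gL f'L g'L H H'; apply: (aeS2 (aeI (U_D fL f'L) (U_D gL g'L)) (aeI H H')).
by move=> x [-> ->] [<- <-]; rewrite mulrDr.
Qed.

Lemma inv_op_Z c f g : L2 f -> L2 g -> inv_op f g -> inv_op (fun x => c * f x) (fun x => c * g x).
Proof.
move=> fL gL H; apply: (aeS2 (aeI (U_Z c fL) (U_Z c gL)) H).
by move=> x [-> ->] <-; rewrite mulrCA.
Qed.

Lemma inv_op_ae f g f' g' : L2 f -> L2 g -> L2 f' -> L2 g' -> {ae mu, forall x, f x = f' x} ->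
  {ae mu, forall x, g x = g' x} -> inv_op f g -> inv_op f' g'.
Proof.
move=> fL gL f'L g'L ff gg H; apply: (aeS2 (aeI (U_ae fL f'L ff) (U_ae gL g'L gg)) H).
by move=> x [-> ->] <-.
Qed.

Lemma inv_op_ex f : L2 f -> exists2 g, L2 g & inv_op f g.
Proof.
move=> fL; have UL := U_L2 fL.
have L : L2 (fun x => U f x * (1 + `|x|)^-1).
  by apply: (L2_boundedM (C := 1) UL) => [|x]; [exact: mden1|exact: den1_bound].
exists (U (fun x => U f x * (1 + `|x|)^-1)); first exact: U_L2.
by apply: (aeS (U_invol L)) => x ->; rewrite mulrCA divff ?mulr1 ?den1_neq0.
Qed.

Lemma inv_op_ip f g h : L2 f -> L2 g -> L2 h -> inv_op f g ->
  ip g h = \int[mu]_x (U f x * U h x * (1 + `|x|)^-1).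
Proof.
move=> fL gL hL H; have UfL := U_L2 fL; have UgL := U_L2 gL; have UhL := U_L2 hL.
rewrite -(U_iso gL hL); apply: Rint_ae.
- exact: (intg_mble (L2M UgL UhL)).
- by apply: measurable_funM; [exact: (intg_mble (L2M UfL UhL))|exact: mden1].
- by apply: (aeS H) => x <-; field; exact: den1_neq0.
Qed.

Lemma inv_op_sym f g f' g' : L2 f -> L2 g -> L2 f' -> L2 g' -> inv_op f g -> inv_op f' g' ->
  ip g f' = ip f g'.
Proof.
move=> fL gL f'L g'L H H'; rewrite (inv_op_ip fL gL f'L H) [RHS]ipC (inv_op_ip f'L g'L fL H').
by apply: eq_Rint => x; rewrite [U f x * _]mulrC.
Qed.

Lemma L2_pexp e : 0 < e -> L2 (@pexp R e).
Proof.
move=> e0; apply/L2P; split; first exact: mpexp.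
apply: (intg_domC (C := 1) _ (intg_pexp e0)) => [|x]; first by apply: measurable_funX; exact: mpexp.
rewrite mul1r !ger0_norm ?sqr_ge0 ?pexp_ge0// expr2 ler_piMl ?pexp_ge0//.
exact/pexp_le1/ltW.
Qed.

(** The integral is the pairing of [h] with the Poisson average of [f] at height [t]. The kernel is
    strictly positive, so the pairing is zero only in trivial cases. *)
Lemma heat_pos t f h : 0 < t -> L2 f -> L2 h -> (forall x, 0 <= f x) -> (forall x, 0 <= h x) ->
  0 <= \int[mu]_x (pexp t x * U f x * U h x) /\
  (\int[mu]_x (pexp t x * U f x * U h x) = 0 ->
    {ae mu, forall x, f x = 0} \/ {ae mu, forall x, h x = 0}).
Proof.
move=> t0 fL hL f0 h0; have eL := L2_pexp t0; have UfL := U_L2 fL.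
have pi : intg mu (fun x => pexp t x * U f x) by exact: L2M.
have pL : L2 (fun x => pexp t x * U f x).
  apply: (L2_dom1 _ UfL) => [|x]; first exact: (intg_mble pi).
  by rewrite normrM (ger0_norm (pexp_ge0 _ _)) ler_piMl//; exact/pexp_le1/ltW.
rewrite -[X in 0 <= X]/(ip _ _) -[X in X = 0 -> _]/(ip _ _); set p := fun x => _ in pi pL *.
have hp := (bessel pi pL).1; rewrite -(U_sym pL hL).
rewrite (ip_ae (U_L2 pL) hp hL hL (U_hart pi pL) (ae_refl _)).
have kL x : L2 (fun xi => pexp t xi * K xi x).
  by apply: (L2_boundedM (C := 1) eL) => [|y]; [exact: mK'|exact: K_bound].
have poisL x : L2 (fun y => pois t (y - x)).
  have := (bessel (intg_pexpK x t0) (kL x)).1; congr L2.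
  by apply/funext => y; exact: hart_pexpK.
have hE x : hart p x = ip (fun y => pois t (y - x)) f.
  transitivity (ip (fun xi => pexp t xi * K xi x) (U f)).
    by apply: eq_Rint => y; rewrite /p mulrAC.
  rewrite -(U_sym (kL x) fL).
  apply: (ip_ae (U_L2 (kL x)) (poisL x) fL fL _ (ae_refl _)).
  by apply: (aeS (U_hart (intg_pexpK x t0) (kL x))) => y ->; exact: hart_pexpK.
have hp0 x : 0 <= hart p x by rewrite hE; apply: Rint_ge0 => y; rewrite mulr_ge0// ltW// pois_gt0.
split=> [|G0]; first by apply: Rint_ge0 => x; exact: mulr_ge0.
case: (pselect {ae mu, forall x, f x = 0}) => [|fn]; first by left.
(* A zero of the average at a single point already forces [f = 0] almost everywhere. *)
right; have hpos x : 0 < hart p x.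
  rewrite lt_neqAle hp0 andbT; apply/negP => /eqP; rewrite hE => e0; apply: fn.
  have nn y : 0 <= pois t (y - x) * f y by rewrite mulr_ge0// ltW// pois_gt0.
  apply: (aeS (Rint_eq0_ae (L2M (poisL x) fL) nn (esym e0))) => y /eqP.
  by rewrite mulf_eq0 gt_eqF ?pois_gt0//= => /eqP.
have nn y : 0 <= hart p y * h y by rewrite mulr_ge0.
apply: (aeS (Rint_eq0_ae (L2M hp hL) nn G0)) => y /eqP.
by rewrite mulf_eq0 gt_eqF//= => /eqP.
Qed.

Lemma Rint_half_exp e : 0 < e -> \int[mu]_x ((0 <= x)%R%:R * expR (- (e * x))) = e^-1.
Proof.
move=> e0; pose F x := - e^-1 * expR (- (e * x)).
have dF : forall x, is_derive x 1 F (expR (- (e * x))).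
  by move=> x; rewrite /F; drve; field; rewrite gt_eqF.
have cf : continuous (fun x : R => expR (- (e * x))).
  move=> x; apply: continuous_comp; last exact: continuous_expR.
  by apply: cvgN; apply: cvgM; [exact: cvg_cst|exact: cvg_id].
have Fl : F n%:R @[n --> \oo] --> (0 : R).
  by rewrite -[X in _ --> X](mulr0 (- e^-1)); apply: cvgM; [exact: cvg_cst|exact: cvg_expRN].
by rewrite (ftc_half cf dF (intg_half_exp e0) Fl) /F mulr0 oppr0 expR0 mulr1 sub0r opprK.
Qed.

(* 1/(1+|x|) = \int_0^oo e^(-t) e^(-t|x|) dt, and e^(-t|D|) has the (positive) Poisson kernel. *)
Lemma inv_op_pos f g h : L2 f -> L2 g -> L2 h -> inv_op f g ->
  (forall x, 0 <= f x) -> (forall x, 0 <= h x) ->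
  0 <= ip g h /\ (ip g h = 0 -> {ae mu, forall x, f x = 0} \/ {ae mu, forall x, h x = 0}).
Proof.
move=> fL gL hL H f0 h0; rewrite (inv_op_ip fL gL hL H).
have UfL := U_L2 fL; have UhL := U_L2 hL; have wi := L2M UfL UhL.
pose T t : R := (0 <= t)%R%:R * expR (- (1 * t)).
(* [T] kills negative times; the absolute value keeps the damping factor at most 1 there too, since
   the domination is required everywhere. *)
pose F (z : R * R) := T z.1 * (pexp `|z.1| z.2 * (U f z.2 * U h z.2)).
have Ti : intg mu T by exact: intg_half_exp.
have mF : measurable_fun setT F.
  apply: measurable_funM; first exact: (measurableT_comp (intg_mble Ti)).
  apply: measurable_funM; last exact: (measurableT_comp (intg_mble wi)).
  apply: measurableT_comp; first by apply: continuous_measurable_fun; exact: continuous_expR.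
  apply: measurable_funN; apply: measurable_funM; apply: measurableT_comp => //;
    by apply: measurableT_comp.
have Fdom x y : `|F (x, y)| <= `|T x| * `|U f y * U h y|.
  rewrite /F !normrM ler_wpM2l// ler_piMl ?mulr_ge0//.
  by rewrite ger0_norm ?pexp_ge0// pexp_le1.
have [i1 _ FE] := fubini_dom mF Ti wi Fdom.
pose G t := \int[mu]_x (pexp t x * U f x * U h x).
have E1 : \int[mu]_x (U f x * U h x * (1 + `|x|)^-1) = \int[mu]_x \int[mu]_y F (x, y).
  rewrite FE; apply: eq_Rint => x; rewrite -Rint_half_exp ?den1_gt0//.
  rewrite -RintZ; last by apply: intg_half_exp; exact: den1_gt0.
  apply: eq_Rint => t; rewrite /F /T /=; case: (leP 0 t) => [t0|]; last by rewrite !mul0r mulr0.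
  rewrite /pexp (ger0_norm t0) (_ : - ((1 + `|x|) * t) = - (1 * t) + - (t * `|x|)); last by ring.
  by rewrite expRD; ring.
have E2 t : \int[mu]_y F (t, y) = T t * G t.
  rewrite /T /G; case: (leP 0 t) => [t0|t0]; last first.
    rewrite !mul0r -[RHS](@Rintegral0 _ _ _ mu); apply: eq_Rint => y.
    by rewrite /F /T /= leNgt t0 !mul0r.
  rewrite -RintZ.
    by apply: eq_Rint => x; rewrite /F /T /= t0 (ger0_norm t0) -!mulrA.
  under eq_fun do rewrite -mulrA mulrC.
  apply: (intg_boundedM (C := 1) wi) => [|x]; first exact: mpexp.
  by rewrite ger0_norm ?pexp_ge0// pexp_le1.
have nn t : t != 0 -> 0 <= T t * G t.
  move=> t0; rewrite /T; case: (leP 0 t) => [tp|_]; last by rewrite !mul0r.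
  rewrite mul1r mulr_ge0 ?expR_ge0//.
  by have := (heat_pos (t := t) _ fL hL f0 h0).1; apply; rewrite lt_neqAle eq_sym t0.
rewrite E1; under eq_Rint do rewrite E2.
have TGi : intg mu (fun t => T t * G t) by under eq_fun do rewrite -E2.
(* Positivity comes from the Poisson kernel and is proved for [t != 0] only; the absolute value
   restores a sign at every [t]. *)
have aE : {ae mu, forall t, T t * G t = `|T t * G t|}.
  by apply: (aeS (ae_neq 0)) => t t0; rewrite ger0_norm ?nn.
rewrite (Rint_ae (intg_mble TGi) (intg_mble (intg_abs TGi)) aE).
split=> [|I0]; first exact: Rint_ge0.
have z := Rint_eq0_ae (intg_abs TGi) (fun x => normr_ge0 _) I0.
have [[N [mN N0 subN]] nz] : {ae mu, forall t, T t * G t = 0} /\ True.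
  by split=> //; apply: (aeS z) => t /eqP; rewrite normr_eq0 => /eqP.
(* A single positive time with zero pairing suffices, and the null set outside which the integrand
   vanishes cannot contain [[1, 2]]. *)
have [t t0 tG] : exists2 t, 0 < t & T t * G t = 0.
  apply: contrapT => no; have : `[1, 2]%classic `<=` N.
    move=> t /=; rewrite in_itv/= => /andP[t1 _]; apply: subN => /= e; apply: no.
    by exists t => //; exact: lt_le_trans t1.
  move=> sub; pose I : set R := `[1, 2]%classic; have : (mu I <= mu N)%E.
    apply: le_measure => //; apply: mem_set; last exact: mN.
    exact: measurable_itv.
  by rewrite [X in (_ <= X)%E](N0 : _ = 0%E) /I lebesgue_measure_itv/= lte_fin ltr1n/= -EFinB lee_fin; lra.
apply: (heat_pos t0 fL hL f0 h0).2; move: tG; rewrite /T ltW// => /eqP.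
by rewrite mulf_eq0 gt_eqF ?mulr_gt0 ?expR_gt0//= => /eqP.
Qed.

(** Pairing [g] with its own negative part gives minus a squared norm, which must be nonnegative. *)
Lemma inv_op_ge0 f g : L2 f -> L2 g -> inv_op f g -> (forall x, 0 <= f x) ->
  {ae mu, forall x, 0 <= g x}.
Proof.
move=> fL gL H f0; have mg := L2_mble gL.
pose h x : R := Num.max 0 (- g x).
have mh : measurable_fun setT h by apply: measurable_maxr => //; exact: measurable_funN.
have hL : L2 h.
  apply: (L2_dom1 mh gL) => x; rewrite /h; case: (leP 0 (- g x)) => _; by rewrite ?normrN ?normr0.
have h0 x : 0 <= h x by rewrite /h le_max lexx.
have [+ _] := inv_op_pos fL gL hL H f0 h0.
have -> : ip g h = - ip h h.
  rewrite /ip -RintN; last exact: L2M.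
  by apply: eq_Rint => x; rewrite /h; case: (leP 0 (- g x)) => _; by rewrite ?mulr0 ?oppr0// !mulrN mulNr opprK.
rewrite oppr_ge0 => le0; have e0 : ip h h = 0 by apply/le_anti; rewrite le0 ip_ge0.
apply: (aeS (ip_eq0_ae hL e0)) => x; rewrite /h; case: (leP 0 (- g x)) => [_|]; lra.
Qed.

End Resolvent.

Section BenjaminOnoSoliton.
Context {R : realType}.
Local Notation mu := (@lebesgue_measure R).
Implicit Types (f g h p r u v : R -> R) (x y xi a b c t : R).

Lemma cont_ae_ge0 f : continuous f -> {ae mu, forall x, 0 <= f x} -> forall x, 0 <= f x.
Proof.
move=> cf f0 x; have cm : continuous (fun x => Num.min (f x) 0).
  by move=> y; apply: continuous_min; [exact: cf|exact: cvg_cst].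
have := cont_ae_eq0 cm; move=> /(_ _ x) H.
have : Num.min (f x) 0 = 0 by apply: H; apply: (aeS f0) => y /min_idPr.
by move/min_idPr.
Qed.

(* With A = |a| and D = R(uA), R the resolvent: D >= A, and pairing with u^2
   gives <D, u^2> = <uA, u> = <A, u^2>, so that A = R(uA). Then A + a = R(u(A+a))
   and u(A - a) are orthogonal, and strict positivity of R kills one of them. *)
Lemma positive_solution_simple u (a : R -> R) B : continuous u -> (forall x, `|u x| <= B) -> L2 u ->
  continuous a -> L2 a -> inv_op (fun x => u x ^+ 2) u -> inv_op (fun x => u x * a x) a ->
  ~ {ae mu, forall x, u x = 0} ->
  [/\ forall x, 0 <= u x, {ae mu, forall x, u x != 0} &
    (forall x, a (- x) = - a x) -> forall x, a x = 0].
Proof.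
move=> cu uB uL ca aL Hu Ha un.
have mu_ := L2_mble uL.
have mulL f : L2 f -> L2 (fun x => u x * f x).
  by move=> fL; under eq_fun do rewrite mulrC; exact: (L2_boundedM (C := B)).
have u2L : L2 (fun x => u x ^+ 2) by under eq_fun do rewrite expr2; exact: mulL.
have u0 : forall x, 0 <= u x.
  by apply: cont_ae_ge0 => //; exact: (inv_op_ge0 u2L uL Hu (fun x => sqr_ge0 _)).
have unz : {ae mu, forall x, u x != 0}.
  (* The indicator of the zero set of [u], damped to be in L^2. Its pairing with [u] is zero, so
     strict positivity forces it to vanish almost everywhere. *)
  pose h x : R := pexp 1 x * \1_(u @^-1` [set 0]) x.
  have mS : measurable (u @^-1` [set (0 : R)]).
    by rewrite -[X in measurable X]setTI; exact: (mu_ measurableT _ (measurable_set1 0)).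
  have hL : L2 h.
    apply: (L2_boundedM (C := 1) (L2_pexp ltr01)) => [|x]; first exact: measurable_indic.
    by rewrite /indic; case: (_ \in _); rewrite ?normr0 ?normr1.
  have h0 x : 0 <= h x by rewrite mulr_ge0 ?pexp_ge0.
  have [_] := inv_op_pos u2L uL hL Hu (fun x => sqr_ge0 _) h0.
  have -> : ip u h = 0.
    rewrite -[RHS](@Rintegral0 _ _ _ mu); apply: eq_Rint => x; rewrite /h /indic.
    by case: (boolP (x \in _)); rewrite ?mulr0// inE => ->; rewrite mul0r.
  case=> // H.
    by exfalso; apply: un; apply: (aeS H) => x /eqP; rewrite sqrf_eq0 => /eqP.
  apply: (aeS H) => x; rewrite /h /indic => /eqP; rewrite mulf_eq0 gt_eqF ?expR_gt0//=.
  by apply: contraTneq => ux; rewrite mem_set//= oner_eq0.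
split=> // ao.
pose A x := `|a x|.
have AL : L2 A by exact: L2_abs.
have cA : continuous A by move=> x; apply: (continuous_comp (ca x)); exact: norm_continuous.
have uAL := mulL _ AL; have uaL := mulL _ aL.
have [D DL HD] := inv_op_ex uAL.
have naL := L2Z (-1) aL; have Hna := inv_op_Z (-1) uaL aL Ha.
have s1 := inv_op_D uAL DL uaL aL HD Ha.
have s2 := inv_op_D uAL DL (L2Z (-1) uaL) naL HD Hna.
have DA : {ae mu, forall x, A x <= D x}.
  have g1 := inv_op_ge0 (L2D uAL uaL) (L2D DL aL) s1.
  have g2 := inv_op_ge0 (L2D uAL (L2Z (-1) uaL)) (L2D DL naL) s2.
  apply: (aeS2 (g1 _) (g2 _)) => x.
  - rewrite -mulrDr mulr_ge0// /A; have := ler_norm (- a x); rewrite normrN; lra.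
  - have -> : u x * A x + -1 * (u x * a x) = u x * (A x - a x) by ring.
    by rewrite mulr_ge0// subr_ge0 ler_norm.
  - by move=> d1 d2; rewrite /A ler_norml; apply/andP; split; lra.
have DAL := L2B DL AL.
have I0 : ip (fun x => D x - A x) (fun x => u x ^+ 2) = 0.
  rewrite ipBl// (inv_op_sym uAL DL u2L uL HD Hu); apply/eqP; rewrite subr_eq0; apply/eqP.
  by apply: eq_Rint => x; ring.
have E : {ae mu, forall x, D x = A x}.
  have i1 := L2M DAL u2L.
  have z : \int[mu]_x `|(D x - A x) * u x ^+ 2| = 0.
    rewrite -I0; apply: Rint_ae; [exact: (intg_mble (intg_abs i1))|exact: (intg_mble i1)|].
    by apply: (aeS DA) => x d; rewrite ger0_norm// mulr_ge0 ?sqr_ge0// subr_ge0.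
  apply: (aeS2 unz (Rint_eq0_ae (intg_abs i1) (fun x => normr_ge0 _) z)) => x ux /eqP.
  by rewrite normr_eq0 mulf_eq0 sqrf_eq0 (negbTE ux) orbF subr_eq0 => /eqP.
have HA : inv_op (fun x => u x * A x) A.
  by exact: (inv_op_ae uAL DL uAL AL (ae_refl _) E HD).
have t1 := inv_op_D uAL AL uaL aL HA Ha.
have pL : L2 (fun x => u x * A x + u x * a x) by exact: L2D.
have mL : L2 (fun x => u x * A x + -1 * (u x * a x)) by apply: L2D => //; exact: L2Z.
have p0 x : 0 <= u x * A x + u x * a x.
  by rewrite -mulrDr mulr_ge0// /A; have := ler_norm (- a x); rewrite normrN; lra.
have m0 x : 0 <= u x * A x + -1 * (u x * a x).
  have -> : u x * A x + -1 * (u x * a x) = u x * (A x - a x) by ring.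
  by rewrite mulr_ge0// subr_ge0 ler_norm.
have [_] := inv_op_pos pL (L2D AL aL) mL t1 p0 m0.
have -> : ip (fun x => A x + a x) (fun x => u x * A x + -1 * (u x * a x)) = 0.
  rewrite -[RHS](@Rintegral0 _ _ _ mu); apply: eq_Rint => x.
  have : A x ^+ 2 = a x ^+ 2 by rewrite /A real_normK ?num_real.
  move=> e; have -> : (A x + a x) * (u x * A x + -1 * (u x * a x)) = u x * (A x ^+ 2 - a x ^+ 2) by ring.
  by rewrite e subrr mulr0.
have sgn (s : R) : {ae mu, forall x, u x * (A x + s * a x) = 0} -> forall x, A x = - (s * a x).
  move=> H; apply: cont_ae_eq => //.
    by move=> x; apply: cvgN; apply: cvgM; [exact: cvg_cst|exact: ca].
  apply: (aeS2 unz H) => x ux /eqP; rewrite mulf_eq0 (negbTE ux)/= addr_eq0.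
  by move/eqP.
have A0 x : 0 <= A x by exact: normr_ge0.
case=> // H x.
- have F : forall x, A x = - (1 * a x) by apply: sgn; apply: (aeS H) => y <-; ring.
  have := F x; have := F (- x); have := A0 x; have := A0 (- x); rewrite ao; lra.
- have F : forall x, A x = - (-1 * a x) by apply: sgn; apply: (aeS H) => y <-; ring.
  have := F x; have := F (- x); have := A0 x; have := A0 (- x); rewrite ao; lra.
Qed.

(** Equal signs determine that of [y + z]; for opposite signs both sides are zero. *)
Lemma sg_add (y z : R) : y != 0 -> z != 0 ->
  1 + Num.sg y * Num.sg z = Num.sg (y + z) * (Num.sg y + Num.sg z).
Proof.
move=> y0 z0; case: (ltgtP y 0) y0 => // hy _; case: (ltgtP z 0) z0 => // hz _.
- by rewrite !ltr0_sg//; [ring|lra].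
- by rewrite (ltr0_sg hy) (gtr0_sg hz); ring.
- by rewrite (gtr0_sg hy) (ltr0_sg hz); ring.
- by rewrite !gtr0_sg//; [ring|lra].
Qed.

Lemma L2_sgM p : L2 p -> L2 (fun x => Num.sg x * p x).
Proof.
move=> pL; have := L2N (L2_sg pL); congr L2; apply/funext => x.
by rewrite mulNr opprK.
Qed.

Lemma conv_comm f g xi : L2 f -> L2 g -> convol f g xi = convol g f xi.
Proof.
move=> fL gL; have i := conv_intg_pt xi gL fL.
rewrite /convol -(Rint_shift xi i) -(Rint_opp (intg_shift xi i)).
by apply: eq_Rint => y /=; rewrite mulrC [_ + xi]addrC; congr (_ * f _); ring.
Qed.

Lemma hart_odd p : intg mu p -> {ae mu, forall x, p (- x) = - p x} ->
  forall x, hart p (- x) = - hart p x.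
Proof.
move=> pi po x; rewrite -(hart_opp x pi) -(RintN (intgK x pi)); apply: Rint_ae.
- exact: (intg_mble (intgK x (intg_opp pi))).
- exact: (intg_mble (intgN (intgK x pi))).
- by apply: (aeS po) => y ->; rewrite mulNr.
Qed.

(* Pointwise this is [1 + s t = sg(y + z) (s + t)] for the signs s, t of y, z;
   it says that (u + iv)^2 has a one-sided spectrum when v is the Hilbert
   transform of u. *)
Lemma conv_sg p xi : L2 p -> xi != 0 ->
  convol p p xi + convol (fun x => Num.sg x * p x) (fun x => Num.sg x * p x) xi =
  Num.sg xi * (2 * convol p (fun x => Num.sg x * p x) xi).
Proof.
move=> pL xi0; have sL := L2_sgM pL.
have i1 := conv_intg_pt xi pL pL; have i2 := conv_intg_pt xi sL sL.
have i3 := conv_intg_pt xi pL sL; have i4 := conv_intg_pt xi sL pL.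
rewrite [2 * _]mulr_natl mulr2n {2}(conv_comm xi pL sL) /convol -(RintD i1 i2) -(RintD i3 i4).
rewrite -(RintZ _ (intgD i3 i4)); apply: Rint_ae.
- exact: (intg_mble (intgD i1 i2)).
- exact: (intg_mble (intgZ _ (intgD i3 i4))).
apply: (aeS2 (ae_neq 0) (ae_neq xi)) => y y0 yx.
have z0 : xi - y != 0 by rewrite subr_eq0 eq_sym.
have := sg_add y0 z0; rewrite (_ : y + (xi - y) = xi); last by ring.
move=> e; transitivity ((1 + Num.sg y * Num.sg (xi - y)) * (p y * p (xi - y))); first by ring.
by rewrite e; ring.
Qed.

Lemma conv_odd p q xi : L2 p -> L2 q -> {ae mu, forall x, p (- x) = p x} ->
  {ae mu, forall x, q (- x) = - q x} -> convol p q (- xi) = - convol p q xi.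
Proof.
move=> pL qL pe qo; have i := conv_intg_pt (- xi) pL qL; have j := conv_intg_pt xi pL qL.
rewrite /convol -(Rint_opp i) -(RintN j); apply: Rint_ae.
- exact: (intg_mble (intg_opp i)).
- exact: (intg_mble (intgN j)).
- apply: (aeS2 pe (ae_opp (ae_shift xi qo))) => y -> /= e.
  have -> : - xi - - y = - (- y + xi) by ring.
  by rewrite e mulrN; congr (- (_ * q _)); ring.
Qed.

End BenjaminOnoSoliton.

(** * Uniqueness of the Benjamin-Ono soliton *)

Section BenjaminOnoUnique.
Context {R : realType}.
Local Notation mu := (@lebesgue_measure R).
Implicit Types (f g h p r u v : R -> R) (x y xi a b c t : R).

Lemma even_deriv_odd f g : (forall x, f (- x) = f x) -> (forall x, is_derive x 1 f (g x)) ->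
  forall x, g (- x) = - g x.
Proof.
move=> fe df x; have := drv_comp (df (- x)) (drvN (drv_id x)).
have -> : (fun y => f (- y)) = f by apply/funext.
by move=> d2; have := is_derive1E d2; rewrite (is_derive1E (df x)); lra.
Qed.

(** Eliminating [w] by the first identity and [u^2 + v^2] by the second, [m = v - x u] satisfies
    [m' = - v m] with [m 0 = 0]. *)
Lemma bo_algebra u v w (B : R) : (forall x, is_derive x 1 v (u x ^+ 2 - u x)) ->
  (forall x, is_derive x 1 u (w x)) -> (forall x, `|v x| <= B) -> v 0 = 0 ->
  (forall x, w x + u x * v x = 0) -> (forall x, 2^-1 * (u x ^+ 2 + v x ^+ 2) - u x = 0) ->
  forall x, u x != 0 -> u x = 2 / (1 + x ^+ 2).
Proof.
move=> dv du vB v0 wa ub x ux.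
pose m x := v x - x * u x.
pose y x := m x ^+ 2.
have dm t : is_derive t 1 m (- v t * m t).
  apply: drv_eq; split; first exact: (drvD (dv t) (drvN (drvM (drv_id t) (du t)))).
  have := wa t; have := ub t; rewrite /m => e1 e2.
  have -> : w t = - (u t * v t) by lra.
  lra.
have dy t : is_derive t 1 y (2 * m t * (- v t * m t)).
  by apply: drv_eq; split; [exact: (drvX 2 (dm t))|rewrite /=; ring].
have y0 : y x = 0.
  apply: (gronwall (M := 2 * B) dy) => [t|t|]; first exact: sqr_ge0.
    have -> : 2 * m t * (- v t * m t) = - v t * (2 * y t) by rewrite /y; ring.
    have y2 : 0 <= 2 * y t by rewrite mulr_ge0 ?sqr_ge0.
    by rewrite normrM normrN (ger0_norm y2) [leRHS](_ : _ = B * (2 * y t)) ?ler_wpM2r//; ring.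
  by rewrite /y /m v0 mul0r subrr expr0n.
have vx : v x = x * u x by move/eqP: y0; rewrite sqrf_eq0 subr_eq0 => /eqP.
have := ub x; rewrite vx => e.
(* The second identity with [v = x u] substituted. *)
have : u x * (u x * (1 + x ^+ 2) - 2) = 0 by move: e; lra.
move/eqP; rewrite mulf_eq0 (negbTE ux)/= subr_eq0 => /eqP <-.
by rewrite mulfK// den_neq0.
Qed.

Lemma bo_unique (phi : R -> R) : even_soliton_profile 0 1 phi -> {ae mu, forall x, phi x = Q_BO x}.
Proof.
move=> [[Hphi ev] Sphi nz]; have [fL xL'] := (H1P phi).1 Hphi.
have pi' := H1_UL1 Hphi; have pL' := U_L2 fL; have re := rep_ae fL pi'.
have E := (solutionP _ _ Hphi).1 Sphi; have sL := sqr_L2 fL pi'.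
pose p x := 2^-1 * U phi x.
have pL : L2 p by exact: L2Z.
have pi : intg mu p by exact: intgZ.
have pe : {ae mu, forall x, p (- x) = p x}.
  by apply: (aeS (even_U fL ev)) => x; rewrite /p => ->.
(* [p] is the transform of [u = phi / 2]. By [hilbertP] and the evenness of [p], [sp] is that of
   [v = - H u]. *)
pose u := hart p; pose sp x := Num.sg x * p x; pose v := hart sp.
have uE x : u x = 2^-1 * rep phi x by exact: hartZ.
have spL : L2 sp by exact: L2_sgM.
have msp := L2_mble spL.
have spi : intg mu sp.
  apply: (intg_domC (C := 1) _ pi) => [|x]; [exact: msp|]; rewrite /sp normrM mul1r ler_piMl//.
  by rewrite normr_sg; case: (x != 0).
have spo : {ae mu, forall x, sp (- x) = - sp x}.
  by apply: (aeS pe) => x e; rewrite /sp e sgrN mulNr.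
pose pp x := c0 * convol p p x.
have ppi : intg mu pp by apply: intgZ; exact: conv_intg.
have ppL : L2 pp by apply: L2Z; exact: conv_L2.
have u2E x : u x ^+ 2 = hart pp x.
  by rewrite (hartZ c0 _ (conv_intg pL pL pi pi)) (hart_conv pL pL pi pi x pe) mulVKf ?c0_neq0// expr2.
have uL : L2 u by exact: (bessel pi pL).1.
have u2L : L2 (fun x => u x ^+ 2) by under eq_fun do rewrite u2E; exact: (bessel ppi ppL).1.
have Uu := ae_trans (U_ae uL (U_L2 pL) (ae_sym (U_hart pi pL))) (U_invol pL).
have UH q : intg mu q -> L2 q -> {ae mu, forall x, U (hart q) x = q x}.
  move=> qi qL; have hL := (bessel qi qL).1.
  exact: ae_trans (U_ae hL (U_L2 qL) (ae_sym (U_hart qi qL))) (U_invol qL).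
have Eq : {ae mu, forall x, (1 + `|x|) * p x = pp x}.
  have e1 : {ae mu, forall x, 4 * u x ^+ 2 = phi x ^+ 2}.
    by apply: (aeS re) => x <-; rewrite uE; field.
  have e2 := U_ae (L2Z 4 u2L) sL e1; have e3 := U_Z 4 u2L.
  have e4 := UH _ ppi ppL.
  apply: (aeS2 (aeI e2 e3) (aeI E e4)) => x [<- ->].
  have -> : (fun x => u x ^+ 2) = hart pp by apply/funext.
  move=> [+ e5]; rewrite e5 /sym mul0r addr0 mul1r /p; lra.
(* The equation expresses [|x| p] through integrable functions, and this is the gain of regularity
   that makes [u] and [v] continuously differentiable. *)
have ap : {ae mu, forall x, `|x| * p x = pp x - p x} by apply: (aeS Eq) => x <-; ring.
have dpi := intgB ppi pi; have dpL := L2B ppL pL.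
have mnp : measurable_fun setT (fun x => `|x| * p x).
  apply: measurable_funM; last exact: (L2_mble pL).
  by apply: continuous_measurable_fun => z; exact: norm_continuous.
have npi : intg mu (fun x => `|x| * p x) by apply: (intg_ae _ dpi ap); exact: mnp.
have npL : L2 (fun x => `|x| * p x) by exact: (L2_ae mnp dpL ap).
have mdd (q : R -> R) : L2 q -> measurable_fun setT (dual_deriv q).
  by move=> qL; apply: measurable_funM; [exact: measurable_funN|exact: (L2_mble (L2_opp qL))].
have ddp : intg mu (dual_deriv p) /\ L2 (dual_deriv p).
  split.
    apply: (intg_domC (C := 1) _ (intg_opp npi)) => [|x]; first exact: (mdd _ pL).
    by rewrite mul1r /dual_deriv !normrM !normrN normr_id.
  apply: (L2_dom1 _ (L2_opp npL)) => [|x]; first exact: (mdd _ pL).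
  by rewrite /dual_deriv !normrM !normrN normr_id.
have [dpi' dpL'] := ddp.
have dsE : {ae mu, forall x, dual_deriv sp x = pp x - p x}.
  apply: (aeS2 ap pe) => x <- e; rewrite /dual_deriv /sp e sgrN normrEsg.
  ring.
have dsL := L2_ae (mdd _ spL) dpL dsE.
have cu : continuous u by exact: hart_cont.
(* The transform of [v'] is [|x| p], which equals [pp - p] and is thus the transform of
   [u^2 - u]. *)
have dv : forall x, is_derive x 1 v (u x ^+ 2 - u x).
  apply: hart_C1 => //; first by move=> x; apply: cvgB; [apply: cvgM; exact: cu|exact: cu].
  apply: (ae_trans (U_ae dsL dpL dsE)); apply: (ae_trans (U_hart dpi dpL)).
  by apply: aeW => x; rewrite (hartB x ppi pi) u2E.
pose w := hart (dual_deriv p).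
have du : forall x, is_derive x 1 u (w x) by exact: hart_C1_hart.
pose ps x := c0 * convol p sp x; pose ss x := c0 * convol sp sp x.
have psi : intg mu ps by apply: intgZ; exact: conv_intg.
have psL : L2 ps by apply: L2Z; exact: conv_L2.
have ssi : intg mu ss by apply: intgZ; exact: conv_intg.
have ssL : L2 ss by apply: L2Z; exact: conv_L2.
have vo x : v (- x) = - v x by exact: hart_odd.
have uvE x : u x * v x = hart ps x.
  by rewrite (hartZ c0 _ (conv_intg pL spL pi spi)) (hart_conv pL spL pi spi x pe) mulVKf ?c0_neq0.
have v2E x : v x ^+ 2 = - hart ss x.
  rewrite (hartZ c0 _ (conv_intg spL spL spi spi)) (hart_conv_odd spL spL spi spi x spo).
  by rewrite mulVKf ?c0_neq0// -[hart sp (- x)]/(v (- x)) vo mulrN opprK expr2.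
pose A x := dual_deriv p x + ps x.
pose B x := 2^-1 * (pp x - ss x) - p x.
have Ai : intg mu A by exact: intgD.
have AL : L2 A by exact: L2D.
have Bi : intg mu B by apply: intgB => //; apply: intgZ; exact: intgB.
have BL : L2 B by apply: L2B => //; apply: L2Z; exact: L2B.
have aE x : w x + u x * v x = hart A x by rewrite uvE (hartD x dpi' psi).
have bE x : 2^-1 * (u x ^+ 2 + v x ^+ 2) - u x = hart B x.
  by rewrite (hartB x (intgZ _ (intgB ppi ssi)) pi) (hartZ _ _ (intgB ppi ssi)) (hartB x ppi ssi) u2E v2E.
(* Substituting the equation in [B] leaves [|x| p] and the two convolutions, which [conv_sg]
   combines into the sign times [2 ps]: what remains is the sign times [- A]. *)
have BA : {ae mu, forall x, B x = - Num.sg x * A x}.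
  apply: (aeS2 (aeI ap pe) (ae_neq 0)) => x [e1 e2] x0.
  have := conv_sg pL x0; rewrite -/sp => e3.
  have -> : B x = pp x - p x - 2^-1 * (c0 * (convol p p x + convol sp sp x)).
    by rewrite /B /pp /ss; field.
  rewrite -e1 e3 /A /dual_deriv e2 /ps normrEsg; by field.
have Ao : {ae mu, forall x, A (- x) = - A x}.
  apply: (aeS pe) => z e; rewrite /A /ps (conv_odd z pL spL pe spo) /dual_deriv e opprK; ring.
pose aa x := w x + u x * v x; pose bb x := 2^-1 * (u x ^+ 2 + v x ^+ 2) - u x.
have aaE : aa = hart A by apply/funext => x; exact: aE.
have bbE : bb = hart B by apply/funext => x; exact: bE.
have aaL : L2 aa by rewrite aaE; exact: (bessel Ai AL).1.
have bbL : L2 bb by rewrite bbE; exact: (bessel Bi BL).1.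
have caa : continuous aa by rewrite aaE; exact: hart_cont.
have dbb x : is_derive x 1 bb ((u x - 1) * aa x).
  apply: drv_eq; split.
    exact: (drvD (drvZ 2^-1 (drvD (drvX 2 (du x)) (drvX 2 (dv x)))) (drvN (du x))).
  by rewrite /aa /=; field.
have [Bd uB] : exists C, forall x, `|u x| <= C by eexists => x; exact: hart_le pi.
have [Cd vB] : exists C, forall x, `|v x| <= C by eexists => x; exact: hart_le spi.
have mu_ := L2_mble uL.
have uaL : L2 (fun x => u x * aa x).
  by under eq_fun do rewrite mulrC; exact: (L2_boundedM (C := Bd)).
have cL : L2 (fun x => (u x - 1) * aa x).
  have := L2B uaL aaL; congr L2; apply/funext => x; ring.
have cc : continuous (fun x => (u x - 1) * aa x).
  by move=> x; apply: cvgM; [apply: cvgB; [exact: cu|exact: cvg_cst]|exact: caa].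
have wd := C1_weak_derivative bbL cL cc dbb.
have UA : {ae mu, forall x, U aa x = A x} by rewrite aaE; exact: UH.
have UB : {ae mu, forall x, U bb x = B x} by rewrite bbE; exact: UH.
(* On transforms, [b' = (u - 1) a] reads [- x B (- x) = U (u a) - A]. By [BA] and the oddness of [A]
   the left side is [|x| A]. *)
have Ha : inv_op (fun x => u x * aa x) aa.
  have eD := U_D cL aaL.
  have ee : (fun x => (u x - 1) * aa x + aa x) = (fun x => u x * aa x).
    by apply/funext => x; ring.
  rewrite ee in eD.
  apply: (aeS2 (aeI (aeI eD wd) (aeI UA (ae_opp UB))) (aeI (ae_opp BA) Ao)).
  by move=> x [[-> ->] [-> ->]] [-> ->]; rewrite sgrN normrEsg; ring.
have Hu : inv_op (fun x => u x ^+ 2) u.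
  have -> : (fun x => u x ^+ 2) = hart pp by apply/funext.
  by apply: (aeS2 (aeI (UH _ ppi ppL) (UH _ pi pL)) Eq) => x [-> ->].
have un : ~ {ae mu, forall x, u x = 0}.
  move=> u0; apply: nz; apply: (aeS2 re u0) => x; rewrite uE => <-; lra.
have ue x : u (- x) = u x.
  by rewrite !uE (even_rep pi' (even_U fL ev)).
have [_ unz a0] := positive_solution_simple cu uB uL caa aaL Hu Ha un.
have wo := even_deriv_odd ue du.
have {}a0 : forall x, aa x = 0.
  by apply: a0 => x; rewrite /aa wo ue vo; ring.
(* [b] inherits its vanishing from [a] through [BA]. *)
have b0 x : bb x = 0.
  have cb : continuous bb by rewrite bbE; exact: hart_cont.
  apply: cont_ae_eq0 => //; have zL : L2 (fun=> 0 : R) := L2_0.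
  apply: (U_eq bbL zL).
  have z1 : {ae mu, forall x, U aa x = U (fun=> 0) x}.
    by apply: (U_ae aaL zL); exact: aeW.
  have z2 : {ae mu, forall x, U (fun=> 0 : R) x = 0}.
    apply: (ae_trans _ (_ : {ae mu, forall x, 0 * U (fun=> 0) x = 0})).
      have := U_Z 0 zL; rewrite (_ : (fun x => 0 * 0) = fun=> 0)//.
      by apply/funext => ?; rewrite mulr0.
    by apply: aeW => ?; rewrite mul0r.
  apply: (aeS2 (aeI UB BA) (aeI (aeI UA z1) z2)) => y [-> ->] [[<- ->] ->].
  by rewrite mulr0.
have v0 : v 0 = 0 by have := vo 0; rewrite oppr0; lra.
have fin := bo_algebra dv du vB v0 a0 b0.
apply: (aeS2 re unz) => x <- ux; have := fin x ux; rewrite uE /Q_BO => e.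
have -> : rep phi x = 2 * (2^-1 * rep phi x) by field.
by rewrite e; field; exact: den_neq0.
Qed.

End BenjaminOnoUnique.

(** * The explicit Benjamin-Ono profile *)

Section BenjaminOnoProfile.
Context {R : realType}.
Local Notation mu := (@lebesgue_measure R).
Implicit Types (f g h p r u v : R -> R) (x y xi a b c t : R).

Lemma Rint_pexp_sin e t : 0 < e ->
  \int[mu]_x (Num.sg x * pexp e x * sin (t * x)) = 2 * (t / (e ^+ 2 + t ^+ 2)).
Proof.
move=> e0; have d0 : e ^+ 2 + t ^+ 2 != 0 by rewrite gt_eqF// ltr_pwDl ?exprn_gt0 ?sqr_ge0.
have msg : measurable_fun setT (fun x : R => Num.sg x * sin (t * x)).
  have -> : (fun x : R => Num.sg x * sin (t * x)) = fun x => - (- Num.sg x * sin (t * x)).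
    by apply/funext => x; rewrite mulNr opprK.
  apply: measurable_funN; apply: measurable_funM; last exact: msinM.
  have := L2_mble (L2_sg (L2_pexp e0)) => m.
  have -> : (fun x : R => - Num.sg x) = fun x => - Num.sg x * pexp e x * expR (e * `|x|).
    by apply/funext => x; rewrite /pexp -mulrA -expRD addNr expR0 mulr1.
  apply: measurable_funM => //; apply: measurableT_comp => //.
  by apply: continuous_measurable_fun => x; apply: cvgM; [exact: cvg_cst|exact: norm_continuous].
have ci : intg mu (fun x => Num.sg x * pexp e x * sin (t * x)).
  under eq_fun do rewrite mulrAC mulrC.
  apply: (intg_boundedM (C := 1) (intg_pexp e0)) => [|x]; first exact: msg.
  by rewrite normrM normr_sg (le_trans _ (sin_max (t * x)))// ler_piMl//; case: (x != 0).
rewrite Rint_even//; last by move=> x; rewrite pexpN sgrN mulrN sinN; ring.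
congr (2 * _).
pose f x := expR (- e * x) * sin (t * x).
pose F x := (e ^+ 2 + t ^+ 2)^-1 * (expR (- e * x) * (- t * cos (t * x) - e * sin (t * x))).
have fE x : (0 <= x)%R%:R * (Num.sg x * pexp e x * sin (t * x)) = (0 <= x)%R%:R * f x.
  case: (leP 0 x) => [|_]; last by rewrite !mul0r.
  rewrite le_eqVlt => /predU1P[<-|x0]; first by rewrite /f mulr0 sin0 !mulr0.
  by rewrite /f /pexp gtr0_sg// mul1r gtr0_norm// mulNr.
have dF x : is_derive x 1 F (f x).
  by rewrite /F; drve; rewrite /f; field; exact: d0.
have cf : continuous f.
  move=> x; apply: cvgM.
    apply: continuous_comp; last exact: continuous_expR.
    by apply: cvgM; [exact: cvg_cst|exact: cvg_id].
  apply: (continuous_comp (g := @sin R)); last exact: continuous_sin.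
  by apply: cvgM; [exact: cvg_cst|exact: cvg_id].
have fi : intg mu (fun x => (0 <= x)%R%:R * f x).
  have := intg_indicM (measurable_itv `[0, +oo[) ci.
  by congr intg; apply/funext => x; rewrite indic_ge0E fE.
under eq_Rint do rewrite fE.
have Fl : F n%:R @[n --> \oo] --> (0 : R).
  rewrite /F -[X in _ --> X](mulr0 (e ^+ 2 + t ^+ 2)^-1).
  apply: cvgM; first exact: cvg_cst.
  apply/norm_cvg0P.
  apply: (@squeeze_cvgr _ _ _ _ (fun=> 0) (fun n => expR (- (e * n%:R)) * (`|t| + e))).
  - apply: nearW => n; rewrite normr_ge0 /= mulNr normrM gtr0_norm ?expR_gt0//.
    rewrite ler_wpM2l ?expR_ge0//; apply: (le_trans (ler_normB _ _)).
    by rewrite !normrM normrN (gtr0_norm e0) lerD// ?ler_piMr ?sin_max ?cos_max// ltW.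
  - exact: cvg_cst.
  - by rewrite -(mul0r (`|t| + e)); apply: cvgM; [exact: cvg_expRN|exact: cvg_cst].
rewrite (ftc_half cf dF fi Fl) /F !mulr0 expR0 sin0 cos0; field; exact: d0.
Qed.

(* The Hartley transform of Q_BO. *)
Definition bo_hat x : R := 2 / c0 * pexp 1 x.

Lemma bo_hat_intg : intg mu bo_hat.
Proof. by apply: intgZ; exact: intg_pexp. Qed.

Lemma bo_hat_L2 : L2 bo_hat.
Proof. by apply: L2Z; exact: L2_pexp. Qed.

Lemma bo_hatN x : bo_hat (- x) = bo_hat x.
Proof. by rewrite /bo_hat pexpN. Qed.

Lemma hart_bo_hat x : hart bo_hat x = Q_BO x.
Proof.
rewrite (hartZ _ _ (intg_pexp ltr01)) (hart_cos_sin (intg_pexp ltr01)).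
rewrite Rint_pexp_cos// poisE// (Rint_odd (f := fun y => pexp 1 y * sin (x * y))); last first.
- by move=> y; rewrite pexpN mulrN sinN mulrN.
- by apply: (intg_boundedM (C := 1) (intg_pexp ltr01)); [exact: msinM|move=> z; exact: sin_max].
by rewrite /Q_BO expr1n; field; rewrite den_neq0 c0_neq0.
Qed.

Lemma hart_sg_bo_hat x : hart (fun y => Num.sg y * bo_hat y) x = x * Q_BO x.
Proof.
have L := L2_mble (L2_sgM bo_hat_L2).
have i : intg mu (fun y => Num.sg y * bo_hat y).
  apply: (intg_domC (C := 1) _ bo_hat_intg) => [|y]; first exact: L.
  by rewrite normrM mul1r ler_piMl// normr_sg; case: (y != 0).
rewrite (hart_cos_sin i) (Rint_odd (f := fun y => Num.sg y * bo_hat y * cos (x * y))); last first.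
- by move=> y; rewrite bo_hatN sgrN mulrN cosN; ring.
- by apply: (intg_boundedM (C := 1) i); [exact: mcosM|move=> z; exact: cos_max].
rewrite add0r; transitivity (c0 * \int[mu]_y (2 / c0 * (Num.sg y * pexp 1 y * sin (x * y)))).
  by congr (_ * _); apply: eq_Rint => y; rewrite /bo_hat; ring.
rewrite RintZ.
  by rewrite Rint_pexp_sin// expr1n /Q_BO; field; rewrite den_neq0 c0_neq0.
have -> : (fun y => Num.sg y * pexp 1 y * sin (x * y)) =
    fun y => (2 / c0)^-1 * ((Num.sg y * bo_hat y) * sin (x * y)).
  by apply/funext => y; rewrite /bo_hat; field; exact: c0_neq0.
apply: intgZ.
by apply: (intg_boundedM (C := 1) i); [exact: msinM|move=> z; exact: sin_max].
Qed.

Lemma Q_BO_L2 : L2 (@Q_BO R).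
Proof.
have := (bessel bo_hat_intg bo_hat_L2).1; congr L2; apply/funext => x; exact: hart_bo_hat.
Qed.

Lemma Q_BO_cont : continuous (@Q_BO R).
Proof.
have -> : @Q_BO R = hart bo_hat by apply/funext => x; rewrite hart_bo_hat.
exact: hart_cont bo_hat_intg.
Qed.

Lemma U_Q_BO : {ae mu, forall x, U (@Q_BO R) x = bo_hat x}.
Proof.
have -> : @Q_BO R = hart bo_hat by apply/funext => x; rewrite hart_bo_hat.
have [hi hL] := (bo_hat_intg, bo_hat_L2).
exact: ae_trans (U_ae (bessel hi hL).1 (U_L2 hL) (ae_sym (U_hart hi hL))) (U_invol hL).
Qed.

(* V = x Q_BO has transform sg(x) bo_hat and V' = Q_BO^2/2 - Q_BO. *)
Lemma Q_BO_soliton : even_soliton_profile 0 1 (@Q_BO R).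
Proof.
have [hi hL] := (bo_hat_intg, bo_hat_L2); have qL := Q_BO_L2.
have xL : L2 (fun x : R => x * U (@Q_BO R) x).
  (* Half of the exponential decay absorbs the factor [x], since [|x| <= 2 exp (|x| / 2)]. *)
  have h2 : 0 < 2^-1 :> R by rewrite invr_gt0.
  have hL2 := L2_pexp h2.
  have xhL : L2 (fun x => x * bo_hat x).
    apply: (L2_dom (C := 4 / c0) _ hL2) => [|x].
      by apply: measurable_funM => //; exact: L2_mble hL.
    have -> : `|x * bo_hat x| = 2 / c0 * (`|x| * pexp 1 x).
      have nn : 0 <= 2 / c0 * pexp 1 x.
        by rewrite mulr_ge0 ?pexp_ge0// divr_ge0//; exact: ltW (@c0_gt0 R).
      by rewrite /bo_hat normrM (ger0_norm nn); ring.
    rewrite (ger0_norm (pexp_ge0 _ _)) (_ : 4 / c0 * pexp 2^-1 x = 2 / c0 * (2 * pexp 2^-1 x)); last by ring.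
    rewrite ler_wpM2l ?divr_ge0 ?(ltW c0_gt0)//.
    have -> : pexp 1 x = pexp 2^-1 x * pexp 2^-1 x by rewrite /pexp -expRD; congr expR; field.
    rewrite mulrA ler_wpM2r ?pexp_ge0//.
    have -> : pexp 2^-1 x = (expR (2^-1 * `|x|))^-1 by rewrite /pexp expRN.
    rewrite ler_pdivrMr ?expR_gt0//; have := expR_ge1Dx (2^-1 * `|x|); lra.
  apply: (L2_ae _ xhL); first by apply: measurable_funM => //; exact: (L2_mble (U_L2 qL)).
  by apply: (aeS U_Q_BO) => x ->.
have HQ : H1 (@Q_BO R) by apply/H1P.
have q4 x : `|Q_BO x| <= 4.
  rewrite /Q_BO normrM normfV ger0_norm// (gtr0_norm (den_gt0 x)).
  by rewrite ler_pdivrMr ?den_gt0// ler_peMr// lerDl sqr_ge0.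
have q2L : L2 (fun x : R => Q_BO x ^+ 2).
  by under eq_fun do rewrite expr2; apply: (L2_boundedM (C := 4) qL) => //; exact: (L2_mble qL).
split; [by split=> //; apply: aeW => x; rewrite /Q_BO sqrrN| |].
  apply/(solutionP _ _ HQ).
  pose V x : R := x * Q_BO x.
  have VE : V = hart (fun y => Num.sg y * bo_hat y) by apply/funext => x; rewrite hart_sg_bo_hat.
  have sL := L2_sgM hL; have msL := L2_mble sL.
  have si : intg mu (fun y => Num.sg y * bo_hat y).
    apply: (intg_domC (C := 1) _ hi) => [|y]; first exact: msL.
    by rewrite normrM mul1r ler_piMl// normr_sg; case: (y != 0).
  have VL : L2 V by rewrite VE; exact: (bessel si sL).1.
  have UV : {ae mu, forall x, U V x = Num.sg x * bo_hat x}.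
    rewrite VE.
    exact: ae_trans (U_ae (bessel si sL).1 (U_L2 sL) (ae_sym (U_hart si sL))) (U_invol sL).
  have dden x : is_derive x 1 (fun x : R => 1 + x ^+ 2) (2 * x) by drve; ring.
  have dV x : is_derive x 1 V (2^-1 * Q_BO x ^+ 2 - Q_BO x).
    apply: drv_eq; split.
      exact: (drvM (drv_id x) (drvZ 4 (@drvV _ (fun x : R => 1 + x ^+ 2) _ _ (den_neq0 x) (dden x)))).
    by rewrite /Q_BO; field; exact: den_neq0.
  have hqL := L2Z 2^-1 q2L.
  have cV : continuous (fun x : R => 2^-1 * Q_BO x ^+ 2 - Q_BO x).
    move=> x; apply: cvgB; last exact: Q_BO_cont.
    by apply: cvgM; [exact: cvg_cst|apply: cvgM; exact: Q_BO_cont].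
  have wd := C1_weak_derivative VL (L2B hqL qL) cV dV.
  apply: (aeS2 (aeI wd (ae_opp UV)) (aeI (aeI (U_B hqL qL) (U_Z 2^-1 q2L)) U_Q_BO)).
  move=> x [e1 e2] [[e3 e4] e5]; rewrite -e4 /sym mul0r addr0 mul1r e5.
  by move: e1; rewrite e3 e2 e5 bo_hatN sgrN normrEsg; lra.
move=> q0; have := cont_ae_eq0 Q_BO_cont q0 0.
by rewrite /Q_BO expr0n addr0 divr1 => /eqP; rewrite pnatr_eq0.
Qed.

Lemma Q_BO_unique : unique_even_soliton_profile 0 1 (@Q_BO R).
Proof. by split; [exact: Q_BO_soliton|exact: bo_unique]. Qed.

End BenjaminOnoProfile.

(** * Existence of ground states *)

Section CubicFunctional.
Context {R : realType}.
Local Notation mu := (@lebesgue_measure R).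
Implicit Types (f g h p q r u v phi psi : R -> R) (x y xi a b c e t al be : R).

(* The Hartley transforms of the even functions of H^1. *)
Definition adm p := [/\ L2 p, L2 (fun x => x * p x) & {ae mu, forall x, p (- x) = p x}].

Lemma adm_intg p : adm p -> intg mu p.
Proof. by move=> [pL xL _]; exact: (intg_of_weight pL xL).1. Qed.

Lemma adm_D p q : adm p -> adm q -> adm (fun x => p x + q x).
Proof.
move=> [pL xpL pe] [qL xqL qe]; split; first exact: L2D.
  by under eq_fun do rewrite mulrDr; exact: L2D.
by apply: (aeS2 pe qe) => x -> ->.
Qed.

Lemma adm_Z c p : adm p -> adm (fun x => c * p x).
Proof.
move=> [pL xpL pe]; split; first exact: L2Z.
  by under eq_fun do rewrite mulrCA; exact: L2Z.
by apply: (aeS pe) => x ->.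
Qed.

Lemma adm_B p q : adm p -> adm q -> adm (fun x => p x - q x).
Proof.
move=> pA qA; have := adm_D pA (adm_Z (-1) qA).
by congr adm; apply/funext => x; rewrite mulN1r.
Qed.

Lemma adm_abs p : adm p -> adm (fun x => `|p x|).
Proof.
move=> [pL xpL pe]; have aL := L2_abs pL; split=> //; last by apply: (aeS pe) => x ->.
apply: (L2_dom1 _ xpL) => [|x]; last by rewrite !normrM normr_id.
by apply: measurable_funM => //; exact: L2_mble aL.
Qed.

Lemma adm_hart_L2 p : adm p -> L2 (hart p).
Proof. by move=> pA; have [pL _ _] := pA; exact: (bessel (adm_intg pA) pL).1. Qed.

Lemma U_of_hart p : intg mu p -> L2 p -> {ae mu, forall x, U (hart p) x = p x}.
Proof.
move=> pi pL; have hL := (bessel pi pL).1.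
exact: ae_trans (U_ae hL (U_L2 pL) (ae_sym (U_hart pi pL))) (U_invol pL).
Qed.

Lemma adm_U p : adm p -> {ae mu, forall x, U (hart p) x = p x}.
Proof. by move=> pA; have [pL _ _] := pA; exact: U_of_hart (adm_intg pA) pL. Qed.

Lemma adm_hart_even p x : adm p -> hart p (- x) = hart p x.
Proof.
move=> pA; have pi := adm_intg pA; have [_ _ pe] := pA.
rewrite -(hart_opp x pi); apply: Rint_ae.
- exact: (intg_mble (intgK x (intg_opp pi))).
- exact: (intg_mble (intgK x pi)).
- by apply: (aeS pe) => y ->.
Qed.

Lemma adm_H1even p : adm p -> H1even (hart p).
Proof.
move=> pA; have [pL xL pe] := pA; have hL := adm_hart_L2 pA.
split; last by apply: aeW => x; exact: adm_hart_even.
apply/H1P; split=> //; apply: (L2_ae _ xL).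
  by apply: measurable_funM => //; exact: (L2_mble (U_L2 hL)).
by apply: (aeS (adm_U pA)) => x ->.
Qed.

Lemma H1even_adm phi : H1even phi ->
  adm (U phi) /\ {ae mu, forall x, hart (U phi) x = phi x}.
Proof.
move=> [Hphi ev]; have [fL xL] := (H1P phi).1 Hphi; split.
  by split=> //; [exact: U_L2|exact: even_U].
exact: rep_ae fL (H1_UL1 Hphi).
Qed.

Lemma ip_hart p q : adm p -> adm q -> ip (hart p) (hart q) = ip p q.
Proof.
move=> pA qA; have [pL _ _] := pA; have [qL _ _] := qA.
have [hp hq] := (adm_hart_L2 pA, adm_hart_L2 qA).
by rewrite -(U_iso hp hq); exact: (ip_ae (U_L2 hp) pL (U_L2 hq) qL (adm_U pA) (adm_U qA)).
Qed.

(* Cauchy-Schwarz against the weight e^2/(e^2+x^2), of integral pi e. *)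
Lemma L1_norm_sq p e : adm p -> 0 < e ->
  (\int[mu]_x `|p x|) ^+ 2 <= pi * e * (ip p p + e ^- 2 * ip (fun x => x * p x) (fun x => x * p x)).
Proof.
move=> pA e0; have [pL xL _] := pA; have pi_ := adm_intg pA.
have [i1 I1] := Rint_pois 0 e0; set N := \int[mu]_x _; set G := (X in _ * X).
have p0 := pi_gt0 R.
have N0 : 0 <= N by apply: Rint_ge0.
have key s : 0 < s -> 2 * s * N <= s ^+ 2 * (pi * e) + G.
  move=> s0.
  have j1 := intgZ (s ^+ 2 * (pi * e)) i1.
  have j2 := intgD (L2M pL pL) (intgZ (e ^- 2) (L2M xL xL)).
  have le1 : 2 * s * N <= \int[mu]_x (s ^+ 2 * (pi * e) * pois e (x - 0) + (p x * p x + e ^- 2 * (x * p x * (x * p x)))).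
    rewrite -RintZ; last exact: intg_abs.
    apply: le_Rint; [exact/intgZ/intg_abs|exact: intgD|move=> x].
    have d0 : 0 < e ^+ 2 + x ^+ 2 by rewrite ltr_pwDl ?exprn_gt0 ?sqr_ge0.
    have -> : s ^+ 2 * (pi * e) * pois e (x - 0) = s ^+ 2 * (e ^+ 2 / (e ^+ 2 + x ^+ 2)).
      rewrite subr0 /pois; move: (@pi R) p0 => P P0; field.
      by rewrite !gt_eqF.
    rewrite -subr_ge0; set D := (X in 0 <= X).
    have -> : D = (e ^+ 2 + x ^+ 2) / e ^+ 2 * (`|p x| - s * e ^+ 2 / (e ^+ 2 + x ^+ 2)) ^+ 2.
      rewrite /D; have : `|p x| ^+ 2 = p x ^+ 2 by rewrite real_normK ?num_real.
      move: (`|p x|) => P PE.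
      have -> : p x * p x + e ^- 2 * (x * p x * (x * p x)) = (1 + e ^- 2 * x ^+ 2) * P ^+ 2.
        by rewrite PE; ring.
      by field; rewrite !gt_eqF.
    by rewrite mulr_ge0 ?sqr_ge0// divr_ge0 ?sqr_ge0 ?ltW.
  apply: (le_trans le1); rewrite RintD// RintZ//.
  rewrite RintD; [|exact: L2M|exact/intgZ/L2M].
  rewrite (RintZ (e ^- 2) (L2M xL xL)) lerD2r ler_piMr//.
  by rewrite mulr_ge0 ?sqr_ge0// mulr_ge0 ?ltW.
have A0 : 0 < pi * e by rewrite mulr_gt0.
case: (ltgtP N 0) => [|Np|->]; first by rewrite ltNge N0.
  (* This [s] maximises [2 s N - s^2 pi e], so that [key] becomes the asserted product
     inequality. *)
  have s0 : 0 < N / (pi * e) by rewrite divr_gt0.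
  have := key _ s0; move: (pi * e) A0 => A A0; rewrite -(ler_pM2l A0).
  have -> : A * (2 * (N / A) * N) = 2 * N ^+ 2 by field; rewrite gt_eqF.
  have -> : A * ((N / A) ^+ 2 * A + G) = N ^+ 2 + A * G by field; rewrite gt_eqF.
  lra.
rewrite expr0n mulr_ge0 ?(ltW A0)// addr_ge0 ?ip_ge0// mulr_ge0 ?ip_ge0//.
by rewrite invr_ge0 sqr_ge0.
Qed.

Lemma EdE p : adm p -> Ed p = ip p p + ip (fun x => x * p x) (fun x => x * p x).
Proof.
move=> [pL xL _]; rewrite /ip -(RintD (L2M pL pL) (L2M xL xL)).
by apply: eq_Rint => x; ring.
Qed.

Lemma hart_sup p x : adm p -> hart p x ^+ 2 <= pi * Ed p.
Proof.
move=> pA; have := L1_norm_sq pA (ltr01 : 0 < 1 :> R).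
rewrite mulr1 expr1n invr1 mul1r -EdE//; apply: le_trans.
rewrite -[X in X <= _]real_normK ?num_real// ler_sqr ?nnegrE ?Rint_ge0//.
exact: hart_le (adm_intg pA).
Qed.

Lemma hart_bounded p : adm p -> exists B, forall x, `|hart p x| <= B.
Proof. by move=> pA; eexists => x; exact: hart_le (adm_intg pA). Qed.

Lemma hartM_L2 p f : adm p -> L2 f -> L2 (fun x => hart p x * f x).
Proof.
move=> pA fL; have [B pB] := hart_bounded pA; under eq_fun do rewrite mulrC.
by apply: (L2_boundedM fL _ pB); exact: mhart (adm_intg pA).
Qed.

Definition tri p q r : R := \int[mu]_x (hart p x * hart q x * hart r x).
Definition kap p : R := \int[mu]_x (hart p x ^+ 3).

Lemma tri_intg p q r : adm p -> adm q -> adm r -> intg mu (fun x => hart p x * hart q x * hart r x).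
Proof.
move=> pA qA rA; have := L2M (hartM_L2 pA (adm_hart_L2 qA)) (adm_hart_L2 rA).
by [].
Qed.

Lemma kap_tri p : kap p = tri p p p.
Proof. by apply: eq_Rint => x; ring. Qed.

Lemma kap_intg p : adm p -> intg mu (fun x => hart p x ^+ 3).
Proof.
move=> pA; have := tri_intg pA pA pA; congr intg; apply/funext => x; ring.
Qed.

Lemma kapDZ p q t : adm p -> adm q -> kap (fun x => p x + t * q x) =
  kap p + 3 * t * tri p p q + 3 * t ^+ 2 * tri p q q + t ^+ 3 * kap q.
Proof.
move=> pA qA; have pi_ := adm_intg pA; have qi := adm_intg qA.
have i1 := kap_intg pA; have i4 := kap_intg qA.
have i2 := tri_intg pA pA qA; have i3 := tri_intg pA qA qA.
rewrite /kap /tri -(RintZ (3 * t) i2) -(RintZ (3 * t ^+ 2) i3) -(RintZ (t ^+ 3) i4).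
have j2 := intgZ (3 * t) i2; have j3 := intgZ (3 * t ^+ 2) i3; have j4 := intgZ (t ^+ 3) i4.
rewrite -(RintD i1 j2) -(RintD (intgD i1 j2) j3) -(RintD (intgD (intgD i1 j2) j3) j4).
apply: eq_Rint => x; rewrite (hartD x pi_ (intgZ t qi)) (hartZ t x qi); ring.
Qed.

Lemma kapZ c p : adm p -> kap (fun x => c * p x) = c ^+ 3 * kap p.
Proof.
move=> pA; rewrite /kap -(RintZ _ (kap_intg pA)); apply: eq_Rint => x.
by rewrite (hartZ _ _ (adm_intg pA)) exprMn.
Qed.

Lemma kap_ae p q : adm p -> adm q -> {ae mu, forall x, p x = q x} -> kap p = kap q.
Proof.
move=> [pL xpL pe] [qL xqL qe] pq; apply: eq_Rint => x; congr (_ ^+ 3); rewrite /hart.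
have pA : adm p by []; have qA : adm q by [].
apply: Rint_ae; [exact: (intg_mble (intgK x (adm_intg pA)))|exact: (intg_mble (intgK x (adm_intg qA)))|].
by apply: (aeS pq) => y ->.
Qed.

Lemma hart_sqr p : adm p -> intg mu (fun x => c0 * convol p p x) /\ L2 (fun x => c0 * convol p p x) /\
  forall x, hart p x ^+ 2 = hart (fun x => c0 * convol p p x) x.
Proof.
move=> pA; have [pL _ pe] := pA; have pi_ := adm_intg pA.
split; [|split]; [exact/intgZ/conv_intg|exact/L2Z/conv_L2|move=> x].
by rewrite (hartZ c0 _ (conv_intg pL pL pi_ pi_)) (hart_conv pL pL pi_ pi_ x pe) mulVKf ?c0_neq0// expr2.
Qed.

Lemma U_hart_sqr p : adm p ->
  {ae mu, forall x, U (fun y => hart p y ^+ 2) x = c0 * convol p p x}.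
Proof.
move=> pA; have [ci [cL cE]] := hart_sqr pA.
have -> : (fun y => hart p y ^+ 2) = hart (fun x => c0 * convol p p x) by apply/funext.
exact: U_of_hart.
Qed.

Lemma hart_sqr_L2 p : adm p -> L2 (fun x => hart p x ^+ 2).
Proof.
by move=> pA; under eq_fun do rewrite expr2; exact: hartM_L2 (adm_hart_L2 pA).
Qed.

Lemma tri_ip p q : adm p -> adm q -> tri p p q = ip (U (fun x => hart p x ^+ 2)) q.
Proof.
move=> pA qA; have [qL _ _] := qA; have sL := hart_sqr_L2 pA; have hq := adm_hart_L2 qA.
rewrite -(ip_ae (U_L2 sL) (U_L2 sL) (U_L2 hq) qL (ae_refl _) (adm_U qA)) (U_iso sL hq).
by apply: eq_Rint => x; rewrite expr2.
Qed.

Lemma kap_conv p : adm p -> kap p = \int[mu]_x (c0 * convol p p x * p x).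
Proof.
move=> pA; have [pL _ _] := pA; have [_ [cL _]] := hart_sqr pA.
rewrite kap_tri (tri_ip pA pA).
exact: (ip_ae (U_L2 (hart_sqr_L2 pA)) cL pL pL (U_hart_sqr pA) (ae_refl _)).
Qed.

(** In convolution form the cubic integral is a trilinear integral of [p] with the positive constant
    [c0], so the triangle inequality applies. *)
Lemma kap_abs p : adm p -> kap p <= kap (fun x => `|p x|).
Proof.
move=> pA; have aA := adm_abs pA; have [pL _ _] := pA; have [aL _ _] := aA.
have [_ [cL _]] := hart_sqr pA; have [_ [caL _]] := hart_sqr aA.
rewrite (kap_conv pA) (kap_conv aA); apply: le_Rint; [exact: L2M|exact: L2M|move=> x].
rewrite -!mulrA ler_wpM2l ?(ltW (@c0_gt0 R))//.
apply: (le_trans (ler_norm _)); rewrite normrM ler_wpM2r//.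
have i := conv_intg_pt x pL pL; apply: (le_trans (le_normr_Rint i)).
apply: le_Rint; [exact: intg_abs|exact: (conv_intg_pt x aL aL)|move=> y].
by rewrite normrM.
Qed.

Lemma kap_le p B : adm p -> (forall x, hart p x <= B) -> kap p <= B * ip p p.
Proof.
move=> pA pB; have hL := adm_hart_L2 pA; rewrite -(ip_hart pA pA) -RintZ; last exact: L2M.
apply: le_Rint; [exact: kap_intg|exact/intgZ/L2M|move=> x].
by rewrite exprS -expr2 ler_wpM2r ?sqr_ge0.
Qed.

(** For even [p] only the cosine part of the kernel contributes, and with nonnegative weight it is
    largest at the origin. *)
Lemma hart_max p x : adm p -> (forall y, 0 <= p y) -> hart p x <= hart p 0.
Proof.
move=> pA p0; have pi_ := adm_intg pA; have [_ _ pe] := pA.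
have sin0' z : \int[mu]_y (p y * sin (z * y)) = 0.
  apply: Rint_odd_ae; last by apply: (aeS pe) => y ->; rewrite mulrN sinN mulrN.
  by apply: (intg_boundedM (C := 1) pi_); [exact: msinM|move=> w; exact: sin_max].
have ci z : intg mu (fun y => p y * cos (z * y)).
  by apply: (intg_boundedM (C := 1) pi_); [exact: mcosM|move=> w; exact: cos_max].
rewrite !(hart_cos_sin pi_) !sin0' !addr0 ler_wpM2l ?(ltW (@c0_gt0 R))//.
apply: le_Rint => // y; rewrite ler_wpM2l// mul0r cos0.
exact: le_trans (ler_norm _) (cos_max _).
Qed.

End CubicFunctional.

(** * Weak convergence in H^1 and the Brezis-Lieb splitting *)

Section WeakLimits.
Context {R : realType}.
Local Notation mu := (@lebesgue_measure R).
Implicit Types (f g h k p q r u v phi psi : R -> R) (x y xi a b c e t al be C : R).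

(** Multiplication by [om] maps the weighted space of transforms of H^1 isometrically to L^2, so
    that weak compactness in H^1 is that of L^2. *)
Definition om x : R := Num.sqrt (1 + x ^+ 2).

Lemma om_gt0 x : 0 < om x.
Proof. by rewrite sqrtr_gt0 den_gt0. Qed.

Lemma om_neq0 x : om x != 0.
Proof. by rewrite gt_eqF ?om_gt0. Qed.

Lemma om_sqr x : om x ^+ 2 = 1 + x ^+ 2.
Proof. by rewrite sqr_sqrtr// ltW ?den_gt0. Qed.

Lemma omN x : om (- x) = om x.
Proof. by rewrite /om sqrrN. Qed.

Lemma om_cont : continuous om.
Proof.
move=> x; apply: continuous_comp; last exact: sqrt_continuous.
by apply: cvgD; [exact: cvg_cst|apply: cvgM; exact: cvg_id].
Qed.

Lemma mom : measurable_fun setT om.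
Proof. exact: continuous_measurable_fun om_cont. Qed.

Lemma momV : measurable_fun setT (fun x => (om x)^-1).
Proof.
by apply: continuous_measurable_fun => x; apply: cvgV; [exact: om_neq0|exact: om_cont].
Qed.

Lemma om_ge1 x : 1 <= om x.
Proof. by rewrite -[X in X <= _]sqrtr1 ler_wsqrtr// lerDl sqr_ge0. Qed.

Lemma om_geN x : `|x| <= om x.
Proof. by rewrite -sqrtr_sqr ler_wsqrtr// lerDr. Qed.

Lemma L2_om p : L2 p -> L2 (fun x => x * p x) -> L2 (fun x => om x * p x).
Proof.
move=> pL xL; apply/L2P; split; first by apply: measurable_funM; [exact: mom|exact: L2_mble].
by under eq_fun do rewrite exprMn om_sqr; exact: Ed_intg.
Qed.

Lemma adm_om p : adm p -> L2 (fun x => om x * p x).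
Proof. by case=> pL xL _; exact: L2_om. Qed.

Lemma om_adm h : L2 h -> {ae mu, forall x, h (- x) = h x} -> adm (fun x => h x / om x).
Proof.
move=> hL he; have mh := L2_mble hL; split.
- apply: (L2_dom1 _ hL) => [|x]; first by apply: measurable_funM => //; exact: momV.
  by rewrite normrM normfV (gtr0_norm (om_gt0 x)) ler_pdivrMr ?om_gt0// ler_peMr// om_ge1.
- apply: (L2_dom1 _ hL) => [|x].
    by apply: measurable_funM => //; apply: measurable_funM => //; exact: momV.
  rewrite !normrM normfV (gtr0_norm (om_gt0 x)) mulrCA ler_piMr//.
  by rewrite ler_pdivrMr ?om_gt0// mul1r om_geN.
- by apply: (aeS he) => x ->; rewrite omN.
Qed.

Lemma om_invL2 k C : measurable_fun setT k -> (forall x, `|k x| <= C) -> L2 (fun x => k x / om x).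
Proof.
move=> mk kC; apply/L2P; split; first by apply: measurable_funM => //; exact: momV.
apply: (intg_domC (C := C ^+ 2) _ intg_den) => [|x].
  by apply: measurable_funX; apply: measurable_funM => //; exact: momV.
rewrite exprMn exprVn om_sqr normrM [X in X * _]ger0_norm ?sqr_ge0// ler_wpM2r//.
rewrite -[k x ^+ 2]real_normK ?num_real// ler_sqr// nnegrE//.
exact: le_trans (normr_ge0 _) (kC x).
Qed.

Definition wcvg_om (p_ : nat -> R -> R) p :=
  forall g, L2 g -> ip (fun x => om x * p_ n x) g @[n --> \oo] --> ip (fun x => om x * p x) g.

Lemma Ed_om p : Ed p = ip (fun x => om x * p x) (fun x => om x * p x).
Proof. by apply: eq_Rint => x; rewrite -expr2 exprMn om_sqr. Qed.

Lemma wcvg_om_int (p_ : nat -> R -> R) p k : wcvg_om p_ p -> L2 (fun x => k x / om x) ->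
  \int[mu]_x (p_ n x * k x) @[n --> \oo] --> \int[mu]_x (p x * k x).
Proof.
move=> W kL; have := W _ kL.
have E q : ip (fun x => om x * q x) (fun x => k x / om x) = \int[mu]_x (q x * k x).
  by apply: eq_Rint => x; field; exact: om_neq0.
by under eq_fun do rewrite E; rewrite E.
Qed.

(** Point evaluation is weakly continuous on H^1: the kernel divided by [om] is in L^2. *)
Lemma wcvg_hart (p_ : nat -> R -> R) p x : wcvg_om p_ p -> hart (p_ n) x @[n --> \oo] --> hart p x.
Proof.
by move=> W; apply: (wcvg_om_int W); apply: (om_invL2 (C := 1)) => [|y]; [exact: mK'|exact: K_bound].
Qed.

Lemma weak_adm (p_ : nat -> R -> R) C : (forall n, adm (p_ n)) -> (forall n, Ed (p_ n) <= C) ->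
  exists s p, [/\ {homo s : m n / (m < n)%N}, adm p & wcvg_om (fun n => p_ (s n)) p].
Proof.
move=> pA pC.
have hL n : L2 (fun x => om x * p_ n x) by exact: adm_om.
have [|s [h [sm hL' W]]] := @weak_compactness R (fun n x => om x * p_ n x) C hL.
  by move=> n; rewrite -Ed_om.
exists s, (fun x => h x / om x).
have E : (fun x => om x * (h x / om x)) = h.
  by apply/funext => x; rewrite mulrCA divff ?mulr1 ?om_neq0.
split=> //; last by move=> g gL; rewrite E; exact: W.
apply: om_adm => //; have hoL := L2_opp hL'.
(* Evenness passes to the weak limit because pairing an even function with [g] or with its
   reflection gives the same number. *)
apply: (ip_dist_eq0_ae hoL hL'); have gL := L2B hoL hL'.
rewrite ipBl// (ip_oppl hL' gL); apply/eqP; rewrite subr_eq0; apply/eqP.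
have goL := L2_opp gL; set g := fun x => _ in gL goL *.
have c1 := W _ goL; have c2 := W _ gL.
have EE : (fun n => ip (fun x => om x * p_ (s n) x) (fun x => g (- x))) =
    (fun n => ip (fun x => om x * p_ (s n) x) g).
  apply/funext => n; rewrite -(ip_oppl (hL (s n)) gL).
  apply: (ip_ae (L2_opp (hL (s n))) (hL (s n)) gL gL _ (ae_refl _)).
  by have [_ _ e] := pA (s n); apply: (aeS e) => x ex; rewrite omN ex.
rewrite EE in c1; exact: (cvg_unique _ c1 c2).
Qed.

Lemma Ed_ge0 p : 0 <= Ed p.
Proof. by rewrite Ed_om ip_ge0. Qed.

Lemma ip_le_Ed p : adm p -> ip p p <= Ed p.
Proof. by move=> pA; rewrite EdE// lerDl ip_ge0. Qed.

(** The defect is the integral of [3 f f_n (f_n - f)]. The factor [f (f_n - f)] tends to 0 in L^2 by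
    dominated convergence, thanks to pointwise convergence and a uniform bound, and [f_n] is bounded
    in L^2. *)
Lemma brezis_lieb (p_ : nat -> R -> R) p C : (forall n, adm (p_ n)) -> (forall n, Ed (p_ n) <= C) ->
  adm p -> wcvg_om p_ p ->
  kap (p_ n) - kap p - kap (fun x => p_ n x - p x) @[n --> \oo] --> (0 : R).
Proof.
move=> pA pC qA W; pose D n x := hart p x * (hart (p_ n) x - hart p x).
have dL n : L2 (fun x => hart (p_ n) x - hart p x) by apply: L2B; exact: adm_hart_L2.
have DL n : L2 (D n) by exact: hartM_L2.
have E n : kap (p_ n) - kap p - kap (fun x => p_ n x - p x) = 3 * ip (D n) (hart (p_ n)).
  have i := L2M (DL n) (adm_hart_L2 (pA n)); have rA := adm_B (pA n) qA.
  have i1 := kap_intg (pA n); have i2 := kap_intg qA; have i3 := kap_intg rA.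
  rewrite -(RintZ _ i) -(RintB i1 i2) -(RintB (intgB i1 i2) i3); apply: eq_Rint => x.
  by rewrite (hartB x (adm_intg (pA n)) (adm_intg qA)) /D; ring.
suff z : 3 * ip (D n) (hart (p_ n)) @[n --> \oo] --> (3 * 0 : R).
  by rewrite mulr0 in z; under eq_fun do rewrite E.
apply: cvgM; first exact: cvg_cst.
have Dz : ip (D n) (D n) @[n --> \oo] --> (0 : R).
  rewrite -[X in _ --> X](@Rintegral0 _ _ _ mu).
  have bnd n x : (hart (p_ n) x - hart p x) ^+ 2 <= 2 * (pi * C) + 2 * (pi * Ed p).
    have h1 := hart_sup x (pA n); have h2 := hart_sup x qA.
    have h3 : pi * Ed (p_ n) <= pi * C by rewrite ler_pM2l ?pi_gt0.
    by have := sqr_ge0 (hart (p_ n) x + hart p x); nra.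
  apply: (@dominated_Rint _ _ _ mu (fun n x => D n x * D n x) (fun=> 0)
    (fun x => (2 * (pi * C) + 2 * (pi * Ed p)) * hart p x ^+ 2) _ _ _ _).2.
  - by move=> n; exact: (intg_mble (L2M (DL n) (DL n))).
  - exact: (intgZ _ (L2_sqr (adm_hart_L2 qA))).
  - move=> n x; rewrite -expr2 ger0_norm ?sqr_ge0// /D exprMn mulrC.
    by rewrite ler_wpM2r ?sqr_ge0.
  - move=> x; rewrite -[X in _ --> X](mulr0 0).
    have z : D n x @[n --> \oo] --> (0 : R).
      rewrite /D -[X in _ --> X](mulr0 (hart p x)); apply: cvgM; first exact: cvg_cst.
      rewrite -[X in _ --> X](subrr (hart p x)); apply: cvgB; last exact: cvg_cst.
      exact: wcvg_hart.
    exact: cvgM.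
have C0 : 0 <= C by apply: le_trans (pC 0%N); exact: Ed_ge0.
apply/norm_cvg0P; apply: (@squeeze_cvgr _ _ _ _ (fun=> 0) (fun n => Num.sqrt (ip (D n) (D n)) * Num.sqrt C)).
- apply: nearW => n; rewrite normr_ge0 /=; apply: (le_trans (CS_nrm (DL n) (adm_hart_L2 (pA n)))).
  rewrite ler_wpM2l ?sqrtr_ge0// ler_wsqrtr// (ip_hart (pA n) (pA n)).
  exact: le_trans (ip_le_Ed (pA n)) (pC n).
- exact: cvg_cst.
- by rewrite -(mul0r (Num.sqrt C)); apply: cvgM; [exact: sqrt_cvg0|exact: cvg_cst].
Qed.

End WeakLimits.

(** * The quadratic energy and its coercivity *)

Section Energy.
Context {R : realType}.
Local Notation mu := (@lebesgue_measure R).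
Implicit Types (f g h k p q r u v phi psi : R -> R) (x y xi a b c e t al be C : R).

Definition Eb al be p q : R := \int[mu]_x (p x * (sym al be x * q x)).

Lemma sym_om_L2 al be q : adm q -> L2 (fun x => sym al be x * q x / om x).
Proof.
move=> qA; have oL := adm_om qA; have [qL _ _] := qA.
apply: (L2_dom (C := 1 + `|be| + `|al|) _ oL) => [|x].
  by apply: measurable_funM; [apply: measurable_funM; [exact: msym|exact: L2_mble]|exact: momV].
rewrite !normrM normfV (gtr0_norm (om_gt0 x)) ler_pdivrMr ?om_gt0//.
have -> : (1 + `|be| + `|al|) * (om x * `|q x|) * om x = (1 + `|be| + `|al|) * om x ^+ 2 * `|q x|.
  by ring.
by rewrite om_sqr ler_wpM2r// sym_bound.
Qed.

Lemma Eb_intg al be p q : adm p -> adm q -> intg mu (fun x => p x * (sym al be x * q x)).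
Proof.
move=> pA qA; have := L2M (adm_om pA) (sym_om_L2 al be qA); congr intg; apply/funext => x.
by field; exact: om_neq0.
Qed.

Lemma Eb_wcvg al be (p_ : nat -> R -> R) p q : adm q -> wcvg_om p_ p ->
  Eb al be (p_ n) q @[n --> \oo] --> Eb al be p q.
Proof. by move=> qA W; apply: (wcvg_om_int W); exact: sym_om_L2. Qed.

Lemma En_Eb al be p : En al be p = Eb al be p p.
Proof. by apply: eq_Rint => x; ring. Qed.

Lemma EnDZ al be p q t : adm p -> adm q ->
  En al be (fun x => p x + t * q x) = En al be p + 2 * t * Eb al be p q + t ^+ 2 * En al be q.
Proof.
move=> pA qA; rewrite !En_Eb; have i1 := Eb_intg al be pA pA.
have i2 := Eb_intg al be pA qA; have i3 := Eb_intg al be qA qA.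
rewrite /Eb -(RintZ (2 * t) i2) -(RintZ (t ^+ 2) i3) -(RintD i1 (intgZ _ i2)).
rewrite -(RintD (intgD i1 (intgZ _ i2)) (intgZ _ i3)).
by apply: eq_Rint => x; ring.
Qed.

Lemma EnZ al be p t : adm p -> En al be (fun x => t * p x) = t ^+ 2 * En al be p.
Proof.
move=> pA; rewrite !En_Eb /Eb -(RintZ _ (Eb_intg al be pA pA)).
by apply: eq_Rint => x; ring.
Qed.

Lemma EnB al be p q : adm p -> adm q ->
  En al be (fun x => p x - q x) = En al be p - 2 * Eb al be p q + En al be q.
Proof.
move=> pA qA; have := EnDZ al be (-1) pA qA.
have -> : (fun x => p x + -1 * q x) = (fun x => p x - q x) by apply/funext => x; rewrite mulN1r.
by move=> ->; ring.
Qed.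

Lemma En_abs al be p : En al be (fun x => `|p x|) = En al be p.
Proof. by apply: eq_Rint => x; rewrite real_normK ?num_real. Qed.

Lemma En_ae al be p q : adm p -> adm q -> {ae mu, forall x, p x = q x} -> En al be p = En al be q.
Proof.
move=> pA qA pq; rewrite !En_Eb; apply: Rint_ae.
- exact: (intg_mble (Eb_intg al be pA pA)).
- exact: (intg_mble (Eb_intg al be qA qA)).
- by apply: (aeS pq) => x ->.
Qed.

Definition coercive al be c := 0 < c /\ forall x, c * (1 + x ^+ 2) <= sym al be x.

Lemma En_coercive al be c p : coercive al be c -> adm p -> c * Ed p <= En al be p.
Proof.
move=> [c0 cs] pA; have [pL xL _] := pA.
rewrite /Ed -RintZ; last exact: Ed_intg.
apply: le_Rint; [exact/intgZ/Ed_intg|exact: En_intg|move=> x].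
by rewrite mulrA ler_wpM2r ?sqr_ge0.
Qed.

(** With [s = sqrt al] and [th = max 0 (- be / (2 s))], the symbol is at least
    [(1 - th) (1 + al x^2) + th (1 - s |x|)^2]. The condition on [be] is [th < 1]. *)
Lemma coercive_ex al be : 0 < al -> - 2 * Num.sqrt al < be -> exists c, coercive al be c.
Proof.
move=> a0 bs; have s0 : 0 < Num.sqrt al by rewrite sqrtr_gt0.
have sE : Num.sqrt al ^+ 2 = al by rewrite sqr_sqrtr ?ltW.
set s := Num.sqrt al in bs s0 sE.
pose th := Num.max 0 (- be / (2 * s)); pose m := Num.min 1 al.
have th0 : 0 <= th by rewrite /th le_max lexx.
have th1 : th < 1 by rewrite /th gt_max ltr01/= ltr_pdivrMr ?mulr_gt0//; lra.
have thb : - be <= th * (2 * s).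
  by rewrite -ler_pdivrMr ?mulr_gt0// /th le_max lexx orbT.
have m0 : 0 < m by rewrite /m lt_min ltr01.
have m1 : m <= 1 by rewrite /m ge_min lexx.
have ma : m <= al by rewrite /m ge_min lexx orbT.
exists ((1 - th) * m); split=> [|x]; first by rewrite mulr_gt0// subr_gt0.
rewrite /sym; have x0 := normr_ge0 x; have xE : x ^+ 2 = `|x| ^+ 2 by rewrite real_normK ?num_real.
rewrite xE; move: `|x| x0 => y y0.
have e1 : - (th * (2 * s)) * y <= be * y by rewrite ler_wpM2r//; lra.
have e2 : m * (1 + y ^+ 2) <= 1 + al * y ^+ 2.
  by have := sqr_ge0 y => y2; have := ler_wpM2r y2 ma; lra.
have e3 : (1 - th) * (m * (1 + y ^+ 2)) <= (1 - th) * (1 + al * y ^+ 2).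
  by rewrite ler_wpM2l// subr_ge0 ltW.
have e4 : 0 <= th * (1 - s * y) ^+ 2 by rewrite mulr_ge0 ?sqr_ge0.
have e5 : th * (1 - s * y) ^+ 2 = th - th * (2 * s) * y + th * (al * y ^+ 2).
  by rewrite -sE; ring.
rewrite -mulrA; lra.
Qed.

End Energy.

(** * Maximisers, their Euler-Lagrange equation and ground states *)

Section Existence.
Context {R : realType}.
Local Notation mu := (@lebesgue_measure R).
Implicit Types (f g h k p q r u v phi psi : R -> R) (x y xi a b c e t al be C : R).

Lemma bo_hat_adm : adm (@bo_hat R).
Proof.
have [[Hq _] _ _] := @Q_BO_soliton R; have [qL xL] := (H1P _).1 Hq.
have hL := @bo_hat_L2 R; split=> //; last by apply: aeW => x; exact: bo_hatN.
apply: (L2_ae _ xL); first by apply: measurable_funM => //; exact: (L2_mble hL).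
by apply: (aeS U_Q_BO) => x ->.
Qed.

(** Some admissible function must have a positive cubic integral for the supremum to be positive;
    the profile [Q_BO] serves for all parameters. *)
Lemma kap_bo_hat : 0 < kap (@bo_hat R).
Proof.
have qp x : 0 < Q_BO x :> R by rewrite /Q_BO divr_gt0// den_gt0.
have nn x : 0 <= hart (@bo_hat R) x ^+ 3 by rewrite hart_bo_hat exprn_ge0// ltW.
rewrite lt_neqAle Rint_ge0// andbT; apply/negP => /eqP e.
have z := Rint_eq0_ae (kap_intg bo_hat_adm) nn (esym e).
have [_ _] := @Q_BO_soliton R; apply; apply: (aeS z) => x /eqP.
by rewrite hart_bo_hat expf_eq0/= => /eqP.
Qed.

Lemma kap_bound p : adm p -> kap p <= Num.sqrt (pi * Ed p) * Ed p.
Proof.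
move=> pA; have b x : hart p x <= Num.sqrt (pi * Ed p).
  apply: (le_trans (ler_norm _)); rewrite -sqrtr_sqr ler_wsqrtr//.
  exact: hart_sup.
apply: (le_trans (kap_le pA b)); rewrite ler_wpM2l ?sqrtr_ge0//.
exact: ip_le_Ed.
Qed.

Lemma poly_min (a b c e : R) : (forall t, 0 <= a * t + b * t ^+ 2 + c * t ^+ 3 + e * t ^+ 4) -> a = 0.
Proof.
have half (a' b' c' e' : R) : (forall t, 0 <= a' * t + b' * t ^+ 2 + c' * t ^+ 3 + e' * t ^+ 4) -> 0 <= a'.
  move=> H; rewrite leNgt; apply/negP => a0.
  pose G := `|b'| + `|c'| + `|e'|; have G0 : 0 <= G by rewrite !addr_ge0.
  have d0 : 0 < G + 1 - a' by lra.
  (* Chosen so that [t <= 1] and [a' + t G = - t (1 - a') < 0], which makes the polynomial negative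
     at [t]. *)
  pose t := - a' / (G + 1 - a'); have t0 : 0 < t by rewrite divr_gt0// oppr_gt0.
  have t1 : t <= 1 by rewrite ler_pdivrMr//; lra.
  have tE : t * (G + 1 - a') = - a' by rewrite mulfVK ?gt_eqF.
  have := H t; have -> : a' * t + b' * t ^+ 2 + c' * t ^+ 3 + e' * t ^+ 4 =
    t * (a' + t * (b' + c' * t + e' * t ^+ 2)) by ring.
  rewrite pmulr_rge0// => h.
  have : b' + c' * t + e' * t ^+ 2 <= G.
    rewrite /G; apply: lerD; [apply: lerD; first exact: ler_norm|].
      apply: (le_trans (ler_norm _)); by rewrite normrM ler_piMr// ger0_norm ?(ltW t0).
    apply: (le_trans (ler_norm _)); rewrite normrM ler_piMr// ger0_norm ?sqr_ge0//.
    by rewrite expr_le1// ltW.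
  move=> hG; have : t * (b' + c' * t + e' * t ^+ 2) <= t * G by rewrite ler_pM2l.
  by move: tE => + ?; have := mulr_gt0 t0 (ltr01 : 0 < 1 :> R); nra.
move=> H; apply/le_anti; rewrite (half a b c e H) andbT -oppr_ge0.
apply: (half _ b (- c) e) => t; have := H (- t).
by rewrite (_ : a * - t + b * (- t) ^+ 2 + c * (- t) ^+ 3 + e * (- t) ^+ 4 =
  - a * t + b * t ^+ 2 + - c * t ^+ 3 + e * t ^+ 4)//; ring.
Qed.

Section Maximizer.
Context (al be c : R) (co : coercive al be c).

Local Notation E := (En al be).

Lemma En_ge0 p : adm p -> 0 <= E p.
Proof.
move=> pA; apply: le_trans (En_coercive co pA); have [c0 _] := co.
by rewrite mulr_ge0 ?Ed_ge0// ltW.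
Qed.

Lemma Ed_le p : adm p -> Ed p <= E p / c.
Proof. by move=> pA; rewrite ler_pdivlMr ?co.1// mulrC; exact: En_coercive. Qed.

Definition best : R := sup [set kap p | p in [set p | adm p /\ E p <= 1]].

Lemma best_has_sup : has_sup [set kap p | p in [set p | adm p /\ E p <= 1]].
Proof.
have [c0 _] := co; split.
  exists (kap (fun x => 0 * @bo_hat R x)), (fun x => 0 * @bo_hat R x) => //.
  have A := adm_Z 0 bo_hat_adm; split=> //.
  by rewrite (EnZ _ _ _ bo_hat_adm) expr0n mul0r.
exists (Num.sqrt (pi * c^-1) * c^-1) => _ [p [pA pE] <-].
have h : Ed p <= c^-1.
  by apply: (le_trans (Ed_le pA)); rewrite ler_piMl// invr_ge0 ltW.
apply: (le_trans (kap_bound pA)); apply: ler_pM; rewrite ?sqrtr_ge0 ?Ed_ge0//.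
by rewrite ler_wsqrtr// ler_pM2l// pi_gt0.
Qed.

Lemma best_ge p : adm p -> E p <= 1 -> kap p <= best.
Proof. by move=> pA pE; apply: (ub_le_sup best_has_sup.2); exists p. Qed.

(** The cubic and quadratic homogeneities extend the bound from the unit ball; when the energy is
    zero, coercivity makes the cubic integral nonpositive as well. *)
Lemma kap_le_best p : adm p -> kap p <= best * (E p * Num.sqrt (E p)).
Proof.
move=> pA; have := En_ge0 pA; rewrite le_eqVlt => /predU1P[E0|E0].
  rewrite -E0 mul0r mulr0; apply: (le_trans (kap_bound pA)).
  have -> : Ed p = 0.
    by apply/le_anti; rewrite Ed_ge0 andbT; have := Ed_le pA; rewrite -E0 mul0r.
  by rewrite !mulr0.
set s := Num.sqrt (E p); have s0 : 0 < s by rewrite sqrtr_gt0.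
have sE : s ^+ 2 = E p by rewrite sqr_sqrtr ?ltW.
have := best_ge (adm_Z s^-1 pA); rewrite (EnZ _ _ _ pA) (kapZ _ pA) -sE exprVn mulVf; last first.
  by rewrite expf_neq0// gt_eqF.
move=> /(_ (lexx _)); rewrite exprVn ler_pdivrMl ?exprn_gt0//.
by rewrite mulrC -exprSr.
Qed.

Lemma best_gt0 : 0 < best.
Proof.
have A := @bo_hat_adm; have := kap_le_best A; have := kap_bo_hat => k0 kl.
have := lt_le_trans k0 kl; rewrite pmulr_lgt0//.
have := En_ge0 A; rewrite le_eqVlt => /predU1P[e0|e0].
  by move: (lt_le_trans k0 kl); rewrite -e0 mul0r mulr0 ltxx.
by rewrite mulr_gt0 ?sqrtr_gt0.
Qed.

Lemma homo_ge_id (s : nat -> nat) : {homo s : m n / (m < n)%N} -> forall n, (n <= s n)%N.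
Proof.
move=> sm; elim=> // n ih; exact: leq_ltn_trans ih (sm _ _ (ltnSn n)).
Qed.

Lemma split_energy e : 0 < e -> e <= 1 -> 1 <= e * Num.sqrt e + (1 - e) * Num.sqrt (1 - e) -> e = 1.
Proof.
move=> e0; rewrite le_eqVlt => /predU1P[//|e1] H; exfalso.
have s1 : Num.sqrt e < 1 by rewrite -[X in _ < X]sqrtr1 ltr_sqrt.
have s2 : Num.sqrt (1 - e) <= 1 by rewrite -[X in _ <= X]sqrtr1 ler_wsqrtr//; lra.
have h1 : e * Num.sqrt e < e * 1 by rewrite ltr_pM2l.
have h2 : (1 - e) * Num.sqrt (1 - e) <= (1 - e) * 1 by rewrite ler_wpM2l//; lra.
lra.
Qed.

Lemma maximizing_sequence : exists p_ : nat -> R -> R, forall n,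
  [/\ adm (p_ n), E (p_ n) <= 1, forall x, 0 <= p_ n x & best - n.+1%:R^-1 <= kap (p_ n)].
Proof.
have H n : exists p, [/\ adm p, E p <= 1, forall x, 0 <= p x & best - n.+1%:R^-1 <= kap p]; last first.
  by have [p_ pP] := choice H; exists p_.
have e0 : 0 < n.+1%:R^-1 :> R by rewrite invr_gt0.
have [_ [p [pA pE] <-] pk] := sup_adherent e0 best_has_sup.
exists (fun x => `|p x|); split; [exact: adm_abs|by rewrite En_abs|by move=> x|].
exact: le_trans (ltW pk) (kap_abs pA).
Qed.

Lemma maximizer : exists p, [/\ adm p, forall x, 0 <= p x, E p = 1 & kap p = best].
Proof.
have [c0 _] := co; have [p0_ p0P] := maximizing_sequence.
have pC n : Ed (p0_ n) <= c^-1.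
  have [pA pE _ _] := p0P n; apply: (le_trans (Ed_le pA)).
  by rewrite ler_piMl// invr_ge0 ltW.
have [|s [p [sm pA W]]] := weak_adm _ pC; first by move=> n; have [] := p0P n.
set q_ := fun n => p0_ (s n) in W.
have qA n : adm (q_ n) by have [] := p0P (s n).
have qE n : E (q_ n) <= 1 by have [] := p0P (s n).
have q0 n x : 0 <= q_ n x by have [_ _ h _] := p0P (s n); exact: h.
have qk n : best - n.+1%:R^-1 <= kap (q_ n).
  have [_ _ _] := p0P (s n); apply: le_trans; rewrite lerD2l lerN2 lef_pV2 ?posrE//.
  by rewrite ler_nat ltnS; exact: homo_ge_id.
have qC n : Ed (q_ n) <= c^-1 by exact: pC.
have bl := brezis_lieb qA qC pA W.
have bc := @Eb_wcvg R al be q_ p p pA W; rewrite -En_Eb in bc.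
set e := E p in bc.
(* The energy of [q_ n - p] is not known to converge. The bound obtained from [E (q_ n) <= 1] does,
   and its limit [1 - e] is all that the splitting requires. *)
pose m n := 1 + e - 2 * Eb al be (q_ n) p.
have mc : m n @[n --> \oo] --> 1 - e.
  have -> : 1 - e = 1 + e - 2 * e by ring.
  by apply: cvgB; [exact: cvg_cst|apply: cvgM; [exact: cvg_cst|exact: bc]].
have rA n : adm (fun x => q_ n x - p x) by exact: adm_B.
have rm n : E (fun x => q_ n x - p x) <= m n.
  by rewrite (EnB _ _ (qA n) pA) /m -/e; have := qE n; lra.
have m0 n : 0 <= m n by apply: le_trans (rm n); exact: En_ge0.
have e1 : e <= 1.
  have zc : (fun _ : nat => (0 : R)) n @[n --> \oo] --> (0 : R) by exact: cvg_cst.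
  by rewrite -subr_ge0; apply: (ler_cvg_to zc mc); exact: nearW.
have F_cvg : m n * Num.sqrt (m n) @[n --> \oo] --> (1 - e) * Num.sqrt (1 - e).
  by apply: cvgM => //; apply: continuous_cvg => //; exact: sqrt_continuous.
have kr n : kap (fun x => q_ n x - p x) <= best * (m n * Num.sqrt (m n)).
  apply: (le_trans (kap_le_best (rA n))); rewrite ler_pM2l ?best_gt0//.
  apply: ler_pM; rewrite ?sqrtr_ge0 ?En_ge0//; exact: ler_wsqrtr.
have key : best <= kap p + best * ((1 - e) * Num.sqrt (1 - e)).
  pose lhs n : R := best - n.+1%:R^-1.
  pose rhs n : R := kap p + best * (m n * Num.sqrt (m n)) + (kap (q_ n) - kap p - kap (fun x => q_ n x - p x)).
  have l1 : lhs n @[n --> \oo] --> best - 0.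
    by apply: cvgB; [exact: cvg_cst|exact: cvg_harmonic].
  have l2 : rhs n @[n --> \oo] --> kap p + best * ((1 - e) * Num.sqrt (1 - e)) + 0.
    apply: cvgD => //; apply: cvgD; first exact: cvg_cst.
    by apply: cvgM => //; exact: cvg_cst.
  rewrite subr0 in l1; rewrite addr0 in l2.
  apply: (ler_cvg_to l1 l2); apply: nearW => n; rewrite /lhs /rhs.
  have := qk n; have := kr n; move: (n.+1%:R^-1) (kap (fun x => _)) (kap (q_ n)) (m n * _).
  by move=> d k1 k2 w; move: (best * w) => z; lra.
(* Vanishing is excluded at the origin: [kap (q_ n)] is at most the maximum [hart (q_ n) 0] times
   the squared L^2 norm, itself at most [1 / c]. So the values at 0 stay above [best * c] in the
   limit. *)
have e0 : 0 < e.
  have h0 : best * c <= hart p 0.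
    have l1 : (best - n.+1%:R^-1) * c @[n --> \oo] --> (best - 0) * c.
      by apply: cvgM; [apply: cvgB; [exact: cvg_cst|exact: cvg_harmonic]|exact: cvg_cst].
    rewrite subr0 in l1.
    have l2 : hart (q_ n) 0 @[n --> \oo] --> hart p 0 by exact: wcvg_hart.
    apply: (ler_cvg_to l1 l2); apply: nearW => n.
    have hmax y := hart_max y (qA n) (q0 n).
    have h0 : 0 <= hart (q_ n) 0.
      by apply: Rint_ge0 => y; rewrite mulr_ge0// /K mulr0 cos0 sin0 addr0 mulr1 ltW// c0_gt0.
    rewrite -ler_pdivlMr//; apply: (le_trans (qk n)); apply: (le_trans (kap_le (qA n) hmax)).
    rewrite ler_wpM2l//; exact: le_trans (ip_le_Ed (qA n)) (qC n).
  rewrite lt_neqAle (En_ge0 pA) andbT; apply/negP => /eqP z.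
  have Ed0 : Ed p = 0.
    by apply/le_anti; rewrite Ed_ge0 andbT; have := Ed_le pA; rewrite -/e -z mul0r.
  have := hart_sup 0 pA; rewrite Ed0 mulr0.
  have : 0 < best * c by rewrite mulr_gt0 ?best_gt0.
  by move=> h1; have := lt_le_trans h1 h0 => h2; rewrite leNgt exprn_gt0.
have ke := kap_le_best pA; rewrite -/e in ke.
have e_1 : e = 1.
  apply: split_energy => //; have := best_gt0; have := le_trans key (lerD ke (lexx _)).
  by rewrite -mulrDr => h b0; move: h; rewrite ler_pMr.
have kp : kap p = best.
  apply/le_anti; move: ke key; rewrite e_1 subrr mul0r sqrtr1 mulr1 !mulr1 mulr0 addr0.
  by move=> -> ->.
(* Passing to the absolute value provides the sign at every point without examining that of the weak
   limit. *)
exists (fun x => `|p x|); split; [exact: adm_abs|by move=> x|by rewrite En_abs|].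
apply/le_anti; rewrite (best_ge (adm_abs pA)) ?En_abs -/e ?e_1//=.
by rewrite -kp; exact: kap_abs.
Qed.

(* Since sqrt E <= (1 + E)/2 with equality at E = 1, p also maximises
   kap - best E (1 + E)/2, which is polynomial along every line. *)
Lemma euler_lagrange p : adm p -> E p = 1 -> kap p = best ->
  {ae mu, forall x, best * sym al be x * p x = U (fun y => hart p y ^+ 2) x}.
Proof.
move=> pA pE pk; have b0 := best_gt0.
have first_order q : adm q -> best * Eb al be p q = tri p p q.
  move=> qA; pose B := Eb al be p q; pose T := tri p p q.
  (* This is the derivative at [t = 0] of [best e (1 + e) / 2 - kap], where [e = 1 + 2 t B + ...];
     the remaining coefficients follow. *)
  have : 3 * (best * B - T) = 0; last by rewrite -/B -/T; lra.
  apply: (@poly_min _ (best * (3 / 2 * E q + 2 * B ^+ 2) - 3 * tri p q q)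
    (best * (2 * B * E q) - kap q) (best / 2 * E q ^+ 2)) => t.
  have tA : adm (fun x => p x + t * q x) by exact: adm_D (adm_Z _ qA).
  have := kap_le_best tA; rewrite (kapDZ t pA qA) pk.
  set e := E (fun x => _); have e0 : 0 <= e by exact: En_ge0.
  have eE : e = 1 + 2 * t * B + t ^+ 2 * E q by rewrite /e (EnDZ _ _ t pA qA) pE.
  have : e * Num.sqrt e <= e * ((1 + e) / 2).
    rewrite ler_wpM2l//; have := sqr_sqrtr e0; have := sqr_ge0 (1 - Num.sqrt e); lra.
  rewrite -(ler_pM2l b0) => h1 h2; have := le_trans h2 h1; rewrite eE -/T; clear eE.
  move: (E q) (kap q) (tri p q q) best B T => ? ? ? ? ? ? h; clear -h; lra.
have [pL xL pe] := pA; have sL := hart_sqr_L2 pA; have UsL := U_L2 sL.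
pose D x := best * sym al be x * p x - U (fun y => hart p y ^+ 2) x.
have DdL : L2 (fun x => D x / (1 + x ^+ 2)).
  have h1 := L2Z best (sym_den_L2 al be pL).
  have h2 : L2 (fun x => U (fun y => hart p y ^+ 2) x / (1 + x ^+ 2)).
    by apply: (L2_boundedM (C := 1) UsL) => [|x]; [exact: mden|exact: den_bound].
  by have := L2B h1 h2; congr L2; apply/funext => x; rewrite /D; ring.
(* Two divisions by [1 + x^2] make [q] admissible, and the pairing of [D] with [q] is the squared
   norm of [D / (1 + x^2)]. *)
pose q x := D x / (1 + x ^+ 2) / (1 + x ^+ 2).
have qA : adm q.
  split.
  - by apply: (L2_boundedM (C := 1) DdL) => [|x]; [exact: mden|exact: den_bound].
  - have mx : measurable_fun setT (fun x : R => x / (1 + x ^+ 2)).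
      by apply: measurable_funM => //; exact: mden.
    have := L2_boundedM DdL mx (@xden_bound R).
    by congr L2; apply/funext => x; rewrite /q; ring.
  - have se : {ae mu, forall x, hart p (- x) ^+ 2 = hart p x ^+ 2}.
      by apply: aeW => x; rewrite adm_hart_even.
    have Ue := even_U sL se; apply: (aeS2 pe Ue) => x ex e2.
    by rewrite /q /D sqrrN symN ex e2.
have := first_order _ qA; rewrite (tri_ip pA qA) => fo.
have z : ip (fun x => D x / (1 + x ^+ 2)) (fun x => D x / (1 + x ^+ 2)) = 0.
  have [qL _ _] := qA.
  transitivity (best * Eb al be p q - ip (U (fun x => hart p x ^+ 2)) q); last by rewrite fo subrr.
  rewrite /Eb -(RintZ best (Eb_intg al be pA qA)) -(RintB (intgZ best (Eb_intg al be pA qA)) (L2M UsL qL)).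
  by apply: eq_Rint => x; rewrite /q; rewrite /D; field; exact: den_neq0.
apply: (aeS (ip_eq0_ae DdL z)) => x /eqP; rewrite mulf_eq0 invr_eq0 (negbTE (den_neq0 x)) orbF.
by rewrite subr_eq0 => /eqP.
Qed.

End Maximizer.

(* The Hartley transform of a ground state. With S the best constant in
   [kap q <= S * En q ^ (3/2)] one has [En p = 4 / S^2], so the last clause
   expresses optimality without mentioning S. *)
Definition gs al be p :=
  [/\ adm p, forall x, 0 <= p x,
      {ae mu, forall x, sym al be x * p x = 2^-1 * U (fun y => hart p y ^+ 2) x},
      0 < En al be p /\ kap p = 2 * En al be p &
      forall q, adm q -> En al be p * kap q ^+ 2 <= 4 * En al be q ^+ 3].

Lemma gs_exists al be : 0 < al -> - 2 * Num.sqrt al < be -> exists p, gs al be p.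
Proof.
move=> a0 bs; have [c co] := coercive_ex a0 bs.
have b0 := best_gt0 co; have [p [pA p0 pE pk]] := maximizer co.
have EL := euler_lagrange co pA pE pk; set S := best al be in b0 pk EL.
(* Multiplying [p] by [t] changes the coefficient [S] of the Euler-Lagrange equation into [t S], and
   the equation to be solved requires 2. *)
have t0 : 0 < 2 / S by rewrite divr_gt0.
have Sn : S != 0 by rewrite gt_eqF.
have eE : En al be (fun x => 2 / S * p x) = 4 / S ^+ 2 by rewrite (EnZ _ _ _ pA) pE; field.
exists (fun x => 2 / S * p x); split.
- exact: adm_Z.
- by move=> x; rewrite mulr_ge0// ltW.
- have sL := hart_sqr_L2 pA.
  have fE : (fun y => hart (fun x => 2 / S * p x) y ^+ 2) = (fun y => (2 / S) ^+ 2 * hart p y ^+ 2).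
    by apply/funext => y; rewrite (hartZ _ _ (adm_intg pA)) exprMn.
  rewrite fE; apply: (aeS2 (U_Z ((2 / S) ^+ 2) sL) EL) => x -> <-.
  by field.
- by rewrite eE (kapZ _ pA) pk; split; [rewrite divr_gt0 ?exprn_gt0|field].
- move=> q qA; rewrite eE.
  have q0 := En_ge0 co qA; have := kap_le_best co qA.
  (* The bound for [- q] controls [kap q] from below, so the inequality can be squared. *)
  have := kap_le_best co (adm_Z (-1) qA); rewrite (kapZ _ qA) (EnZ _ _ _ qA) sqrrN expr1n mul1r -/S.
  rewrite (_ : (-1) ^+ 3 = -1 :> R); last by ring.
  set w := S * _ => h1 h2.
  have w2 : w ^+ 2 = S ^+ 2 * En al be q ^+ 3.
    by rewrite /w !exprMn sqr_sqrtr//; ring.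
  have : kap q ^+ 2 <= w ^+ 2.
    rewrite -[X in X <= _]real_normK ?num_real// ler_sqr ?nnegrE//.
      by rewrite ler_norml; move: (kap q) w h1 h2 {w2} => ? ? h1 h2; clear -h1 h2; apply/andP; split; lra.
    by rewrite /w mulr_ge0 ?(ltW b0)// mulr_ge0// sqrtr_ge0.
  rewrite w2 (_ : 4 / S ^+ 2 * kap q ^+ 2 = 4 * kap q ^+ 2 / S ^+ 2); last by ring.
  by rewrite ler_pdivrMr ?exprn_gt0// => h; lra.
Qed.

Lemma gs_ground_state al be p : gs al be p -> 0 < al -> - 2 * Num.sqrt al < be ->
  even_ground_state al be (hart p).
Proof.
move=> [pA p0 eqn [e0 kE] opt] a0 bs; have [c co] := coercive_ex a0 bs.
have HE := adm_H1even pA; have [H _] := HE; have Up := adm_U pA.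
have EE q : adm q -> En al be (U (hart q)) = En al be q.
  move=> qA; have [qa _] := H1even_adm (adm_H1even qA).
  exact: (En_ae al be qa qA (adm_U qA)).
split.
  apply: (solutionP _ _ H).2; have hL := hart_sqr_L2 pA.
  by apply: (aeS2 Up eqn) => x ->.
have KE q : functional_K (hart q) = 6^-1 * kap q by [].
have IE q : adm q -> functional_I al be (hart q) = 2^-1 * En al be q.
  by move=> qA; have [Hq _] := adm_H1even qA; rewrite (functional_IE _ _ Hq) EE.
exists (6^-1 * kap p); split=> //; first by rewrite mulr_gt0// kE mulr_gt0.
rewrite (IE _ pA) /min_I; apply/eqP; rewrite eq_le; apply/andP; split; last first.
  by apply: ereal_inf_lbound; exists (hart p) => //; rewrite /= (IE _ pA).
apply: le_ereal_inf_tmp => _ [psi [Hpsi Kpsi] <-].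
have [qA re] := H1even_adm Hpsi; have [Hp _] := Hpsi.
rewrite lee_fin (functional_IE _ _ Hp) ler_pM2l//.
have k : kap (U psi) = kap p.
  have : functional_K psi = 6^-1 * kap (U psi); last first.
    by rewrite Kpsi; move: (kap _) (kap _) => ? ? h; clear -h; lra.
  congr (_ * _); have [[pL _] _] := Hpsi; have mp := L2_mble pL.
  apply: Rint_ae; [exact: measurable_funX|exact: (intg_mble (kap_intg qA))|].
  by apply: (aeS re) => x ->.
(* For a competitor with the same cubic integral [2 e], optimality reduces to [e^3 <= w^3]. *)
have := opt _ qA; rewrite k kE; set e := En al be p in e0 *.
have := En_ge0 co qA; move: (En al be (U psi)) => w w0.
rewrite (_ : e * (2 * e) ^+ 2 = 4 * e ^+ 3); last by ring.
rewrite ler_pM2l// => h; rewrite leNgt; apply/negP => we.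
by move: h; rewrite leNgt => /negP; apply; rewrite ltrXn2r.
Qed.

End Existence.

(** * Limits of ground states *)

Section GroundStateLimits.
Context {R : realType}.
Local Notation mu := (@lebesgue_measure R).
Implicit Types (f g h k p q r u v phi psi Q : R -> R) (x y xi a b c e t al be C : R).

(** The left side is linear in [p] and pairs it with a fixed function, the form suited to weak
    limits. *)
Lemma weak_eqnP al be p : adm p -> H1_solution al be (hart p) <->
  forall psi, test_function psi ->
    \int[mu]_x (p x * (sym al be x * hart psi x)) = \int[mu]_x (2^-1 * hart p x ^+ 2 * psi x).
Proof.
move=> pA; have [Hp _] := adm_H1even pA; have [pL _ _] := pA.
have UhL := U_L2 (adm_hart_L2 pA).
have E psi : test_function psi ->
    \int[mu]_x ((hart p x - be * hilbert (weak_derivative (hart p)) x) * psi x)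
      - al * \int[mu]_x (hart p x * derive1n 2 psi x) =
    \int[mu]_x (p x * (sym al be x * hart psi x)).
  move=> tp; rewrite (weak_form al be Hp tp); apply: Rint_ae.
  - exact: (intg_mble (intg_sym_hart al be UhL tp)).
  - have := intg_mble (intg_sym_hart al be pL tp); congr measurable_fun.
    by apply/funext => x; ring.
  - by apply: (aeS (adm_U pA)) => x ->; ring.
split=> [[_ H] psi tp|H]; first by rewrite -(E psi tp) H.
by split=> // psi tp; rewrite (E psi tp) H.
Qed.

Lemma gs_solution al be p : gs al be p -> H1_solution al be (hart p).
Proof.
move=> [pA _ eqn _ _]; have [Hp _] := adm_H1even pA; apply: (solutionP _ _ Hp).2.
by apply: (aeS2 (adm_U pA) eqn) => x ->.
Qed.

Lemma test_weight_L2 psi (w : R -> R) : test_function psi -> measurable_fun setT w ->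
  (forall x, `|w x| <= 1 + x ^+ 2) -> L2 (fun x => w x * hart psi x / om x).
Proof.
move=> tp mw wb; have [q qL [qE _]] := hart_test_dec tp.
apply: (L2_dom1 _ qL) => [|x].
  by apply: measurable_funM; [apply: measurable_funM => //; exact: mhart (test_intg tp)|exact: momV].
rewrite qE !normrM !normfV (gtr0_norm (om_gt0 x)) (gtr0_norm (den_gt0 x)).
rewrite ler_pdivrMr ?om_gt0// mulrA; apply: (@le_trans _ _ (1 * `|q x|)).
  by rewrite ler_wpM2r// ler_pdivrMr ?den_gt0// mul1r.
by rewrite mul1r ler_peMr// om_ge1.
Qed.

Lemma sym_split al be p k : adm p -> (forall w : R -> R, measurable_fun setT w ->
    (forall x, `|w x| <= 1 + x ^+ 2) -> L2 (fun x => w x * k x / om x)) ->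
  \int[mu]_x (p x * (sym al be x * k x)) = \int[mu]_x (p x * (1 * k x)) +
    be * \int[mu]_x (p x * (`|x| * k x)) + al * \int[mu]_x (p x * (x ^+ 2 * k x)).
Proof.
move=> pA kL.
have I (w : R -> R) : measurable_fun setT w -> (forall x, `|w x| <= 1 + x ^+ 2) ->
    intg mu (fun x => p x * (w x * k x)).
  move=> mw wb; have := L2M (adm_om pA) (kL w mw wb); congr intg; apply/funext => x.
  by field; exact: om_neq0.
have i0 := I (fun=> 1) (measurable_cst _) _; have i1 := I (fun x => `|x|) _ _; have i2 := I (fun x => x ^+ 2) _ _.
have {}i0 : intg mu (fun x => p x * (1 * k x)) by apply: i0 => x; rewrite normr1 lerDl sqr_ge0.
have {}i1 : intg mu (fun x => p x * (`|x| * k x)).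
  apply: i1 => [|x]; first by apply: continuous_measurable_fun => z; exact: norm_continuous.
  rewrite normr_id -[x ^+ 2]real_normK ?num_real//.
  by have := sqr_ge0 (`|x| - 1); have := normr_ge0 x; nra.
have {}i2 : intg mu (fun x => p x * (x ^+ 2 * k x)).
  by apply: i2 => [|x]; [exact: measurable_funX|rewrite ger0_norm ?sqr_ge0// lerDr].
rewrite -(RintZ be i1) -(RintZ al i2) -(RintD i0 (intgZ _ i1)) -(RintD (intgD i0 (intgZ _ i1)) (intgZ _ i2)).
by apply: eq_Rint => x; rewrite /sym; ring.
Qed.

(** The linear side converges weight by weight, [sym_split] separating the varying coefficients from
    the pairings. The quadratic side converges by pointwise convergence, dominated by a multiple of
    [|psi|]. *)
Lemma limit_solution (a_ b_ : nat -> R) (p_ : nat -> R -> R) al be p C :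
  a_ n @[n --> \oo] --> al -> b_ n @[n --> \oo] --> be -> (forall n, gs (a_ n) (b_ n) (p_ n)) ->
  (forall n, Ed (p_ n) <= C) -> adm p -> wcvg_om p_ p -> H1_solution al be (hart p).
Proof.
move=> ca cb gsn EC pA W; apply/(weak_eqnP al be pA) => psi tp.
have pnA n : adm (p_ n) by have [] := gsn n.
have kL (w : R -> R) (mw : measurable_fun setT w) (wb : forall x, `|w x| <= 1 + x ^+ 2) :=
  test_weight_L2 tp mw wb.
have l1 (w : R -> R) : measurable_fun setT w -> (forall x, `|w x| <= 1 + x ^+ 2) ->
    \int[mu]_x (p_ n x * (w x * hart psi x)) @[n --> \oo] --> \int[mu]_x (p x * (w x * hart psi x)).
  by move=> mw wb; apply: wcvg_om_int => //; exact: kL.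
have c0' := l1 (fun=> 1) (measurable_cst _); have c1' := l1 (fun x => `|x|); have c2' := l1 (fun x => x ^+ 2).
have lhs : \int[mu]_x (p_ n x * (sym (a_ n) (b_ n) x * hart psi x)) @[n --> \oo] -->
    \int[mu]_x (p x * (sym al be x * hart psi x)).
  rewrite (sym_split al be pA kL).
  have -> : (fun n => \int[mu]_x (p_ n x * (sym (a_ n) (b_ n) x * hart psi x))) =
    (fun n => \int[mu]_x (p_ n x * (1 * hart psi x)) + b_ n * \int[mu]_x (p_ n x * (`|x| * hart psi x)) +
       a_ n * \int[mu]_x (p_ n x * (x ^+ 2 * hart psi x))).
    by apply/funext => n; exact: sym_split.
  apply: cvgD; [apply: cvgD|]; [|apply: cvgM => //|apply: cvgM => //].
  - by apply: c0' => x; rewrite normr1 lerDl sqr_ge0.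
  - apply: c1' => [|x]; first by apply: continuous_measurable_fun => z; exact: norm_continuous.
    rewrite normr_id -[x ^+ 2]real_normK ?num_real//.
    by have := sqr_ge0 (`|x| - 1); have := normr_ge0 x; nra.
  - by apply: c2' => [|x]; [exact: measurable_funX|rewrite ger0_norm ?sqr_ge0// lerDr].
have rhs : \int[mu]_x (2^-1 * hart (p_ n) x ^+ 2 * psi x) @[n --> \oo] -->
    \int[mu]_x (2^-1 * hart p x ^+ 2 * psi x).
  have mpsi := intg_mble (test_intg tp).
  apply: (@dominated_Rint _ _ _ mu (fun n x => 2^-1 * hart (p_ n) x ^+ 2 * psi x)
    (fun x => 2^-1 * hart p x ^+ 2 * psi x) (fun x => 2^-1 * (pi * C) * `|psi x|) _ _ _ _).2.
  - move=> n; apply: measurable_funM; last exact: mpsi.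
    by apply: measurable_funM => //; apply: measurable_funX; exact: mhart (adm_intg (pnA n)).
  - exact: (intgZ _ (intg_abs (test_intg tp))).
  - move=> n x; have nn : 0 <= 2^-1 * hart (p_ n) x ^+ 2 by rewrite mulr_ge0// sqr_ge0.
    rewrite normrM ler_wpM2r// (ger0_norm nn) ler_pM2l//; apply: (le_trans (hart_sup x (pnA n))).
    by rewrite ler_pM2l ?pi_gt0.
  - move=> x; have h : hart (p_ n) x @[n --> \oo] --> hart p x by exact: wcvg_hart.
    apply: cvgM; last exact: cvg_cst.
    by apply: cvgM; [exact: cvg_cst|exact: cvgM].
have EE : (fun n => \int[mu]_x (p_ n x * (sym (a_ n) (b_ n) x * hart psi x))) =
    (fun n => \int[mu]_x (2^-1 * hart (p_ n) x ^+ 2 * psi x)).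
  by apply/funext => n; exact: ((weak_eqnP _ _ (pnA n)).1 (gs_solution (gsn n)) psi tp).
rewrite EE in lhs; exact: (cvg_unique _ lhs rhs).
Qed.

(** The lower bound at 0 survives the weak limit because point evaluation is weakly continuous. It
    excludes the zero solution, so uniqueness applies. *)
Lemma limit_identify (a_ b_ : nat -> R) (p_ : nat -> R -> R) al be p C Q :
  a_ n @[n --> \oo] --> al -> b_ n @[n --> \oo] --> be -> (forall n, gs (a_ n) (b_ n) (p_ n)) ->
  (forall n, Ed (p_ n) <= C) -> adm p -> wcvg_om p_ p -> (forall n, 1 <= hart (p_ n) 0) ->
  unique_even_soliton_profile al be Q -> {ae mu, forall x, p x = U Q x}.
Proof.
move=> ca cb gsn EC pA W p1 [[[[QL _] _] _ _] uni].
have S : even_soliton_profile al be (hart p).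
  split; [exact: adm_H1even|exact: (limit_solution ca cb gsn EC)|].
  move=> z; have hc : continuous (hart p) by exact: hart_cont (adm_intg pA).
  have h0 := cont_ae_eq0 hc z 0.
  have c1 : (fun _ : nat => (1 : R)) n @[n --> \oo] --> (1 : R) by exact: cvg_cst.
  have c2 : hart (p_ n) 0 @[n --> \oo] --> hart p 0 by exact: wcvg_hart.
  have le1 : 1 <= hart p 0 by apply: (ler_cvg_to c1 c2); exact: nearW.
  by move: le1; rewrite h0 ler10.
have := U_ae (adm_hart_L2 pA) QL (uni _ S).
exact: ae_trans (ae_sym (adm_U pA)).
Qed.

(** [2 E = kap p <= hart p 0 * ip p p <= 2 E * hart p 0], the last inequality by the lower bound 1/2
    on the symbol. *)
Lemma gs_hart0 al be p : gs al be p -> (forall x, 2^-1 <= sym al be x) -> 1 <= hart p 0.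
Proof.
move=> [pA p0 _ [e0 kE] _] s2; have [pL xL _] := pA.
have le1 : 2^-1 * ip p p <= En al be p.
  rewrite /ip -(RintZ _ (L2M pL pL)); apply: le_Rint; [exact/intgZ/L2M|exact: En_intg|move=> x].
  by rewrite -expr2 ler_wpM2r ?sqr_ge0.
have := kap_le pA (fun y => hart_max y pA p0); rewrite kE.
have h0 : 0 <= hart p 0.
  by apply: Rint_ge0 => y; rewrite mulr_ge0// /K mulr0 cos0 sin0 addr0 mulr1 ltW// c0_gt0.
move=> hk; have h1 := ler_wpM2l h0 le1.
have : En al be p <= hart p 0 * En al be p by lra.
by rewrite ler_pMl.
Qed.

Lemma En_lip al be a b p : adm p -> En al be p <= En a b p + (`|al - a| + `|be - b|) * Ed p.
Proof.
move=> [pL xL _]; have i1 := En_intg al be pL xL; have i2 := En_intg a b pL xL.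
have i3 := Ed_intg pL xL; rewrite -(RintZ _ i3) -(RintD i2 (intgZ _ i3)).
apply: le_Rint; [exact: i1|exact: (intgD i2 (intgZ _ i3))|move=> x].
rewrite mulrA -mulrDl ler_wpM2r ?sqr_ge0// -lerBlDl.
have -> : sym al be x - sym a b x = (be - b) * `|x| + (al - a) * x ^+ 2 by rewrite /sym; ring.
have h : `|x| <= 1 + x ^+ 2.
  rewrite -[x ^+ 2]real_normK ?num_real//.
  by have := sqr_ge0 (`|x| - 1); have := normr_ge0 x; nra.
rewrite [leRHS]mulrDl [leLHS]addrC; apply: lerD.
  apply: (@le_trans _ _ (`|al - a| * x ^+ 2)); first by rewrite ler_wpM2r ?sqr_ge0// ler_norm.
  by rewrite ler_wpM2l// lerDr.
apply: (@le_trans _ _ (`|be - b| * `|x|)); first by rewrite ler_wpM2r// ler_norm.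
by rewrite ler_wpM2l.
Qed.

(** The equation paired with its own solution. *)
Lemma profile_energy al be Q : even_soliton_profile al be Q -> adm (U Q) /\
  kap (U Q) = 2 * En al be (U Q).
Proof.
move=> [HQ sQ _]; have [qA re] := H1even_adm HQ; split=> //; have [Hq _] := HQ.
have [qL xL _] := qA; have [QL _] := Hq; have sL := hart_sqr_L2 qA.
have Q2L := sqr_L2 QL (H1_UL1 Hq).
have e := (solutionP _ _ Hq).1 sQ.
have e2 : {ae mu, forall x, hart (U Q) x ^+ 2 = Q x ^+ 2} by apply: (aeS re) => x ->.
have e3 := U_ae sL Q2L e2.
rewrite kap_tri (tri_ip qA qA) -(RintZ 2 (En_intg al be qL xL)); apply: Rint_ae.
- exact: (intg_mble (L2M (U_L2 sL) qL)).
- exact: (intg_mble (intgZ _ (En_intg al be qL xL))).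
- apply: (aeS2 e e3) => x h ->.
  have -> : 2 * (sym al be x * U Q x ^+ 2) = 2 * (sym al be x * U Q x) * U Q x by ring.
  by rewrite h; field.
Qed.

Lemma gs_energy al be p q : gs al be p -> adm q -> 0 < kap q ->
  En al be p <= 4 * En al be q ^+ 3 / kap q ^+ 2.
Proof.
by move=> [_ _ _ _ opt] qA k0; rewrite ler_pdivlMr ?exprn_gt0//; exact: opt.
Qed.

(** Strong convergence is obtained in the energy of the limit symbol. For the pair [(1, 0)] this is
    the H^1 norm; for [(0, 1)] it controls only half a derivative. *)
Lemma subsequence_limit (a_ b_ : nat -> R) (p_ : nat -> R -> R) al be C Q :
  a_ n @[n --> \oo] --> al -> b_ n @[n --> \oo] --> be -> (forall n, gs (a_ n) (b_ n) (p_ n)) ->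
  (forall n, Ed (p_ n) <= C) -> (forall n, 1 <= hart (p_ n) 0) ->
  unique_even_soliton_profile al be Q -> (forall x, 0 < sym al be x) ->
  exists s : nat -> nat, {homo s : m n / (m < n)%N} /\
    En al be (fun x => p_ (s n) x - U Q x) @[n --> \oo] --> (0 : R).
Proof.
move=> ca cb gsn EC p1 uQ s0.
have pnA n : adm (p_ n) by have [] := gsn n.
have [s [p [sm pA W]]] := weak_adm pnA EC; exists s; split=> //.
have sub (u : nat -> R) (l : R) : u n @[n --> \oo] --> l -> u (s n) @[n --> \oo] --> l.
  move=> ul; apply: (cvg_comp s u _ ul) => A [N _ NA]; exists N => // n /= Nn; apply: NA => /=.
  exact: leq_trans Nn (homo_ge_id sm n).
have pQ := limit_identify (sub _ _ ca) (sub _ _ cb) (fun n => gsn (s n)) (fun n => EC (s n)) pA W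
  (fun n => p1 (s n)) uQ.
have [qA kE] := profile_energy uQ.1; set q := U Q in qA kE pQ *.
have en0 r : adm r -> 0 <= En al be r.
  by move=> rA; apply: Rint_ge0 => x; rewrite mulr_ge0 ?sqr_ge0// ltW.
have Eq0 : 0 < En al be q.
  rewrite lt_neqAle en0// andbT; apply/negP => /eqP z.
  have [[[QL _] _] _ nz] := uQ.1; have [qL xL _] := qA.
  have nn x : 0 <= sym al be x * q x ^+ 2 by rewrite mulr_ge0 ?sqr_ge0// ltW.
  have q0 := Rint_eq0_ae (En_intg al be qL xL) nn (esym z).
  have q00 : {ae mu, forall x, q x = 0}.
    by apply: (aeS q0) => x /eqP; rewrite mulf_eq0 gt_eqF//= sqrf_eq0 => /eqP.
  apply: nz; apply: (ip_eq0_ae QL); rewrite -(U_iso QL QL) -/q.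
  rewrite -[RHS](@Rintegral0 _ _ _ mu); apply: Rint_ae => //; first exact: (intg_mble (L2M qL qL)).
  by apply: (aeS q00) => x ->; rewrite mulr0.
have k0 : 0 < kap q by rewrite kE mulr_gt0.
pose de n := `|a_ (s n) - al| + `|b_ (s n) - be|.
have dc : de n @[n --> \oo] --> (0 : R).
  have z (u : nat -> R) (l : R) : u n @[n --> \oo] --> l -> `|u (s n) - l| @[n --> \oo] --> (0 : R).
    move=> ul; apply/norm_cvg0P; rewrite -(subrr l); apply: cvgB; last exact: cvg_cst.
    exact: sub.
  by rewrite -(addr0 0); apply: cvgD; exact: z.
(* Optimality against the competitor [q] bounds the energy of [p_ (s n)], and [de n] measures the
   change of symbol. With [e] the energy of [q] and [kap q = 2 e], the limit is
   [4 e^3 / (2 e)^2 - 2 e + e = 0]. *)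
pose ub n := 4 * (En al be q + de n * Ed q) ^+ 3 / kap q ^+ 2 + de n * C - 2 * Eb al be (p_ (s n)) q + En al be q.
have lim : ub n @[n --> \oo] --> (0 : R).
  set e := En al be q in Eq0 ub *.
  have -> : 0 = 4 * (e + 0 * Ed q) ^+ 3 / kap q ^+ 2 + 0 * C - 2 * e + e.
    by rewrite kE -/e; field; rewrite gt_eqF.
  have eb : Eb al be (p_ (s n)) q @[n --> \oo] --> e.
    have := @Eb_wcvg R al be _ _ q qA W; rewrite /e En_Eb.
    suff -> : Eb al be p q = Eb al be q q by [].
    apply: Rint_ae; [exact: (intg_mble (Eb_intg al be pA qA))|exact: (intg_mble (Eb_intg al be qA qA))|].
    by apply: (aeS pQ) => x ->.
  have e1 : e + de n * Ed q @[n --> \oo] --> e + 0 * Ed q.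
    by apply: cvgD; [exact: cvg_cst|apply: cvgM => //; exact: cvg_cst].
  apply: cvgD; last exact: cvg_cst.
  apply: cvgB; last by apply: cvgM => //; exact: cvg_cst.
  apply: cvgD; last by apply: cvgM => //; exact: cvg_cst.
  apply: cvgM; last exact: cvg_cst.
  apply: cvgM; first exact: cvg_cst.
  by rewrite !exprS expr0 mulr1; under eq_fun do rewrite !exprS expr0 mulr1; apply: cvgM => //; apply: cvgM.
apply: (@squeeze_cvgr _ _ _ _ (fun=> 0) ub) => //; last exact: cvg_cst.
apply: nearW => n; rewrite en0/=; last exact: adm_B.
rewrite (EnB _ _ (pnA _) qA) /ub lerD2r lerD2r.
apply: (le_trans (En_lip al be (a_ (s n)) (b_ (s n)) (pnA (s n)))).
have dE : `|al - a_ (s n)| + `|be - b_ (s n)| = de n by rewrite /de (distrC al) (distrC be).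
have d0 : 0 <= de n by rewrite addr_ge0.
rewrite dE; apply: lerD; last by rewrite ler_wpM2l.
apply: (le_trans (gs_energy (gsn (s n)) qA k0)).
rewrite ler_wpM2r ?invr_ge0 ?sqr_ge0// ler_wpM2l//.
have h := En_lip (a_ (s n)) (b_ (s n)) al be qA; rewrite -/(de n) in h.
have [e0|e0] := leP 0 (En (a_ (s n)) (b_ (s n)) q).
  by rewrite lerXn2r ?nnegrE// (le_trans e0).
apply: (@le_trans _ _ 0).
  by rewrite exprS mulr_le0_ge0 ?sqr_ge0// ltW.
by rewrite exprn_ge0// addr_ge0 ?mulr_ge0 ?Ed_ge0// ltW.
Qed.

Lemma H1norm_Ed p Q : adm p -> H1even Q -> H1norm (fun x => hart p x - Q x) = Num.sqrt (Ed (fun x => p x - U Q x)).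
Proof.
move=> pA HQ; have [qA re] := H1even_adm HQ; have [[QL _] _] := HQ.
have rA := adm_B pA qA; have hL := adm_hart_L2 pA; have [rL xrL _] := rA.
have fL : L2 (fun x => hart p x - Q x) by exact: L2B.
have Uf : {ae mu, forall x, U (fun x => hart p x - Q x) x = p x - U Q x}.
  by apply: (aeS2 (U_B hL QL) (adm_U pA)) => x -> ->.
have UfL := U_L2 fL.
have xfE : {ae mu, forall x, x * U (fun x => hart p x - Q x) x = x * (p x - U Q x)}.
  by apply: (aeS Uf) => x ->.
have xfL : L2 (fun x => x * U (fun x => hart p x - Q x) x).
  by apply: (L2_ae _ xrL xfE); apply: measurable_funM => //; exact: (L2_mble UfL).
have Hf : H1 (fun x => hart p x - Q x) by apply/H1P.
have [_ wL _] := H1_weak_derivative Hf.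
rewrite /H1norm (L2norm_nrm fL) (L2norm_nrm wL) !sqr_nrm (nrm_weak_derivative Hf).
rewrite -(U_iso fL fL) (EdE rA); congr (Num.sqrt (_ + _)).
- exact: ip_ae.
- exact: ip_ae.
Qed.

(** For each [e] a single index with [f (u n) < e] is enough to contradict a bad sequence, hence
    convergence along a subsequence suffices. *)
Lemma near0_by_sequences (f : R -> R) (P : R -> Prop) :
  (forall u : nat -> R, (forall n, P (u n)) -> u n @[n --> \oo] --> (0 : R) ->
    forall e, 0 < e -> exists n, f (u n) < e) ->
  forall e, 0 < e -> exists2 d, 0 < d & forall x, P x -> `|x| < d -> f x < e.
Proof.
move=> H e e0; apply: contrapT => no.
have ex n : exists x, [/\ P x, `|x| < n.+1%:R^-1 & e <= f x].
  apply: contrapT => nx; apply: no; exists n.+1%:R^-1; first by rewrite invr_gt0.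
  by move=> x Px xn; rewrite ltNge; apply/negP => ef; apply: nx; exists x.
have [u uP] := choice ex.
have u0 : u n @[n --> \oo] --> (0 : R).
  apply/norm_cvg0P; apply: (@squeeze_cvgr _ _ _ _ (fun=> 0) (fun n => n.+1%:R^-1)).
  - by apply: nearW => n; rewrite normr_ge0 /=; have [_ /ltW] := uP n.
  - exact: cvg_cst.
  - exact: cvg_harmonic.
have [n] := H u (fun n => let: And3 Px _ _ := uP n in Px) u0 e e0.
by have [_ _ ef] := uP n; rewrite ltNge ef.
Qed.

End GroundStateLimits.

(** * The KdV limit and uniform estimates for the Benjamin-Ono limit *)

Section Limits.
Context {R : realType}.
Local Notation mu := (@lebesgue_measure R).
Implicit Types (f g h k p q r u v phi psi Q : R -> R) (x y xi a b c e t al be C : R).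

Definition gsel al be : R -> R := xget (cst 0) [set p | gs al be p].

Lemma gselP al be : 0 < al -> - 2 * Num.sqrt al < be -> gs al be (gsel al be).
Proof. by move=> a0 bs; have := xgetPex (cst 0) (gs_exists a0 bs). Qed.

Lemma En_KdV p : En 1 0 p = Ed p.
Proof. by apply: eq_Rint => x; rewrite /sym mul0r addr0 mul1r. Qed.

Lemma exists_lt_of_cvg0 (u : nat -> R) (s : nat -> nat) e :
  u (s n) @[n --> \oo] --> (0 : R) -> 0 < e -> exists n, u n < e.
Proof.
move=> /cvgrPdist_lt/(_ e) H e0; have [N _ NP] := H e0.
exists (s N); have := NP N (leqnn N); rewrite /= sub0r normrN.
exact: le_lt_trans (ler_norm _).
Qed.

Lemma kdv_limit e : 0 < e -> exists2 d, 0 < d & forall be, `|be| <= 1 -> `|be| < d ->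
  H1norm (fun x => hart (gsel 1 be) x - Q_KdV x) < e.
Proof.
apply: (near0_by_sequences (f := fun be => H1norm (fun x => hart (gsel 1 be) x - Q_KdV x))).
move=> u u1 u0 {}e e0; have [uQ1 uQ2] := @Q_KdV_unique R; have [HQ _ _] := uQ1.
have [qA kE] := profile_energy uQ1; set q := U (@Q_KdV R) in qA kE.
have ub n : - 1 <= u n /\ u n <= 1 by have := u1 n; rewrite ler_norml => /andP[].
have gsn n : gs 1 (u n) (gsel 1 (u n)).
  by apply: gselP => //; rewrite sqrtr1 mulr1; have [h _] := ub n; lra.
(* For [be >= -1] the inequality [2 |x| <= 1 + x^2] gives a coercivity constant independent of
   [be]. *)
have sl n x : 2^-1 * (1 + x ^+ 2) <= sym 1 (u n) x.
  rewrite /sym -[x ^+ 2]real_normK ?num_real//; have := sqr_ge0 (`|x| - 1).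
  have [h _] := ub n; have h2 := ler_wpM2r (normr_ge0 x) h; lra.
have co n : coercive 1 (u n) 2^-1 by split.
have pA n : adm (gsel 1 (u n)) by have [] := gsn n.
have k0 : 0 < kap q.
  rewrite kE mulr_gt0// En_KdV lt_neqAle Ed_ge0 andbT; apply/negP => /eqP z.
  have [_ _ nz] := uQ1; have [_ re] := H1even_adm HQ; apply: nz.
  apply: (aeS re) => x <-; apply/eqP; rewrite -sqrf_eq0; apply/eqP/le_anti.
  by rewrite sqr_ge0 andbT; have := hart_sup x qA; rewrite -/q -z mulr0.
(* The energy of the competitor [q] is at most [2 Ed q] when [|u n| <= 1], and the leading 2 inverts
   the coercivity constant. *)
pose C := 2 * (4 * (2 * Ed q) ^+ 3 / kap q ^+ 2).
have EC n : Ed (gsel 1 (u n)) <= C.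
  have h := En_coercive (co n) (pA n); rewrite /C -ler_pdivrMl// mulrC.
  have {}h : Ed (gsel 1 (u n)) / 2 <= En 1 (u n) (gsel 1 (u n)) by rewrite mulrC.
  apply: (le_trans h); apply: (le_trans (gs_energy (gsn n) qA k0)).
  rewrite ler_wpM2r ?invr_ge0 ?sqr_ge0// ler_wpM2l// lerXn2r ?nnegrE ?mulr_ge0 ?Ed_ge0//.
    by apply: le_trans (En_coercive (co n) qA); rewrite mulr_ge0 ?Ed_ge0.
  have h2 := En_lip 1 (u n) 1 0 qA; rewrite En_KdV subrr normr0 add0r subr0 in h2.
  apply: (le_trans h2); rewrite [2 * _]mulr_natl mulr2n lerD2l.
  by rewrite ler_piMl ?Ed_ge0.
have p1 n : 1 <= hart (gsel 1 (u n)) 0.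
  apply: (gs_hart0 (gsn n)) => x; apply: le_trans (sl n x).
  by rewrite ler_peMr// lerDl sqr_ge0.
have s0 x : 0 < sym 1 0 x :> R by rewrite /sym mul0r addr0 mul1r den_gt0.
have ca : (fun _ : nat => (1 : R)) n @[n --> \oo] --> (1 : R) by exact: cvg_cst.
have [s [sm lim]] := subsequence_limit ca u0 gsn EC p1 (@Q_KdV_unique R) s0.
apply: (@exists_lt_of_cvg0 _ s) => //.
under eq_fun do rewrite (H1norm_Ed (pA _) HQ).
by apply: sqrt_cvg0; under eq_fun do rewrite -En_KdV.
Qed.

(** Since [|x| p <= U (f^2) / 2], the squared seminorm [Z] is at most a quarter of the squared norm
    of [f^2], itself at most [N^2 H]. As [N] is estimated by [H] and [Z], the bound closes with no
    dependence on [al]. *)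
Lemma H1_bound_BO al p : 0 < al -> gs al 1 p -> 0 < ip p p /\
  ip (fun x => x * p x) (fun x => x * p x) <= pi ^+ 2 * (ip p p) ^+ 3 / 4.
Proof.
move=> a0 [pA p0 eqn [e0 kE] _]; have [pL xL _] := pA; have p_0 := pi_gt0 R.
have H0 : 0 < ip p p.
  rewrite lt_neqAle ip_ge0 andbT; apply/negP => /eqP z.
  have := kap_le pA (fun y => hart_max y pA p0); rewrite kE -z mulr0 leNgt mulr_gt0//.
split=> //; set H := ip p p in H0 *; set Z := ip _ _.
have sL := hart_sqr_L2 pA; have UsL := U_L2 sL; have hL := adm_hart_L2 pA.
set N := \int[mu]_x `|p x|.
have Z1 : Z <= 4^-1 * (N ^+ 2 * H).
  apply: (@le_trans _ _ (4^-1 * ip (U (fun y => hart p y ^+ 2)) (U (fun y => hart p y ^+ 2)))).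
    have hUL := L2Z 2^-1 UsL.
    have -> : 4^-1 * ip (U (fun y => hart p y ^+ 2)) (U (fun y => hart p y ^+ 2)) =
      ip (fun x => sym al 1 x * p x) (fun x => sym al 1 x * p x).
      have symL : L2 (fun x => sym al 1 x * p x).
        by apply: (L2_ae _ hUL eqn); apply: measurable_funM; [exact: msym|exact: L2_mble].
      rewrite (ip_ae symL hUL symL hUL eqn eqn) (ipZl 2^-1 UsL hUL) (ipZr 2^-1 UsL UsL).
      by rewrite mulrA; congr (_ * _); field.
    have symL : L2 (fun x => sym al 1 x * p x).
      by apply: (L2_ae _ hUL eqn); apply: measurable_funM; [exact: msym|exact: L2_mble].
    apply: le_Rint; [exact: L2M|exact: L2M|move=> x].
    rewrite -!expr2 !exprMn ler_wpM2r ?sqr_ge0// -[x ^+ 2]real_normK ?num_real//.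
    rewrite lerXn2r ?nnegrE// /sym mul1r; have := sqr_ge0 x => x2.
      by rewrite !addr_ge0// mulr_ge0// ltW.
    have : 0 <= al * x ^+ 2 by rewrite mulr_ge0// ltW.
    lra.
  rewrite ler_wpM2l// (U_iso sL sL) /H -(ip_hart pA pA) -RintZ; last exact: L2M.
  apply: le_Rint; [exact: L2M|exact/intgZ/L2M|move=> x].
  rewrite -!expr2 [X in X <= _]expr2 ler_wpM2r ?sqr_ge0//.
  rewrite -[X in X <= _]real_normK ?num_real// lerXn2r ?nnegrE ?Rint_ge0//.
  exact: hart_le (adm_intg pA).
(* At this scale [N^2 H <= pi^2 H^3 / 2 + 2 Z]; after division by 4 half of [Z] is absorbed on the
   left. *)
have e1 : 0 < pi * H / 2 by rewrite divr_gt0// mulr_gt0.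
have Z2 := L1_norm_sq pA e1; rewrite -/N -/H -/Z in Z2.
have Z3 : N ^+ 2 * H <= pi * (pi * H / 2) * (H + (pi * H / 2) ^- 2 * Z) * H.
  by rewrite ler_wpM2r// ltW.
have E : pi * (pi * H / 2) * (H + (pi * H / 2) ^- 2 * Z) * H = pi ^+ 2 * H ^+ 3 / 2 + 2 * Z.
  move: (@pi R) p_0 => P P0; field; by rewrite !gt_eqF.
rewrite E in Z3; have := le_trans Z1 (ler_wpM2l (_ : 0 <= 4^-1) Z3).
by rewrite invr_ge0 => /(_ (ler0n _ _)); lra.
Qed.

(* Subtracting the equations: [sym 0 1 (p - q) = (w (Up2 - Uq2) - (1 - w) Uq2)/2]
   with [w = sym 0 1 / sym al 1] between 0 and 1. *)
Lemma Ed_le_BO al p q B : 0 < al -> gs al 1 p -> adm q ->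
  {ae mu, forall x, sym 0 1 x * q x = 2^-1 * U (fun y => hart q y ^+ 2) x} ->
  (forall x, (hart p x + hart q x) ^+ 2 <= B) ->
  Ed (fun x => p x - q x) <= 2^-1 * (B * ip (fun x => p x - q x) (fun x => p x - q x)) +
    2^-1 * \int[mu]_x ((1 - sym 0 1 x / sym al 1 x) ^+ 2 * U (fun y => hart q y ^+ 2) x ^+ 2).
Proof.
move=> a0 [pA _ eqp _ _] qA eqq hB.
have dA := adm_B pA qA; have [dL xdL _] := dA.
have [pL xpL _] := pA; have [qL xqL _] := qA.
have spL := hart_sqr_L2 pA; have sqL := hart_sqr_L2 qA.
set P2 := fun y => hart p y ^+ 2 in eqp spL *; set Q2 := fun y => hart q y ^+ 2 in eqq sqL *.
pose w x : R := sym 0 1 x / sym al 1 x.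
have s0 x : 0 < sym 0 1 x :> R by rewrite /sym mul0r addr0 mul1r den1_gt0.
have s1 x : sym 0 1 x <= sym al 1 x.
  by rewrite /sym mul0r addr0 lerDl mulr_ge0 ?sqr_ge0// ltW.
have sa x : 0 < sym al 1 x by exact: lt_le_trans (s0 x) (s1 x).
have w0 x : 0 <= w x by rewrite divr_ge0 ?ltW.
have w1 x : w x <= 1 by rewrite ler_pdivrMr// mul1r.
have mw : measurable_fun setT w.
  apply: measurable_funM; first exact: msym.
  by apply: continuous_measurable_fun => x; apply: cvgV; [rewrite gt_eqF|exact: sym_cont].
have eL := L2B spL sqL.
have UeL := U_L2 eL; have UqL := U_L2 sqL.
have A1 : L2 (fun x => w x * U (fun y => P2 y - Q2 y) x).
  apply: (L2_dom1 _ UeL) => [|x]; first by apply: measurable_funM => //; exact: L2_mble UeL.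
  by rewrite normrM ler_piMl// ger0_norm.
have A2 : L2 (fun x => (1 - w x) * U Q2 x).
  apply: (L2_dom1 _ UqL) => [|x].
    by apply: measurable_funM; [exact: measurable_funB|exact: L2_mble UqL].
  by rewrite normrM ler_piMl// ger0_norm ?subr_ge0// gerBl.
have dE : {ae mu, forall x, sym 0 1 x * (p x - q x) =
    2^-1 * (w x * U (fun y => P2 y - Q2 y) x - (1 - w x) * U Q2 x)}.
  apply: (aeS2 (aeI eqp eqq) (U_B spL sqL)) => x [e1 e2] ->.
  have -> : sym 0 1 x * (p x - q x) = w x * (sym al 1 x * p x) - sym 0 1 x * q x.
    by rewrite /w; field; rewrite gt_eqF.
  by rewrite e1 e2; ring.
have sdL : L2 (fun x => sym 0 1 x * (p x - q x)).
  apply: (L2_ae _ (L2Z 2^-1 (L2B A1 A2)) dE).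
  by apply: measurable_funM; [exact: msym|exact: (L2_mble dL)].
apply: (@le_trans _ _ (ip (fun x => sym 0 1 x * (p x - q x)) (fun x => sym 0 1 x * (p x - q x)))).
  apply: le_Rint; [exact: Ed_intg|exact: L2M|move=> x].
  rewrite -expr2 exprMn ler_wpM2r ?sqr_ge0// /sym mul0r addr0 mul1r -[x ^+ 2]real_normK ?num_real//.
  have := normr_ge0 x; nra.
have hL := L2Z 2^-1 (L2B A1 A2).
rewrite (ip_ae sdL hL sdL hL dE dE).
have j1 := L2_sqr A1; have j2 := L2_sqr A2.
apply: (@le_trans _ _ (2^-1 * ip (fun x => w x * U (fun y => P2 y - Q2 y) x) (fun x => w x * U (fun y => P2 y - Q2 y) x)
   + 2^-1 * ip (fun x => (1 - w x) * U Q2 x) (fun x => (1 - w x) * U Q2 x))).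
  have i1 := L2M A1 A1; have i2 := L2M A2 A2.
  rewrite -(RintZ 2^-1 i1) -(RintZ 2^-1 i2) -(RintD (intgZ _ i1) (intgZ _ i2)).
  apply: le_Rint; [exact: L2M|exact: intgD (intgZ _ i1) (intgZ _ i2)|move=> x].
  move: (w x * _) ((1 - w x) * _) => s t; have := sqr_ge0 (s + t); lra.
apply: lerD; rewrite ler_wpM2l//; last first.
  apply: le_Rint; [exact: L2M| |by move=> x; rewrite -expr2 exprMn].
  by have := j2; congr intg; apply/funext => x; rewrite exprMn.
apply: (@le_trans _ _ (ip (fun y => P2 y - Q2 y) (fun y => P2 y - Q2 y))).
  rewrite -(U_iso eL eL); apply: le_Rint; [exact: L2M|exact: L2M|move=> x].
  rewrite -!expr2 exprMn ler_piMl ?sqr_ge0// expr_le1//.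
rewrite -(ip_hart dA dA) -RintZ; last by apply: L2M; exact: adm_hart_L2.
apply: le_Rint; [exact: L2M|apply: intgZ; apply: L2M; exact: adm_hart_L2|move=> x].
rewrite (hartB x (adm_intg pA) (adm_intg qA)) /P2 /Q2.
have -> : (hart p x ^+ 2 - hart q x ^+ 2) * (hart p x ^+ 2 - hart q x ^+ 2) =
  (hart p x + hart q x) ^+ 2 * ((hart p x - hart q x) ^+ 2) by ring.
by rewrite -expr2 ler_wpM2r ?sqr_ge0.
Qed.

End Limits.

(** * The Benjamin-Ono limit *)

Section BOLimit.
Context {R : realType}.
Local Notation mu := (@lebesgue_measure R).
Implicit Types (f g h k p q r u v phi psi Q : R -> R) (x y xi a b c e t al be C : R).

Lemma sym_ratio_cvg (a_ : nat -> R) x : a_ n @[n --> \oo] --> (0 : R) ->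
  sym 0 1 x / sym (a_ n) 1 x @[n --> \oo] --> (1 : R).
Proof.
move=> a0; have s0 : sym 0 1 x != 0 :> R by rewrite /sym mul0r addr0 mul1r den1_neq0.
have l : sym (a_ n) 1 x @[n --> \oo] --> sym 0 1 x.
  rewrite /sym; apply: cvgD; first exact: cvg_cst.
  by apply: cvgM; [exact: a0|exact: cvg_cst].
rewrite -[X in _ --> X](divff s0); apply: cvgM; first exact: cvg_cst.
exact: cvgV.
Qed.

Lemma bo_limit e : 0 < e -> exists2 d, 0 < d & forall al, 0 < al /\ al <= 1 -> `|al| < d ->
  H1norm (fun x => hart (gsel al 1) x - Q_BO x) < e.
Proof.
apply: (near0_by_sequences (f := fun al => H1norm (fun x => hart (gsel al 1) x - Q_BO x))).
move=> u u1 u0 {}e e0; have [uQ1 uQ2] := @Q_BO_unique R; have [HQ sQ _] := uQ1.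
have [qA kE] := profile_energy uQ1; set q := U (@Q_BO R) in qA kE.
have up n : 0 < u n by have [] := u1 n.
have gsn n : gs (u n) 1 (gsel (u n) 1).
  by apply: gselP => //; have := sqrtr_ge0 (u n); lra.
have sl n x : 1 <= sym (u n) 1 x.
  have h : 0 <= u n * x ^+ 2 by rewrite mulr_ge0 ?sqr_ge0// ltW.
  by rewrite /sym; have := normr_ge0 x; lra.
have pA n : adm (gsel (u n) 1) by have [] := gsn n.
have k0 : 0 < kap q by rewrite (kap_ae qA bo_hat_adm U_Q_BO) kap_bo_hat.
have ipE n r : adm r -> ip r r <= En (u n) 1 r.
  move=> [rL xrL _]; apply: le_Rint; [exact: L2M|exact: En_intg|move=> x].
  by rewrite -expr2 ler_peMl ?sqr_ge0.
(* The energy bounds the L^2 norm uniformly in [al <= 1]; the seminorm is then bounded by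
   [H1_bound_BO]. *)
pose C1 := 4 * (En 0 1 q + Ed q) ^+ 3 / kap q ^+ 2.
have HC n : ip (gsel (u n) 1) (gsel (u n) 1) <= C1.
  apply: (le_trans (ipE n _ (pA n))); apply: (le_trans (gs_energy (gsn n) qA k0)).
  rewrite ler_wpM2r ?invr_ge0 ?sqr_ge0// ler_wpM2l//.
  have eq0 : 0 <= En (u n) 1 q by apply: le_trans (ipE n _ qA); exact: ip_ge0.
  have h2 := En_lip (u n) 1 0 1 qA; rewrite subrr normr0 addr0 subr0 in h2.
  have {}h2 : En (u n) 1 q <= En 0 1 q + Ed q.
    apply: (le_trans h2); rewrite lerD2l ler_piMl ?Ed_ge0//.
    by rewrite gtr0_norm//; have [] := u1 n.
  by rewrite lerXn2r ?nnegrE// (le_trans eq0).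
pose C := C1 + pi ^+ 2 * C1 ^+ 3 / 4.
have EC n : Ed (gsel (u n) 1) <= C.
  have [H0 Z] := H1_bound_BO (up n) (gsn n); rewrite (EdE (pA n)); apply: lerD => //.
  apply: (le_trans Z); rewrite ler_wpM2r ?invr_ge0// ler_wpM2l ?sqr_ge0//.
  by rewrite lerXn2r ?nnegrE ?ip_ge0// (le_trans _ (HC n)) ?ip_ge0.
have p1 n : 1 <= hart (gsel (u n) 1) 0.
  by apply: (gs_hart0 (gsn n)) => x; apply: le_trans (sl n x); lra.
have s0 x : 0 < sym 0 1 x :> R by rewrite /sym mul0r addr0 mul1r den1_gt0.
have cb : (fun _ : nat => (1 : R)) n @[n --> \oo] --> (1 : R) by exact: cvg_cst.
have [s [sm lim]] := subsequence_limit u0 cb gsn EC p1 (@Q_BO_unique R) s0.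
rewrite -/q in lim.
have dA n : adm (fun x => gsel (u n) 1 x - q x) by exact: adm_B.
have eqq : {ae mu, forall x, sym 0 1 x * q x = 2^-1 * U (fun y => hart q y ^+ 2) x}.
  have [Hq _] := HQ; have [QL _] := Hq; have [_ re] := H1even_adm HQ.
  have e2 : {ae mu, forall x, Q_BO x ^+ 2 = hart q x ^+ 2} by apply: (aeS re) => x ->.
  have e3 := U_ae (sqr_L2 QL (H1_UL1 Hq)) (hart_sqr_L2 qA) e2.
  by apply: (aeS2 ((solutionP _ _ Hq).1 sQ) e3) => x -> ->.
pose B := 2 * (pi * C) + 2 * (pi * Ed q).
have hB n x : (hart (gsel (u n) 1) x + hart q x) ^+ 2 <= B.
  have h1 := hart_sup x (pA n); have h2 := hart_sup x qA.
  have h3 : pi * Ed (gsel (u n) 1) <= pi * C by rewrite ler_pM2l ?pi_gt0.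
  by have := sqr_ge0 (hart (gsel (u n) 1) x - hart q x); rewrite /B; nra.
have us : u (s n) @[n --> \oo] --> (0 : R).
  apply: (cvg_comp s u _ u0) => A [N _ NA]; exists N => // n /= Nn; apply: NA => /=.
  exact: leq_trans Nn (homo_ge_id sm n).
have sqL := hart_sqr_L2 qA; have UqL := U_L2 sqL.
set Uq := U (fun y => hart q y ^+ 2) in UqL eqq.
pose w n x : R := 1 - sym 0 1 x / sym (u n) 1 x.
have sy n x : 0 < sym (u n) 1 x by exact: lt_le_trans (sl n x).
have wb n x : 0 <= w n x /\ w n x <= 1.
  have h : sym 0 1 x <= sym (u n) 1 x.
    by rewrite /sym mul0r addr0 lerDl mulr_ge0 ?sqr_ge0// ltW.
  split; first by rewrite subr_ge0 ler_pdivrMr// mul1r.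
  by rewrite gerBl divr_ge0// ltW.
have mw n : measurable_fun setT (w n).
  apply: measurable_funB => //; apply: measurable_funM; first exact: msym.
  by apply: continuous_measurable_fun => x; apply: cvgV; [rewrite gt_eqF|exact: sym_cont].
(* The symbol ratio tends to 1 only pointwise, not uniformly in [x]; the fixed integrable majorant
   [Uq^2] makes this enough. *)
have I0 : \int[mu]_x (w (s n) x ^+ 2 * Uq x ^+ 2) @[n --> \oo] --> (0 : R).
  rewrite -[X in _ --> X](@Rintegral0 _ _ _ mu).
  apply: (@dominated_Rint _ _ _ mu (fun n x => w (s n) x ^+ 2 * Uq x ^+ 2) (fun=> 0)
    (fun x => Uq x ^+ 2) _ _ _ _).2.
  - move=> n; apply: measurable_funM; apply: measurable_funX; [exact: mw|exact: (L2_mble UqL)].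
  - exact: L2_sqr UqL.
  - move=> n x; have [w0 w1] := wb (s n) x.
    rewrite -exprMn ger0_norm ?sqr_ge0// exprMn ler_piMl ?sqr_ge0//.
    by rewrite expr_le1.
  - move=> x; have wc : w (s n) x @[n --> \oo] --> (0 : R).
      by rewrite -(subrr 1); apply: cvgB; [exact: cvg_cst|exact: sym_ratio_cvg].
    have : w (s n) x * w (s n) x * Uq x ^+ 2 @[n --> \oo] --> 0 * 0 * Uq x ^+ 2.
      by apply: cvgM; [exact: cvgM|exact: cvg_cst].
    by rewrite !mul0r; under eq_fun do rewrite -expr2.
apply: (@exists_lt_of_cvg0 _ _ s) => //.
under eq_fun do rewrite (H1norm_Ed (pA _) HQ).
apply: sqrt_cvg0; rewrite -/q.
(* The first term is controlled by the convergence in energy, since [sym 0 1 >= 1]; the second is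
   [I0]. *)
pose ub n := 2^-1 * (B * En 0 1 (fun x => gsel (u (s n)) 1 x - q x)) +
  2^-1 * \int[mu]_x (w (s n) x ^+ 2 * Uq x ^+ 2).
have ubl : ub n @[n --> \oo] --> (0 : R).
  have -> : 0 = 2^-1 * (B * 0) + 2^-1 * 0 :> R by rewrite !mulr0 addr0.
  apply: cvgD; apply: cvgM => //; try exact: cvg_cst.
  by apply: cvgM => //; exact: cvg_cst.
apply: (@squeeze_cvgr _ _ _ _ (fun=> 0) ub) => //; last exact: cvg_cst.
apply: nearW => n; rewrite Ed_ge0/=.
apply: (le_trans (Ed_le_BO (up (s n)) (gsn (s n)) qA eqq (hB (s n)))).
rewrite /ub lerD2r ler_wpM2l// ler_wpM2l//.
  by apply: le_trans (hB (s n) 0); exact: sqr_ge0.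
have [rL xrL _] := dA (s n); apply: le_Rint; [exact: L2M|exact: En_intg|move=> x].
rewrite -expr2 ler_peMl ?sqr_ge0// /sym mul0r addr0 mul1r lerDl.
exact: normr_ge0.
Qed.

Lemma H1norm_ge0 f : 0 <= H1norm f.
Proof. exact: sqrtr_ge0. Qed.

End BOLimit.

Theorem theorem2p1 (R : realType) :
  [/\ exists phi : R -> R -> R -> R,
        [/\ forall alpha beta : R,
              0 < alpha -> alpha <= 1 -> - 2 * Num.sqrt alpha < beta ->
              even_ground_state alpha beta (phi alpha beta),
            H1norm (fun x => phi 1 beta x - Q_KdV x)
              @[beta --> (0 : R)^'] --> (0 : R)
          & H1norm (fun x => phi alpha 1 x - Q_BO x)
              @[alpha --> (0 : R)^'+] --> (0 : R)],
      unique_even_soliton_profile 1 0 (@Q_KdV R)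
    & unique_even_soliton_profile 0 1 (@Q_BO R)].
Proof.
split; [|exact: Q_KdV_unique|exact: Q_BO_unique].
(* One arbitrary choice of ground state for each parameter serves both limits: [subsequence_limit]
   holds for any selection of solutions of [gs]. *)
exists (fun al be => hart (gsel al be)); split.
- by move=> al be a0 _ bs; apply: gs_ground_state => //; exact: gselP.
- apply/cvgrPdist_lt => e e0; have [d d0 H] := kdv_limit e0; near=> be.
  rewrite sub0r normrN ger0_norm ?H1norm_ge0//; apply: H.
    by near: be; exact: dnbhs0_le.
  by near: be; exact: dnbhs0_lt.
- apply/cvgrPdist_lt => e e0; have [d d0 H] := bo_limit e0; near=> al.
  have a0 : 0 < al by near: al; exact: nbhs_right_gt.
  rewrite sub0r normrN ger0_norm ?H1norm_ge0//; apply: H.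
    by split=> //; near: al; exact: nbhs_right_le.
  by rewrite gtr0_norm//; near: al; exact: nbhs_right_lt.
Unshelve. all: by end_near. Qed.
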